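(* Let $\Omega\subset M$ be a domain in the class $\mathcal{O}^+$ such that $\mathrm{vol}(\Omega)\le\rho$, $\mathrm{Ric}_x(\xi,\xi)\ge-\kappa|\xi|^2$ for all $x\in\Omega$, $\xi\in T_xM$, and the Sobolev constant $C_{\rm Sob}(\Omega)$ can be chosen with $C_{\rm Sob}(\Omega)\le\sigma$, where $\kappa,\rho,\sigma$ are given positive constants. Let $\gamma>1$ and $f\in\mathcal{C}^1(\Omega,\mathbb{R})\cap\mathcal{C}^0(\overline\Omega,\mathbb{R})$. Let $u\in\mathcal{C}^3(\Omega,\mathbb{R})\cap\mathcal{C}^2(\overline\Omega,\mathbb{R})$ be a solution of the Neumann problem $$\begin{cases}-\Delta u+\tfrac1\gamma|\nabla u|^\gamma=f&\text{in }\Omega,\\ \partial_\nu u=0&\text{on }\partial\Omega.\end{cases}$$ Assume that there exist an exponent $q$ and a constant $K>0$ such that $$q>\max\big\{d\tfrac{\gamma-1}{\gamma},2\big\},\qquad \|f\|_{L^q(\Omega,\mathbb{R})}+\|\nabla u\|_{L^1(\Omega,TM|_\Omega)}\le K.$$ Then there exists a constant $C=C(d,\gamma,\kappa,\rho,\sigma,q,K)>0$, depending only on the listed data, such that $$\|\Delta u\|_{L^q(\Omega,\mathbb{R})}+\big\||\nabla u|^\gamma\big\|_{L^q(\Omega,\mathbb{R})}\le C.$$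
   Context: $(M^d,g)$ is a smooth, connected, orientable, not necessarily complete Riemannian manifold of dimension $d\ge3$; $\nabla$ is the gradient, $\Delta=\mathrm{div}\,\nabla$ the Laplacian, $\mathrm{Ric}$ the Ricci tensor, $D$ the Levi-Civita connection, $\omega_{\rm vol}$ the Riemannian volume form, and $\mathrm{vol}(E)=\int_E\omega_{\rm vol}$. For a tensor field $T$, $\|T\|_{L^p(\Omega)}=\big(\int_\Omega|T|^p\omega_{\rm vol}\big)^{1/p}$. A domain is a non-empty connected open subset. The class $\mathcal{O}$ consists of the domains $\Omega\subset M$ with compact closure whose boundary $\partial\Omega$ is an orientable embedded hypersurface of class $\mathcal{C}^\infty$; $\nu$ is the outward unit normal field on $\partial\Omega$, $\partial_\nu u=g(\nabla u,\nu)$, and the second fundamental form is $\mathrm{II}(X,Y)=-g(D_XY,\nu)$ for $X,Y$ tangent to $\partial\Omega$. The class $\mathcal{O}^+$ consists of those $\Omega\in\mathcal{O}$ for which $\mathrm{II}$ is non-negative definite. The Sobolev constant $C_{\rm Sob}(\Omega)>0$ is any constant such that $\|v\|_{L^{2d/(d-2)}(\Omega)}\le C_{\rm Sob}(\Omega)\big(\|\nabla v\|_{L^2(\Omega)}+\|v\|_{L^2(\Omega)}\big)$ for all $v\in W^{1,2}(\Omega,\mathbb{R})$. *)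

(* Defs.v *)
From HB Require Import structures.
From mathcomp Require Import all_boot all_order all_algebra.
From mathcomp Require Import all_classical all_reals all_analysis.
Set Implicit Arguments.
Unset Strict Implicit.
Unset Printing Implicit Defensive.
Import Order.TTheory GRing.Theory Num.Theory.
Import numFieldNormedType.Exports.
Local Open Scope classical_set_scope.
Local Open Scope ring_scope.

Section Euclidean.
Context {R : realType}.

Definition partial {n} (i : 'I_n) (F : 'rV[R]_n -> R) : 'rV[R]_n -> R :=
  fun x => 'D_(delta_mx 0 i) F x.

Definition iter_partial {n} (s : seq 'I_n) (F : 'rV[R]_n -> R) :
    'rV[R]_n -> R :=
  foldr partial F s.

(* Meant for open A only. *)
Definition Ck_on {n} (k : nat) (A : set 'rV[R]_n) (F : 'rV[R]_n -> R) : Prop :=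
  (forall s : seq 'I_n, (size s <= k)%N ->
     forall x, A x -> {for x, continuous (iter_partial s F)}) /\
  (forall (s : seq 'I_n) (i : 'I_n), (size s < k)%N ->
     forall x, A x -> derivable (iter_partial s F) x (delta_mx 0 i)).

Definition smooth_on {n} (A : set 'rV[R]_n) (F : 'rV[R]_n -> R) : Prop :=
  forall k, Ck_on k A F.

(* For non-negative Borel F this is, by Tonelli, the integral of F against the
   n-dimensional Lebesgue measure, which the library does not provide. *)
Fixpoint lebesgue_int {n} : ('rV[R]_n -> \bar R) -> \bar R :=
  match n with
  | 0 => fun F => F 0
  | m.+1 => fun F =>
      (\int[@lebesgue_measure R]_t
        @lebesgue_int m (fun y => F (row_mx (const_mx t : 'rV[R]_1) y)))%E
  end.

End Euclidean.

Section Manifold.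
Context {R : realType} {d : nat} {M : topologicalType}.

(* chart_map and chart_inv are total functions; only their values on chart_dom
   and on the image of chart_dom are meaningful. *)
Record chart := Chart {
  chart_dom : set M;
  chart_map : M -> 'rV[R]_d;
  chart_inv : 'rV[R]_d -> M }.

Definition chart_image (c : chart) (A : set M) : set 'rV[R]_d :=
  chart_map c @` (chart_dom c `&` A).

Definition is_chart (c : chart) : Prop :=
  [/\ open (chart_dom c),
      open (chart_image c setT),
      forall p, chart_dom c p -> chart_inv c (chart_map c p) = p,
      {within chart_dom c, continuous (chart_map c)} &
      {within chart_image c setT, continuous (chart_inv c)}].

Definition transition (c1 c2 : chart) : 'rV[R]_d -> 'rV[R]_d :=
  chart_map c2 \o chart_inv c1.

Definition compatible (c1 c2 : chart) : Prop :=
  forall j, smooth_on (chart_image c1 (chart_dom c2))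
                      (fun x => transition c1 c2 x 0 j).

Record smooth_structure := SmoothStructure {
  atlas : set chart;
  atlas_chart : forall c, atlas c -> is_chart c;
  atlas_compatible : forall c1 c2, atlas c1 -> atlas c2 -> compatible c1 c2;
  atlas_cover : forall p, exists c, atlas c /\ chart_dom c p;
  atlas_maximal : forall c, is_chart c ->
    (forall c', atlas c' -> compatible c c' /\ compatible c' c) -> atlas c }.

Definition orientable (S : smooth_structure) : Prop :=
  exists A : set chart,
    [/\ A `<=` atlas S,
        forall p, exists c, A c /\ chart_dom c p &
        forall c1 c2, A c1 -> A c2 ->
          forall x, chart_image c1 (chart_dom c2) x ->
            0 < \det (jacobian (transition c1 c2) x)].

Definition chart_at (S : smooth_structure) (p : M) : chart :=
  projT1 (cid (atlas_cover S p)).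

(* A tangent vector at p is encoded by its components in the chart chart_at p,
   so a vector field, of whatever regularity, is a function M -> 'rV[R]_d.  The
   components in another chart are obtained by the tangent map; recall that
   the derivative of f at x along v is v *m jacobian f x. *)
Definition vec_in (S : smooth_structure) (c : chart) (p : M) (v : 'rV[R]_d) :
    'rV[R]_d :=
  v *m jacobian (transition (chart_at S p) c) (chart_map (chart_at S p) p).

Definition field_in (S : smooth_structure) (c : chart) (X : M -> 'rV[R]_d) :
    'rV[R]_d -> 'rV[R]_d :=
  fun x => vec_in S c (chart_inv c x) (X (chart_inv c x)).

Definition smooth_field (S : smooth_structure) (V : set M)
    (X : M -> 'rV[R]_d) : Prop :=
  forall c, atlas S c -> forall i,
    smooth_on (chart_image c V) (fun x => field_in S c X x 0 i).

(* Gram matrix in the chart c of a bilinear form given at each point p by its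
   matrix in the chart chart_at p. *)
Definition form_in (S : smooth_structure) (G : M -> 'M[R]_d) (c : chart)
    (x : 'rV[R]_d) : 'M[R]_d :=
  let J := jacobian (transition c (chart_at S (chart_inv c x))) x in
  J *m G (chart_inv c x) *m J^T.

Record riemannian_metric (S : smooth_structure) := RiemannianMetric {
  metric_mx : M -> 'M[R]_d;
  metric_sym : forall p, (metric_mx p)^T = metric_mx p;
  metric_pos : forall p (v : 'rV[R]_d), v != 0 ->
    0 < (v *m metric_mx p *m v^T) 0 0;
  metric_smooth : forall c, atlas S c -> forall i j,
    smooth_on (chart_image c setT)
              (fun x => form_in S metric_mx c x i j) }.

Section Riemannian.
Context {S : smooth_structure} (g : riemannian_metric S).

Definition inner (p : M) (v w : 'rV[R]_d) : R :=
  (v *m metric_mx g p *m w^T) 0 0.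

Definition tnorm (p : M) (v : 'rV[R]_d) : R := Num.sqrt (inner p v v).

Definition gram (c : chart) : 'rV[R]_d -> 'M[R]_d := form_in S (metric_mx g) c.

Definition density (c : chart) (x : 'rV[R]_d) : R :=
  Num.sqrt (\det (gram c x)).

Definition sharp (p : M) (w : 'rV[R]_d) : 'rV[R]_d :=
  w *m invmx (metric_mx g p).

Definition grad (u : M -> R) (p : M) : 'rV[R]_d :=
  let c := chart_at S p in
  sharp p (\row_i partial i (u \o chart_inv c) (chart_map c p)).

(* Extension of the gradient by continuity from the open set Omega to its
   closure. *)
Definition grad_closure (Omega : set M) (u : M -> R) (p : M) : 'rV[R]_d :=
  let c := chart_at S p in
  sharp p (\row_i lim (partial i (u \o chart_inv c)
             @ within (chart_image c Omega) (nbhs (chart_map c p)))).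

Definition div (X : M -> 'rV[R]_d) (p : M) : R :=
  let c := chart_at S p in
  let x := chart_map c p in
  (density c x)^-1 *
  \sum_i partial i (fun y => density c y * field_in S c X y 0 i) x.

Definition laplacian (u : M -> R) : M -> R := div (grad u).

Definition christoffel (c : chart) (k i j : 'I_d) (x : 'rV[R]_d) : R :=
  2^-1 * \sum_l invmx (gram c x) k l *
    (partial i (fun y => gram c y j l) x +
     partial j (fun y => gram c y i l) x -
     partial l (fun y => gram c y i j) x).

(* The Levi-Civita derivative at p of the field Y along the vector v. *)
Definition levi_civita (p : M) (v : 'rV[R]_d) (Y : M -> 'rV[R]_d) :
    'rV[R]_d :=
  let c := chart_at S p in
  let x := chart_map c p in
  \row_k (\sum_i v 0 i * partial i (fun y => field_in S c Y y 0 k) x +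
          \sum_i \sum_j christoffel c k i j x * v 0 i * Y p 0 j).

(* The l-th component of the vector
   D_k (D_j e_i) - D_j (D_k e_i), with e_1, ..., e_d the coordinate fields
   of c. *)
Definition curvature (c : chart) (l k j i : 'I_d) (x : 'rV[R]_d) : R :=
  partial k (christoffel c l j i) x - partial j (christoffel c l k i) x +
  \sum_m (christoffel c l k m x * christoffel c m j i x -
          christoffel c l j m x * christoffel c m k i x).

(* Ric(v, w) is the trace of the map sending z to R(z, v)w. *)
Definition ricci (p : M) (v w : 'rV[R]_d) : R :=
  let c := chart_at S p in
  \sum_j \sum_i
    (\sum_k curvature c k k j i (chart_map c p)) * v 0 j * w 0 i.

End Riemannian.

Section Domains.
Context {S : smooth_structure} (g : riemannian_metric S).

Definition boundary (A : set M) : set M := closure A `\` A°.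

Definition slice_chart (N : set M) (c : chart) (i : 'I_d) : Prop :=
  atlas S c /\
  forall p, chart_dom c p -> (N p <-> chart_map c p 0 i = 0).

Definition embedded_hypersurface (N : set M) : Prop :=
  forall p, N p -> exists c i, slice_chart N c i /\ chart_dom c p.

(* The coordinates other than the i-th of a slice chart are coordinates on N;
   row' i and col' i extract the Jacobian of the change of these
   coordinates. *)
Definition orientable_hypersurface (N : set M) : Prop :=
  exists (i : 'I_d) (A : set chart),
    [/\ forall c, A c -> slice_chart N c i,
        forall p, N p -> exists c, A c /\ chart_dom c p &
        forall c1 c2, A c1 -> A c2 ->
          forall x, chart_image c1 (chart_dom c2 `&` N) x ->
            0 < \det (row' i (col' i (jacobian (transition c1 c2) x)))].

Definition tangent_to (N : set M) (p : M) (v : 'rV[R]_d) : Prop :=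
  forall c i, slice_chart N c i -> chart_dom c p -> vec_in S c p v 0 i = 0.

Definition domain (Omega : set M) : Prop :=
  [/\ Omega !=set0, connected Omega & open Omega].

Definition class_O (Omega : set M) : Prop :=
  [/\ domain Omega, compact (closure Omega),
      embedded_hypersurface (boundary Omega) &
      orientable_hypersurface (boundary Omega)].

Definition outward_unit_normal (Omega : set M) (nu : M -> 'rV[R]_d) : Prop :=
  forall p, boundary Omega p ->
    let c := chart_at S p in
    [/\ inner g p (nu p) (nu p) = 1,
        forall v, tangent_to (boundary Omega) p v -> inner g p (nu p) v = 0 &
        \forall t \near (0 : R)^'+,
          Omega (chart_inv c (chart_map c p - t *: nu p)) /\
          ~ closure Omega (chart_inv c (chart_map c p + t *: nu p))].

Definition second_fundamental_form (nu : M -> 'rV[R]_d) (p : M)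
    (X Y : M -> 'rV[R]_d) : R :=
  - inner g p (levi_civita g p (X p) Y) (nu p).

Definition second_form_nonneg (Omega : set M) (nu : M -> 'rV[R]_d) : Prop :=
  forall p (V : set M) (X : M -> 'rV[R]_d),
    boundary Omega p -> open V -> V p -> smooth_field S V X ->
    (forall y, V y -> boundary Omega y -> tangent_to (boundary Omega) y (X y)) ->
    0 <= second_fundamental_form nu p X X.

Definition class_Oplus (Omega : set M) (nu : M -> 'rV[R]_d) : Prop :=
  [/\ class_O Omega, outward_unit_normal Omega nu &
      second_form_nonneg Omega nu].

Definition Ck (k : nat) (Omega : set M) (u : M -> R) : Prop :=
  forall c, atlas S c -> Ck_on k (chart_image c Omega) (u \o chart_inv c).

(* All derivatives of order at most k of u in Omega extend continuously to the
   closure of Omega. *)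
Definition Ck_closure (k : nat) (Omega : set M) (u : M -> R) : Prop :=
  [/\ Ck k Omega u,
      {within closure Omega, continuous u} &
      forall c, atlas S c -> forall s : seq 'I_d, (size s <= k)%N ->
        exists h : 'rV[R]_d -> R,
          {within chart_image c (closure Omega), continuous h} /\
          forall x, chart_image c Omega x ->
            h x = iter_partial s (u \o chart_inv c) x].

End Domains.

End Manifold.

Arguments chart : clear implicits.
Arguments smooth_structure : clear implicits.
Arguments Ck {R d M} S k Omega u.
Arguments Ck_closure {R d M} S k Omega u.

Definition borel (M : ptopologicalType) := g_sigma_algebraType (@open M).

Section Integration.
Context {R : realType} {d : nat} {M : ptopologicalType}.
Context {S : smooth_structure R d M} (g : riemannian_metric S).

(* On a second countable M there is exactly one such measure. *)
Definition is_volume (vol : {measure set (borel M) -> \bar R}) : Prop :=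
  forall (c : chart R d M) (E : set (borel M)),
    atlas S c -> measurable E -> E `<=` chart_dom c ->
    vol E = lebesgue_int (fun x => (density g c x * \1_(chart_map c @` E) x)%:E).

Context (vol : {measure set (borel M) -> \bar R}).

Definition Lp_norm (Omega : set M) (p : R) (h : M -> R) : \bar R :=
  ((\int[vol]_(x in Omega) (`|h x| `^ p)%:E) `^ p^-1)%E.

Definition Lp_norm_field (Omega : set M) (p : R) (X : M -> 'rV[R]_d) : \bar R :=
  Lp_norm Omega p (fun x => tnorm g x (X x)).

Definition measurable_field (Omega : set M) (X : M -> 'rV[R]_d) : Prop :=
  forall c, atlas S c -> forall i,
    measurable_fun (Omega `&` chart_dom c : set (borel M))
      (fun p : borel M => vec_in S c p (X p) 0 i).

Definition test_field (Omega : set M) (X : M -> 'rV[R]_d) : Prop :=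
  smooth_field S setT X /\
  exists2 K : set M, compact K & K `<=` Omega /\ forall p, ~ K p -> X p = 0.

Definition weak_gradient (Omega : set M) (v : M -> R) (W : M -> 'rV[R]_d) :
    Prop :=
  forall X, test_field Omega X ->
    (\int[vol]_(p in Omega) (v p * div g X p)%:E =
     - \int[vol]_(p in Omega) (inner g p (W p) (X p))%:E)%E.

(* v is in the Sobolev space W^{1,2}(Omega) and W is its weak gradient. *)
Definition sobolev12 (Omega : set M) (v : M -> R) (W : M -> 'rV[R]_d) : Prop :=
  [/\ measurable_fun (Omega : set (borel M)) v /\ measurable_field Omega W,
      (Lp_norm Omega 2 v < +oo)%E,
      (Lp_norm_field Omega 2 W < +oo)%E &
      weak_gradient Omega v W].

Definition sobolev_constant (Omega : set M) (C : R) : Prop :=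
  0 < C /\
  forall v W, sobolev12 Omega v W ->
    (Lp_norm Omega (2 * d%:R / (d%:R - 2)) v <=
     C%:E * (Lp_norm_field Omega 2 W + Lp_norm Omega 2 v))%E.

Definition neumann_solution (Omega : set M) (nu : M -> 'rV[R]_d) (gamma : R)
    (f u : M -> R) : Prop :=
  (forall p, Omega p ->
     - laplacian g u p + gamma^-1 * tnorm g p (grad g u p) `^ gamma = f p) /\
  (forall p, boundary Omega p ->
     inner g p (grad_closure g Omega u p) (nu p) = 0).

End Integration.

(* Main.v *)
(** Bernstein's method in integral form.  Let z = |grad u|^2.  If F >= 0 vanishes below a level
    k > 0, Bochner's formula, the equation and the bound on Ric give a lower bound for the
    divergence of F(z) (grad z + 2 f grad u), and the outward normal component of this field is
    - 2 F(z) II(grad u, grad u) <= 0 on the boundary; hence the lower bound has integral <= 0.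
    Take F(z) = y^a z^b with y = (z - k)_+, a = q/2 and b such that F(z) z^gamma = s^(q/2),
    where s = y z^(gamma-1).  The terms containing f are then f^2 s^(q/2-1), absorbed by
    Young's inequality at the price of the integral of |f|^q.  The only remaining bad term, the
    integral of F(z) y z^(gamma-1), is controlled by the Sobolev inequality as soon as
    S(k), the integral of y^((gamma-1)d/2), is at most some eps; in that case the integral of
    s^(q/2) is at most a constant.  Since q > d(gamma-1)/gamma and the set where z > k has
    measure at most K k^(-1/2), S(k) <= eps improves to a much smaller bound when k is large
    enough.  Now S(k) = 0 for k >= max z, and S(k) is at most a constant times
    S(k + delta) + delta^((gamma-1)d/2), so descending in steps of a fixed small size delta
    gives S(k) <= eps for all k above a level depending only on the data. *)

(* The regularity of the data dictates the form of the argument. Only the derivatives of [u] up to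
   order two extend to the boundary; its third derivatives and grad f may blow up there. The summand
   2 f grad u makes grad f disappear: Bochner's formula gives 2 <grad Laplacian u, grad u>, the
   divergence of 2 f grad u gives 2 <grad f, grad u>, and by the equation the two add up to
   z^(gamma/2-1) <grad z, grad u>. What remains is a bounded lower bound for a divergence that may
   itself be unbounded, so the divergence theorem is proved as an inequality. It uses neither a
   surface measure nor boundary values: a thin layer is cut off in charts that flatten the boundary,
   and only the lower limit of the inner normal component matters. For gamma < 2 the factor
   z^(gamma/2-1) is singular where grad u vanishes; a level k > 0 keeps away from these points. The
   maximum of z is finite but not controlled by the data; it affects only the number of descent
   steps, not the level they reach. The descent itself is free of geometry: it is carried out for an
   abstract positive functional. *)
From HB Require Import structures.
From mathcomp Require Import all_boot all_order all_algebra fingroup perm finmap.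
From mathcomp Require Import all_classical all_reals all_analysis.
From mathcomp Require Import measurable_realfun ring lra.
Require Import Defs.
Set Implicit Arguments.
Unset Strict Implicit.
Unset Printing Implicit Defensive.
Import Order.TTheory GRing.Theory Num.Theory.
Import numFieldNormedType.Exports.
Local Open Scope classical_set_scope.
Local Open Scope ring_scope.

(** * C^k functions on open subsets of R^n *)

Section Lines.
Context {R : realType} {V : normedModType R}.
Implicit Types (F : V -> R) (x v : V).

Lemma line_growthE F x v (t : R) :
  (fun h : R => h^-1 *: (F ((h *: 1 + t) *: v + x) - F (t *: v + x))) =
  (fun h : R => h^-1 *: (F (h *: v + (t *: v + x)) - F (t *: v + x))).
Proof. by apply/funext => h /=; rewrite [h *: 1]mulr1 scalerDl addrA. Qed.

Lemma is_derive_line F x v (t : R) : derivable F (t *: v + x) v ->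
  is_derive t (1 : R) (fun s : R => F (s *: v + x)) ('D_v F (t *: v + x)).
Proof.
move=> dF; split.
  by rewrite /derivable /= line_growthE; exact: dF.
by rewrite /derive /= line_growthE.
Qed.

Lemma line_MVT F x v (h : R) : 0 <= h ->
  (forall t, 0 <= t <= h -> derivable F (t *: v + x) v) ->
  exists2 c, 0 <= c <= h & F (h *: v + x) - F x = h * 'D_v F (c *: v + x).
Proof.
move=> h0 dF.
have dL t : t \in `[0, h]%R ->
    is_derive t (1 : R) (fun s : R => F (s *: v + x)) ('D_v F (t *: v + x)).
  by rewrite in_itv /= => th; apply: is_derive_line; exact: dF.
have dL' t : t \in `]0, h[%R ->
    is_derive t (1 : R) (fun s : R => F (s *: v + x)) ('D_v F (t *: v + x)).
  by move=> th; apply: dL; exact: subset_itv_oo_cc th.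
have cL : {within `[0, h], continuous (fun s : R => F (s *: v + x))}.
  apply: derivable_within_continuous => t th.
  by have [] := dL t th.
have [c] := MVT_segment h0 dL' cL.
rewrite in_itv /= => ch E; exists c => //.
by rewrite scale0r add0r subr0 in E; rewrite E mulrC.
Qed.

Lemma line_MVT_signed F x v (h : R) :
  (forall t, `|t| <= `|h| -> derivable F (t *: v + x) v) ->
  exists2 c, `|c| <= `|h| & F (h *: v + x) - F x = h * 'D_v F (c *: v + x).
Proof.
move=> dF; have [h0|h0] := leP 0 h.
  have [|c ch E] := @line_MVT F x v h h0.
    by move=> t /andP[t0 th]; apply: dF; rewrite !ger0_norm// (le_trans t0).
  by exists c => //; move/andP: ch => [c0 ch]; rewrite !ger0_norm.
(* For negative [h] the segment is run from its other endpoint [h *: v + x], and the intermediate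
   parameter is shifted back by [h]. *)
have [||c /andP[c0 ch] E] := @line_MVT F (h *: v + x) v (- h).
- by rewrite oppr_ge0 ltW.
- move=> t /andP[t0 th]; rewrite addrA -scalerDl; apply: dF.
  by rewrite ler0_norm ?ltr0_norm//; lra.
- exists (c + h); first by rewrite ler0_norm ?ltr0_norm//; lra.
  move: E; rewrite scaleNr addrA addNr add0r addrA -scalerDl => E.
  by rewrite -opprB E mulNr opprK.
Qed.

End Lines.

Section Partials.
Context {R : realType} {n : nat}.
Implicit Types (F G : 'rV[R]_n -> R) (A B : set 'rV[R]_n) (x : 'rV[R]_n).

(** The last entry of the list is the derivative taken first. Peeling it off is what makes the
    induction on the order in [Ck_onS] possible. *)
Lemma iter_partial_rcons (s : seq 'I_n) i F :
  iter_partial (rcons s i) F = iter_partial s (partial i F).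
Proof. by rewrite /iter_partial -cats1 foldr_cat. Qed.

Lemma Ck_on0 A F : Ck_on 0 A F <-> forall x, A x -> {for x, continuous F}.
Proof.
split=> [[h _] x Ax|h]; first exact: (h [::]).
by split=> // -[]// ; move=> _; exact: h.
Qed.

(** This recursive description replaces the definition by lists of indices: all closure properties
    below are inductions on [k] through it. *)
Lemma Ck_onS k A F : Ck_on k.+1 A F <->
  [/\ forall x, A x -> {for x, continuous F},
      forall x i, A x -> derivable F x (delta_mx 0 i) &
      forall i, Ck_on k A (partial i F)].
Proof.
split=> [[h1 h2]|[h1 h2 h3]].
  split; first exact: (h1 [::]).
    by move=> x i Ax; exact: (h2 [::]).
  move=> i; split.
    by move=> s sk x Ax; rewrite -iter_partial_rcons; apply: h1; rewrite ?size_rcons.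
  move=> s j sk x Ax; rewrite -iter_partial_rcons; apply: h2 => //.
  by rewrite size_rcons.
split.
  move=> s; case/lastP: s => [_|s i]; first exact: h1.
  rewrite size_rcons ltnS iter_partial_rcons => sk x Ax.
  by have [h _] := h3 i; exact: h.
move=> s j; case/lastP: s => [_ x Ax|s i]; first exact: h2.
rewrite size_rcons ltnS iter_partial_rcons => sk x Ax.
by have [_ h] := h3 i; exact: h.
Qed.

Lemma Ck_onW k l A F : (l <= k)%N -> Ck_on k A F -> Ck_on l A F.
Proof.
move=> lk [h1 h2]; split=> s.
  by move=> sl; apply: h1; exact: leq_trans lk.
by move=> i sl; apply: h2; exact: leq_trans lk.
Qed.

Lemma Ck_on_sub k A B F : B `<=` A -> Ck_on k A F -> Ck_on k B F.
Proof. by move=> BA [h1 h2]; split=> [s sk x /BA|s i sk x /BA]; [exact: h1|exact: h2]. Qed.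

Lemma Ck_on_continuous k A F x : Ck_on k A F -> A x -> {for x, continuous F}.
Proof. by move=> [h _] Ax; exact: (h [::]). Qed.

Lemma Ck_on_derivable k A F x i : Ck_on k.+1 A F -> A x ->
  derivable F x (delta_mx 0 i).
Proof. by move=> /Ck_onS[_ h _] Ax; exact: h. Qed.

Lemma Ck_on_partial k A F i : Ck_on k.+1 A F -> Ck_on k A (partial i F).
Proof. by case/Ck_onS. Qed.

Lemma partial_near F G x i : (\near x, F x = G x) -> partial i F x = partial i G x.
Proof. by move=> FG; exact: near_eq_derive. Qed.

Lemma partial_open A F G x i : open A -> A x -> (forall y, A y -> F y = G y) ->
  partial i F x = partial i G x.
Proof.
move=> oA Ax FG; apply: partial_near.
by apply: filterS (open_nbhs_nbhs (conj oA Ax)) => y /FG.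
Qed.

(** Expressions in charts agree with workable formulas only on an open set, so regularity must be
    insensitive to the values elsewhere. *)
Lemma Ck_on_eq k A F G : open A -> (forall y, A y -> F y = G y) ->
  Ck_on k A F -> Ck_on k A G.
Proof.
move=> oA; elim: k F G => [|k IH] F G FG.
  move=> /Ck_on0 h; apply/Ck_on0 => x Ax.
  have nFG : {near x, F =1 G}.
    by apply: filterS (open_nbhs_nbhs (conj oA Ax)) => y /FG.
  rewrite /prop_for /continuous_at -(FG x Ax).
  exact: cvg_trans (near_eq_cvg nFG) (h x Ax).
have nFG x : A x -> {near x, F =1 G}.
  by move=> Ax; apply: filterS (open_nbhs_nbhs (conj oA Ax)) => y /FG.
move=> /Ck_onS[h1 h2 h3]; apply/Ck_onS; split.
- move=> x Ax; rewrite /prop_for /continuous_at -(FG x Ax).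
  exact: cvg_trans (near_eq_cvg (nFG x Ax)) (h1 x Ax).
- by move=> x i Ax; exact: near_eq_derivable (nFG x Ax) (h2 x i Ax).
- move=> i; apply: IH (h3 i) => y Ay.
  exact: (partial_open _ oA).
Qed.

Lemma partialC (c : R) i : partial i (fun _ : 'rV[R]_n => c) = fun=> 0.
Proof. by apply/funext => x; rewrite /partial; exact: derive_cst. Qed.

Lemma Ck_on_cst k A (c : R) : Ck_on k A (fun=> c).
Proof.
elim: k c => [|k IH] c; first by apply/Ck_on0 => x _; exact: cst_continuous.
apply/Ck_onS; split; [by move=> x _; exact: cst_continuous| |].
  by move=> x i _; exact: derivable_cst.
by move=> i; rewrite partialC; exact: IH.
Qed.

Lemma partialD F G x i : derivable F x (delta_mx 0 i) ->
  derivable G x (delta_mx 0 i) ->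
  partial i (fun y => F y + G y) x = partial i F x + partial i G x.
Proof. by move=> dF dG; rewrite /partial; exact: deriveD. Qed.

Lemma partialM F G x i : derivable F x (delta_mx 0 i) ->
  derivable G x (delta_mx 0 i) ->
  partial i (fun y => F y * G y) x = partial i F x * G x + F x * partial i G x.
Proof.
move=> dF dG; rewrite /partial.
have -> : 'D_(delta_mx 0 i) (fun y => F y * G y) x = 'D_(delta_mx 0 i) (F * G) x.
  by [].
by rewrite (deriveM dF dG) addrC; congr (_ + _); exact: mulrC.
Qed.

Lemma Ck_onD k A F G : open A -> Ck_on k A F -> Ck_on k A G ->
  Ck_on k A (fun x => F x + G x).
Proof.
move=> oA; elim: k F G => [|k IH] F G.
  move=> /Ck_on0 hF /Ck_on0 hG; apply/Ck_on0 => x Ax.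
  exact: (cvgD (hF x Ax) (hG x Ax)).
move=> cF cG; have /Ck_onS[F1 F2 F3] := cF; have /Ck_onS[G1 G2 G3] := cG.
apply/Ck_onS; split.
- by move=> x Ax; exact: (cvgD (F1 x Ax) (G1 x Ax)).
- by move=> x i Ax; apply: derivableD; [exact: F2|exact: G2].
- move=> i; apply: Ck_on_eq (IH _ _ (F3 i) (G3 i)) => // x Ax.
  by rewrite partialD//; [exact: F2|exact: G2].
Qed.

Lemma Ck_onM k A F G : open A -> Ck_on k A F -> Ck_on k A G ->
  Ck_on k A (fun x => F x * G x).
Proof.
move=> oA; elim: k F G => [|k IH] F G.
  move=> /Ck_on0 hF /Ck_on0 hG; apply/Ck_on0 => x Ax.
  exact: (cvgM (hF x Ax) (hG x Ax)).
move=> cF cG; have /Ck_onS[F1 F2 F3] := cF; have /Ck_onS[G1 G2 G3] := cG.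
apply/Ck_onS; split.
- by move=> x Ax; exact: (cvgM (F1 x Ax) (G1 x Ax)).
- by move=> x i Ax; apply: derivableM; [exact: F2|exact: G2].
- move=> i; apply: (@Ck_on_eq _ _
      (fun x => partial i F x * G x + F x * partial i G x)) => //.
    by move=> x Ax; rewrite partialM//; [exact: F2|exact: G2].
  have cG' : Ck_on k A G by exact: Ck_onW cG.
  have cF' : Ck_on k A F by exact: Ck_onW cF.
  exact: (Ck_onD oA (IH _ _ (F3 i) cG') (IH _ _ cF' (G3 i))).
Qed.

Lemma Ck_onZ k A (c : R) F : open A -> Ck_on k A F -> Ck_on k A (fun x => c * F x).
Proof. by move=> oA; apply: (Ck_onM oA); exact: Ck_on_cst. Qed.

Lemma Ck_onN k A F : open A -> Ck_on k A F -> Ck_on k A (fun x => - F x).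
Proof.
move=> oA cF; have -> : (fun x => - F x) = (fun x => -1 * F x).
  by apply/funext => x; rewrite mulN1r.
exact: (Ck_onZ (-1) oA cF).
Qed.

Lemma Ck_onB k A F G : open A -> Ck_on k A F -> Ck_on k A G ->
  Ck_on k A (fun x => F x - G x).
Proof. by move=> oA cF cG; exact: (Ck_onD oA cF (Ck_onN oA cG)). Qed.

Lemma Ck_on_sum (I : Type) (r : seq I) (P : pred I) k A (F : I -> 'rV[R]_n -> R) :
  open A -> (forall i, P i -> Ck_on k A (F i)) ->
  Ck_on k A (fun x => \sum_(i <- r | P i) F i x).
Proof.
move=> oA h; elim: r => [|a r IH].
  by apply: (Ck_on_eq oA _ (Ck_on_cst k A 0)) => y _; rewrite big_nil.
have [Pa|Pa] := boolP (P a).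
  by apply: (Ck_on_eq oA _ (Ck_onD oA (h _ Pa) IH)) => y _; rewrite big_cons Pa.
by apply: (Ck_on_eq oA _ IH) => y _; rewrite big_cons (negbTE Pa).
Qed.

Lemma Ck_on_prod (I : Type) (r : seq I) (P : pred I) k A (F : I -> 'rV[R]_n -> R) :
  open A -> (forall i, P i -> Ck_on k A (F i)) ->
  Ck_on k A (fun x => \prod_(i <- r | P i) F i x).
Proof.
move=> oA h; elim: r => [|a r IH].
  by apply: (Ck_on_eq oA _ (Ck_on_cst k A 1)) => y _; rewrite big_nil.
have [Pa|Pa] := boolP (P a).
  by apply: (Ck_on_eq oA _ (Ck_onM oA (h _ Pa) IH)) => y _; rewrite big_cons Pa.
by apply: (Ck_on_eq oA _ IH) => y _; rewrite big_cons (negbTE Pa).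
Qed.

Lemma partialV F x i : F x != 0 -> derivable F x (delta_mx 0 i) ->
  partial i (fun y => (F y)^-1) x = - (F x)^-1 ^+ 2 * partial i F x.
Proof.
move=> F0 dF; rewrite /partial.
by rewrite (deriveV F0 dF) exprVn.
Qed.

Lemma Ck_onV k A F : open A -> (forall x, A x -> F x != 0) -> Ck_on k A F ->
  Ck_on k A (fun x => (F x)^-1).
Proof.
move=> oA F0; elim: k => [|k IH].
  by move=> /Ck_on0 hF; apply/Ck_on0 => x Ax; exact: (cvgV (F0 x Ax) (hF x Ax)).
move=> cF; have /Ck_onS[F1 F2 F3] := cF.
apply/Ck_onS; split.
- by move=> x Ax; exact: (cvgV (F0 x Ax) (F1 x Ax)).
- by move=> x i Ax; apply: derivableV; [exact: F0|exact: F2].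
- move=> i; apply: (@Ck_on_eq _ _
      (fun x => - ((F x)^-1 * (F x)^-1) * partial i F x)) => //.
    by move=> x Ax; rewrite partialV//; [exact: F0|exact: F2].
  have cV : Ck_on k A (fun x => (F x)^-1) by apply: IH; exact: Ck_onW cF.
  exact: (Ck_onM oA (Ck_onN oA (Ck_onM oA cV cV)) (F3 i)).
Qed.

Lemma is_derive_coord x i j :
  is_derive x (delta_mx 0 i) (fun y : 'rV[R]_n => y 0 j) (i == j)%:R.
Proof.
have E : \forall h \near (0 : R)^',
    h^-1 *: (((fun y : 'rV[R]_n => y 0 j) \o shift x) (h *: delta_mx 0 i) - x 0 j)
    = (i == j)%:R.
  near=> h.
  rewrite /= !mxE eqxx /= addrK [j == i]eq_sym [LHS]mulrA mulVf ?mul1r//.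
  by near: h; exact: nbhs_dnbhs_neq.
split; first by apply: is_cvg_near_cst; exact: E.
by apply: lim_near_cst => //; exact: E.
Unshelve. all: by end_near. Qed.

Lemma partial_coord i j : partial i (fun y : 'rV[R]_n => y 0 j) = fun=> (i == j)%:R.
Proof. by apply/funext => x; apply: derive_val; exact: is_derive_coord. Qed.

Lemma Ck_on_coord k A j : Ck_on k A (fun y : 'rV[R]_n => y 0 j).
Proof.
case: k => [|k]; first by apply/Ck_on0 => x _; exact: coord_continuous.
apply/Ck_onS; split.
- by move=> x _; exact: coord_continuous.
- by move=> x i _; have [] := is_derive_coord x i j.
- by move=> i; rewrite partial_coord; exact: Ck_on_cst.
Qed.

(* Restriction of f to a line reduces the statement to the one-dimensional
   chain rule. *)
Lemma is_derive_comp1 (f : R -> R) (df : R) F x v : derivable F x v ->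
  is_derive (F x) (1 : R) f df ->
  is_derive x v (fun y => f (F y)) (df * 'D_v F x).
Proof.
move=> dF df1.
have dL : is_derive (0 : R) (1 : R) (fun s : R => F (s *: v + x)) ('D_v F x).
  by have := @is_derive_line R _ F x v 0; rewrite scale0r add0r => /(_ dF).
have df1' : is_derive ((fun s : R => F (s *: v + x)) 0) (1 : R) f df.
  by rewrite /= scale0r add0r.
have h := @is_derive1_comp R f (fun s : R => F (s *: v + x)) 0 _ _ df1' dL.
have dG : derivable (fun y => f (F y)) x v.
  by apply/derivable1P; have [] := h.
split=> //.
have := @is_derive_line R _ (fun y => f (F y)) x v 0.
rewrite scale0r add0r => /(_ dG) h'.
by rewrite -(@derive_val _ _ _ _ _ _ _ h) -(@derive_val _ _ _ _ _ _ _ h').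
Qed.

(** The outer function is tested only at the values that [F] takes on [A]; thus the lemma covers the
    square root of a positive determinant. *)
Lemma C1_on_comp1 (f df : R -> R) A F : open A -> Ck_on 1 A F ->
  (forall x, A x -> is_derive (F x) (1 : R) f (df (F x))) ->
  (forall x, A x -> {for F x, continuous df}) ->
  Ck_on 1 A (fun x => f (F x)).
Proof.
move=> oA cF hf hdf; have /Ck_onS[F1 F2 F3] := cF.
apply/Ck_onS; split.
- move=> x Ax; apply: continuous_comp; first exact: F1.
  apply: differentiable_continuous; apply/derivable1_diffP.
  by have [] := hf x Ax.
- by move=> x i Ax; have [] := is_derive_comp1 (F2 x i Ax) (hf x Ax).
- move=> i; apply: (@Ck_on_eq _ _ (fun x => df (F x) * partial i F x)) => //.
    move=> x Ax; apply/esym/derive_val.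
    exact: is_derive_comp1 (F2 x i Ax) (hf x Ax).
  have /Ck_on0 F3i := F3 i.
  apply/Ck_on0 => x Ax.
  have cc : {for x, continuous (df \o F)}.
    exact: (continuous_comp (F1 x Ax) (hdf x Ax)).
  exact: (cvgM cc (F3i x Ax)).
Qed.

End Partials.

Lemma dist_half (R : realFieldType) (b c d e : R) :
  `|b - c| <= e / 2 -> `|b - d| <= e / 2 -> `|c - d| <= e.
Proof.
rewrite !ler_norml => /andP[? ?] /andP[? ?]; apply/andP; split; lra.
Qed.

Section SupNorm.
Context {R : realType} {n : nat}.
Implicit Types (x : 'rV[R]_n) (e : R).

(** Row vectors carry the sup norm, so balls are cubes and cutoffs can later be products over the
    coordinates. The sign of [e] matters in dimension 0. *)
Lemma rV_norm_leP x e : 0 <= e -> reflect (forall i, `|x 0 i| <= e) (`|x| <= e).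
Proof.
move=> e0; apply: (iffP idP).
  rewrite [ `|x|]/Num.Def.normr /= mx_normrE => /bigmax_leP[_ h] i.
  exact: (h (0, i)).
move=> h; rewrite [ `|x|]/Num.Def.normr /= mx_normrE; apply/bigmax_leP; split=> //.
by move=> [a i] _ /=; rewrite ord1.
Qed.

Lemma rV_norm_ltP x e : 0 < e -> reflect (forall i, `|x 0 i| < e) (`|x| < e).
Proof.
move=> e0; apply: (iffP idP).
  rewrite [ `|x|]/Num.Def.normr /= mx_normrE => /bigmax_ltP[_ h] i.
  exact: (h (0, i)).
move=> h; rewrite [ `|x|]/Num.Def.normr /= mx_normrE; apply/bigmax_ltP; split=> //.
by move=> [a i] _ /=; rewrite ord1.
Qed.

Lemma coord_le_norm x i : `|x 0 i| <= `|x|.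
Proof. by have /rV_norm_leP := lexx `|x|; apply. Qed.

Lemma row_decomp x : x = \sum_i x 0 i *: delta_mx 0 i.
Proof. exact: row_sum_delta. Qed.

End SupNorm.

Section Differentiability.
Context {R : realType}.

(** The candidate for the differential of a C^1 function with partial derivatives [c]. It has a name
    so that a linear structure can be attached to it. *)
Definition weighted_sum n (c : 'I_n -> R) (h : 'rV[R]_n) : R :=
  \sum_i h 0 i * c i.

Lemma weighted_sum_linear n (c : 'I_n -> R) : linear (weighted_sum c : _ -> R^o).
Proof.
move=> a u v; rewrite /weighted_sum scaler_sumr -big_split /=.
by apply: eq_bigr => i _; rewrite !mxE mulrDl scalerAl.
Qed.

HB.instance Definition _ n (c : 'I_n -> R) :=
  GRing.isLinear.Build R 'rV[R]_n R^o _ (weighted_sum c)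
    (weighted_sum_linear c).

Lemma weighted_sum_continuous n (c : 'I_n -> R) :
  continuous (weighted_sum c : 'rV[R]_n -> R).
Proof.
move=> x; have : Ck_on 0 setT (weighted_sum c).
  apply: Ck_on_sum => [|i _]; first exact: openT.
  by apply: (Ck_onM openT); [exact: Ck_on_coord|exact: Ck_on_cst].
by move=> /Ck_on0; apply.
Qed.

Let trunc n k (h : 'rV[R]_n) : 'rV[R]_n :=
  \row_j (if (j < k)%N then h 0 j else 0).

(** The point [h + x] is reached from [x] by changing one coordinate at a time. On each edge the
    mean value theorem gives a partial derivative at a nearby point, which continuity compares with
    the one at [x]. *)
Lemma C1_on_taylor n (A : set 'rV[R]_n) (F : 'rV[R]_n -> R) x : open A -> A x ->
  Ck_on 1 A F -> forall e, 0 < e -> \forall h \near (0 : 'rV[R]_n),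
  `|F (h + x) - F x - weighted_sum (fun i => partial i F x) h| <= e * `|h|.
Proof.
move=> oA Ax /Ck_onS[F1 F2 F3] e e0.
(* Each of the [n] edges costs [e' * |h|]; the successor keeps the quotient meaningful in dimension
   0. *)
pose e' := e / n.+1%:R; have e'0 : 0 < e' by rewrite divr_gt0.
have : \forall y \near x, A y /\ forall i, `|partial i F y - partial i F x| <= e'.
  near=> y; split.
    by near: y; exact: (open_nbhs_nbhs (conj oA Ax)).
  near: y; apply: filter_forall => i.
  have /Ck_on0 /(_ x Ax) := F3 i.
  move=> /cvgrPdist_le /(_ _ e'0); apply: filterS => y.
  by rewrite distrC.
rewrite -nbhs_nearE => /nbhs_ballP[r /= r0 Hr].
near=> h.
have hr : `|h| < r.
    near: h; apply/nbhs_ballP; exists r => // y.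
    by rewrite mx_norm_ball /ball_ /= sub0r normrN.
have near_x (u : 'rV[R]_n) : (forall i, `|u 0 i| <= `|h|) ->
    A (u + x) /\ forall i, `|partial i F (u + x) - partial i F x| <= e'.
  move=> hu; apply: Hr; rewrite mx_norm_ball /ball_ /= opprD addrCA subrr addr0 normrN.
  by rewrite (le_lt_trans _ hr)//; apply/rV_norm_leP.
have step k : (k <= n)%N ->
   `|F (trunc k h + x) - F x
      - \sum_(i < n | (i < k)%N) h 0 i * partial i F x| <= k%:R * (e' * `|h|).
  elim: k => [|k IH] kn.
    rewrite big_pred0// mul0r (_ : trunc 0 h = 0) ?add0r ?subrr ?subr0 ?normr0//.
    by apply/rowP => j; rewrite !mxE ltn0.
  pose i := Ordinal kn.
  have tE : trunc k.+1 h = h 0 i *: delta_mx 0 i + trunc k h.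
    apply/rowP => j; rewrite !mxE eqxx /= ltnS leq_eqVlt.
    have [->|ji] := eqVneq j i; first by rewrite /= eqxx ltnn mulr1 addr0.
    by rewrite (_ : _ == k :> nat = false) ?mulr0 ?add0r//; exact/negbTE.
  have bnd t : `|t| <= `|h 0 i| -> forall j,
      `|(t *: delta_mx 0 i + trunc k h) 0 j| <= `|h|.
    move=> th j; rewrite !mxE eqxx /=.
    have [->|ji] := eqVneq j i.
      by rewrite ltnn addr0 mulr1 (le_trans th)// coord_le_norm.
    by rewrite mulr0 add0r; case: ifPn => _; rewrite ?coord_le_norm ?normr0.
  have [|c ch E] := @line_MVT_signed R _ F (trunc k h + x) (delta_mx 0 i) (h 0 i).
    by move=> t th; rewrite addrA; apply: F2; have [] := near_x _ (bnd t th).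
  have sE : \sum_(j < n | (j < k.+1)%N) h 0 j * partial j F x =
      h 0 i * partial i F x + \sum_(j < n | (j < k)%N) h 0 j * partial j F x.
    rewrite (bigD1 i)//=; congr (_ + _); apply: eq_bigl => j.
    rewrite ltnS leq_eqVlt andb_orl -(inj_eq val_inj) /=.
    by case: (ltngtP (j : nat) k).
  rewrite sE tE -(addrA (h 0 i *: delta_mx 0 i)).
  have -> : F (h 0 i *: delta_mx 0 i + (trunc k h + x)) =
     h 0 i * partial i F (c *: delta_mx 0 i + (trunc k h + x)) + F (trunc k h + x).
    by apply/eqP; rewrite -subr_eq; apply/eqP.
  set P := partial i F _; set Q := partial i F x; set S := \sum_(_ < n | _) _.
  have -> : h 0 i * P + F (trunc k h + x) - F x - (h 0 i * Q + S) =
     h 0 i * (P - Q) + (F (trunc k h + x) - F x - S) by ring.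
  rewrite (le_trans (ler_normD _ _))// -natr1 mulrDl mul1r addrC lerD ?IH ?(ltnW kn)//.
  rewrite normrM mulrC ler_pM ?coord_le_norm// /P addrA.
  by have [_] := near_x _ (bnd _ ch); apply.
have := step n (leqnn n).
rewrite (_ : trunc n h = h); last by apply/rowP => j; rewrite !mxE ltn_ord.
rewrite (eq_bigl xpredT); last by move=> i; rewrite ltn_ord.
move/le_trans; apply.
rewrite mulrA ler_wpM2r// /e' mulrCA ler_piMr ?(ltW e0)//.
by rewrite ler_pdivrMr// mul1r ler_nat.
Unshelve. all: by end_near. Qed.

Lemma differentiable_taylor (V W : normedModType R) (f : V -> W)
    (L : {linear V -> W}) x : continuous L ->
  (forall e, 0 < e -> \forall h \near (0 : V),
     `|f (h + x) - f x - L h| <= e * `|h|) ->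
  differentiable f x /\ 'd f x = L :> (V -> W).
Proof.
move=> LC h.
have E : f \o shift x = cst (f x) + L +o_ (nbhs (0 : V)) id.
  apply/eqaddoP => e e0; apply: filterS (h e e0) => y /=.
  by rewrite opprD addrA.
have dE : 'd f x = L :> (V -> W) := diff_unique LC E.
by split=> //; apply/diff_locallyP; rewrite dE.
Qed.

Lemma C1_on_diff n (A : set 'rV[R]_n) (F : 'rV[R]_n -> R) x :
  open A -> A x -> Ck_on 1 A F -> differentiable F x /\
  'd F x = weighted_sum (fun i => partial i F x) :> ('rV[R]_n -> R).
Proof.
move=> oA Ax cF.
exact: (@differentiable_taylor 'rV[R]_n R^o F
  (weighted_sum (fun i => partial i F x)) x (@weighted_sum_continuous _ _)
  (C1_on_taylor oA Ax cF)).
Qed.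

Lemma C1_on_derive n (A : set 'rV[R]_n) (F : 'rV[R]_n -> R) x v :
  open A -> A x -> Ck_on 1 A F -> 'D_v F x = \sum_i v 0 i * partial i F x.
Proof.
by move=> oA Ax cF; have [dF E] := C1_on_diff oA Ax cF; rewrite deriveE// E.
Qed.

Lemma C1_on_diff_map m n (A : set 'rV[R]_m) (T : 'rV[R]_m -> 'rV[R]_n) x :
  open A -> A x -> (forall j, Ck_on 1 A (fun y => T y 0 j)) ->
  differentiable T x.
Proof.
move=> oA Ax cT.
have -> : T = \sum_j ((fun y => T y 0 j *: (delta_mx 0 j : 'rV[R]_n))).
  by apply/funext => y; rewrite fct_sumE; exact: row_decomp.
apply: differentiable_sum => j; apply: differentiableZl.
by have [] := C1_on_diff oA Ax (cT j).
Qed.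

Lemma jacobian_partial m n (A : set 'rV[R]_m) (T : 'rV[R]_m -> 'rV[R]_n) x :
  open A -> A x -> (forall j, Ck_on 1 A (fun y => T y 0 j)) ->
  forall i j, jacobian T x i j = partial i (fun y => T y 0 j) x.
Proof.
move=> oA Ax cT i j; have dT := C1_on_diff_map oA Ax cT.
have dTd : derivable T x (delta_mx 0 i) := diff_derivable dT.
have := @deriveEjacobian R m n T x (delta_mx 0 i) dT.
by rewrite derive_mx// -rowE => /rowP/(_ j); rewrite mxE [RHS]mxE => <-.
Qed.

Lemma partial_comp m n (A : set 'rV[R]_m) (B : set 'rV[R]_n)
    (T : 'rV[R]_m -> 'rV[R]_n) (F : 'rV[R]_n -> R) x i :
  open A -> A x -> (forall j, Ck_on 1 A (fun y => T y 0 j)) ->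
  open B -> B (T x) -> Ck_on 1 B F ->
  partial i (F \o T) x =
  \sum_j partial i (fun y => T y 0 j) x * partial j F (T x).
Proof.
move=> oA Ax cT oB BTx cF; have dT := C1_on_diff_map oA Ax cT.
have [dF EF] := C1_on_diff oB BTx cF.
rewrite {1}/partial deriveE; last exact: differentiable_comp.
rewrite diff_comp//= EF /weighted_sum; apply: eq_bigr => j _; congr (_ * _).
by rewrite -(jacobian_partial oA Ax cT) /jacobian -(mul_rV_lin1 ('d T x)) -rowE mxE.
Qed.

Lemma partial_sym n (A : set 'rV[R]_n) (F : 'rV[R]_n -> R) x i j :
  open A -> A x -> Ck_on 2 A F ->
  partial i (partial j F) x = partial j (partial i F) x.
Proof.
move=> oA Ax cF.
(* Both mixed derivatives are attained near x by the same second difference. *)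
have key k l e : 0 < e -> \forall h \near (0 : R)^'+,
    exists2 y, `|y - x| <= e &
    F (h *: delta_mx 0 k + (h *: delta_mx 0 l + x)) - F (h *: delta_mx 0 k + x)
    - F (h *: delta_mx 0 l + x) + F x = h ^+ 2 * partial l (partial k F) y.
  move=> e0.
  have /nbhs_ballP[r /= r0 Ar] := open_nbhs_nbhs (conj oA Ax).
  near=> h.
  have h0 : 0 < h by [].
  have hr : 2 * h < r.
    rewrite mulrC -ltr_pdivlMr//; near: h; apply: nbhs_right_lt.
    by rewrite divr_gt0.
  have he : 2 * h <= e.
    rewrite mulrC -ler_pdivlMr//; near: h; apply: nbhs_right_le.
    by rewrite divr_gt0.
  have bnd s t : 0 <= s <= h -> 0 <= t <= h ->
      `|(s *: delta_mx 0 k + t *: delta_mx 0 l : 'rV[R]_n)| <= 2 * h.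
    move=> /andP[s0 sh] /andP[t0 th].
    apply/rV_norm_leP => [|c]; first by rewrite mulr_ge0// ltW.
    rewrite !mxE /= mulr_natl mulr2n (le_trans (ler_normD _ _))// lerD//.
      rewrite normrM (le_trans (ler_piMr _ _))// ?ger0_norm//.
      by case: (c == k); rewrite /= ?normr0// ler01.
    rewrite normrM (le_trans (ler_piMr _ _))// ?ger0_norm//.
    by case: (c == l); rewrite /= ?normr0// ler01.
  have inA s t : 0 <= s <= h -> 0 <= t <= h ->
      A (s *: delta_mx 0 k + (t *: delta_mx 0 l + x)).
    move=> sh th; apply: Ar; rewrite mx_norm_ball /ball_ /=.
    by rewrite addrA opprD addrCA subrr addr0 normrN (le_lt_trans (bnd _ _ sh th)).
  have h0h : 0 <= h <= h by rewrite lexx ltW.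
  have h00 : 0 <= (0 : R) <= h by rewrite lexx ltW.
  have d1 y c : A y -> derivable F y (delta_mx 0 c).
    by move=> Ay; exact: Ck_on_derivable (Ck_onW (isT : (1 <= 2)%N) cF) Ay.
  pose G y := F (h *: delta_mx 0 l + y) - F y.
  have dsh y c : A (h *: delta_mx 0 l + y) ->
      is_derive y (delta_mx 0 c) (fun y => F (h *: delta_mx 0 l + y))
        (partial c F (h *: delta_mx 0 l + y)).
    move=> Ay.
    have E : (fun t : R => t^-1 *: (((fun y => F (h *: delta_mx 0 l + y)) \o shift y)
          (t *: delta_mx 0 c) - F (h *: delta_mx 0 l + y))) =
        (fun t : R => t^-1 *: ((F \o shift (h *: delta_mx 0 l + y))
          (t *: delta_mx 0 c) - F (h *: delta_mx 0 l + y))).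
      by apply/funext => t /=; rewrite addrCA.
    split; first by rewrite /derivable E; exact: d1.
    by rewrite /derive E.
  have dG t : 0 <= t <= h -> is_derive (t *: delta_mx 0 k + x) (delta_mx 0 k) G
      (partial k F (h *: delta_mx 0 l + (t *: delta_mx 0 k + x))
       - partial k F (t *: delta_mx 0 k + x)).
    move=> th; apply: is_deriveB; last first.
      by apply: DeriveDef => //; apply: d1; have := inA t 0 th h00;
        rewrite scale0r add0r.
    by apply: dsh; rewrite addrCA; exact: inA.
  have [|s sh Es] := @line_MVT R _ G x (delta_mx 0 k) h (ltW h0).
    by move=> t th; have [] := dG t th.
  have [|t th Et] := @line_MVT R _ (partial k F) (s *: delta_mx 0 k + x)
      (delta_mx 0 l) h (ltW h0).
    move=> t th; apply: (Ck_on_derivable (Ck_on_partial k cF)).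
    by rewrite addrCA; exact: inA.
  exists (t *: delta_mx 0 l + (s *: delta_mx 0 k + x)).
    by rewrite addrA addrK addrC (le_trans (bnd _ _ sh th)).
  have Ed := @derive_val _ _ _ _ _ _ _ (dG s sh).
  transitivity (G (h *: delta_mx 0 k + x) - G x).
    by rewrite /G [X in F X - F (_ + x) - _]addrCA; ring.
  by rewrite Es Ed Et expr2 mulrA.
have ck k l e : 0 < e -> \forall r \near (0 : R)^'+, forall y, `|y - x| <= r ->
    `|partial l (partial k F) y - partial l (partial k F) x| <= e.
  move=> e0; have /Ck_on0 /(_ x Ax) := Ck_on_partial l (Ck_on_partial k cF).
  move=> /cvgrPdist_le /(_ _ e0) /nbhs_ballP[r /= r0 Hr].
  near=> s.
  have sr : s < r by near: s; exact: nbhs_right_lt.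
  move=> y yd; rewrite distrC; apply: Hr.
  by rewrite mx_norm_ball /ball_ /= distrC (le_lt_trans yd).
apply/eqP; rewrite -subr_eq0 -normr_eq0; apply/eqP/le_anti; rewrite normr_ge0 andbT.
apply/ler_addgt0Pl => e e0; rewrite addr0.
have e20 : 0 < e / 2 by rewrite divr_gt0.
(* [r] is a radius on which both mixed derivatives vary by at most [e / 2]; afterwards [h] is taken
   so small that the points produced by [key] lie within [r] of [x]. *)
near (0 : R)^'+ => r.
have r0 : 0 < r by [].
have [c1 c2] : (forall y, `|y - x| <= r ->
      `|partial i (partial j F) y - partial i (partial j F) x| <= e / 2) /\
    (forall y, `|y - x| <= r ->
      `|partial j (partial i F) y - partial j (partial i F) x| <= e / 2).
  by near: r; apply: filterI; [exact: (ck j i _ e20)|exact: (ck i j _ e20)].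
near (0 : R)^'+ => h.
have h0 : 0 < h by [].
pose second_diff k l h y := F (h *: delta_mx 0 k + (h *: delta_mx 0 l + x))
  - F (h *: delta_mx 0 k + x) - F (h *: delta_mx 0 l + x) + F x
  = h ^+ 2 * partial l (partial k F) y.
have [[y yr Ey] [w wr Ew]] : (exists2 y, `|y - x| <= r & second_diff j i h y) /\
    (exists2 y, `|y - x| <= r & second_diff i j h y).
  by near: h; apply: filterI; [exact: (key j i r r0)|exact: (key i j r r0)].
rewrite /second_diff in Ey Ew.
have E : partial i (partial j F) y = partial j (partial i F) w.
  have h20 : h ^+ 2 != 0 by rewrite expf_neq0// gt_eqF.
  apply: (mulfI h20); apply: etrans (esym Ey) (etrans _ Ew).
  have -> : h *: delta_mx 0 j + (h *: delta_mx 0 i + x) =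
     h *: delta_mx 0 i + (h *: delta_mx 0 j + x) by rewrite addrCA.
  by congr (_ + _); rewrite addrAC.
have {}c1 := c1 y yr; have {}c2 := c2 w wr.
move: E c1 c2; move: (partial i (partial j F) y) (partial j (partial i F) w)
  (partial i (partial j F) x) (partial j (partial i F) x) => a b c d -> c1 c2.
exact: dist_half c1 c2.
Unshelve. all: by end_near. Qed.

End Differentiability.

(** * Positive definite matrices *)

Section PositiveDefinite.
Context {R : realType}.

Definition posdef d (G : 'M[R]_d) : Prop :=
  G^T = G /\ forall v : 'rV[R]_d, v != 0 -> 0 < (v *m G *m v^T) 0 0.

Lemma mx11_eq (A B : 'M[R]_1) : A 0 0 = B 0 0 -> A = B.
Proof. by move=> AB; apply/matrixP => i j; rewrite !ord1. Qed.

(** Induction on the size: the corner entry is a positive pivot and its Schur complement is again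
    positive definite. The factorization turns traces and quadratic forms into sums of squares. *)
Lemma cholesky d (G : 'M[R]_d) : posdef G -> exists L : 'M[R]_d, L *m L^T = G.
Proof.
elim: d G => [|d IH] G [symG posG].
  by exists 0; apply/matrixP => -[].
move: G symG posG; rewrite -[d.+1]/(1 + d)%N => G symG posG.
pose a := ulsubmx G 0 0; pose b : 'rV[R]_d := ursubmx G.
pose C := drsubmx G.
have aM : ulsubmx G = a%:M.
  by rewrite /a -mx11_scalar.
have dlE : dlsubmx G = b^T by rewrite /b trmx_ursub symG.
have CE : C^T = C by rewrite /C trmx_drsub symG.
have GE : G = block_mx a%:M b b^T C by rewrite -aM -dlE /b /C submxK.
have quadE (x : R) (v : 'rV[R]_d) :
   (row_mx x%:M v *m G *m (row_mx x%:M v)^T) 0 0 =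
   x * x * a + 2 * x * (b *m v^T) 0 0 + (v *m C *m v^T) 0 0.
  rewrite GE mul_row_block tr_row_mx mul_row_col !mulmxDl tr_scalar_mx.
  have -> : v *m b^T = b *m v^T.
    apply: mx11_eq; rewrite !mxE; apply: eq_bigr => i _.
    by rewrite !mxE mulrC.
  rewrite !mul_mx_scalar !mul_scalar_mx -scalemxAl.
  move: (b *m v^T) (v *m C *m v^T) => X Y.
  by rewrite !mxE eqxx !mulr1n; ring.
have a0 : 0 < a.
  have := posG (row_mx 1%:M 0); rewrite quadE trmx0 !mulmx0 mxE !(mulr0, addr0) !mul1r.
  apply; apply/eqP => /(congr1 (fun M => lsubmx M 0 0)).
  rewrite row_mxKl !mxE eqxx => /eqP; apply/negP.
  exact: oner_neq0.
pose S := C - a^-1 *: (b^T *m b).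
have posS : posdef S.
  split; first by rewrite /S linearB /= CE linearZ /= trmx_mul trmxK.
  (* For given [v], this first coordinate minimizes the form of [G], and the minimum is the value of
     the form of [S] at [v]. *)
  move=> v v0; have := posG (row_mx (- a^-1 * (b *m v^T) 0 0)%:M v).
  rewrite quadE => h; apply: lt_le_trans (h _) _.
    by apply: contra v0 => /eqP/(congr1 rsubmx); rewrite row_mxKr linear0 => ->.
  rewrite /S mulmxBr mulmxBl -scalemxAr -scalemxAl.
  have -> : v *m (b^T *m b) *m v^T = (b *m v^T)^T *m (b *m v^T).
    by rewrite trmx_mul trmxK !mulmxA.
  rewrite [b *m v^T]mx11_scalar tr_scalar_mx -scalar_mxM !mxE eqxx !mulr1n.
  set t := (\sum_j b 0 j * v^T j 0).
  have a1 : a != 0 by rewrite gt_eqF.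
  move: t (\sum_j _) => t u; rewrite le_eqVlt; apply/orP; left; apply/eqP.
  by field.
have [L LE] := IH S posS.
pose r := Num.sqrt a.
have r0 : r != 0 by rewrite gt_eqF// sqrtr_gt0.
have rr : r * r = a by rewrite -expr2 sqr_sqrtr// ltW.
exists (block_mx r%:M 0 (r^-1 *: b^T) L).
rewrite tr_block_mx mulmx_block GE !tr_scalar_mx !trmx0 linearZ /= trmxK.
rewrite !mul0mx !mulmx0 !addr0 -scalar_mxM rr mul_scalar_mx scalerA divff// scale1r.
congr (block_mx _ _ _ _).
  by rewrite mul_mx_scalar scalerA divff// scale1r.
by rewrite LE /S -scalemxAr -scalemxAl scalerA -invfM rr addrC subrK.
Qed.

Lemma posdef_unit d (G : 'M[R]_d) : posdef G -> G \in unitmx.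
Proof.
move=> [_ posG]; rewrite -row_free_unit -kermx_eq0; apply/eqP/row_matrixP => i.
rewrite row0; apply/eqP/negPn/negP => /posG.
by rewrite -row_mul mulmx_ker row0 mul0mx mxE ltxx.
Qed.

Lemma posdef_det_gt0 d (G : 'M[R]_d) : posdef G -> 0 < \det G.
Proof.
move=> pG; have [L LE] := cholesky pG.
have := posdef_unit pG; rewrite unitmxE unitfE -LE det_mulmx det_tr -expr2.
by rewrite sqrf_eq0 => h; rewrite lt_def sqrf_eq0 h sqr_ge0.
Qed.

Lemma sum_sqr_le d (x : 'I_d -> R) :
  (\sum_i x i) ^+ 2 <= d%:R * \sum_i x i ^+ 2.
Proof.
have : 0 <= \sum_i \sum_j (x i - x j) ^+ 2.
  by apply: sumr_ge0 => i _; apply: sumr_ge0 => j _; exact: sqr_ge0.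
have -> : \sum_i \sum_j (x i - x j) ^+ 2 =
    2 * (d%:R * \sum_i x i ^+ 2 - (\sum_i x i) ^+ 2).
  transitivity (\sum_i \sum_j (x i ^+ 2 + x j ^+ 2 - 2 * (x i * x j))).
    by apply: eq_bigr => i _; apply: eq_bigr => j _; ring.
  transitivity (\sum_i (d%:R * x i ^+ 2 + \sum_j x j ^+ 2 - 2 * (x i * \sum_j x j))).
    apply: eq_bigr => i _; rewrite big_split /= big_split /= sumr_const card_ord.
    by rewrite mulr_natl sumrN -!mulr_sumr.
  rewrite big_split /= big_split /= -mulr_sumr sumr_const card_ord sumrN -mulr_sumr.
  by rewrite -mulr_suml -mulr_natl; ring.
by rewrite pmulr_rge0// subr_ge0.
Qed.

(** This becomes the bound of the squared Laplacian by d times the squared norm of the Hessian.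
    Writing G^-1 = Q^T Q, the traces are those of the symmetric matrix Q H Q^T and of its square;
    only the diagonal of the latter's sum of squares is kept. *)
Lemma trace_sqr_le d (G H : 'M[R]_d) : posdef G -> H^T = H ->
  (\tr (invmx G *m H)) ^+ 2 <= d%:R * \tr (invmx G *m H *m (invmx G *m H)).
Proof.
move=> pG symH; have [L LE] := cholesky pG.
have uL : L \in unitmx.
  have := posdef_unit pG; rewrite !unitmxE -LE det_mulmx det_tr unitrM.
  by case/andP.
pose Q := invmx L.
have iG : invmx G = Q^T *m Q.
  have u := posdef_unit pG.
  rewrite -[RHS]mulmx1 -(mulmxV u) mulmxA -[X in _ *m X *m _]LE /Q.
  rewrite -(mulmxA _ (invmx L)) mulKmx// -trmx_mul mulmxV// trmx1.
  by rewrite mul1mx.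
pose S := Q *m H *m Q^T.
have symS i j : S i j = S j i.
  have : S^T = S by rewrite /S !trmx_mul trmxK symH mulmxA.
  by move=> /matrixP/(_ j i); rewrite mxE.
have t1 : \tr (invmx G *m H) = \sum_i S i i.
  by rewrite iG -mulmxA mxtrace_mulC.
have t2 : \tr (invmx G *m H *m (invmx G *m H)) = \sum_i \sum_j S i j ^+ 2.
  rewrite iG -!mulmxA mxtrace_mulC !mulmxA -[X in \tr X]mulmxA.
  rewrite (_ : Q *m H *m Q^T *m Q *m (H *m Q^T) = S *m S); last first.
    by rewrite /S !mulmxA.
  apply: eq_bigr => i _; rewrite mxE; apply: eq_bigr => j _.
  by rewrite [S j i]symS expr2.
rewrite t1 t2 (le_trans (sum_sqr_le _))// ler_wpM2l// ler_sum// => i _.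
rewrite (bigD1 i)//= lerDl; apply: sumr_ge0 => j _; exact: sqr_ge0.
Qed.

Lemma posdef_CS d (G : 'M[R]_d) (v w : 'rV[R]_d) : posdef G ->
  ((v *m G *m w^T) 0 0) ^+ 2 <= (v *m G *m v^T) 0 0 * (w *m G *m w^T) 0 0.
Proof.
move=> pG; have [L LE] := cholesky pG.
have E (a b : 'rV[R]_d) : (a *m G *m b^T) 0 0 = \sum_i (a *m L) 0 i * (b *m L) 0 i.
  rewrite -LE mulmxA -mulmxA -trmx_mul mxE.
  by apply: eq_bigr => i _; rewrite [(_ *m _)^T _ _]mxE.
rewrite !E; set x := v *m L; set y := w *m L.
have [y0|y0] := eqVneq (\sum_i y 0 i * y 0 i) 0.
  have yi i : y 0 i = 0.
    have : y 0 i * y 0 i == 0.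
      have /eqP := y0; rewrite psumr_eq0; last by move=> j _; exact: sqr_ge0.
      by move/allP/(_ i (mem_index_enum i)).
    by rewrite mulf_eq0 orbb => /eqP.
  by rewrite big1 ?expr0n ?mulr0 ?y0 ?mulr0// => i _; rewrite yi mulr0.
set A := \sum_i x 0 i * x 0 i; set B := \sum_i y 0 i * y 0 i; set C := \sum_i _.
have B0 : 0 < B.
  by rewrite lt_def y0; apply: sumr_ge0 => i _; exact: sqr_ge0.
have : 0 <= \sum_i (B * x 0 i - C * y 0 i) ^+ 2.
  by apply: sumr_ge0 => i _; exact: sqr_ge0.
have -> : \sum_i (B * x 0 i - C * y 0 i) ^+ 2 = B * (A * B - C ^+ 2).
  transitivity (B ^+ 2 * A + C ^+ 2 * B - 2 * B * C * C); last by ring.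
  have gen (b c : R) : \sum_i (b * x 0 i - c * y 0 i) ^+ 2 =
      b ^+ 2 * A + c ^+ 2 * B - 2 * b * c * C.
    rewrite /A /B /C !mulr_sumr -big_split /= -sumrB.
    by apply: eq_bigr => i _; ring.
  exact: gen.
by rewrite pmulr_rge0// subr_ge0.
Qed.

End PositiveDefinite.

(** * Derivatives of determinants and of inverse matrices *)

Section MatrixCalculus.
Context {R : realType} {n : nat}.
Implicit Types (A : set 'rV[R]_n) (x : 'rV[R]_n).

Lemma partial_sum (I : Type) (r : seq I) (P : pred I) (F : I -> 'rV[R]_n -> R) x i :
  (forall a, P a -> derivable (F a) x (delta_mx 0 i)) ->
  partial i (fun y => \sum_(a <- r | P a) F a y) x =
  \sum_(a <- r | P a) partial i (F a) x /\
  derivable (fun y => \sum_(a <- r | P a) F a y) x (delta_mx 0 i).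
Proof.
move=> dF; elim: r => [|a r [IH1 IH2]].
  rewrite big_nil (_ : (fun _ => _) = fun=> 0); last first.
    by apply/funext => y; rewrite big_nil.
  by rewrite partialC; split=> //; exact: derivable_cst.
rewrite big_cons; have [Pa|Pa] := boolP (P a).
  have -> : (fun y => \sum_(j <- a :: r | P j) F j y) =
      fun y => F a y + \sum_(j <- r | P j) F j y.
    by apply/funext => y; rewrite big_cons Pa.
  have dFa := dF a Pa; rewrite (partialD dFa IH2) IH1.
  by split; [reflexivity|exact: (derivableD dFa IH2)].
have -> : (fun y => \sum_(j <- a :: r | P j) F j y) =
    fun y => \sum_(j <- r | P j) F j y.
  by apply/funext => y; rewrite big_cons (negbTE Pa).
by [].
Qed.

Lemma partial_prod (I : eqType) (r : seq I) (F : I -> 'rV[R]_n -> R) x i :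
  uniq r -> (forall a, derivable (F a) x (delta_mx 0 i)) ->
  partial i (fun y => \prod_(a <- r) F a y) x =
  \sum_(a <- r) partial i (F a) x * \prod_(b <- r | b != a) F b x /\
  derivable (fun y => \prod_(a <- r) F a y) x (delta_mx 0 i).
Proof.
move=> + dF; elim: r => [_|a r IH /= /andP[ar ur]].
  rewrite big_nil (_ : (fun _ => _) = fun=> 1); last first.
    by apply/funext => y; rewrite big_nil.
  by rewrite partialC; split=> //; exact: derivable_cst.
have [IH1 IH2] := IH ur.
have -> : (fun y => \prod_(j <- a :: r) F j y) =
    fun y => F a y * \prod_(j <- r) F j y.
  by apply/funext => y; rewrite big_cons.
split; last exact: (derivableM (dF a) IH2).
rewrite (partialM (dF a) IH2) IH1 big_cons big_cons eqxx /=; congr (_ * _ + _).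
  rewrite [RHS]big_seq_cond [LHS]big_seq_cond; apply: eq_bigl => b.
  by rewrite andbT; case: (boolP (b \in r)) => //= br; apply/esym/eqP => ba; rewrite -ba br in ar.
rewrite mulr_sumr [LHS]big_seq [RHS]big_seq; apply: eq_bigr => b br.
rewrite big_cons ifT; first by rewrite mulrCA.
by apply/eqP => ab; rewrite ab br in ar.
Qed.

Lemma Ck_on_det m k A (G : 'rV[R]_n -> 'M[R]_m) : open A ->
  (forall i j, Ck_on k A (fun x => G x i j)) -> Ck_on k A (fun x => \det (G x)).
Proof.
move=> oA cG; apply: Ck_on_sum => // s _.
by apply: (Ck_onZ _ oA); apply: Ck_on_prod => // i _; exact: cG.
Qed.

Lemma Ck_on_cofactor m k A (G : 'rV[R]_n -> 'M[R]_m) i j : open A ->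
  (forall i j, Ck_on k A (fun x => G x i j)) ->
  Ck_on k A (fun x => cofactor (G x) i j).
Proof.
move=> oA cG; apply: (Ck_onZ _ oA); apply: Ck_on_det => // a b.
have -> : (fun x => row' i (col' j (G x)) a b) = fun x => G x (lift i a) (lift j b).
  by apply/funext => x; rewrite !mxE.
exact: cG.
Qed.

Lemma Ck_on_invmx m k A (G : 'rV[R]_n -> 'M[R]_m) i j : open A ->
  (forall x, A x -> G x \in unitmx) ->
  (forall i j, Ck_on k A (fun x => G x i j)) ->
  Ck_on k A (fun x => invmx (G x) i j).
Proof.
move=> oA uG cG.
apply: (@Ck_on_eq _ _ _ _ (fun x => (\det (G x))^-1 * cofactor (G x) j i)) => //.
  by move=> x Ax; rewrite /invmx (uG x Ax) !mxE.
apply: (Ck_onM oA); last exact: Ck_on_cofactor.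
apply: Ck_onV => //; last exact: Ck_on_det.
by move=> x /uG; rewrite unitmxE unitfE.
Qed.

(** Jacobi's formula. Differentiating the Leibniz expansion means differentiating one row at a time;
    [M a] is the matrix with row [a] differentiated, and its expansion along that row produces the
    cofactors. *)
Lemma partial_det m (G : 'rV[R]_n -> 'M[R]_m) x i :
  (forall a b, derivable (fun y => G y a b) x (delta_mx 0 i)) ->
  partial i (fun y => \det (G y)) x =
  \sum_a \sum_b partial i (fun y => G y a b) x * cofactor (G x) a b.
Proof.
move=> dG.
pose M a : 'M[R]_m := \matrix_(u, v)
  if u == a then partial i (fun y => G y u v) x else G x u v.
transitivity (\sum_a \det (M a)); last first.
  apply: eq_bigr => a _; rewrite (expand_det_row _ a); apply: eq_bigr => b _.
  rewrite mxE eqxx; congr (_ * _); congr (_ * \det _).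
  by apply/matrixP => u v; rewrite !mxE eq_sym (negbTE (neq_lift _ _)).
have dP s := @partial_prod _ (index_enum 'I_m) (fun a y => G y a (s a)) x i
   (index_enum_uniq _) (fun a => dG a (s a)).
rewrite /determinant (@partial_sum _ _ _ (fun (s : {perm 'I_m}) y =>
   (-1) ^+ s * \prod_a G y a (s a)) x i _).1; last first.
  move=> s _; apply: derivableM; first exact: derivable_cst.
  by have [] := dP s.
rewrite exchange_big /=; apply: eq_bigr => s _.
rewrite partialM ?partialC ?mul0r ?add0r; last 2 first.
- exact: derivable_cst.
- by have [] := dP s.
rewrite (dP s).1 -mulr_sumr; congr (_ * _); apply: eq_bigr => a _.
rewrite [RHS](bigD1 a)//= mxE eqxx; congr (_ * _); apply: eq_bigr => b ba.
by rewrite mxE (negbTE ba).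
Qed.

Lemma partial_det_unit m (G : 'rV[R]_n -> 'M[R]_m) x i : G x \in unitmx ->
  (forall a b, derivable (fun y => G y a b) x (delta_mx 0 i)) ->
  partial i (fun y => \det (G y)) x =
  \det (G x) * \sum_a \sum_b invmx (G x) b a * partial i (fun y => G y a b) x.
Proof.
move=> uG dG; rewrite partial_det// mulr_sumr; apply: eq_bigr => a _.
rewrite mulr_sumr; apply: eq_bigr => b _; rewrite mulrC mulrA; congr (_ * _).
rewrite /invmx uG !mxE mulrA divff ?mul1r//.
by rewrite -unitfE -unitmxE.
Qed.

(* d(G^-1) = - G^-1 dG G^-1 *)
Lemma partial_invmx m A (G : 'rV[R]_n -> 'M[R]_m) x i u v : open A -> A x ->
  (forall y, A y -> G y \in unitmx) ->
  (forall a b, Ck_on 1 A (fun y => G y a b)) ->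
  partial i (fun y => invmx (G y) u v) x =
  - \sum_a \sum_b invmx (G x) u a * partial i (fun y => G y a b) x * invmx (G x) b v.
Proof.
move=> oA Ax uG cG.
have dG a b : derivable (fun y => G y a b) x (delta_mx 0 i).
  exact: Ck_on_derivable (cG a b) Ax.
have dI a b : derivable (fun y => invmx (G y) a b) x (delta_mx 0 i).
  by apply: (Ck_on_derivable _ Ax); exact: Ck_on_invmx.
pose D : 'M[R]_m := \matrix_(a, b) partial i (fun y => G y a b) x.
pose E : 'M[R]_m := \matrix_(a, b) partial i (fun y => invmx (G y) a b) x.
have : E *m G x + invmx (G x) *m D = 0.
  apply/matrixP => a b; rewrite !mxE -big_split /=.
  transitivity (partial i (fun y => \sum_c invmx (G y) a c * G y c b) x).
    rewrite (@partial_sum _ _ _ (fun c y => invmx (G y) a c * G y c b) x i _).1.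
      by apply: eq_bigr => c _; rewrite !mxE partialM.
    by move=> c _; exact: derivableM.
  rewrite (@partial_open _ _ A _ (fun=> (1%:M : 'M[R]_m) a b))//; first by rewrite partialC.
  by move=> y Ay; rewrite -(mulVmx (uG y Ay)) mxE.
move=> /eqP; rewrite addr_eq0 => /eqP /(congr1 (mulmx^~ (invmx (G x)))).
rewrite mulmxK ?uG// => /matrixP/(_ u v); rewrite mxE => ->.
rewrite mulNmx mxE; congr (- _); rewrite mxE exchange_big /=; apply: eq_bigr => b _.
by rewrite mxE mulr_suml; apply: eq_bigr => a _; rewrite mxE.
Qed.

End MatrixCalculus.

(** * Local Riemannian geometry and Bochner's formula *)

Section BochnerAlgebra.
Context {R : comNzRingType} {d : nat}.
Implicit Types (V : 'I_d -> R).

(** [C k i j] stands for a Christoffel symbol with upper index [k] at a point and [dC l k i j] for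
    its derivative along the coordinate [l]. Abstract values make the identity below purely
    algebraic. *)
Definition ricci_form (C : 'I_d -> 'I_d -> 'I_d -> R)
    (dC : 'I_d -> 'I_d -> 'I_d -> 'I_d -> R) (v w : 'I_d -> R) : R :=
  \sum_j \sum_i (\sum_k (dC k k j i - dC j k k i +
     \sum_m (C k k m * C m j i - C k j m * C m k i))) * v j * w i.

(** Bochner's identity at one point, up to the factor 2, with derivatives treated as unknowns:
    [A k i] is component [k] of the covariant derivative of [V] along [i], [dV] and [ddV] are
    ordinary derivatives of [V], and [dA] those of [A]. The left side is half the divergence of the
    gradient of the squared norm of [V]. *)
Lemma bochner_algebra V C (A : 'I_d -> 'I_d -> R) (dV : 'I_d -> 'I_d -> R)
    (dA ddV : 'I_d -> 'I_d -> 'I_d -> R)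
    (dC : 'I_d -> 'I_d -> 'I_d -> 'I_d -> R) :
  (forall k i j, C k i j = C k j i) ->
  (forall i k, dV i k = A k i - \sum_m C k i m * V m) ->
  (forall j k i, dA j k i =
     ddV j i k + \sum_m (dC j k i m * V m + C k i m * dV j m)) ->
  (forall i j k, ddV i j k = ddV j i k) ->
  \sum_k \sum_l (dA k k l * V l + A k l * dV k l) +
    \sum_k (\sum_m C m m k) * (\sum_l A k l * V l) =
  \sum_k \sum_l A k l * A l k + \sum_l V l * (\sum_k dA l k k) +
  ricci_form C dC V V.
Proof.
move=> symC dVE dAE sym.
have rE : ricci_form C dC V V =
    \sum_k \sum_l \sum_m (dC k k l m - dC l k k m) * V m * V l
    + \sum_k \sum_l \sum_m \sum_n (C k k n * C n l m - C k l n * C n k m) * V m * V l.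
  pose X k l m := dC k k l m - dC l k k m
     + \sum_n (C k k n * C n l m - C k l n * C n k m).
  transitivity (\sum_l \sum_k \sum_m X k l m * V m * V l).
    apply: eq_bigr => l _; rewrite [RHS]exchange_big /=; apply: eq_bigr => m _.
    rewrite -mulrA mulr_suml; apply: eq_bigr => k _.
    by rewrite -mulrA; congr (_ * _); exact: mulrC.
  rewrite exchange_big -big_split /=; apply: eq_bigr => k _.
  rewrite -big_split /=; apply: eq_bigr => l _.
  rewrite -big_split /=; apply: eq_bigr => m _.
  by rewrite /X 2!mulrDl; congr (_ + _); rewrite !mulr_suml.
(* The Ricci identity: exchanging the two differentiations of [V] produces the curvature, apart from
   two sums with [A] that are matched later by the symmetry of [C]. *)
have dAk k l : dA k k l = dA l k k + \sum_m (dC k k l m - dC l k k m) * V m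
     + \sum_m C k l m * A m k - \sum_m C k k m * A m l
     + \sum_m \sum_n (C k k n * C n l m - C k l n * C n k m) * V m.
  rewrite !dAE (sym k l k).
  have E (a b : 'I_d) : \sum_m C k a m * dV b m =
     \sum_m C k a m * A m b - \sum_m \sum_n C k a n * C n b m * V m.
    rewrite exchange_big -sumrB; apply: eq_bigr => m _.
    rewrite dVE mulrBr mulr_sumr; congr (_ - _).
    by apply: eq_bigr => n _; ring.
  rewrite !big_split /= !E.
  under [X in _ = _ + X]eq_bigr => m _ do
    (under eq_bigr => n _ do rewrite mulrBl; rewrite sumrB).
  under [X in _ = _ + X + _ - _ + _]eq_bigr => m _ do rewrite mulrBl.
  rewrite !sumrB; ring.
rewrite rE.
have AdV : \sum_k \sum_l A k l * dV k l =
    \sum_k \sum_l A k l * A l k - \sum_k \sum_l \sum_m A k l * C l k m * V m.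
  rewrite -sumrB; apply: eq_bigr => k _; rewrite -sumrB; apply: eq_bigr => l _.
  rewrite dVE mulrBr mulr_sumr; congr (_ - _).
  by apply: eq_bigr => m _; rewrite mulrA.
have dAV : \sum_k \sum_l dA k k l * V l =
    \sum_l V l * (\sum_k dA l k k)
    + \sum_k \sum_l \sum_m (dC k k l m - dC l k k m) * V m * V l
    + \sum_k \sum_l \sum_m C k l m * A m k * V l
    - \sum_k \sum_l \sum_m C k k m * A m l * V l
    + \sum_k \sum_l \sum_m \sum_n (C k k n * C n l m - C k l n * C n k m) * V m * V l.
  have -> : \sum_l V l * (\sum_k dA l k k) = \sum_k \sum_l dA l k k * V l.
    rewrite exchange_big; apply: eq_bigr => l _; rewrite mulr_sumr.
    by apply: eq_bigr => k _; rewrite mulrC.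
  rewrite -!big_split /= -sumrB -big_split /=; apply: eq_bigr => k _.
  rewrite -!big_split /= -sumrB -big_split /=; apply: eq_bigr => l _.
  rewrite dAk 3!mulrDl mulNr mulrDl !mulr_suml; congr (_ + _).
  by apply: eq_bigr => m _; rewrite mulr_suml.
have cA : \sum_k (\sum_m C m m k) * (\sum_l A k l * V l) =
    \sum_k \sum_l \sum_m C k k m * A m l * V l.
  under eq_bigr => k _ do rewrite mulr_suml.
  rewrite exchange_big /=; apply: eq_bigr => k _.
  under eq_bigr => m _ do rewrite mulr_sumr.
  rewrite exchange_big /=; apply: eq_bigr => l _; apply: eq_bigr => m _.
  by rewrite mulrA.
have cB : \sum_k \sum_l \sum_m C k l m * A m k * V l =
    \sum_k \sum_l \sum_m A k l * C l k m * V m.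
  rewrite exchange_big /=.
  under eq_bigr => l _ do rewrite exchange_big /=.
  rewrite exchange_big /=.
  apply: eq_bigr => m _; rewrite exchange_big /=; apply: eq_bigr => k _.
  by apply: eq_bigr => l _; rewrite (symC k l m); ring.
under [X in X + _ = _]eq_bigr => k _ do rewrite big_split /=.
rewrite big_split /= AdV dAV cA cB.
move: (\sum_k \sum_l \sum_m C k k m * A m l * V l)
 (\sum_k \sum_l \sum_m A k l * C l k m * V m) (\sum_k \sum_l A k l * A l k)
 (\sum_l V l * (\sum_k dA l k k)) => a b c e.
move: (\sum_k \sum_l \sum_m (dC k k l m - dC l k k m) * V m * V l)
 (\sum_k \sum_l \sum_m \sum_n (C k k n * C n l m - C k l n * C n k m) * V m * V l)
 => f h.
by ring.
Qed.

End BochnerAlgebra.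

Section LocalGeometry.
Context {R : realType} {d : nat} (U : set 'rV[R]_d) (G : 'rV[R]_d -> 'M[R]_d).

(** The formula of [christoffel] with an arbitrary matrix function in place of the Gram matrix of a
    chart. Geometry in coordinates is thus developed without a manifold and specialized afterwards
    by conversion. *)
Definition chr (k i j : 'I_d) (x : 'rV[R]_d) : R :=
  2^-1 * \sum_l invmx (G x) k l *
    (partial i (fun y => G y j l) x +
     partial j (fun y => G y i l) x -
     partial l (fun y => G y i j) x).

Definition vol_density (x : 'rV[R]_d) : R := Num.sqrt (\det (G x)).

Definition local_grad (w : 'rV[R]_d -> R) (x : 'rV[R]_d) : 'rV[R]_d :=
  (\row_i partial i w x) *m invmx (G x).

Definition local_div (X : 'rV[R]_d -> 'rV[R]_d) (x : 'rV[R]_d) : R :=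
  (vol_density x)^-1 * \sum_i partial i (fun y => vol_density y * X y 0 i) x.

Definition quad (v w : 'rV[R]_d) (x : 'rV[R]_d) : R := (v *m G x *m w^T) 0 0.

Definition local_ricci (x v w : 'rV[R]_d) : R :=
  ricci_form (fun k i j => chr k i j x)
    (fun l k i j => partial l (chr k i j) x) (v 0) (w 0).

Hypothesis oU : open U.
Hypothesis sG : forall i j, smooth_on U (fun x => G x i j).
Hypothesis pG : forall x, U x -> posdef (G x).

Let uG x : U x -> G x \in unitmx.
Proof. by move=> /pG; exact: posdef_unit. Qed.

Let dG x i a b : U x -> derivable (fun y => G y a b) x (delta_mx 0 i).
Proof. exact: (Ck_on_derivable (@sG a b 1)). Qed.

Let symG x a b : U x -> G x a b = G x b a.
Proof. by move=> /pG[h _]; rewrite -[in LHS]h mxE. Qed.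

Let symI x a b : U x -> invmx (G x) a b = invmx (G x) b a.
Proof.
by move=> /pG[h _]; rewrite -[in LHS]h -trmx_inv mxE.
Qed.

Let dsymG x i a b : U x ->
  partial i (fun y => G y a b) x = partial i (fun y => G y b a) x.
Proof. by move=> Ux; apply: (partial_open _ oU Ux) => y /symG. Qed.

Lemma smooth_invmx k a b : Ck_on k U (fun x => invmx (G x) a b).
Proof. by apply: Ck_on_invmx => // i j; exact: sG. Qed.

Lemma smooth_chr m k i j : Ck_on m U (chr k i j).
Proof.
apply: (Ck_onZ _ oU); apply: Ck_on_sum => // l _.
apply: (Ck_onM oU); first exact: smooth_invmx.
have P a b c : Ck_on m U (partial a (fun y => G y b c)).
  by apply: Ck_on_partial; exact: sG.
exact: (Ck_onB oU (Ck_onD oU (P _ _ _) (P _ _ _)) (P _ _ _)).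
Qed.

Lemma chr_sym x k i j : U x -> chr k i j x = chr k j i x.
Proof.
move=> Ux; rewrite /chr; congr (_ * _); apply: eq_bigr => l _; congr (_ * _).
by rewrite (dsymG l i j Ux) [X in X - _]addrC.
Qed.

Lemma chr_lower x k i j : U x -> \sum_m G x k m * chr m i j x =
  2^-1 * (partial i (fun y => G y j k) x + partial j (fun y => G y i k) x -
          partial k (fun y => G y i j) x).
Proof.
move=> Ux; pose B l := partial i (fun y => G y j l) x +
     partial j (fun y => G y i l) x - partial l (fun y => G y i j) x.
transitivity (2^-1 * \sum_l (\sum_m G x k m * invmx (G x) m l) * B l).
  rewrite mulr_sumr; under [RHS]eq_bigr => l _ do rewrite mulr_suml mulr_sumr.
  rewrite exchange_big /=; apply: eq_bigr => m _.
  rewrite /chr mulrCA mulr_sumr mulr_sumr; apply: eq_bigr => l _.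
  by congr (_ * _); exact: mulrA.
congr (_ * _); rewrite (bigD1 k)//= [X in _ + X]big1 ?addr0.
  have /matrixP/(_ k k) := mulmxV (uG Ux); rewrite !mxE eqxx => ->.
  by rewrite mul1r.
move=> l lk; have /matrixP/(_ k l) := mulmxV (uG Ux); rewrite !mxE => ->.
by rewrite eq_sym (negbTE lk) mul0r.
Qed.

Lemma metric_compat x i j k : U x -> partial i (fun y => G y j k) x =
  \sum_m G x k m * chr m i j x + \sum_m G x j m * chr m i k x.
Proof.
move=> Ux; rewrite !chr_lower// (dsymG i k j Ux) (dsymG k i j Ux) (dsymG j i k Ux).
move: (partial i _ x) (partial j _ x) (partial k _ x) => a b c.
by field.
Qed.

Lemma density_gt0 x : U x -> 0 < vol_density x.
Proof. by move=> Ux; rewrite sqrtr_gt0 posdef_det_gt0//; exact: pG. Qed.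

Lemma is_derive_sqrt (t : R) : 0 < t ->
  is_derive t (1 : R) (@Num.sqrt R) ((2 * Num.sqrt t)^-1).
Proof. exact: is_derive1_sqrt. Qed.

Lemma C1_density : Ck_on 1 U vol_density.
Proof.
have h x : U x -> is_derive (\det (G x)) (1 : R) (@Num.sqrt R)
    ((2 * Num.sqrt (\det (G x)))^-1).
  by move=> Ux; apply: is_derive_sqrt; apply: posdef_det_gt0; exact: pG.
apply: (C1_on_comp1 (df := fun t => (2 * Num.sqrt t)^-1) oU _ h).
  by apply: Ck_on_det => // i j; exact: sG.
move=> x Ux; apply: cvgV.
  by rewrite mulf_neq0// gt_eqF//; exact: density_gt0.
by apply: cvgM; [exact: cvg_cst|exact: sqrt_continuous].
Qed.

(** Jacobi's formula gives half the trace of G^-1 times the derivative of G. In the contracted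
    Christoffel symbol two of the three derivatives of the metric cancel by symmetry and leave the
    same trace. *)
Lemma partial_density x i : U x ->
  partial i vol_density x = vol_density x * \sum_k chr k k i x.
Proof.
move=> Ux.
have dd : derivable (fun y => \det (G y)) x (delta_mx 0 i).
  apply: (@Ck_on_derivable _ _ 0 U) => //.
  by apply: Ck_on_det => // a b; exact: sG.
have d0 : 0 < \det (G x) by apply: posdef_det_gt0; exact: pG.
have h := is_derive_comp1 dd (is_derive_sqrt d0).
have -> : partial i vol_density x =
    (2 * Num.sqrt (\det (G x)))^-1 * partial i (fun y => \det (G y)) x.
  exact: (@derive_val _ _ _ _ _ _ _ h).
rewrite (partial_det_unit (uG Ux) (fun a b => @dG x i a b Ux)).
have -> : \sum_k chr k k i x =
    2^-1 * \sum_a \sum_b invmx (G x) b a * partial i (fun y => G y a b) x.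
  rewrite /chr -mulr_sumr; congr (_ * _).
  under eq_bigr => k _ do under eq_bigr => l _ do rewrite mulrBr mulrDr.
  under eq_bigr => k _ do rewrite sumrB big_split /=.
  rewrite sumrB big_split /=.
  rewrite [X in _ - X]exchange_big /=.
  under [X in _ - X]eq_bigr => l _ do under eq_bigr => k _ do
     rewrite (symI _ _ Ux) (dsymG _ _ _ Ux).
  rewrite addrAC subrr add0r exchange_big /=.
  by apply: eq_bigr => l _; apply: eq_bigr => k _; rewrite (dsymG _ _ _ Ux).
move: (\sum_a _) => s.
have -> : \det (G x) = vol_density x * vol_density x.
  by rewrite -expr2 sqr_sqrtr// ltW.
rewrite sqrtrM ?sqrtr_ge0// -/(vol_density x).
have := density_gt0 Ux; rewrite /vol_density; move: (Num.sqrt _) => r r0.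
rewrite -expr2 sqr_sqrtr ?ltW//; field.
by rewrite gt_eqF.
Qed.

Lemma local_divE (X : 'rV[R]_d -> 'rV[R]_d) x : U x ->
  (forall i, derivable (fun y => X y 0 i) x (delta_mx 0 i)) ->
  local_div X x = \sum_i partial i (fun y => X y 0 i) x +
    \sum_i (\sum_k chr k k i x) * X x 0 i.
Proof.
move=> Ux dX; rewrite /local_div mulr_sumr -big_split /=.
apply: eq_bigr => i _.
have dr : derivable vol_density x (delta_mx 0 i).
  exact: Ck_on_derivable C1_density Ux.
rewrite (partialM dr (dX i)) partial_density//.
have := density_gt0 Ux; move: (vol_density x) => r r0.
by field; rewrite gt_eqF.
Qed.

Lemma local_gradE w x k : local_grad w x 0 k = \sum_l partial l w x * invmx (G x) l k.
Proof. by rewrite /local_grad mxE; apply: eq_bigr => l _; rewrite mxE. Qed.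

Lemma Ck_on_local_grad w m k : Ck_on m.+1 U w ->
  Ck_on m U (fun x => local_grad w x 0 k).
Proof.
move=> cw; apply: (@Ck_on_eq _ _ _ _
  (fun x => \sum_l partial l w x * invmx (G x) l k)) => //.
  by move=> y _; rewrite local_gradE.
apply: Ck_on_sum => // l _; apply: (Ck_onM oU); last exact: smooth_invmx.
exact: Ck_on_partial.
Qed.

Section Gradient.
Context (w : 'rV[R]_d -> R).

Let V := local_grad w.

Lemma lower_grad x j : U x -> \sum_k G x j k * V x 0 k = partial j w x.
Proof.
move=> Ux; transitivity ((V x *m G x) 0 j).
  by rewrite mxE; apply: eq_bigr => k _; rewrite mulrC (symG j k Ux).
by rewrite /V /local_grad mulmxKV ?uG// mxE.
Qed.

(** The Hessian of [w] with one index raised, written as the covariant derivative of the gradient;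
    [lower_covder] relates it to [hess]. *)
Definition covder (k i : 'I_d) (x : 'rV[R]_d) : R :=
  partial i (fun y => V y 0 k) x + \sum_m chr k i m x * V x 0 m.

Definition hess (i j : 'I_d) (x : 'rV[R]_d) : R :=
  partial i (partial j w) x - \sum_k chr k i j x * partial k w x.

Hypothesis cw : Ck_on 3 U w.

Let cV k : Ck_on 2 U (fun x => V x 0 k).
Proof. exact: Ck_on_local_grad. Qed.

Let dV x i k : U x -> derivable (fun x => V x 0 k) x (delta_mx 0 i).
Proof. exact: (Ck_on_derivable (cV k)). Qed.

Lemma hess_sym x i j : U x -> hess i j x = hess j i x.
Proof.
move=> Ux; rewrite /hess (partial_sym i j oU Ux); last exact: Ck_onW cw.
by congr (_ - _); apply: eq_bigr => k _; rewrite chr_sym.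
Qed.

(** Obtained by differentiating G V = dw and expressing the derivative of G by Christoffel symbols
    through [metric_compat]. *)
Lemma lower_covder x i j : U x -> \sum_k G x j k * covder k i x = hess i j x.
Proof.
move=> Ux; rewrite /covder /hess.
have -> : partial i (partial j w) x =
    \sum_k (partial i (fun y => G y j k) x * V x 0 k
            + G x j k * partial i (fun y => V y 0 k) x).
  rewrite -(@partial_open _ _ U (fun y => \sum_k G y j k * V y 0 k))//.
    rewrite (@partial_sum _ _ _ _ _ (fun k y => G y j k * V y 0 k) x i _).1.
      by apply: eq_bigr => k _; rewrite (partialM (@dG _ _ _ _ Ux) (@dV _ _ _ Ux)).
    by move=> k _; exact: (derivableM (@dG _ _ _ _ Ux) (@dV _ _ _ Ux)).
  by move=> y Uy; rewrite lower_grad.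
rewrite big_split /=.
under [X in _ = X + _ - _]eq_bigr => k _ do rewrite (metric_compat _ _ _ Ux) mulrDl.
rewrite big_split /=.
under eq_bigr => k _ do rewrite mulrDr.
rewrite big_split /=.
have -> : \sum_k G x j k * (\sum_m chr k i m x * V x 0 m) =
    \sum_k (\sum_m G x j m * chr m i k x) * V x 0 k.
  under eq_bigr => k _ do rewrite mulr_sumr.
  rewrite exchange_big /=; apply: eq_bigr => k _; rewrite mulr_suml.
  by apply: eq_bigr => m _; rewrite mulrA.
have -> : \sum_k (\sum_m G x k m * chr m i j x) * V x 0 k =
    \sum_k chr k i j x * partial k w x.
  under eq_bigr => k _ do rewrite mulr_suml.
  rewrite exchange_big /=; apply: eq_bigr => m _.
  rewrite -(lower_grad _ Ux) mulr_sumr; apply: eq_bigr => k _.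
  by rewrite (symG k m Ux); ring.
move: (\sum_k _) (\sum_k _) (\sum_k _) => a b c.
by ring.
Qed.

Definition energy (x : 'rV[R]_d) : R := quad (V x) (V x) x.

Lemma energyE x : U x -> energy x = \sum_k partial k w x * V x 0 k.
Proof.
move=> Ux; rewrite /energy /quad /V /local_grad mulmxKV ?uG// mxE.
by apply: eq_bigr => k _; rewrite !mxE.
Qed.

Lemma C2_energy : Ck_on 2 U energy.
Proof.
apply: (@Ck_on_eq _ _ _ _ (fun x => \sum_k partial k w x * V x 0 k)) => //.
  by move=> y Uy; rewrite energyE.
apply: Ck_on_sum => // k _; apply: (Ck_onM oU _ (cV k)).
exact: Ck_on_partial.
Qed.

(** The energy is dw applied to the gradient. In the product rule each of the two terms equals the
    Hessian term up to a Christoffel correction, and the two corrections cancel. *)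
Lemma partial_energy x i : U x ->
  partial i energy x = 2 * \sum_l hess i l x * V x 0 l.
Proof.
move=> Ux.
have dw l : derivable (partial l w) x (delta_mx 0 i).
  by apply: Ck_on_derivable Ux; apply: Ck_on_partial; exact: Ck_onW cw.
rewrite (@partial_open _ _ U _ (fun x => \sum_k partial k w x * V x 0 k))//; last first.
  by move=> y Uy; rewrite energyE.
rewrite (@partial_sum _ _ _ _ _ (fun k y => partial k w y * V y 0 k) x i _).1; last first.
  by move=> k _; exact: (derivableM (dw k) (@dV _ _ _ Ux)).
under eq_bigr => k _ do rewrite (partialM (dw k) (@dV _ _ _ Ux)).
rewrite big_split /=.
have -> : \sum_k partial k w x * partial i (fun y => V y 0 k) x =
    \sum_l hess i l x * V x 0 l - \sum_k partial k w x * \sum_m chr k i m x * V x 0 m.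
  apply/eqP; rewrite -subr_eq opprK; apply/eqP; rewrite -big_split /=.
  under eq_bigr => k _ do rewrite -mulrDr -/(covder k i x) -(lower_grad _ Ux) mulr_suml.
  rewrite exchange_big /=; apply: eq_bigr => l _.
  rewrite -(lower_covder _ _ Ux) mulr_suml; apply: eq_bigr => k _.
  by rewrite (symG k l Ux); ring.
have -> : \sum_k partial i (partial k w) x * V x 0 k =
    \sum_l hess i l x * V x 0 l + \sum_k partial k w x * \sum_m chr k i m x * V x 0 m.
  under [X in _ = _ + X]eq_bigr => k _ do rewrite mulr_sumr.
  rewrite [X in _ = _ + X]exchange_big -big_split /=; apply: eq_bigr => l _.
  rewrite /hess mulrBl mulr_suml [X in _ = _ - _ + X](_ : _ =
    \sum_k chr k i l x * partial k w x * V x 0 l) ?subrK//.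
  by apply: eq_bigr => k _; ring.
by ring.
Qed.

Lemma grad_energy x k : U x ->
  local_grad energy x 0 k = 2 * \sum_l covder k l x * V x 0 l.
Proof.
move=> Ux; rewrite /local_grad mxE.
under eq_bigr => i _ do rewrite mxE (partial_energy _ Ux) -mulrA.
rewrite -mulr_sumr; congr (_ * _).
under eq_bigr => i _ do rewrite mulr_suml.
rewrite exchange_big /=; apply: eq_bigr => l _.
under eq_bigr => i _ do rewrite mulrAC.
rewrite -mulr_suml; congr (_ * _).
under eq_bigr => i _ do rewrite (hess_sym _ _ Ux) -(lower_covder _ _ Ux) mulr_suml.
rewrite exchange_big /= (bigD1 k)//= [X in _ + X]big1 ?addr0.
  under eq_bigr => i _ do rewrite mulrAC (symG i k Ux).
  rewrite -mulr_suml; have /matrixP/(_ k k) := mulmxV (uG Ux).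
  by rewrite !mxE eqxx => ->; rewrite mul1r.
move=> m mk.
under eq_bigr => i _ do rewrite mulrAC (symG i m Ux).
rewrite -mulr_suml; have /matrixP/(_ m k) := mulmxV (uG Ux).
by rewrite !mxE (negbTE mk) => ->; rewrite mul0r.
Qed.

Lemma laplacian_trace x : U x -> local_div V x = \sum_k covder k k x.
Proof.
move=> Ux; rewrite local_divE//; last by move=> i; exact: dV.
rewrite /covder big_split /=; congr (_ + _); rewrite [RHS]exchange_big /=.
by apply: eq_bigr => i _; rewrite mulr_suml.
Qed.

Let cA k i : Ck_on 1 U (covder k i).
Proof.
apply: (Ck_onD oU); first exact: (Ck_on_partial i (cV k)).
apply: Ck_on_sum => // m _; apply: (Ck_onM oU); first exact: smooth_chr.
exact: Ck_onW (cV m).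
Qed.

Lemma C1_laplacian : Ck_on 1 U (local_div V).
Proof.
apply: (@Ck_on_eq _ _ _ _ (fun x => \sum_k covder k k x)) => //.
  by move=> y Uy; rewrite laplacian_trace.
by apply: Ck_on_sum => // k _; exact: cA.
Qed.

Lemma bochner x : U x ->
  local_div (local_grad energy) x =
  2 * (\sum_k \sum_l covder k l x * covder l k x +
       \sum_l V x 0 l * partial l (local_div V) x + local_ricci x (V x) (V x)).
Proof.
move=> Ux.
have dA j k l : derivable (covder k l) x (delta_mx 0 j).
  exact: Ck_on_derivable (cA k l) Ux.
have dC j k l m : derivable (chr k l m) x (delta_mx 0 j).
  exact: Ck_on_derivable (smooth_chr 1 k l m) Ux.
have ddV j k l : derivable (partial l (fun y => V y 0 k)) x (delta_mx 0 j).
  exact: Ck_on_derivable (Ck_on_partial l (cV k)) Ux.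
have gE i : partial i (fun y => local_grad energy y 0 i) x =
    2 * \sum_l (partial i (covder i l) x * V x 0 l
                + covder i l x * partial i (fun y => V y 0 l) x).
  rewrite (@partial_open _ _ U _ (fun y => 2 * \sum_l covder i l y * V y 0 l))//.
    have ds := (@partial_sum _ _ _ (index_enum 'I_d) xpredT
      (fun l y => covder i l y * V y 0 l) x i
      (fun l _ => derivableM (dA i i l) (@dV _ _ _ Ux))).
    rewrite (partialM (derivable_cst _ _ _) ds.2) partialC mul0r add0r ds.1.
    by congr (_ * _); apply: eq_bigr => l _; rewrite (partialM (dA i i l) (@dV _ _ _ Ux)).
  by move=> y Uy; rewrite grad_energy.
rewrite local_divE//; last first.
  by move=> i; exact: (Ck_on_derivable (Ck_on_local_grad i C2_energy) Ux).
under eq_bigr => i _ do rewrite gE.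
under [X in _ + X]eq_bigr => i _ do rewrite grad_energy// mulrCA.
rewrite -!mulr_sumr -mulrDr; congr (_ * _).
have -> : \sum_l V x 0 l * partial l (local_div V) x =
    \sum_l V x 0 l * \sum_k partial l (covder k k) x.
  apply: eq_bigr => l _; congr (_ * _).
  rewrite (@partial_open _ _ U _ (fun y => \sum_k covder k k y))//.
    by rewrite (@partial_sum _ _ _ _ _ (fun k y => covder k k y) x l _).1.
  by move=> y Uy; rewrite laplacian_trace.
rewrite /local_ricci.
apply: (@bochner_algebra _ _ (V x 0) (fun k i j => chr k i j x)
  (fun k i => covder k i x) (fun i k => partial i (fun y => V y 0 k) x)
  (fun j k i => partial j (covder k i) x)
  (fun i j k => partial i (partial j (fun y => V y 0 k)) x)).
- by move=> k i j; rewrite chr_sym.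
- by move=> i k; rewrite /covder addrK.
- move=> j k i; rewrite /covder.
  have ds := (@partial_sum _ _ _ (index_enum 'I_d) xpredT
      (fun m y => chr k i m y * V y 0 m) x j
      (fun m _ => derivableM (dC j k i m) (@dV _ _ _ Ux))).
  rewrite (partialD (ddV j k i) ds.2) ds.1; congr (_ + _).
  by apply: eq_bigr => m _; rewrite (partialM (dC j k i m) (@dV _ _ _ Ux)).
- by move=> i j k; apply: (partial_sym _ _ oU Ux); exact: cV.
Qed.

(** The double sum in [bochner] is the trace of the square of G^-1 times the Hessian, hence is
    bounded below by [trace_sqr_le]. *)
Lemma bochner_le x : U x ->
  2 * ((local_div V x) ^+ 2 / d%:R +
       \sum_l V x 0 l * partial l (local_div V) x + local_ricci x (V x) (V x))
  <= local_div (local_grad energy) x.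
Proof.
move=> Ux; rewrite bochner// ler_pM2l// lerD2r lerD2r laplacian_trace//.
pose H : 'M[R]_d := \matrix_(i, j) hess i j x.
pose A : 'M[R]_d := \matrix_(k, i) covder k i x.
have AE : A = invmx (G x) *m H.
  apply: (can_inj (mulKmx (uG Ux))); rewrite mulKVmx ?uG//.
  apply/matrixP => j i; rewrite !mxE (hess_sym _ _ Ux) -(lower_covder _ _ Ux).
  by apply: eq_bigr => k _; rewrite mxE.
have symH : H^T = H by apply/matrixP => i j; rewrite !mxE hess_sym.
have := trace_sqr_le (pG Ux) symH; rewrite -AE.
have -> : \tr A = \sum_k covder k k x by apply: eq_bigr => k _; rewrite mxE.
have -> : \tr (A *m A) = \sum_k \sum_l covder k l x * covder l k x.
  by apply: eq_bigr => k _; rewrite mxE; apply: eq_bigr => l _; rewrite !mxE.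
(* In dimension 0 the division by [d%:R] has to be treated apart; all sums are then empty. *)
have [d0|d0] := posnP d.
  have no (k : 'I_d) : False by have := ltn_ord k; move: (nat_of_ord k) => m; rewrite d0.
  by rewrite !big1 ?expr0n/= ?mul0r// => k; case: (no k).
by rewrite ler_pdivrMr ?ltr0n// mulrC.
Qed.

End Gradient.

End LocalGeometry.

(** * Gradient, divergence and Christoffel symbols under a change of coordinates *)

Section ChangeOfCoordinates.
Context {R : realType} {d : nat}.
Implicit Types (U : set 'rV[R]_d) (T : 'rV[R]_d -> 'rV[R]_d).

Definition smooth_map U T : Prop := forall j, smooth_on U (fun x => T x 0 j).

Lemma smooth_map_jacobian U T m i j : open U -> smooth_map U T ->
  Ck_on m U (fun x => jacobian T x i j).
Proof.
move=> oU sT; apply: (@Ck_on_eq _ _ _ _ (partial i (fun y => T y 0 j))) => //.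
  move=> x Ux; rewrite (jacobian_partial oU Ux)// => k; exact: sT.
by apply: Ck_on_partial; exact: sT.
Qed.

Lemma smooth_jacobianE U T x i j : open U -> smooth_map U T -> U x ->
  jacobian T x i j = partial i (fun y => T y 0 j) x.
Proof. by move=> oU sT Ux; apply: (jacobian_partial oU Ux) => k; exact: sT. Qed.

Lemma mulmx_jacobian T x v : v *m jacobian T x = 'd T x v.
Proof. by rewrite /jacobian mul_rV_lin1. Qed.

(** Vectors are rows multiplied by Jacobians from the right, so the Jacobian of the map applied
    first stands first. *)
Lemma jacobian_comp U1 U2 T1 T2 x : open U1 -> open U2 -> smooth_map U1 T1 ->
  smooth_map U2 T2 -> U1 x -> U2 (T1 x) ->
  jacobian (T2 \o T1) x = jacobian T1 x *m jacobian T2 (T1 x).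
Proof.
move=> o1 o2 s1 s2 x1 x2.
have d1 : differentiable T1 x.
  by apply: (C1_on_diff_map o1 x1) => j; exact: s1.
have d2 : differentiable T2 (T1 x).
  by apply: (C1_on_diff_map o2 x2) => j; exact: s2.
have h (v : 'rV[R]_d) : v *m jacobian (T2 \o T1) x =
    v *m (jacobian T1 x *m jacobian T2 (T1 x)).
  apply: etrans (mulmx_jacobian _ _ _) _.
  apply: etrans _ (esym (mulmxA _ _ _)).
  apply: etrans _ (congr1 (mulmx^~ _) (esym (mulmx_jacobian _ _ _))).
  apply: etrans _ (esym (mulmx_jacobian _ _ _)).
  exact: (congr1 (fun f : _ -> _ => f v) (diff_comp d1 d2)).
apply/row_matrixP => i.
exact: etrans (rowE i _) (etrans (h _) (esym (rowE i _))).
Qed.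

Lemma jacobian_near T1 T2 x : (\near x, T1 x = T2 x) ->
  differentiable T1 x -> differentiable T2 x -> jacobian T1 x = jacobian T2 x.
Proof.
move=> nT d1 d2; have h (v : 'rV[R]_d) : v *m jacobian T1 x = v *m jacobian T2 x.
  apply: etrans (mulmx_jacobian _ _ _) _.
  apply: etrans _ (esym (mulmx_jacobian _ _ _)).
  apply: etrans (esym (deriveE v d1)) (etrans _ (deriveE v d2)).
  exact: near_eq_derive.
apply/row_matrixP => i.
exact: etrans (rowE i _) (etrans (h _) (esym (rowE i _))).
Qed.

Lemma jacobian_id x : jacobian (@id 'rV[R]_d) x = 1%:M.
Proof.
apply/matrixP => i j.
have sid : smooth_map setT (@id 'rV[R]_d).
  by move=> k m; exact: Ck_on_coord.
by rewrite (smooth_jacobianE i j openT sid I) partial_coord !mxE.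
Qed.

Context (U1 U2 : set 'rV[R]_d) (t s : 'rV[R]_d -> 'rV[R]_d).
Hypotheses (o1 : open U1) (o2 : open U2) (st : smooth_map U1 t)
  (ss : smooth_map U2 s) (t12 : forall x, U1 x -> U2 (t x))
  (s21 : forall x, U2 x -> U1 (s x)) (tK : forall x, U1 x -> s (t x) = x)
  (sK : forall x, U2 x -> t (s x) = x).

Let J := jacobian t.

Lemma jacobian_inverse x : U1 x -> J x *m jacobian s (t x) = 1%:M.
Proof.
move=> x1; rewrite -(jacobian_comp o1 o2 st ss x1 (t12 x1)) -(jacobian_id x).
apply: jacobian_near.
- by apply: filterS (open_nbhs_nbhs (conj o1 x1)) => y /tK.
- apply: differentiable_comp.
    by apply: (C1_on_diff_map o1 x1) => j; exact: st.
  by apply: (C1_on_diff_map o2 (t12 x1)) => j; exact: ss.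
- by [].
Qed.

Lemma jacobian_unit x : U1 x -> J x \in unitmx.
Proof. by move=> x1; have [h _] := mulmx1_unit (jacobian_inverse x1). Qed.

Lemma jacobian_invE x : U1 x -> jacobian s (t x) = invmx (J x).
Proof.
move=> x1; rewrite -[RHS]mulmx1 -(jacobian_inverse x1) mulKmx//.
exact: jacobian_unit.
Qed.

Context (G1 G2 : 'rV[R]_d -> 'M[R]_d).
Hypotheses (sG1 : forall i j, smooth_on U1 (fun x => G1 x i j))
  (sG2 : forall i j, smooth_on U2 (fun x => G2 x i j))
  (pG1 : forall x, U1 x -> posdef (G1 x)) (pG2 : forall x, U2 x -> posdef (G2 x))
  (GE : forall x, U1 x -> G1 x = J x *m G2 (t x) *m (J x)^T).

Let T2 i j l x := partial i (partial j (fun y => t y 0 l)) x.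

Let T2sym i j l x : U1 x -> T2 i j l x = T2 j i l x.
Proof. by move=> x1; apply: (partial_sym _ _ o1 x1); exact: st. Qed.

Let T2E i j l x : U1 x -> partial i (fun y => J y j l) x = T2 i j l x.
Proof.
by move=> x1; apply: (partial_open _ o1 x1) => y y1; exact: smooth_jacobianE y1.
Qed.

Let dJ i j l x : U1 x -> derivable (fun y => J y j l) x (delta_mx 0 i).
Proof. exact: (Ck_on_derivable (smooth_map_jacobian 1 j l o1 st)). Qed.

Lemma partial_transition (F : 'rV[R]_d -> R) x i : U1 x -> Ck_on 1 U2 F ->
  partial i (F \o t) x = \sum_j J x i j * partial j F (t x).
Proof.
move=> x1 cF; rewrite (partial_comp _ o1 x1 _ o2 (t12 x1) cF).
  by apply: eq_bigr => j _; rewrite (smooth_jacobianE i j o1 st x1).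
by move=> j; exact: st.
Qed.

Lemma Ck1_transition (F : 'rV[R]_d -> R) : Ck_on 1 U2 F -> Ck_on 1 U1 (F \o t).
Proof.
move=> cF; have /Ck_onS[F1 F2 F3] := cF.
have ct x : U1 x -> {for x, continuous t}.
  move=> x1; apply: differentiable_continuous.
  by apply: (C1_on_diff_map o1 x1) => j; exact: st.
have cc (H : 'rV[R]_d -> R) : Ck_on 0 U2 H -> Ck_on 0 U1 (H \o t).
  move=> /Ck_on0 cH; apply/Ck_on0 => x x1.
  by apply: continuous_comp; [exact: ct|exact/cH/t12].
apply/Ck_onS; split.
- by move=> x x1; have /Ck_on0 := cc F ((Ck_on0 _ _).2 F1); exact.
- move=> x i x1; apply: diff_derivable; apply: differentiable_comp.
    by apply: (C1_on_diff_map o1 x1) => j; exact: st.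
  by have [] := C1_on_diff o2 (t12 x1) cF.
- move=> i; apply: (@Ck_on_eq _ _ _ _
      (fun x => \sum_j J x i j * partial j F (t x))) => //.
    by move=> x x1; rewrite partial_transition.
  apply: Ck_on_sum => // j _; apply: (Ck_onM o1).
    exact: (smooth_map_jacobian 0 i j o1 st).
  exact: (cc _ (F3 j)).
Qed.

Lemma local_grad_transition (w : 'rV[R]_d -> R) x : U1 x -> Ck_on 1 U2 w ->
  local_grad G1 (w \o t) x *m J x = local_grad G2 w (t x).
Proof.
move=> x1 cw; rewrite /local_grad.
have -> : \row_i partial i (w \o t) x = (\row_i partial i w (t x)) *m (J x)^T.
  apply/rowP => i; rewrite !mxE partial_transition//.
  by apply: eq_bigr => j _; rewrite !mxE mulrC.
rewrite -!mulmxA; have uJ := jacobian_unit x1; have u2 := posdef_unit (pG2 (t12 x1)).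
have u1 := posdef_unit (pG1 x1).
have -> : invmx (G1 x) *m J x = invmx (J x)^T *m invmx (G2 (t x)).
  apply: (can_inj (mulKmx u1)); rewrite mulKVmx// GE//.
  by rewrite -!mulmxA (mulKVmx (_ : (J x)^T \in unitmx)) ?unitmx_tr// mulmxV// mulmx1.
congr (_ *m _); rewrite mulmxA mulmxV ?mul1mx ?unitmx_tr//.
Qed.

Lemma chr_trace (U : set 'rV[R]_d) (G : 'rV[R]_d -> 'M[R]_d) x i : open U -> U x ->
  (forall i j, smooth_on U (fun x => G x i j)) ->
  (forall x, U x -> posdef (G x)) ->
  partial i (fun y => \det (G y)) x = \det (G x) * (2 * \sum_k chr G k k i x).
Proof.
move=> oU Ux sG pG.
have dd : derivable (vol_density G) x (delta_mx 0 i).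
  exact: Ck_on_derivable (C1_density oU sG pG) Ux.
rewrite (partial_open _ oU Ux (_ : forall y, U y -> \det (G y) =
  vol_density G y * vol_density G y)); last first.
  by move=> y Uy; rewrite -expr2 sqr_sqrtr// ltW// posdef_det_gt0//; exact: pG.
rewrite (partialM dd dd) (partial_density oU sG pG _ Ux).
have -> : \det (G x) = vol_density G x * vol_density G x.
  by rewrite -expr2 sqr_sqrtr// ltW// posdef_det_gt0//; exact: pG.
by ring.
Qed.

(** By [chr_trace] the contracted symbol is half the logarithmic derivative of the determinant of
    the metric. The law follows from det G1 = (det J)^2 det G2, without the transformation of the
    individual symbols. *)
Lemma chr_trace_transition x i : U1 x ->
  \sum_k chr G1 k k i x = \sum_a \sum_b invmx (J x) b a * T2 i a b x
    + \sum_l J x i l * \sum_k chr G2 k k l (t x).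
Proof.
move=> x1; have uJ := jacobian_unit x1.
have dJ0 : \det (J x) != 0 by rewrite -unitfE -unitmxE.
have d2 : derivable (fun y => \det (G2 (t y))) x (delta_mx 0 i).
  have := Ck1_transition (_ : Ck_on 1 U2 (fun y => \det (G2 y))).
  move/(_ _)/Ck_on_derivable; apply => //.
  by apply: (Ck_on_det o2) => a b; exact: (sG2 a b 1).
have d1 : derivable (fun y => \det (J y)) x (delta_mx 0 i).
  have cdet : Ck_on 1 U1 (fun y => \det (J y)).
    by apply: (Ck_on_det o1) => a b; exact: (smooth_map_jacobian 1 a b o1 st).
  exact: Ck_on_derivable cdet x1.
have E : partial i (fun y => \det (G1 y)) x =
   partial i (fun y => \det (J y) * \det (J y) * \det (G2 (t y))) x.
  apply: (partial_open _ o1 x1) => y y1.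
  by rewrite GE// !det_mulmx det_tr; ring.
have d11 : derivable (fun y => \det (J y) * \det (J y)) x (delta_mx 0 i).
  exact: (derivableM d1 d1).
move: E; rewrite (chr_trace _ o1 x1 sG1 pG1) (partialM d11 d2) (partialM d1 d1).
rewrite (partial_det_unit uJ (fun a b => @dJ i a b _ x1)).
have -> : partial i (fun y => \det (G2 (t y))) x =
    \det (G2 (t x)) * (2 * \sum_l J x i l * \sum_k chr G2 k k l (t x)).
  rewrite (partial_transition (F := fun y => \det (G2 y)) i x1); last first.
    by apply: (Ck_on_det o2) => a b; exact: (sG2 a b 1).
  rewrite !mulr_sumr; apply: eq_bigr => l _.
  by rewrite (chr_trace _ o2 (t12 x1) sG2 pG2); ring.
have -> : \sum_a \sum_b invmx (J x) b a * partial i (fun y => J y a b) x =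
    \sum_a \sum_b invmx (J x) b a * T2 i a b x.
  by apply: eq_bigr => a _; apply: eq_bigr => b _; rewrite T2E.
have d0 : \det (G1 x) != 0 by rewrite gt_eqF// posdef_det_gt0//; exact: pG1.
have : \det (G1 x) = \det (J x) * \det (J x) * \det (G2 (t x)).
  by rewrite GE// !det_mulmx det_tr; ring.
move: d0 dJ0; move: (\det (G1 x)) (\det (J x)) (\det (G2 (t x))) => a b c a0 b0 aE.
move: (\sum_k chr G1 k k i x) (\sum_l _) => u v.
move: (\sum_l _) => w E.
apply: (mulfI a0); have : a * (2 * u) = 2 * (a * (v + w)).
  by rewrite E aE; ring.
by rewrite mulrCA => /(mulfI _); apply; rewrite pnatr_eq0.
Qed.

(* The derivatives of the cofactors of J cancel by symmetry of the second
   derivatives of t (Piola's identity). *)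
Lemma local_div_transition (X1 X2 : 'rV[R]_d -> 'rV[R]_d) x : U1 x ->
  (forall i, Ck_on 1 U2 (fun y => X2 y 0 i)) ->
  (forall y, U1 y -> X1 y *m J y = X2 (t y)) ->
  local_div G1 X1 x = local_div G2 X2 (t x).
Proof.
move=> x1 cX2 XE.
pose K y := invmx (J y).
have X1E y i : U1 y -> X1 y 0 i = \sum_k X2 (t y) 0 k * K y k i.
  move=> y1; have := XE y y1 => /(congr1 (mulmx^~ (K y))).
  by rewrite /= mulmxK ?jacobian_unit// => ->; rewrite mxE.
have dX2 i k : derivable (fun y => X2 (t y) 0 k) x (delta_mx 0 i).
  exact: Ck_on_derivable (Ck1_transition (cX2 k)) x1.
have cK k i : Ck_on 1 U1 (fun y => K y k i).
  apply: Ck_on_invmx => //; first exact: jacobian_unit.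
  by move=> a b; exact: (smooth_map_jacobian 1 a b o1 st).
have dK i k j : derivable (fun y => K y k j) x (delta_mx 0 i).
  exact: Ck_on_derivable (cK k j) x1.
have cX1 i : Ck_on 1 U1 (fun y => X1 y 0 i).
  apply: (@Ck_on_eq _ _ _ _ (fun y => \sum_k X2 (t y) 0 k * K y k i)) => //.
    by move=> y y1; rewrite X1E.
  by apply: Ck_on_sum => // k _; apply: (Ck_onM o1 (Ck1_transition (cX2 k))).
have dX1E i : partial i (fun y => X1 y 0 i) x =
   \sum_k (\sum_l J x i l * partial l (fun y => X2 y 0 k) (t x)) * K x k i
   + \sum_k X2 (t x) 0 k * partial i (fun y => K y k i) x.
  rewrite (@partial_open _ _ U1 _ (fun y => \sum_k X2 (t y) 0 k * K y k i))//; last first.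
    by move=> y y1; rewrite X1E.
  rewrite (@partial_sum _ _ _ _ _ (fun k y => X2 (t y) 0 k * K y k i) x i _).1; last first.
    by move=> k _; exact: (derivableM (dX2 i k) (dK i k i)).
  rewrite -big_split /=; apply: eq_bigr => k _.
  rewrite (partialM (dX2 i k) (dK i k i)); congr (_ * _ + _).
  exact: (partial_transition (F := fun y => X2 y 0 k) i x1).
rewrite (local_divE o1 sG1 pG1 x1); last first.
  by move=> i; exact: Ck_on_derivable (cX1 i) x1.
rewrite (local_divE o2 sG2 pG2 (t12 x1)); last first.
  by move=> i; exact: Ck_on_derivable (cX2 i) (t12 x1).
under eq_bigr => i _ do rewrite dX1E.
rewrite big_split /=.
have -> : \sum_i \sum_k (\sum_l J x i l * partial l (fun y => X2 y 0 k) (t x)) * K x k i =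
    \sum_k partial k (fun y => X2 y 0 k) (t x).
  rewrite exchange_big /=; apply: eq_bigr => k _.
  under eq_bigr => i _ do rewrite mulr_suml.
  rewrite exchange_big /= (bigD1 k)//= [X in _ + X]big1 ?addr0.
    under eq_bigr => i _ do rewrite mulrAC [X in X * _]mulrC.
    rewrite -mulr_suml; have /matrixP/(_ k k) := mulVmx (jacobian_unit x1).
    by rewrite mxE [RHS]mxE eqxx => ->; rewrite mul1r.
  move=> l lk; under eq_bigr => i _ do rewrite mulrAC [X in X * _]mulrC.
  rewrite -mulr_suml; have /matrixP/(_ k l) := mulVmx (jacobian_unit x1).
  by rewrite mxE [RHS]mxE eq_sym (negbTE lk) => ->; rewrite mul0r.
have -> : \sum_i (\sum_k chr G1 k k i x) * X1 x 0 i =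
   \sum_i (\sum_a \sum_b K x b a * T2 i a b x) * X1 x 0 i +
   \sum_l (\sum_k chr G2 k k l (t x)) * X2 (t x) 0 l.
  under eq_bigr => i _ do rewrite (chr_trace_transition _ x1) mulrDl.
  rewrite big_split /=; congr (_ + _).
  under eq_bigr => i _ do rewrite mulr_suml.
  rewrite exchange_big /=; apply: eq_bigr => l _.
  rewrite -(XE x x1) mxE mulr_sumr; apply: eq_bigr => i _.
  by rewrite mulrAC mulrC [X in _ = _ * X]mulrC mulrA.
have P : \sum_i \sum_k X2 (t x) 0 k * partial i (fun y => K y k i) x =
   - \sum_i (\sum_a \sum_b K x b a * T2 i a b x) * X1 x 0 i.
  under [X in _ = - X]eq_bigr => i _ do rewrite (X1E _ _ x1) mulr_sumr.
  rewrite [LHS]exchange_big [X in _ = - X]exchange_big /= -sumrN.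
  apply: eq_bigr => k _; rewrite -mulr_sumr.
  have -> : \sum_i (\sum_a \sum_b K x b a * T2 i a b x) * (X2 (t x) 0 k * K x k i) =
    X2 (t x) 0 k * \sum_i (\sum_a \sum_b K x b a * T2 i a b x) * K x k i.
    by rewrite mulr_sumr; apply: eq_bigr => i _; rewrite mulrCA.
  rewrite -mulrN; congr (_ * _).
  under eq_bigr => i _ do rewrite (partial_invmx _ _ _ o1 x1 jacobian_unit
     (fun a b => smooth_map_jacobian 1 a b o1 st)).
  rewrite sumrN; congr (- _).
  under eq_bigr => i _ do under eq_bigr => a _ do under eq_bigr => b _ do
    rewrite (T2E _ _ _ x1) (T2sym _ _ _ x1).
  rewrite exchange_big /=; apply: eq_bigr => a _.
  rewrite mulr_suml; apply: eq_bigr => i _; rewrite mulr_suml.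
  by apply: eq_bigr => b _; rewrite /K; ring.
rewrite P; move: (\sum_i _) (\sum_k _) (\sum_l _) => a b c; ring.
Qed.

(** After lowering an index, Christoffel symbols are combinations of first derivatives of the
    metric, and these are computed from G1 = J G2 J^T. The inhomogeneous term is the second
    derivative of the transition map. *)
Lemma chr_transition x i j l : U1 x ->
  \sum_k chr G1 k i j x * J x k l =
  T2 i j l x + \sum_a \sum_b J x i a * J x j b * chr G2 l a b (t x).
Proof.
move=> x1; have x2 := t12 x1.
pose g a b := G2 (t x) a b.
pose dg c a b := partial c (fun y => G2 y a b) (t x).
have symg a b : g a b = g b a.
  by have [h _] := pG2 x2; rewrite /g -[in LHS]h mxE.
have dsymg c a b : dg c a b = dg c b a.
  apply: (partial_open _ o2 x2) => y /pG2[h _]; by rewrite -[in LHS]h mxE.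
have dG2 a b c : derivable (fun y => G2 (t y) a b) x (delta_mx 0 c).
  exact: Ck_on_derivable (Ck1_transition (sG2 a b 1)) x1.
have G1E y a b : U1 y -> G1 y a b = \sum_c \sum_e J y a c * G2 (t y) c e * J y b e.
  move=> y1; rewrite GE// mxE exchange_big /=; apply: eq_bigr => e _.
  by rewrite !mxE mulr_suml.
have dG1E c a b : partial c (fun y => G1 y a b) x =
   \sum_m \sum_e (T2 c a m x * g m e * J x b e + J x a m * g m e * T2 c b e x)
   + \sum_m \sum_e \sum_f J x a m * J x b e * J x c f * dg f m e.
  rewrite (@partial_open _ _ U1 _
     (fun y => \sum_m \sum_e J y a m * G2 (t y) m e * J y b e))//; last first.
    by move=> y y1; rewrite G1E.
  have dm m e : derivable (fun y => J y a m * G2 (t y) m e) x (delta_mx 0 c).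
    exact: (derivableM (@dJ _ _ _ _ x1) (dG2 m e c)).
  have dd m e : derivable (fun y => J y a m * G2 (t y) m e * J y b e) x (delta_mx 0 c).
    exact: (derivableM (dm m e) (@dJ _ _ _ _ x1)).
  have ds m := @partial_sum _ _ _ (index_enum 'I_d) xpredT
    (fun e y => J y a m * G2 (t y) m e * J y b e) x c (fun e _ => dd m e).
  rewrite (@partial_sum _ _ _ _ _
    (fun m y => \sum_e J y a m * G2 (t y) m e * J y b e) x c (fun m _ => (ds m).2)).1.
  rewrite -big_split /=; apply: eq_bigr => m _.
  rewrite (ds m).1 -big_split /=; apply: eq_bigr => e _.
  rewrite (partialM (dm m e) (@dJ _ _ _ _ x1)).
  rewrite (partialM (@dJ _ _ _ _ x1) (dG2 m e c)) !(T2E _ _ _ x1).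
  have -> : partial c (fun y => G2 (t y) m e) x = \sum_f J x c f * dg f m e.
    exact: (partial_transition (F := fun y => G2 y m e) c x1 (sG2 m e 1)).
  have -> : \sum_f J x a m * J x b e * J x c f * dg f m e =
     J x a m * J x b e * \sum_f J x c f * dg f m e.
    by rewrite mulr_sumr; apply: eq_bigr => f _; rewrite mulrA.
  rewrite -/(g m e).
  move: (T2 c a m x) (T2 c b e x) (g m e) (J x a m) (J x b e) (\sum_f _).
  by move=> u1 u2 u3 u4 u5 u6; ring.
pose rhs a := T2 i j a x + \sum_b \sum_c J x i b * J x j c * chr G2 a b c (t x).
(* Since G1 = J G2 J^T with J and G2 invertible, the lowered identity implies the raised one. *)
suff E m : \sum_k G1 x m k * chr G1 k i j x = \sum_a (\sum_b J x m b * g b a) * rhs a.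
  pose c1 : 'cV[R]_d := \col_k chr G1 k i j x.
  pose c2 : 'cV[R]_d := \col_k rhs k.
  have : G1 x *m c1 = J x *m G2 (t x) *m c2.
    apply/colP => m; rewrite !mxE.
    under eq_bigr => k _ do rewrite mxE.
    by rewrite E; apply: eq_bigr => a _; rewrite !mxE.
  rewrite GE// -!mulmxA => /(can_inj (mulKmx (jacobian_unit x1))).
  move=> /(can_inj (mulKmx (posdef_unit (pG2 x2)))) /colP/(_ l).
  rewrite /c1 /c2 [RHS]mxE /rhs => <-; rewrite mxE; apply: eq_bigr => k _.
  by rewrite !mxE mulrC.
have R1 : \sum_a (\sum_b J x m b * g b a) * T2 i j a x =
    \sum_b \sum_a J x m b * g b a * T2 i j a x.
  by rewrite exchange_big; apply: eq_bigr => a _; rewrite mulr_suml.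
have R2 : \sum_a (\sum_b J x m b * g b a) *
     \sum_b \sum_c J x i b * J x j c * chr G2 a b c (t x) =
  \sum_e \sum_b \sum_c J x m e * J x i b * J x j c *
     (2^-1 * (dg b c e + dg c b e - dg e b c)).
  transitivity (\sum_e \sum_a \sum_b \sum_c J x m e * J x i b * J x j c *
     (g e a * chr G2 a b c (t x))).
    rewrite exchange_big; apply: eq_bigr => a _.
    rewrite mulr_suml; apply: eq_bigr => e _; rewrite mulr_sumr.
    apply: eq_bigr => b _; rewrite mulr_sumr; apply: eq_bigr => c _; ring.
  apply: eq_bigr => e _; rewrite exchange_big; apply: eq_bigr => b _.
  rewrite exchange_big; apply: eq_bigr => c _; rewrite -mulr_sumr.
  by rewrite (chr_lower pG2 _ _ _ x2).
have -> : \sum_a (\sum_b J x m b * g b a) * rhs a =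
    \sum_a (\sum_b J x m b * g b a) * T2 i j a x +
    \sum_a (\sum_b J x m b * g b a) *
     \sum_b \sum_c J x i b * J x j c * chr G2 a b c (t x).
  by rewrite -big_split; apply: eq_bigr => a _; exact: mulrDr.
rewrite R1 R2.
(* [Q] collects the second derivatives of [t] and [P] the derivatives of [G2]. In the alternating
   sum of three derivatives of [G1], the symmetry of [Q] in its first two indices leaves twice
   [Q i j m]. *)
pose Q a b c := \sum_m0 \sum_e T2 a b m0 x * g m0 e * J x c e.
have S1 a b c : \sum_m0 \sum_e (T2 c a m0 x * g m0 e * J x b e
      + J x a m0 * g m0 e * T2 c b e x) = Q c a b + Q c b a.
  rewrite /Q; under eq_bigr => m0 _ do rewrite big_split /=.
  rewrite big_split /=; congr (_ + _); rewrite exchange_big.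
  by apply: eq_bigr => e _; apply: eq_bigr => m0 _; rewrite symg; ring.
have Qsym a b c : Q a b c = Q b a c.
  by apply: eq_bigr => m0 _; apply: eq_bigr => e _; rewrite (T2sym _ _ _ x1).
have -> : \sum_b \sum_a J x m b * g b a * T2 i j a x = Q i j m.
  rewrite /Q exchange_big; apply: eq_bigr => a _; apply: eq_bigr => b _.
  by rewrite symg; ring.
pose P (a b c : 'I_d) := \sum_e \sum_b0 \sum_c0 J x a e * J x b b0 * J x c c0 * dg e b0 c0.
have D a b c : \sum_m0 \sum_e \sum_f J x a m0 * J x b e * J x c f * dg f m0 e = P c a b.
  rewrite /P.
  under eq_bigr => m0 _ do rewrite exchange_big /=.
  rewrite exchange_big /=; apply: eq_bigr => f _; apply: eq_bigr => m0 _.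
  by apply: eq_bigr => e _; ring.
have dG1' c a b : partial c (fun y => G1 y a b) x = Q c a b + Q c b a + P c a b.
  exact: etrans (dG1E c a b) (congr2 +%R (S1 a b c) (D a b c)).
rewrite (chr_lower pG1 _ _ _ x1) (dG1' i) (dG1' j) (dG1' m).
rewrite (Qsym j i m) (Qsym m i j) (Qsym m j i).
have -> : \sum_e \sum_b \sum_c J x m e * J x i b * J x j c *
     (2^-1 * (dg b c e + dg c b e - dg e b c)) = 2^-1 * (P i j m + P j i m - P m i j).
  have -> : P i j m = \sum_e \sum_b \sum_c J x m e * J x i b * J x j c * dg b c e.
    rewrite /P [LHS](eq_bigr _ (fun b _ => exchange_big _ _ _ _ _ _)) exchange_big /=.
    apply: eq_bigr => e _; apply: eq_bigr => b _; apply: eq_bigr => c _; ring.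
  have -> : P j i m = \sum_e \sum_b \sum_c J x m e * J x i b * J x j c * dg c b e.
    rewrite /P [LHS](eq_bigr _ (fun b _ => exchange_big _ _ _ _ _ _)) exchange_big /=.
    apply: eq_bigr => e _; rewrite exchange_big; apply: eq_bigr => b _.
    by apply: eq_bigr => c _; ring.
  rewrite /P -big_split -sumrB mulr_sumr; apply: eq_bigr => e _.
  rewrite -big_split -sumrB mulr_sumr; apply: eq_bigr => b _.
  rewrite -big_split -sumrB mulr_sumr; apply: eq_bigr => c _ /=.
  by ring.
move: (Q i j m) (Q i m j) (Q j m i) (P i j m) (P j i m) (P m i j) => q1 q2 q3 p1 p2 p3.
by field.
Qed.

End ChangeOfCoordinates.

(** * Lebesgue measure and integration by parts on R^n *)

Section BorelSets.
Context {R : realType}.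

Lemma borel_open (M : ptopologicalType) (A : set M) : open A ->
  measurable (A : set (borel M)).
Proof. by move=> oA; exact: sub_sigma_algebra. Qed.

Lemma open_preimage_within (M N : topologicalType) (A : set M) (B : set N)
    (f : M -> N) : open A -> (forall x, A x -> {for x, continuous f}) ->
  open B -> open (A `&` f @^-1` B).
Proof.
move=> oA cf oB; rewrite openE => x [Ax Bfx]; apply: filterI.
  exact: (open_nbhs_nbhs (conj oA Ax)).
exact: (cf x Ax) (open_nbhs_nbhs (conj oB Bfx)).
Qed.

Lemma continuous_borel (M N : ptopologicalType) (A : set M) (f : M -> N) :
  open A -> (forall x, A x -> {for x, continuous f}) ->
  measurable_fun (A : set (borel M)) (f : borel M -> borel N).
Proof.
move=> oA cf; apply: (@measurability _ _ (borel M) (borel N) A f (@open N)) => //.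
by move=> _ [B oB <-]; apply: borel_open; exact: open_preimage_within.
Qed.

Lemma continuous_measurableR (M : ptopologicalType) (A : set M) (f : M -> R) :
  open A -> (forall x, A x -> {for x, continuous f}) ->
  measurable_fun (A : set (borel M)) (f : borel M -> measurableTypeR R).
Proof.
move=> oA cf; apply: (measurability _ (RGenOpens.measurableE R)).
move=> _ [_ [a [b ->]] <-]; apply: borel_open.
by apply: open_preimage_within => //; exact: interval_open.
Qed.

End BorelSets.

Lemma continuous_addr (R : realType) (V : normedModType R) (v : V) :
  continuous (fun x : V => x + v).
Proof. by move=> x; apply: cvgD; [exact: cvg_id|exact: cvg_cst]. Qed.

Section SigmaFiniteMeasure.
Context d (T : measurableType d) (R : realType)
  (nu : {measure set T -> \bar R}) (h : sigma_finite setT nu).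

(** An alias that remembers the proof of sigma-finiteness, so that the structure can be attached to
    a measure for which it is a theorem. *)
Definition sigma_finite_copy of sigma_finite setT nu : set T -> \bar R := nu.

HB.instance Definition _ := Measure.on (sigma_finite_copy h).
HB.instance Definition _ :=
  Measure_isSigmaFinite.Build _ _ _ (sigma_finite_copy h) h.

End SigmaFiniteMeasure.

Section LebesgueMeasure.
Context {R : realType}.

Definition cons_row m (p : R * 'rV[R]_m) : 'rV[R]_(1 + m) :=
  row_mx (const_mx p.1 : 'rV[R]_1) p.2.

Lemma cons_row0 m (p : R * 'rV[R]_m) : cons_row p 0 (lshift m 0) = p.1.
Proof. by rewrite /cons_row row_mxEl mxE. Qed.

Lemma cons_rowS m (p : R * 'rV[R]_m) i : cons_row p 0 (rshift 1 i) = p.2 0 i.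
Proof. by rewrite /cons_row row_mxEr. Qed.

Lemma cons_row_norm m (p : R * 'rV[R]_m) e : 0 < e ->
  (`|cons_row p| < e) <-> (`|p.1| < e /\ `|p.2| < e).
Proof.
move=> e0; split.
  move=> /(rV_norm_ltP _ e0) h; split; first by rewrite -cons_row0; exact: h.
  by apply/rV_norm_ltP => // i; rewrite -cons_rowS; exact: h.
move=> [h1 /(rV_norm_ltP _ e0) h2]; apply/rV_norm_ltP => // i.
by case: (split_ordP i) => j ->; rewrite ?ord1 ?cons_row0 ?cons_rowS.
Qed.

Lemma cons_rowB m (p q : R * 'rV[R]_m) :
  cons_row p - cons_row q = cons_row (p.1 - q.1, p.2 - q.2).
Proof.
rewrite /cons_row opp_row_mx add_row_mx; congr (row_mx _ _).
by apply/rowP => i; rewrite !mxE.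
Qed.

Lemma rat_approx m (y : 'rV[R]_m) (e : R) : 0 < e ->
  exists c : 'rV[rat]_m, `|y - map_mx ratr c| < e.
Proof.
move=> e0.
have h i : exists q : rat, `|y 0 i - ratr q| < e.
  have [|q] := @rat_in_itvoo R (y 0 i - e) (y 0 i + e); first by lra.
  rewrite in_itv /= => /andP[q1 q2]; exists q.
  by rewrite ltr_norml; apply/andP; split; lra.
exists (\row_i projT1 (cid (h i))); apply/rV_norm_ltP => // i.
by rewrite !mxE; exact: (projT2 (cid (h i))).
Qed.

Lemma ball0_open n (r : R) : open [set x : 'rV[R]_n | `|x| < r].
Proof.
rewrite (_ : [set x | _] = ball (0 : 'rV[R]_n) r).
  have [r0|r0] := ltP 0 r; first exact: ball_open.
  rewrite (_ : ball _ _ = set0); first exact: open0.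
  apply/seteqP; split=> // y; rewrite mx_norm_ball /ball_ /= => yr.
  by have := normr_ge0 (0 - y); rewrite leNgt (lt_le_trans yr).
by rewrite mx_norm_ball; apply/seteqP; split => y /=; rewrite /ball_ /= sub0r normrN.
Qed.

(* An open set of R^(1+m) is a countable union of rational boxes. *)
Lemma measurable_cons_row m :
  measurable_fun setT (@cons_row m : (measurableTypeR R * borel 'rV[R]_m)%type ->
    borel 'rV[R]_(1 + m)).
Proof.
apply: (@measurability _ _ (measurableTypeR R * borel 'rV[R]_m)%type
  (borel 'rV[R]_(1 + m)) setT (@cons_row m) (@open 'rV[R]_(1 + m))) => //.
move=> _ [U oU <-].
rewrite setTI.
pose I := (rat * 'rV[rat]_m * rat)%type.
pose ctr (k : I) : R * 'rV[R]_m := (ratr k.1.1, map_mx ratr k.1.2).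
pose B (k : I) : set (measurableTypeR R * borel 'rV[R]_m) :=
  if pselect (forall x, `|x - cons_row (ctr k)| < ratr k.2 -> U x) then
    [set t | `|t - (ctr k).1| < ratr k.2] `*` [set y | `|y - (ctr k).2| < ratr k.2]
  else set0.
have -> : (@cons_row m) @^-1` U = \bigcup_k B k.
  apply/seteqP; split => [p /= Up|p [k _]]; last first.
    rewrite /B; case: pselect => // h [/= h1 h2]; apply: h.
    rewrite cons_rowB; apply/cons_row_norm => //=.
    by rewrite (le_lt_trans _ h1).
  have /nbhs_ballP[r /= r0 rU] := open_nbhs_nbhs (conj oU Up).
  have [|q] := @rat_in_itvoo R 0 (r / 2); first by rewrite divr_gt0.
  rewrite in_itv /= => /andP[q0 qr].
  have [c1] := @rat_approx 1 (const_mx p.1) _ q0.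
  have [c2 h2 h1] := @rat_approx m p.2 _ q0.
  have {}h1 : `|p.1 - ratr (c1 0 0)| < ratr q.
    by move/(rV_norm_ltP _ q0) : h1 => /(_ 0); rewrite !mxE.
  exists (c1 0 0, c2, q) => //; rewrite /B; case: pselect => //= h; exfalso; apply: h.
  move=> x xq; apply: rU; rewrite mx_norm_ball /ball_ /=.
  rewrite (_ : _ - x = (cons_row p - cons_row (ctr (c1 0 0, c2, q))) -
    (x - cons_row (ctr (c1 0 0, c2, q)))); last by rewrite opprB addrA subrK.
  have ha : `|cons_row p - cons_row (ctr (c1 0 0, c2, q))| < ratr q.
    by rewrite cons_rowB; apply/cons_row_norm.
  apply: le_lt_trans (ler_normB _ _) _; apply: lt_trans (ltrD ha xq) _.
  by move: qr; clear; move: (ratr q) => q' qr; lra.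
apply: countable_bigcupT_measurable; first exact: countableP.
move=> k; rewrite /B; case: (pselect _) => h /=; last exact: measurable0.
apply: measurableX.
  have -> : [set t | `|t - (ctr k).1| < ratr k.2] =
      `](ctr k).1 - ratr k.2, (ctr k).1 + ratr k.2[%classic.
    by apply/seteqP; split => t /=; rewrite in_itv /= ltr_distl.
  exact: measurable_itv.
apply: borel_open.
have -> : [set y | `|y - (ctr k).2| < ratr k.2] =
    setT `&` (fun y => y - (ctr k).2) @^-1` [set y : 'rV[R]_m | `|y| < ratr k.2].
  by rewrite setTI.
apply: open_preimage_within; [exact: openT| |exact: ball0_open].
by move=> x _; exact: continuous_addr.
Qed.

Lemma sigma_finite_balls n (nu : {measure set (borel 'rV[R]_n) -> \bar R}) :
  (forall r : R, (nu [set x | (`|x| < r)%R] < +oo)%E) -> sigma_finite setT nu.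
Proof.
move=> h; exists (fun k => [set x : 'rV[R]_n | `|x| < k%:R]).
  apply/seteqP; split=> // x _.
  exists (Num.truncn `|x|).+1 => //=.
  exact: truncnS_gt.
by move=> k; split; [apply: borel_open; exact: ball0_open|exact: h].
Qed.

(** Integration theorems need a measure behind the iterated integral. It is the image under
    [cons_row] of the product with the measure of the previous dimension, and Tonelli's theorem
    identifies the integrals. Finiteness on balls is carried along because it yields
    sigma-finiteness at the next step. *)
Lemma lebesgue_measure_exists n :
  exists mu : {sigma_finite_measure set (borel 'rV[R]_n) -> \bar R},
   (forall F : borel 'rV[R]_n -> \bar R,
      measurable_fun setT F -> (forall x, (0 <= F x)%E) ->
      lebesgue_int F = (\int[mu]_x F x)%E) /\
   (forall r : R, (mu [set x | (`|x| < r)%R] < +oo)%E).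
Proof.
elim: n => [|m [mu [muE mub]]].
  exists (@dirac _ (borel 'rV[R]_0) 0 R : {sigma_finite_measure set _ -> \bar R}).
  split=> [F mF F0 /=|r].
    by rewrite integral_dirac// diracT mul1e.
  by rewrite /= /dirac indicE ltry.
pose e : (measurableTypeR R * borel 'rV[R]_m)%type -> borel 'rV[R]_(1 + m) :=
  @cons_row m.
have me : measurable_fun setT e by exact: measurable_cons_row.
pose P := (@lebesgue_measure R \x mu)%E.
pose nuf : {measure set (borel 'rV[R]_(1 + m)) -> \bar R} := pushforward P e.
pose nu := nuf me.
have nub (r : R) : (nu [set x | (`|x| < r)%R] < +oo)%E.
  rewrite /= /pushforward.
  have [r0|r0] := ltP 0 r; last first.
    rewrite (_ : [set x | _] = set0) ?preimage_set0 ?measure0//.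
    apply/seteqP; split => // x /= xr; have := normr_ge0 x.
    by rewrite leNgt (lt_le_trans xr).
  have -> : e @^-1` [set x | `|x| < r] =
      `]- r, r[%classic `*` [set y | `|y| < r].
    apply/seteqP; split => p /=; first last.
      by rewrite in_itv /= => -[p1 p2]; apply/cons_row_norm => //; rewrite ltr_norml.
    by move=> /(cons_row_norm _ r0)[p1 p2]; rewrite in_itv /= -ltr_norml.
  rewrite /P product_measure1E//; last by apply: borel_open; exact: ball0_open.
  have L : (@lebesgue_measure R `](- r)%R, r[%classic < +oo)%E.
    by rewrite lebesgue_measure_itv /=; case: ifP => _ //; rewrite ltry.
  apply: lte_mul_pinfty; [exact: measure_ge0| |exact: mub].
  by rewrite ge0_fin_numE; [exact: L|exact: measure_ge0].
pose nus : {sigma_finite_measure set (borel 'rV[R]_(1 + m)) -> \bar R} :=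
  sigma_finite_copy (sigma_finite_balls nub).
exists nus; split=> // F mF F0.
rewrite [RHS](_ : _ = (\int[pushforward P e]_x F x)%E)//.
rewrite ge0_integral_pushforward//= preimage_setT.
have mFe : measurable_fun setT (F \o e) by exact: measurableT_comp.
rewrite (fubini_tonelli1 _ mFe)//; last by move=> x; exact: F0.
apply: eq_integral => t _; rewrite /fubini_F muE//.
by apply: (measurable_fun_pair2 (f := F \o e)).
Qed.

Definition lebesgue_rV n : {sigma_finite_measure set (borel 'rV[R]_n) -> \bar R} :=
  projT1 (cid (lebesgue_measure_exists n)).

Lemma lebesgue_intE n (F : borel 'rV[R]_n -> \bar R) : measurable_fun setT F ->
  (forall x, (0 <= F x)%E) -> lebesgue_int F = (\int[lebesgue_rV n]_x F x)%E.
Proof. by have [h _] := projT2 (cid (lebesgue_measure_exists n)); exact: h. Qed.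

Lemma lebesgue_rV_ball n (r : R) : (lebesgue_rV n [set x | (`|x| < r)%R] < +oo)%E.
Proof. by have [_ h] := projT2 (cid (lebesgue_measure_exists n)); exact: h. Qed.

Definition shiftR (a : R) (x : measurableTypeR R) : measurableTypeR R := x + a.

Lemma measurable_shiftR a : measurable_fun setT (shiftR a).
Proof. exact: measurable_funD. Qed.

Lemma lebesgue_measure_shift (a : R) (A : set R) : measurable A ->
  pushforward (@lebesgue_measure R) (shiftR a) A = lebesgue_measure A.
Proof.
pose nuf : {measure set (measurableTypeR R) -> \bar R} :=
  pushforward (@lebesgue_measure R) (shiftR a).
move=> mA; apply/esym.
apply: (@lebesgue_measure_unique R (nuf (measurable_shiftR a))) => //= _ [[b c]] _ <-.
rewrite /pushforward.
rewrite (_ : _ @^-1` _ = `]b - a, c - a]%classic); last first.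
  by apply/seteqP; split=> x /=; rewrite /shiftR !in_itv /= ltrBlDr lerBrDr.
rewrite !lebesgue_measure_itv/= !lte_fin ltrD2r.
by case: ifP => // _; rewrite -!EFinD; congr (_%:E); ring.
Qed.

Lemma ge0_integral_shift (a : R) (f : R -> \bar R) : measurable_fun setT f ->
  (forall x, (0 <= f x)%E) ->
  (\int[lebesgue_measure]_x f (x + a)%R = \int[lebesgue_measure]_x f x)%E.
Proof.
move=> mf f0.
have := @ge0_integral_pushforward _ _ _ _ R _ (measurable_shiftR a) (@lebesgue_measure R) setT f
  measurableT mf.
rewrite preimage_setT => <-; last by move=> y _; exact: f0.
apply: eq_measure_integral => [|/= mA A mB _]; first exact: measurable_shiftR.
exact: lebesgue_measure_shift.
Qed.

Lemma measurable_shift n (v : 'rV[R]_n) :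
  measurable_fun setT (fun x : borel 'rV[R]_n => (x : 'rV[R]_n) + v : borel 'rV[R]_n).
Proof.
apply: (@continuous_borel 'rV[R]_n 'rV[R]_n setT (fun x => x + v)); first exact: openT.
by move=> x _; exact: continuous_addr.
Qed.

Lemma lebesgue_int_shift n (v : 'rV[R]_n) (F : borel 'rV[R]_n -> \bar R) :
  measurable_fun setT F -> (forall x, (0 <= F x)%E) ->
  lebesgue_int (fun x : 'rV[R]_n => F (x + v)) = lebesgue_int F.
Proof.
elim: n v F => [|m IH] v F mF F0.
  by rewrite /=; congr (F _); apply/rowP => -[].
rewrite /=.
pose a : R := (v : 'rV[R]_(1 + m)) 0 (lshift m 0); pose w : 'rV[R]_m := @rsubmx _ 1 1 m v.
pose e : (measurableTypeR R * borel 'rV[R]_m)%type -> borel 'rV[R]_(1 + m) :=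
  @cons_row m.
have mFe : measurable_fun setT (F \o e).
  by apply: measurableT_comp => //; exact: measurable_cons_row.
have mFt (t : R) : measurable_fun setT (fun y : borel 'rV[R]_m => F (e (t, y))).
  exact: (measurable_fun_pair2 (f := F \o e)).
pose g (t : R) := lebesgue_int (fun y : 'rV[R]_m => F (e (t, y))).
have mg : measurable_fun setT (g : measurableTypeR R -> \bar R).
  rewrite (_ : g = fubini_F (lebesgue_rV m) (F \o e)).
    by apply: measurable_fun_fubini_tonelli_F => // x; exact: F0.
  by apply/funext => t; rewrite /g /fubini_F lebesgue_intE.
transitivity (\int[lebesgue_measure]_t g (t + a)%R)%E.
  apply: eq_integral => t _; rewrite /g.
  rewrite -(IH w (fun y => F (e (t + a, y))))//.
  congr (lebesgue_int _); apply/funext => y; congr (F _).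
  rewrite /e /cons_row /=; apply/(@rowP _ (1 + m)) => i; rewrite [LHS]mxE.
  case: (@split_ordP 1 m i) => j ->; rewrite ?ord1.
    exact: etrans (congr1 (+%R^~ _) (cons_row0 (t, y)))
      (esym (cons_row0 (t + a, y + w))).
  apply: etrans (congr1 (+%R^~ _) (cons_rowS (t, y) j))
    (etrans _ (esym (cons_rowS (t + a, y + w) j))).
  by rewrite !mxE.
apply: ge0_integral_shift => // t.
by rewrite /g lebesgue_intE//; exact: integral_ge0.
Qed.

Lemma integral_rV_shift n (v : 'rV[R]_n) (F : borel 'rV[R]_n -> \bar R) :
  measurable_fun setT F -> (forall x, (0 <= F x)%E) ->
  (\int[lebesgue_rV n]_x F ((x : 'rV[R]_n) + v)%R = \int[lebesgue_rV n]_x F x)%E.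
Proof.
move=> mF F0; rewrite -lebesgue_intE//; last first.
  exact: (measurableT_comp mF (measurable_shift v)).
by rewrite lebesgue_int_shift// lebesgue_intE.
Qed.

End LebesgueMeasure.

Lemma integrable_dominated d (T : measurableType d) (R : realType)
    (mu : {measure set T -> \bar R}) (A : set T) (f : T -> R) (c : R) :
  measurable A -> (mu A < +oo)%E -> measurable_fun setT f ->
  (forall x, `|f x| <= c * \1_A x) -> mu.-integrable setT (EFin \o f).
Proof.
move=> mA fA mf fc.
have i1 : mu.-integrable A (EFin \o f).
  apply: measurable_bounded_integrable => //; first exact: measurable_funTS.
  exists `|c|; split; first exact: num_real.
  move=> M cM x Ax /=; apply: le_trans (fc x) _.
  by rewrite indicE mem_set// mulr1 (le_trans (ler_norm c))// ltW.
move: i1; rewrite integrable_mkcond//; congr (integrable _ _ _).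
apply/funext => x; rewrite patchE; case: ifPn => // xA /=.
apply/esym; congr (_%:E); apply/eqP; rewrite -normr_le0 (le_trans (fc x))//.
by rewrite indicE (negbTE xA) mulr0.
Qed.

Lemma dominated_convergence_EFin d (T : measurableType d) (R : realType)
    (mu : {measure set T -> \bar R}) (D : set T) (f_ : nat -> T -> R)
    (f g : T -> R) : measurable D -> (forall n, measurable_fun D (f_ n)) ->
  measurable_fun D f -> (forall x, D x -> f_ ^~ x @ \oo --> f x) ->
  mu.-integrable D (EFin \o g) -> (forall n x, D x -> `|f_ n x| <= g x) ->
  (fun n => \int[mu]_(x in D) (f_ n x)%:E)%E @ \oo --> (\int[mu]_(x in D) (f x)%:E)%E.
Proof.
move=> mD mf_ mf fcvg ig fg.
apply: (@dominated_cvg _ _ R mu D mD _ _ (EFin \o g)) => //.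
- by move=> n; exact/measurable_EFinP.
- by move=> x Dx; apply: cvg_EFin; [exact: nearW|exact: fcvg].
Qed.

(** * Integrals of derivatives of compactly supported functions *)

Section IntegrationByParts.
Context {R : realType} {n : nat}.
Local Notation lam := (@lebesgue_rV R n).

Lemma integral_shift (v : 'rV[R]_n) (F : borel 'rV[R]_n -> \bar R) :
  measurable_fun setT F ->
  (\int[lam]_x F ((x : 'rV[R]_n) + v)%R = \int[lam]_x F x)%E.
Proof.
move=> mF; rewrite integralE [RHS]integralE; congr (_ - _)%E.
  have -> : (fun x : borel 'rV[R]_n => F ((x : 'rV[R]_n) + v)) = F \o (fun x => x + v).
    by [].
  rewrite funepos_comp.
  exact: (integral_rV_shift v (measurable_funepos mF) (funepos_ge0 F)).
have -> : (fun x : borel 'rV[R]_n => F ((x : 'rV[R]_n) + v)) = F \o (fun x => x + v).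
  by [].
rewrite funeneg_comp.
exact: (integral_rV_shift v (measurable_funeneg mF) (funeneg_ge0 F)).
Qed.

Lemma compact_sup_ball (r : R) : compact [set x : 'rV[R]_n | `|x| <= r].
Proof.
apply: bounded_closed_compact.
  exists r; split; first exact: num_real.
  by move=> M rM x /= /le_trans; apply; exact: ltW.
have -> : [set x : 'rV[R]_n | `|x| <= r] = (fun x => `|x|) @^-1` [set t | t <= r].
  by [].
by apply: closed_comp => [x _|]; [exact: norm_continuous|exact: closed_le].
Qed.

(** The difference quotients [D k] have integral 0 by translation invariance and converge to the
    partial derivative under a common bound. No integration in a single variable is needed. *)
Lemma integral_partial0 (F : 'rV[R]_n -> R) (B : R) i : Ck_on 1 setT F ->
  (forall x, B <= `|x| -> F x = 0) ->
  (\int[lam]_x (partial i F x)%:E = 0)%E.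
Proof.
move=> cF F0; have /Ck_onS[F1 F2 F3] := cF.
have cP : continuous (partial i F) by move=> x; have /Ck_on0 := F3 i; exact.
have [M M0 PM] : exists2 M, 0 <= M & forall x, `|partial i F x| <= M.
  have [|||c _ hc] := @EVT_max_rV R n (fun x => `|partial i F x|) [set x | `|x| <= `|B| + 1].
  - by exists 0; rewrite /= normr0 addr_ge0.
  - exact: compact_sup_ball.
  - apply: continuous_subspaceT => x; apply: continuous_comp; first exact: cP.
    exact: norm_continuous.
  exists `|partial i F c| => // x.
  have [xB|xB] := leP `|x| (`|B| + 1); first by apply: hc; rewrite inE.
  rewrite (@partial_near _ _ _ (fun=> 0)) ?partialC ?normr0//.
  near=> y; apply: F0.
  have xy : `|x - y| < 1.
    near: y; apply/nbhs_ballP; exists 1 => //= y.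
    by rewrite mx_norm_ball.
  have := ler_normB x y; have := ler_norm B; move: xy xB.
  have : `|x| <= `|x - y| + `|y| by rewrite -{1}(subrK y x) ler_normD.
  by move: `|x| `|y| `|B| `|x - y| (`|_ - _|) => a b c' e f; lra.
pose v : 'rV[R]_n := delta_mx 0 i.
have v1 : `|v| <= 1.
  by apply/rV_norm_leP => // j; rewrite !mxE; case: (j == i); rewrite /= ?normr1 ?normr0.
pose h (k : nat) : R := k.+1%:R^-1.
have h0 k : 0 < h k by rewrite invr_gt0.
have h1 k : h k <= 1 by rewrite invf_le1// ler1n.
pose D k (x : 'rV[R]_n) : R := (h k)^-1 * (F (x + h k *: v) - F x).
have mF : measurable_fun setT (F : borel 'rV[R]_n -> R).
  by apply: (@continuous_measurableR R 'rV[R]_n setT F) => //; exact: openT.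
have mP : measurable_fun setT (partial i F : borel 'rV[R]_n -> R).
  apply: (@continuous_measurableR R 'rV[R]_n setT) => //; first exact: openT.
  by move=> x _; exact: cP.
have mS k : measurable_fun setT (fun x : borel 'rV[R]_n => F ((x : 'rV[R]_n) + h k *: v)).
  exact: (measurableT_comp mF (measurable_shift (h k *: v))).
have mD k : measurable_fun setT (D k : borel 'rV[R]_n -> R).
  by apply: measurable_funM => //; exact: measurable_funB.
(* The translations have length at most 1, so this ball contains the supports of [F] and of all
   difference quotients. *)
pose A : set (borel 'rV[R]_n) := [set x : 'rV[R]_n | `|x| < `|B| + 1].
have mA : measurable A by apply: borel_open; exact: ball0_open.
have DA k x : `|D k x| <= M * \1_A x.
  rewrite indicE; have [xA|xA] := boolP (x \in A).
    rewrite mulr1 /D.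
    have [|c _ E] := @line_MVT R _ F x v (h k) (ltW (h0 k)).
      by move=> t _; exact: F2.
    by rewrite [x + _]addrC E mulKf ?gt_eqF//; exact: PM.
  have {}xA : `|B| + 1 <= `|x| by rewrite leNgt; apply/negP => xB; move/negP: xA; apply; rewrite inE.
  rewrite mulr0 /D !F0 ?subr0 ?mulr0 ?normr0//.
    by rewrite (le_trans _ xA)// (le_trans (ler_norm B))// lerDl.
  have : `|x| <= `|x + h k *: v| + `|h k *: v|.
    by rewrite -{1}(addrK (h k *: v) x) ler_normB.
  have : `|h k *: v| <= 1.
    by rewrite normrZ gtr0_norm// mulr_ile1// ltW.
  have := ler_norm B; move: xA; clear.
  by move: `|x| `|x + _| `|h k *: v| `|B| => a b c e; lra.
have iF k : (\int[lam]_x (D k x)%:E = 0)%E.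
  have IA : (lam A < +oo)%E by exact: lebesgue_rV_ball.
  have bF : exists2 C, 0 <= C & forall x, `|F x| <= C * \1_A x.
    have [|||c _ hc] := @EVT_max_rV R n (fun x => `|F x|) [set x | `|x| <= `|B| + 1].
    - by exists 0; rewrite /= normr0 addr_ge0.
    - exact: compact_sup_ball.
    - apply: continuous_subspaceT => x; apply: continuous_comp; first exact: F1.
      exact: norm_continuous.
    exists `|F c| => // x; rewrite indicE.
    have [xA|xA] := boolP (x \in A).
      by rewrite mulr1; apply: hc; rewrite inE /=; apply: ltW; move: xA; rewrite inE.
    rewrite F0 ?normr0 ?mulr0//.
    have : `|B| + 1 <= `|x| by rewrite leNgt; apply/negP => xB; move/negP: xA; apply; rewrite inE.
    by apply: le_trans; rewrite (le_trans (ler_norm B))// lerDl.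
  have [C C0 FC] := bF.
  have intF : lam.-integrable setT (EFin \o F) by exact: (integrable_dominated mA IA mF FC).
  have intD : lam.-integrable setT (EFin \o D k) by exact: (integrable_dominated mA IA (mD k) (DA k)).
  have E x : F ((x : 'rV[R]_n) + h k *: v) = h k * D k x + F x.
    by rewrite /D mulVKf ?subrK// gt_eqF.
  have := @integral_shift (h k *: v) (EFin \o F) (iffRL (measurable_EFinP _ _) mF).
  under eq_integral do rewrite /= E EFinD EFinM.
  rewrite integralD//=; last exact: integrableZl.
  rewrite integralZl//.
  have fF := integrable_fin_num measurableT intF.
  have fD := integrable_fin_num measurableT intD.
  rewrite -[in RHS](fineK fF) -[X in (_ + X)%E](fineK fF) /= -[X in (_ * X)%E](fineK fD).
  rewrite -EFinM -EFinD => -[] /eqP.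
  rewrite eq_sym -subr_eq subrr eq_sym mulf_eq0 gt_eqF//= => /eqP z.
  by rewrite -(fineK fD) z.
have cvgD x : (fun k => D k x) @ \oo --> partial i F x.
  have dF := F2 x i I.
  have hc : h @ \oo --> (0 : R)^'.
    have hc0 : h @ \oo --> (0 : R) by exact: cvg_harmonic.
    move=> Q dQ; have /hc0 : nbhs (0 : R) [set y | y != 0 -> Q y] by exact: dQ.
    move=> H; have {}H : \forall k \near \oo, h k != 0 -> Q (h k) by exact: H.
    suff : \forall k \near \oo, Q (h k) by [].
    by apply: filterS H => k; apply; rewrite gt_eqF.
  have := cvg_comp _ _ hc dF; rewrite /comp /=.
  move=> H; apply: cvg_trans H.
  apply: near_eq_cvg; apply: nearW => k /=.
  by rewrite /D [x + _]addrC.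
have iM : lam.-integrable setT (EFin \o (fun x => M * \1_A x)).
  apply: (@integrable_dominated _ _ _ _ A (fun x => M * \1_A x) M) => //.
  - exact: lebesgue_rV_ball.
  - exact: measurable_funM.
  - by move=> x; rewrite ger0_norm// mulr_ge0.
have := @dominated_convergence_EFin _ _ R lam setT D (partial i F) _ measurableT
  mD mP (fun x _ => cvgD x) iM (fun k x _ => DA k x).
rewrite (_ : (fun k => _) = fun=> 0%E); last by apply/funext => k; exact: iF.
move=> L; rewrite -(cvg_lim _ L)//; apply: cvg_lim => //; exact: cvg_cst.
Unshelve. all: by end_near. Qed.

End IntegrationByParts.

(** * Tensors on a manifold in charts *)

Section Charts.
Context {R : realType} {d : nat} {M : topologicalType}.
Implicit Types (c : chart R d M) (A : set M).

Lemma chart_imageP c A x : is_chart c ->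
  chart_image c A x <-> chart_image c setT x /\ A (chart_inv c x).
Proof.
move=> [_ _ cK _ _]; split.
  move=> [p [cp Ap] <-]; split; first by exists p.
  by rewrite cK.
move=> [[p [cp _] <-]]; rewrite cK// => Ap; by exists p.
Qed.

Lemma chart_image_dom c x : is_chart c -> chart_image c setT x ->
  chart_dom c (chart_inv c x) /\ chart_map c (chart_inv c x) = x.
Proof. by move=> [_ _ cK _ _] [p [cp _] <-]; rewrite cK. Qed.

Lemma chart_image_map c A p : chart_dom c p -> A p -> chart_image c A (chart_map c p).
Proof. by move=> cp Ap; exists p. Qed.

Lemma chart_inv_continuous c x : is_chart c -> chart_image c setT x ->
  {for x, continuous (chart_inv c)}.
Proof.
move=> [_ oi _ _ ci] ix.
have := ci; rewrite continuous_open_subspace// => h.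
by apply: h; rewrite inE.
Qed.

Lemma open_chart_image c A : is_chart c -> open A -> open (chart_image c A).
Proof.
move=> hc oA; have [od oi cK cm ci] := hc.
have -> : chart_image c A = chart_image c setT `&` chart_inv c @^-1` A.
  by apply/seteqP; split=> x /=; rewrite (chart_imageP A x hc).
rewrite openE => x [ix Ax]; apply: filterI.
  exact: (open_nbhs_nbhs (conj oi ix)).
exact: (chart_inv_continuous hc ix) (open_nbhs_nbhs (conj oA Ax)).
Qed.

Lemma chart_map_continuous c p : is_chart c -> chart_dom c p ->
  {for p, continuous (chart_map c)}.
Proof.
move=> [od _ _ cm _] cp.
have := cm; rewrite continuous_open_subspace// => h.
by apply: h; rewrite inE.
Qed.

Lemma chart_mapK c p : is_chart c -> chart_dom c p -> chart_inv c (chart_map c p) = p.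
Proof. by case=> _ _ cK _ _; exact: cK. Qed.

End Charts.

Section Transitions.
Context {R : realType} {d : nat} {M : topologicalType}.
Context (S : smooth_structure R d M).
Implicit Types (c : chart R d M) (A : set M) (p : M).

Lemma chart_at_atlas p : atlas S (chart_at S p).
Proof. by have [] := projT2 (cid (atlas_cover S p)). Qed.

Lemma chart_at_dom p : chart_dom (chart_at S p) p.
Proof. by have [] := projT2 (cid (atlas_cover S p)). Qed.

Let hc c : atlas S c -> is_chart c := @atlas_chart _ _ _ S c.

Lemma transition_map c1 c2 p : atlas S c1 -> chart_dom c1 p ->
  transition c1 c2 (chart_map c1 p) = chart_map c2 p.
Proof. by move=> a1 p1; rewrite /transition /= (chart_mapK (hc a1) p1). Qed.

(** The additional set [A] serves as the domain on which a function or field is regular, or as the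
    domain of a third chart when transition maps are composed. *)
Definition overlap c1 c2 A : set 'rV[R]_d := chart_image c1 (chart_dom c2 `&` A).

Lemma overlapP c1 c2 A x : atlas S c1 -> overlap c1 c2 A x <->
  [/\ chart_image c1 setT x, chart_dom c2 (chart_inv c1 x) & A (chart_inv c1 x)].
Proof.
move=> a1; rewrite /overlap chart_imageP; last exact: hc.
by split=> [[? []]|[]].
Qed.

Lemma open_overlap c1 c2 A : atlas S c1 -> atlas S c2 -> open A ->
  open (overlap c1 c2 A).
Proof.
move=> a1 a2 oA; apply: open_chart_image; first exact: hc.
by apply: openI => //; have [] := hc a2.
Qed.

Lemma overlap_map c1 c2 A p : chart_dom c1 p -> chart_dom c2 p -> A p ->
  overlap c1 c2 A (chart_map c1 p).
Proof. by move=> p1 p2 Ap; apply: chart_image_map. Qed.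

Lemma overlap_transition c1 c2 A x : atlas S c1 -> atlas S c2 ->
  overlap c1 c2 A x -> overlap c2 c1 A (transition c1 c2 x).
Proof.
move=> a1 a2 /(overlapP _ _ _ a1)[i1 d2 Ax].
apply: overlap_map => //.
by have [] := chart_image_dom (hc a1) i1.
Qed.

Lemma transitionK c1 c2 A x : atlas S c1 -> atlas S c2 -> overlap c1 c2 A x ->
  transition c2 c1 (transition c1 c2 x) = x.
Proof.
move=> a1 a2 /(overlapP _ _ _ a1)[i1 d2 _]; rewrite /transition /=.
have [_ _ cK _ _] := hc a2; rewrite cK//.
by have [] := chart_image_dom (hc a1) i1.
Qed.

Lemma transition_inv c1 c2 A x : atlas S c1 -> atlas S c2 -> overlap c1 c2 A x ->
  chart_inv c2 (transition c1 c2 x) = chart_inv c1 x.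
Proof.
move=> a1 a2 /(overlapP _ _ _ a1)[i1 d2 _]; rewrite /transition /=.
by have [_ _ cK _ _] := hc a2; rewrite cK.
Qed.

Lemma smooth_transition c1 c2 A : atlas S c1 -> atlas S c2 ->
  smooth_map (overlap c1 c2 A) (transition c1 c2).
Proof.
move=> a1 a2 j k; apply: (Ck_on_sub _ (atlas_compatible a1 a2 j k)).
by move=> x [p [p1 [p2 _]] <-]; exists p.
Qed.

Lemma jacobian_transition_comp c1 c2 c3 x : atlas S c1 -> atlas S c2 -> atlas S c3 ->
  overlap c1 c2 (chart_dom c3) x ->
  jacobian (transition c1 c3) x =
  jacobian (transition c1 c2) x *m jacobian (transition c2 c3) (transition c1 c2 x).
Proof.
move=> a1 a2 a3 x12; have [i1 d2 d3] := (overlapP _ _ _ a1).1 x12.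
have o3 : open (chart_dom c3) by have [] := hc a3.
have o12 := open_overlap a1 a2 o3.
have o2 : open (chart_dom c2) by have [] := hc a2.
have o1 : open (chart_dom c1) by have [] := hc a1.
have x2 := overlap_transition a1 a2 x12.
have x23 : overlap c2 c3 (chart_dom c1) (transition c1 c2 x).
  apply/(overlapP _ _ _ a2); rewrite (transition_inv a1 a2 x12).
  by have [i2 ? ?] := (overlapP _ _ _ a2).1 x2; split=> //;
    have [] := chart_image_dom (hc a1) i1.
rewrite -(@jacobian_comp _ _ _ _ _ _ _ o12 (open_overlap a2 a3 o1)
   (smooth_transition _ a1 a2) (smooth_transition _ a2 a3) x12 x23).
have x13 : overlap c1 c3 (chart_dom c2) x by apply/(overlapP _ _ _ a1).
apply: jacobian_near.
- apply: filterS (open_nbhs_nbhs (conj o12 x12)) => y y12.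
  by rewrite /= {2}/transition /= (transition_inv a1 a2 y12).
- apply: (C1_on_diff_map (open_overlap a1 a3 o2) x13) => j.
  exact: smooth_transition.
- apply: differentiable_comp.
    apply: (C1_on_diff_map o12 x12) => j; exact: smooth_transition.
  apply: (C1_on_diff_map (open_overlap a2 a3 o1) x23) => j; exact: smooth_transition.
Qed.

Lemma jacobian_transition_id c x : atlas S c -> chart_image c setT x ->
  jacobian (transition c c) x = 1%:M.
Proof.
move=> a ix; rewrite -(jacobian_id x).
have oi : open (chart_image c setT) by apply: open_chart_image; [exact: hc|exact: openT].
have E y : chart_image c setT y -> transition c c y = y.
  by move=> iy; have [_ h] := chart_image_dom (hc a) iy.
apply: jacobian_near => //.
- by apply: filterS (open_nbhs_nbhs (conj oi ix)) => y /E.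
- have xo : overlap c c setT x.
    by apply/(overlapP _ _ _ a); split=> //; have [] := chart_image_dom (hc a) ix.
  apply: (C1_on_diff_map (open_overlap a a openT) xo) => j.
  exact: smooth_transition.
Qed.

Lemma vec_inE c1 c2 p v : atlas S c1 -> atlas S c2 -> chart_dom c1 p ->
  chart_dom c2 p ->
  vec_in S c2 p v =
  vec_in S c1 p v *m jacobian (transition c1 c2) (chart_map c1 p).
Proof.
move=> a1 a2 p1 p2; rewrite /vec_in -mulmxA; congr (_ *m _).
have a0 := chart_at_atlas p; have p0 := chart_at_dom p.
have po := @overlap_map (chart_at S p) c1 (chart_dom c2) p p0 p1 p2.
apply: etrans (@jacobian_transition_comp (chart_at S p) c1 c2 _ a0 a1 a2 po) _.
by rewrite (transition_map c1 a0 p0).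
Qed.

Lemma vec_in_chart_at p v : vec_in S (chart_at S p) p v = v.
Proof.
rewrite /vec_in jacobian_transition_id ?mulmx1//; first exact: chart_at_atlas.
exact: chart_image_map (chart_at_dom p) I.
Qed.

Lemma vec_in_surj c p w : atlas S c -> chart_dom c p ->
  vec_in S c p (w *m jacobian (transition c (chart_at S p)) (chart_map c p)) = w.
Proof.
move=> a pc; have a0 := chart_at_atlas p; have p0 := chart_at_dom p.
rewrite /vec_in -mulmxA.
have po := @overlap_map c (chart_at S p) (chart_dom c) p pc p0 pc.
rewrite -(transition_map (chart_at S p) a pc).
rewrite -(@jacobian_transition_comp c (chart_at S p) c _ a a0 a po).
by rewrite (jacobian_transition_id a (chart_image_map pc I)) mulmx1.
Qed.

Lemma vec_inD c p v w : vec_in S c p (v + w) = vec_in S c p v + vec_in S c p w.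
Proof. exact: mulmxDl. Qed.

Lemma vec_inZ c p a v : vec_in S c p (a *: v) = a *: vec_in S c p v.
Proof. by rewrite /vec_in -scalemxAl. Qed.

Lemma field_in_transition c1 c2 A (X : M -> 'rV[R]_d) x : atlas S c1 -> atlas S c2 ->
  overlap c1 c2 A x ->
  field_in S c1 X x *m jacobian (transition c1 c2) x =
  field_in S c2 X (transition c1 c2 x).
Proof.
move=> a1 a2 x12; rewrite /field_in (transition_inv a1 a2 x12).
have [i1 d2 _] := (overlapP _ _ _ a1).1 x12.
have [d1 E] := chart_image_dom (hc a1) i1.
by rewrite (vec_inE _ a1 a2 d1 d2) E.
Qed.

Lemma comp_transition c1 c2 A x (u : M -> R) : atlas S c1 -> atlas S c2 ->
  overlap c1 c2 A x ->
  ((u \o chart_inv c2) \o transition c1 c2) x = (u \o chart_inv c1) x.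
Proof. by move=> a1 a2 x12; rewrite /= (transition_inv a1 a2 x12). Qed.

End Transitions.

Lemma local_laplacian_eq {R : realType} {d : nat} (U : set 'rV[R]_d) G w w' x :
  open U -> U x -> (forall y, U y -> w y = w' y) ->
  local_div G (local_grad G w) x = local_div G (local_grad G w') x.
Proof.
move=> oU Ux E; apply: (congr1 (fun a => _ * a)); apply: eq_bigr => i _.
apply: (partial_open _ oU Ux) => y Uy; apply: (congr1 (fun a => _ * a)).
apply: (congr1 (fun v : 'rV_d => (v *m invmx (G y)) 0 i)).
by apply/rowP => l; rewrite !mxE; exact: (partial_open _ oU Uy).
Qed.

Section Metric.
Context {R : realType} {d : nat} {M : topologicalType}.
Context {S : smooth_structure R d M} (g : riemannian_metric S).
Implicit Types (c : chart R d M) (A : set M) (p : M).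

Let hc c : atlas S c -> is_chart c := @atlas_chart _ _ _ S c.

Lemma posdef_metric p : posdef (metric_mx g p).
Proof. by split; [exact: metric_sym|exact: metric_pos]. Qed.

Lemma gramE c p : atlas S c -> chart_dom c p ->
  gram g c (chart_map c p) =
  jacobian (transition c (chart_at S p)) (chart_map c p) *m metric_mx g p *m
  (jacobian (transition c (chart_at S p)) (chart_map c p))^T.
Proof. by move=> a pc; rewrite /gram /form_in (chart_mapK (hc a) pc). Qed.

Lemma gram_chart_at p : gram g (chart_at S p) (chart_map (chart_at S p) p) = metric_mx g p.
Proof.
have a0 := chart_at_atlas S p; have p0 := chart_at_dom S p.
rewrite (gramE a0 p0) (jacobian_transition_id a0 (chart_image_map p0 I)).
by rewrite trmx1 mulmx1 mul1mx.
Qed.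

Lemma gram_transition c1 c2 A x : atlas S c1 -> atlas S c2 -> overlap c1 c2 A x ->
  gram g c1 x = jacobian (transition c1 c2) x *m gram g c2 (transition c1 c2 x) *m
    (jacobian (transition c1 c2) x)^T.
Proof.
move=> a1 a2 x12; rewrite /gram /form_in (transition_inv a1 a2 x12).
have [i1 d2 _] := (overlapP _ _ _ a1).1 x12.
have [d1 E] := chart_image_dom (hc a1) i1.
set p := chart_inv c1 x.
have xo : overlap c1 c2 (chart_dom (chart_at S p)) x.
  by apply/(overlapP _ _ _ a1); split=> //; exact: chart_at_dom.
rewrite (@jacobian_transition_comp _ _ _ S c1 c2 _ _ a1 a2 (chart_at_atlas S p) xo).
by rewrite trmx_mul !mulmxA.
Qed.

Lemma smooth_gram c A : atlas S c -> forall i j,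
  smooth_on (chart_image c A) (fun x => gram g c x i j).
Proof.
move=> a i j k; apply: (Ck_on_sub _ (metric_smooth g a i j k)).
by move=> x [p [p1 _] <-]; exists p.
Qed.

Lemma inner_chart c p v w : atlas S c -> chart_dom c p ->
  inner g p v w = quad (gram g c) (vec_in S c p v) (vec_in S c p w) (chart_map c p).
Proof.
move=> a pc; have a0 := chart_at_atlas S p; have p0 := chart_at_dom S p.
have po : overlap (chart_at S p) c setT (chart_map (chart_at S p) p) by exact: overlap_map.
have E : metric_mx g p = jacobian (transition (chart_at S p) c) (chart_map (chart_at S p) p)
    *m gram g c (chart_map c p) *m
    (jacobian (transition (chart_at S p) c) (chart_map (chart_at S p) p))^T.
  rewrite -gram_chart_at; apply: etrans (gram_transition a0 a po) _.
  exact: (congr1 (fun y => _ *m gram g c y *m _) (transition_map c a0 p0)).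
rewrite /inner E /quad /vec_in.
move: (jacobian _ _) (gram g c _) => J G.
by rewrite trmx_mul !mulmxA.
Qed.

Lemma posdef_gram c x : atlas S c -> chart_image c setT x -> posdef (gram g c x).
Proof.
move=> a ix; have [pc E] := chart_image_dom (hc a) ix.
split.
  by rewrite /gram /form_in !trmx_mul trmxK metric_sym mulmxA.
move=> w w0; rewrite -E -[w](vec_in_surj w a pc) -/(quad _ _ _ _) -inner_chart//.
apply: metric_pos; apply: contra w0 => /eqP h.
by rewrite -(vec_in_surj w a pc) h /vec_in mul0mx.
Qed.

Lemma posdef_gram_image c A x : atlas S c -> chart_image c A x -> posdef (gram g c x).
Proof. by move=> a /(chart_imageP _ _ (hc a))[ix _]; exact: posdef_gram. Qed.

Section OverlapData.
Context (c1 c2 : chart R d M) (A : set M).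
Hypotheses (a1 : atlas S c1) (a2 : atlas S c2) (oA : open A).

Lemma grad_overlap (u : M -> R) x : overlap c1 c2 A x ->
  Ck_on 1 (overlap c2 c1 A) (u \o chart_inv c2) ->
  local_grad (gram g c1) (u \o chart_inv c1) x *m jacobian (transition c1 c2) x =
  local_grad (gram g c2) (u \o chart_inv c2) (transition c1 c2 x).
Proof.
move=> x12 cu.
have o12 := open_overlap a1 a2 oA; have o21 := open_overlap a2 a1 oA.
have E := (@local_grad_transition _ _ _ _ _ (transition c2 c1) o12 o21
   (smooth_transition A a1 a2) (smooth_transition A a2 a1)
   (fun x => @overlap_transition _ _ _ S c1 c2 A x a1 a2)
   (fun x => @transitionK _ _ _ S c1 c2 A x a1 a2) (gram g c1) (gram g c2)
   (fun x h => @posdef_gram_image c1 _ x a1 h)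
   (fun x h => @posdef_gram_image c2 _ x a2 h)
   (fun x h => @gram_transition c1 c2 A x a1 a2 h) _ _ x12 cu).
apply: etrans E; congr (_ *m _); rewrite /local_grad; congr (_ *m _).
apply/rowP => i; rewrite !mxE.
apply: (partial_open _ o12 x12) => y y12.
by rewrite (comp_transition u a1 a2 y12).
Qed.

Lemma div_overlap (X : M -> 'rV[R]_d) x : overlap c1 c2 A x ->
  (forall i, Ck_on 1 (overlap c2 c1 A) (fun y => field_in S c2 X y 0 i)) ->
  local_div (gram g c1) (field_in S c1 X) x =
  local_div (gram g c2) (field_in S c2 X) (transition c1 c2 x).
Proof.
move=> x12 cX.
have o12 := open_overlap a1 a2 oA; have o21 := open_overlap a2 a1 oA.
exact: (@local_div_transition _ _ _ _ _ (transition c2 c1) o12 o21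
   (smooth_transition A a1 a2) (smooth_transition A a2 a1)
   (fun x => @overlap_transition _ _ _ S c1 c2 A x a1 a2)
   (fun x => @transitionK _ _ _ S c1 c2 A x a1 a2) (gram g c1) (gram g c2)
   (@smooth_gram c1 _ a1) (@smooth_gram c2 _ a2)
   (fun x h => @posdef_gram_image c1 _ x a1 h)
   (fun x h => @posdef_gram_image c2 _ x a2 h)
   (fun x h => @gram_transition c1 c2 A x a1 a2 h) _ _ _ x12 cX
   (fun y h => @field_in_transition _ _ _ S c1 c2 A X y a1 a2 h)).
Qed.

Lemma chr_overlap x i j l : overlap c1 c2 A x ->
  \sum_k chr (gram g c1) k i j x * jacobian (transition c1 c2) x k l =
  partial i (partial j (fun y => transition c1 c2 y 0 l)) x +
  \sum_a \sum_b jacobian (transition c1 c2) x i a * jacobian (transition c1 c2) x j b *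
    chr (gram g c2) l a b (transition c1 c2 x).
Proof.
move=> x12.
have o12 := open_overlap a1 a2 oA; have o21 := open_overlap a2 a1 oA.
exact: (@chr_transition _ _ _ _ _ (transition c2 c1) o12 o21
   (smooth_transition A a1 a2) (smooth_transition A a2 a1)
   (fun x => @overlap_transition _ _ _ S c1 c2 A x a1 a2)
   (fun x => @transitionK _ _ _ S c1 c2 A x a1 a2) (gram g c1) (gram g c2)
   (@smooth_gram c2 _ a2)
   (fun x h => @posdef_gram_image c1 _ x a1 h)
   (fun x h => @posdef_gram_image c2 _ x a2 h)
   (fun x h => @gram_transition c1 c2 A x a1 a2 h) _ i j l x12).
Qed.

End OverlapData.

Definition C1_field A (X : M -> 'rV[R]_d) : Prop :=
  forall c, atlas S c -> forall i,
    Ck_on 1 (chart_image c A) (fun x => field_in S c X x 0 i).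

Lemma overlap_sub c1 c2 A : overlap c1 c2 A `<=` chart_image c1 A.
Proof. by move=> x [p [p1 [p2 Ap]] <-]; exists p. Qed.

Lemma gradE p (u : M -> R) : grad g u p =
  local_grad (gram g (chart_at S p)) (u \o chart_inv (chart_at S p))
    (chart_map (chart_at S p) p).
Proof. by rewrite /grad /sharp /local_grad gram_chart_at. Qed.

(** The definition of [grad] uses the chart [chart_at S p], which may jump with [p]. Only an
    expression in one fixed chart can be differentiated or integrated over a neighbourhood;
    [div_chart] and [laplacian_chart] serve the same end. *)
Lemma grad_chart c A p u : atlas S c -> open A -> Ck S 1 A u -> A p -> chart_dom c p ->
  vec_in S c p (grad g u p) =
  local_grad (gram g c) (u \o chart_inv c) (chart_map c p).
Proof.
move=> a oA cu Ap pc; have a0 := chart_at_atlas S p; have p0 := chart_at_dom S p.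
rewrite /vec_in gradE.
have E := @grad_overlap _ c A a0 a oA u _ (overlap_map p0 pc Ap)
  (Ck_on_sub (@overlap_sub _ _ _) (cu c a)).
by apply: etrans E _; rewrite (transition_map c a0 p0).
Qed.

Lemma field_in_grad c A u x : atlas S c -> open A -> Ck S 1 A u ->
  chart_image c A x ->
  field_in S c (grad g u) x = local_grad (gram g c) (u \o chart_inv c) x.
Proof.
move=> a oA cu [p [pc Ap] <-]; rewrite /field_in.
by rewrite (chart_mapK (hc a) pc) (grad_chart a oA cu Ap pc).
Qed.

Lemma div_chart c A p X : atlas S c -> open A -> C1_field A X -> A p ->
  chart_dom c p ->
  div g X p = local_div (gram g c) (field_in S c X) (chart_map c p).
Proof.
move=> a oA cX Ap pc; have a0 := chart_at_atlas S p; have p0 := chart_at_dom S p.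
rewrite -[LHS]/(local_div (gram g (chart_at S p)) (field_in S (chart_at S p) X)
  (chart_map (chart_at S p) p)).
have E := @div_overlap _ c A a0 a oA X _ (overlap_map p0 pc Ap)
  (fun i => Ck_on_sub (@overlap_sub _ _ _) (cX c a i)).
by apply: etrans E _; rewrite (transition_map c a0 p0).
Qed.

Lemma C1_field_grad A u : open A -> Ck S 2 A u -> C1_field A (grad g u).
Proof.
move=> oA cu c a i.
have cu1 : Ck S 1 A u by move=> c' a'; exact: Ck_onW (cu c' a').
have oi := open_chart_image (hc a) oA.
apply: (@Ck_on_eq _ _ _ _ (fun x => local_grad (gram g c) (u \o chart_inv c) x 0 i)) => //.
  by move=> x xA; rewrite (field_in_grad a oA cu1 xA).
exact: (@Ck_on_local_grad _ _ _ _ oi (@smooth_gram c _ a)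
  (fun x h => @posdef_gram_image c _ x a h) _ 1 i (cu c a)).
Qed.

Lemma inner_grad c A p (h : M -> R) v : atlas S c -> open A -> Ck S 1 A h -> A p ->
  chart_dom c p ->
  inner g p (grad g h p) v =
  \sum_l vec_in S c p v 0 l * partial l (h \o chart_inv c) (chart_map c p).
Proof.
move=> a oA ch Ap pc; rewrite (inner_chart _ _ a pc) (grad_chart a oA ch Ap pc).
rewrite /quad /local_grad -(mulmxA _ (invmx _)) mulVmx ?mulmx1.
  by rewrite mxE; apply: eq_bigr => l _; rewrite !mxE mulrC.
exact: posdef_unit (posdef_gram a (chart_image_map pc I)).
Qed.

Lemma inner_sym p v w : inner g p v w = inner g p w v.
Proof.
have -> : inner g p v w = ((v *m metric_mx g p *m w^T)^T) 0 0 by rewrite mxE.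
by rewrite !trmx_mul trmxK metric_sym mulmxA.
Qed.

Lemma inner_ge0 p v : 0 <= inner g p v v.
Proof.
have [->|v0] := eqVneq v 0; first by rewrite /inner mul0mx mul0mx mxE.
by apply: ltW; exact: metric_pos.
Qed.

Lemma innerDl p v1 v2 w : inner g p (v1 + v2) w = inner g p v1 w + inner g p v2 w.
Proof. by rewrite /inner !mulmxDl mxE. Qed.

Lemma innerZl p a v w : inner g p (a *: v) w = a * inner g p v w.
Proof. by rewrite /inner -!scalemxAl mxE. Qed.

Lemma inner_CS p v w : inner g p v w ^+ 2 <= inner g p v v * inner g p w w.
Proof. exact: posdef_CS (posdef_metric p). Qed.

Definition grad_sqr (u : M -> R) p : R := inner g p (grad g u p) (grad g u p).

Lemma grad_sqr_chart c A u x : atlas S c -> open A -> Ck S 1 A u ->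
  chart_image c A x ->
  grad_sqr u (chart_inv c x) = energy (gram g c) (u \o chart_inv c) x.
Proof.
move=> a oA cu xA; have [p [pc Ap] E] := xA.
rewrite -E (chart_mapK (hc a) pc) /grad_sqr (inner_chart _ _ a pc).
by rewrite (grad_chart a oA cu Ap pc).
Qed.

Lemma CkW k A u : Ck S k.+1 A u -> Ck S k A u.
Proof. by move=> cu c a; exact: Ck_onW (cu c a). Qed.

Lemma C2_grad_sqr A u : open A -> Ck S 3 A u -> Ck S 2 A (grad_sqr u).
Proof.
move=> oA cu c a; have oi := open_chart_image (hc a) oA.
apply: (@Ck_on_eq _ _ _ _ (energy (gram g c) (u \o chart_inv c))) => //.
  by move=> x xA; rewrite /= (grad_sqr_chart a oA (CkW (CkW cu)) xA).
exact: (@C2_energy _ _ _ _ oi (@smooth_gram c _ a)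
  (fun x h => @posdef_gram_image c _ x a h) _ (cu c a)).
Qed.

Lemma laplacian_chart c A u x : atlas S c -> open A -> Ck S 2 A u ->
  chart_image c A x ->
  laplacian g u (chart_inv c x) =
  local_div (gram g c) (local_grad (gram g c) (u \o chart_inv c)) x.
Proof.
move=> a oA cu xA; have [p [pc Ap] E] := xA.
rewrite -{1}E (chart_mapK (hc a) pc) /laplacian.
rewrite (div_chart a oA (C1_field_grad oA cu) Ap pc) E.
rewrite /local_div; congr (_ * _); apply: eq_bigr => i _.
apply: (partial_open _ (open_chart_image (hc a) oA) xA) => y yA.
by rewrite (field_in_grad a oA (CkW cu) yA).
Qed.

Lemma C1_manifold_laplacian A u : open A -> Ck S 3 A u -> Ck S 1 A (laplacian g u).
Proof.
move=> oA cu c a; have oi := open_chart_image (hc a) oA.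
apply: (@Ck_on_eq _ _ _ _
  (local_div (gram g c) (local_grad (gram g c) (u \o chart_inv c)))) => //.
  by move=> x xA; rewrite /= (laplacian_chart a oA (CkW cu) xA).
exact: (@C1_laplacian _ _ _ _ oi (@smooth_gram c _ a)
  (fun x h => @posdef_gram_image c _ x a h) _ (cu c a)).
Qed.

Lemma ricciE p v w : ricci g p v w =
  local_ricci (gram g (chart_at S p)) (chart_map (chart_at S p) p) v w.
Proof. by []. Qed.

(* Computed in chart_at p, the chart in which Ric is defined: no invariance of Ric under
   changes of charts has been proved. *)
Lemma bochner_manifold A u p : open A -> Ck S 3 A u -> A p ->
  2 * (laplacian g u p ^+ 2 / d%:R +
       inner g p (grad g (laplacian g u) p) (grad g u p) +
       ricci g p (grad g u p) (grad g u p)) <= laplacian g (grad_sqr u) p.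
Proof.
move=> oA cu Ap; have a := chart_at_atlas S p; have pc := chart_at_dom S p.
have oi := open_chart_image (hc a) oA; have xA := chart_image_map pc Ap.
have B := @bochner_le _ _ _ _ oi (@smooth_gram _ _ a)
  (fun x h => @posdef_gram_image _ _ x a h) _ (cu _ a) _ xA.
have E1 := laplacian_chart a oA (CkW cu) xA.
have E2 := laplacian_chart a oA (C2_grad_sqr oA cu) xA.
rewrite (chart_mapK (hc a) pc) in E1 E2.
rewrite ricciE E1 E2 (inner_grad _ a oA (C1_manifold_laplacian oA cu) Ap pc).
rewrite vec_in_chart_at gradE.
have -> : local_div (gram g (chart_at S p))
    (local_grad (gram g (chart_at S p)) (grad_sqr u \o chart_inv (chart_at S p)))
    (chart_map (chart_at S p) p) = local_div (gram g (chart_at S p))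
    (local_grad (gram g (chart_at S p)) (energy (gram g (chart_at S p))
       (u \o chart_inv (chart_at S p)))) (chart_map (chart_at S p) p).
  apply: (local_laplacian_eq _ oi xA) => y yA.
  by rewrite /= (grad_sqr_chart a oA (CkW (CkW cu)) yA).
apply: le_trans B; rewrite le_eqVlt; apply/orP; left; apply/eqP.
apply: (congr1 (fun a => 2 * (_ + a + _))).
apply: eq_bigr => l _; apply: (congr1 (fun a => _ * a)).
apply: (partial_open _ oi xA) => y yA.
exact: (laplacian_chart a oA (CkW cu) yA).
Qed.

End Metric.

Lemma bounded_integrable {R : realType} d1 (X : measurableType d1)
    (mu : {measure set X -> \bar R}) (D : set X) (h : X -> R) (B : R) :
  measurable D -> (mu D < +oo)%E -> measurable_fun D h ->
  (forall x, D x -> `|h x| <= B) -> mu.-integrable D (EFin \o h).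
Proof.
move=> mD finD mh hB; apply: (measurable_bounded_integrable mD finD mh).
exists `|B|; split; first exact: num_real.
move=> x Bx p Dp; apply: le_trans (hB p Dp) _; apply: ltW.
exact: le_lt_trans (ler_norm _) Bx.
Qed.

(** * Integrals over a chart domain as weighted Lebesgue integrals *)

Section WeightedIntegral.
Local Open Scope ereal_scope.
Context d1 d2 (X : measurableType d1) (Y : measurableType d2) (R : realType).
Context (mu : {measure set X -> \bar R}) (nu : {measure set Y -> \bar R}).
Context (D : set X) (E : set Y) (phi : Y -> X) (w : Y -> R).
Hypotheses (mD : measurable D) (mE : measurable E) (mphi : measurable_fun E phi)
  (phiD : forall y, E y -> D (phi y)) (mw : measurable_fun E w)
  (w0 : forall y, E y -> (0 <= w y)%R)
  (muE : forall A, measurable A -> A `<=` D ->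
     mu A = \int[nu]_(y in E) (w y * \1_A (phi y))%:E).

Import HBNNSimple.

(** Extension of [muE] from sets to simple functions by linearity and to non-negative functions by
    monotone convergence. In the application [phi] is the inverse of a chart and [w] the Riemannian
    density. *)
Lemma ge0_integral_weighted (f : X -> \bar R) : measurable_fun D f ->
  (forall x, D x -> 0 <= f x) ->
  \int[mu]_(x in D) f x = \int[nu]_(y in E) (f (phi y) * (w y)%:E).
Proof.
move=> mf f0.
pose f_ := nnsfun_approx mD mf.
have mfp n : measurable_fun E (fun y => f_ n (phi y)).
  by apply: measurableT_comp mphi; exact/measurable_funP.
transitivity (limn (fun n => \int[mu]_(x in D) (f_ n x)%:E)).
  rewrite -monotone_convergence//.
  - apply: eq_integral => y /[!inE] yD; apply/esym/cvg_lim => //.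
    by apply: cvg_nnsfun_approx.
  - by move=> n; exact/measurable_EFinP/measurable_funP.
  - by move=> n y _; rewrite lee_fin.
  - by move=> y _ m n mn; rewrite lee_fin; exact/lefP/nd_nnsfun_approx.
rewrite [X in limn X](_ : _ =
    (fun n => \int[nu]_(y in E) (f_ n (phi y) * w y)%:E)).
  rewrite -monotone_convergence//; last 3 first.
  - by move=> n; apply/measurable_EFinP/measurable_funM.
  - by move=> n y Ey; rewrite lee_fin mulr_ge0// w0.
  - move=> y Ey m n mn; rewrite lee_fin ler_wpM2r ?w0//.
    exact/lefP/nd_nnsfun_approx.
  apply: eq_integral => y /[!inE] Ey; apply/cvg_lim => //.
  rewrite (_ : (fun n => _) = (fun n => (f_ n (phi y))%:E * (w y)%:E)).
    apply: cvgeZr => //; apply: cvg_nnsfun_approx => //; exact: phiD.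
  by apply/funext => n; rewrite EFinM.
apply/funext => n.
have mI r : measurable (f_ n @^-1` [set r]) by [].
have key r : (0 <= r)%R -> \int[mu]_(x in D) (r * \1_(f_ n @^-1` [set r]) x)%:E =
    \int[nu]_(y in E) (r * \1_(f_ n @^-1` [set r]) (phi y) * w y)%:E.
  move=> r0; under eq_integral do rewrite EFinM.
  rewrite ge0_integralZl_EFin//; last first.
    by apply/measurable_EFinP; exact: measurable_indic.
  under [RHS]eq_integral do rewrite -mulrA EFinM.
  have mi : measurable_fun E (fun y => \1_(f_ n @^-1` [set r]) (phi y) : R).
    by apply: measurableT_comp mphi; exact: measurable_indic.
  rewrite [RHS]ge0_integralZl_EFin//; last 2 first.
  - by move=> y Ey; rewrite lee_fin mulr_ge0// w0.
  - by apply/measurable_EFinP/measurable_funM.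
  congr (_ * _); rewrite integral_indic// muE; last 2 first.
  - exact: measurableI.
  - by move=> x [].
  apply: eq_integral => y /[!inE] Ey; rewrite mulrC indicI /=.
  have -> : \1_D (phi y) = 1%R :> R by rewrite indicE mem_set//; exact: phiD.
  by rewrite mulr1.
transitivity (\sum_(k \in range (f_ n))
    \int[mu]_(x in D) (k * \1_(f_ n @^-1` [set k]) x)%:E).
  under eq_integral do rewrite fimfunE -fsumEFin//.
  rewrite ge0_integral_fsum//.
  - by move=> y; apply/measurable_EFinP/measurable_funM => //; exact: measurable_indic.
  - by move=> y x _; rewrite nnfun_muleindic_ge0.
transitivity (\sum_(k \in range (f_ n))
    \int[nu]_(y in E) (k * \1_(f_ n @^-1` [set k]) (phi y) * w y)%:E).
  apply: eq_fsbigr => r /[!inE] -[x _ <-]; apply: key.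
  exact: fun_ge0.
rewrite -ge0_integral_fsum//.
- apply: eq_integral => y _; rewrite fsumEFin// [in RHS]fimfunE.
    by congr (_%:E); rewrite !fsbig_finite// mulr_suml.
- move=> r; apply/measurable_EFinP; apply: measurable_funM => //.
  apply: measurable_funM => //.
  by apply: measurableT_comp mphi; exact: measurable_indic.
- move=> r y Ey; rewrite EFinM mule_ge0// ?lee_fin ?w0//.
  exact: nnfun_muleindic_ge0.
Qed.

Lemma integral_weighted (h : X -> R) : measurable_fun D h ->
  \int[mu]_(x in D) (h x)%:E = \int[nu]_(y in E) (h (phi y) * w y)%:E.
Proof.
move=> mh; rewrite integralE [RHS]integralE.
have mh' : measurable_fun D (EFin \o h) by exact/measurable_EFinP.
congr (_ - _).
- rewrite ge0_integral_weighted//; last exact: measurable_funepos.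
  apply: eq_integral => y /[!inE] Ey; rewrite !funeposE /=.
  by rewrite EFinM maxe_pMl ?mul0e// lee_fin w0.
- rewrite ge0_integral_weighted//; last exact: measurable_funeneg.
  apply: eq_integral => y /[!inE] Ey; rewrite !funenegE /=.
  by rewrite -mulNr EFinM maxe_pMl ?mul0e// lee_fin w0.
Qed.

End WeightedIntegral.

Section ChartIntegral.
Context {R : realType} {d : nat} {M : ptopologicalType}.
Context {S : smooth_structure R d M} (g : riemannian_metric S).
Context (vol : {measure set (borel M) -> \bar R}) (hvol : is_volume g vol).
Implicit Types (c : chart R d M) (A : set M).

Let hc c : atlas S c -> is_chart c := @atlas_chart _ _ _ S c.

Lemma density_continuous c x : atlas S c -> chart_image c setT x ->
  {for x, continuous (density g c)}.
Proof.
move=> a ix.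
have := @C1_density _ _ _ _ (open_chart_image (hc a) openT) (@smooth_gram _ _ _ _ g c _ a)
  (fun x h => @posdef_gram_image _ _ _ _ g c _ x a h).
by move/Ck_onW/Ck_on0; exact.
Qed.

Lemma density_chart_gt0 c x : atlas S c -> chart_image c setT x -> 0 < density g c x.
Proof.
move=> a ix.
exact: (@density_gt0 _ _ _ _ (fun x h => @posdef_gram_image _ _ _ _ g c _ x a h) _ ix).
Qed.

Lemma integral_chart c A (h : M -> R) : atlas S c -> open A ->
  measurable_fun (chart_dom c `&` A : set (borel M)) (h : borel M -> R) ->
  (\int[vol]_(p in chart_dom c `&` A) (h p)%:E =
   \int[lebesgue_rV d]_(x in chart_image c A) (h (chart_inv c x) * density g c x)%:E)%E.
Proof.
move=> a oA mh; have [od oi _ _ _] := hc a.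
have oiA : open (chart_image c A) by exact: open_chart_image (hc a) oA.
have sub x : chart_image c A x -> chart_image c setT x.
  by move=> /(chart_imageP _ _ (hc a))[].
have mD : measurable (chart_dom c `&` A : set (borel M)).
  by apply: borel_open; exact: openI.
have mE : measurable (chart_image c A : set (borel 'rV[R]_d)) by exact: borel_open.
have mw : measurable_fun (chart_image c A : set (borel 'rV[R]_d))
    (density g c : borel 'rV[R]_d -> R).
  apply: (@continuous_measurableR R 'rV[R]_d (chart_image c A) (density g c)) => //.
  by move=> x /sub ix; exact: density_continuous.
have mi : measurable_fun (chart_image c A : set (borel 'rV[R]_d))
    (chart_inv c : borel 'rV[R]_d -> borel M).
  apply: (@continuous_borel 'rV[R]_d M (chart_image c A) (chart_inv c)) => //.
  by move=> x /sub ix; exact: chart_inv_continuous (hc a) ix.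
apply: (@integral_weighted _ _ (borel M) (borel 'rV[R]_d) R vol (lebesgue_rV d)
  (chart_dom c `&` A) (chart_image c A) (chart_inv c) (density g c)) => //.
- move=> x ix; have [h1 h2] := (chart_imageP _ _ (hc a)).1 ix.
  by split=> //; have [] := chart_image_dom (hc a) h1.
- by move=> x /sub ix; apply: ltW; exact: density_chart_gt0.
move=> B mB BD.
rewrite (hvol a mB (fun x Bx => (BD x Bx).1)).
(* The integrand in [is_volume] lives on the whole space, where [density] has no meaning off the
   image of the chart; the indicator vanishes there. *)
have E : (fun x => (density g c x * \1_(chart_map c @` B) x)%:E) =
   (fun x : borel 'rV[R]_d => (density g c x * \1_B (chart_inv c x))%:E) \_ (chart_image c A).
  apply/funext => x; rewrite patchE; case: ifPn => [/[!inE] ix|].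
    congr (_ * _)%:E; rewrite !indicE; congr (nat_of_bool _)%:R.
    have [h1 h2] := (chart_imageP _ _ (hc a)).1 ix.
    have [e1 e2] := chart_image_dom (hc a) h1.
    apply/idP/idP => /[!inE]; last by move=> Bx; exists (chart_inv c x).
    by move=> [p Bp <-]; rewrite (chart_mapK (hc a)) //; exact: (BD p Bp).1.
  move=> /negP nx; rewrite indicE memNset ?mulr0//.
  by move=> [p Bp px]; apply: nx; rewrite inE; exists p => //; exact: BD.
have mF : measurable_fun (chart_image c A : set (borel 'rV[R]_d))
   (fun x : borel 'rV[R]_d => (density g c x * \1_B (chart_inv c x))%:E).
  apply/measurable_EFinP; apply: measurable_funM => //.
  by apply: (measurableT_comp (measurable_indic _) mi).
rewrite E lebesgue_intE; first by rewrite -integral_mkcond.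
- by apply/(measurable_restrictT _ _).1.
- move=> x; rewrite patchE; case: ifPn => [/[!inE] /sub ix|//].
  by rewrite lee_fin mulr_ge0// ltW// density_chart_gt0.
Qed.

End ChartIntegral.

(** * One-sided divergence theorem *)

Section SquaredPositivePart.
Context {R : realType}.
Implicit Types t : R.

Definition pos (t : R) : R := Num.max t 0.

(** Squaring makes the positive part C^1, and C^1 is all that the cutoffs below have to be. *)
Definition posq (t : R) : R := pos t ^+ 2.

Lemma pos_ge0 t : 0 <= pos t.
Proof. by rewrite le_max lexx orbT. Qed.

Lemma pos_id t : 0 <= t -> pos t = t.
Proof. by move=> t0; apply/max_idPl. Qed.

Lemma pos_0 t : t <= 0 -> pos t = 0.
Proof. by move=> t0; apply/max_idPr. Qed.

Lemma pos_lip t h : `|pos (t + h) - pos t| <= `|h|.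
Proof.
have [a|a] := leP 0 t; have [b|b] := leP 0 (t + h).
- by rewrite !pos_id// [X in `|X|](_ : _ = h)//; lra.
- rewrite (pos_0 (ltW b)) (pos_id a) sub0r normrN ger0_norm// ler0_norm; lra.
- rewrite (pos_id b) (pos_0 (ltW a)) subr0 ger0_norm// ger0_norm; lra.
- by rewrite !pos_0 ?subrr ?normr0//; exact: ltW.
Qed.

Lemma pos_continuous : continuous pos.
Proof.
move=> t; apply/cvgrPdist_le => e e0; near=> y.
have := pos_lip y (t - y); rewrite [y + _]addrC subrK => /le_trans; apply.
near: y; apply/nbhs_ballP; exists e => //= y.
by rewrite /ball /= => /ltW.
Unshelve. all: by end_near.
Qed.

Lemma posq_taylor t h : `|posq (t + h) - posq t - h * (2 * pos t)| <= `|h| ^+ 2.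
Proof.
rewrite /posq; have -> : `|h| ^+ 2 = h ^+ 2 by rewrite real_normK// num_real.
rewrite ler_norml.
have [a|a] := leP 0 t; have [b|b] := leP 0 (t + h).
- by rewrite !pos_id//; apply/andP; split; nra.
- by rewrite (pos_0 (ltW b)) (pos_id a); apply/andP; split; nra.
- by rewrite (pos_id b) (pos_0 (ltW a)); apply/andP; split; nra.
- by rewrite (pos_0 (ltW b)) (pos_0 (ltW a)); apply/andP; split; nra.
Qed.

Lemma is_derive_posq t : is_derive t (1 : R) posq (2 * pos t).
Proof.
have h : (fun h : R => h^-1 *: ((posq \o shift t) (h *: 1) - posq t)) @ 0^' --> 2 * pos t.
  apply/cvgrPdist_le => e e0; near=> h.
  have h0 : h != 0 by near: h; exact: nbhs_dnbhs_neq.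
  have he : `|h| <= e by near: h; apply: dnbhs0_le.
  rewrite /= [h *: 1]mulr1 [h + t]addrC.
  have := posq_taylor t h; rewrite [in X in _ -> X]distrC.
  have -> : h^-1 *: (posq (t + h) - posq t) - 2 * pos t =
      h^-1 * (posq (t + h) - posq t - h * (2 * pos t)).
    by rewrite mulrBr mulKf.
  rewrite normrM normfV => k.
  rewrite ler_pdivrMl ?normr_gt0//; apply: le_trans k _.
  by rewrite expr2 ler_wpM2l.
split; first by apply/cvg_ex; exists (2 * pos t).
exact/cvg_lim.
Unshelve. all: by end_near.
Qed.

Lemma posq_ge0 t : 0 <= posq t.
Proof. exact: sqr_ge0. Qed.

(** A C^1 switch, equal to 0 up to 1 and to 1 from 2 on, obtained from two nested squared positive
    parts. *)
Definition step t : R := 1 - posq (1 - posq (t - 1)).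

Definition step' t : R := 2 * pos (1 - posq (t - 1)) * (2 * pos (t - 1)).

Lemma is_derive_step t : is_derive t (1 : R) step (step' t).
Proof.
have d1 : is_derive t (1 : R) (fun t => t - 1) 1.
  by apply: is_derive_eq; rewrite ?subr0 ?addr0.
have d2 : is_derive t (1 : R) (fun t => posq (t - 1)) (2 * pos (t - 1) *: 1).
  exact: (@is_derive1_comp _ posq (fun t => t - 1) t _ _ (is_derive_posq _) d1).
have d3 : is_derive t (1 : R) (fun t => 1 - posq (t - 1)) (- (2 * pos (t - 1))).
  have dc : is_derive t (1 : R) (cst 1 : R -> R) 0 by exact: is_derive_cst.
  apply: (@is_derive_eq _ _ _ _ _ _ _ _ (is_deriveB dc d2)).
  by rewrite sub0r [_ *: _]mulr1.
have d4 := (@is_derive1_comp _ posq (fun t => 1 - posq (t - 1)) t _ _ (is_derive_posq _) d3).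
have dc : is_derive t (1 : R) (cst 1 : R -> R) 0 by exact: is_derive_cst.
apply: (@is_derive_eq _ _ _ _ _ _ _ _ (is_deriveB dc d4)).
by rewrite sub0r mulrN opprK.
Qed.

Lemma posq_continuous : continuous posq.
Proof.
by move=> t; apply: differentiable_continuous; apply/derivable1_diffP;
  have [] := is_derive_posq t.
Qed.

Lemma step'_continuous : continuous step'.
Proof.
move=> t; have c1 : {for t, continuous (fun t : R => t - 1)}.
  by apply: cvgB; [exact: cvg_id|exact: cvg_cst].
have c2 : {for t, continuous (fun t : R => 1 - posq (t - 1))}.
  apply: cvgB; first exact: cvg_cst.
  by apply: (continuous_comp c1); exact: posq_continuous.
apply: cvgM; (apply: cvgM; first exact: cvg_cst).
  exact: (continuous_comp c2 (@pos_continuous _)).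
exact: (continuous_comp c1 (@pos_continuous _)).
Qed.

Lemma step'_ge0 t : 0 <= step' t.
Proof. by rewrite !mulr_ge0// pos_ge0. Qed.

Lemma step_lt1 t : t <= 1 -> step t = 0.
Proof.
move=> t1; rewrite /step /posq [pos (t - 1)]pos_0 ?subr_le0//.
by rewrite expr0n subr0 pos_id ?ler01// expr1n subrr.
Qed.

Lemma posq_ge1 t : 1 <= t -> 1 <= posq t.
Proof. by move=> t1; rewrite /posq pos_id ?exprn_ege1// (le_trans ler01). Qed.

Lemma step_gt2 t : 2 <= t -> step t = 1.
Proof.
move=> t2; rewrite /step {1}/posq pos_0 ?expr0n ?subr0// subr_le0.
by apply: posq_ge1; lra.
Qed.

Lemma step'_lt1 t : t <= 1 -> step' t = 0.
Proof. by move=> t1; rewrite /step' [pos (t - 1)]pos_0 ?mulr0// subr_le0. Qed.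

Lemma step'_gt2 t : 2 <= t -> step' t = 0.
Proof.
move=> t2; rewrite /step' pos_0 ?mulr0 ?mul0r// subr_le0.
by apply: posq_ge1; lra.
Qed.

Lemma step_bounds t : 0 <= step t <= 1.
Proof.
rewrite /step; have := posq_ge0 (t - 1); move: (posq (t - 1)) => a a0.
have a1 : 0 <= posq (1 - a) <= 1.
  rewrite posq_ge0 /=.
  have [h|h] := leP 0 (1 - a); first by rewrite /posq pos_id//; nra.
  by rewrite /posq pos_0 ?expr0n ?ler01// ltW.
by move: (posq (1 - a)) a1 => b /andP[]; lra.
Qed.

End SquaredPositivePart.

(** * Compactly supported fields and cutoffs in R^n *)

Section EuclideanDivergence.
Context {R : realType} {n : nat}.
Local Notation lam := (lebesgue_rV n).
Implicit Types (K U : set 'rV[R]_n).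

Lemma compact_closed_rV K : compact K -> closed K.
Proof. by move=> cK; apply: compact_closed => //; exact: norm_hausdorff. Qed.

Lemma compact_norm_bound K : compact K -> exists2 r : R, 0 < r &
  forall x, K x -> `|x| < r.
Proof.
move=> /compact_bounded[B [_ hB]]; exists (`|B| + 2) => [|x Kx].
  by rewrite ltr_wpDl.
apply: le_lt_trans (hB (`|B| + 1) _ x Kx) _.
  by rewrite (le_lt_trans (ler_norm _))// ltrDl.
by rewrite ltrD2l ltr1n.
Qed.

Lemma compact_continuous_bound K (F : 'rV[R]_n -> R) : compact K ->
  (forall x, K x -> {for x, continuous F}) -> exists2 B, 0 <= B &
  forall x, K x -> `|F x| <= B.
Proof.
move=> cK cF.
have [->|/set0P K0] := eqVneq K set0; first by exists 0.
have [|||c _ hc] := @EVT_max_rV R n (fun x => `|F x|) K => //.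
  apply: continuous_in_subspaceT => x /set_mem Kx.
  by apply: continuous_comp; [exact: cF|exact: norm_continuous].
by exists `|F c| => // x Kx; apply: hc; rewrite inE.
Qed.

Lemma integrable_compact K (F : 'rV[R]_n -> R) : compact K ->
  continuous F -> (forall x, ~ K x -> F x = 0) ->
  lam.-integrable setT (EFin \o F).
Proof.
move=> cK cF F0; have [r r0 hr] := compact_norm_bound cK.
have [B B0 hB] := compact_continuous_bound cK (fun x _ => cF x).
pose A : set (borel 'rV[R]_n) := [set x : 'rV[R]_n | `|x| < r].
have mA : measurable A by apply: borel_open; exact: ball0_open.
apply: (@integrable_dominated _ (borel 'rV[R]_n) R lam A F B) => //.
- exact: lebesgue_rV_ball.
- apply: (@continuous_measurableR R 'rV[R]_n setT F); first exact: openT.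
  by move=> x _; exact: cF.
move=> x; have [Kx|Kx] := pselect (K x).
  by rewrite indicE mem_set ?mulr1 ?hB//; exact: hr.
by rewrite F0// normr0 mulr_ge0.
Qed.

Lemma partial_off K (F : 'rV[R]_n -> R) i x : compact K ->
  (forall x, ~ K x -> F x = 0) -> ~ K x -> partial i F x = 0.
Proof.
move=> cK F0 nx.
have oK : open (~` K) by apply: closed_openC; exact: compact_closed_rV.
rewrite (@partial_open _ _ (~` K) F (fun=> 0)) ?partialC//.
Qed.

Lemma Ck_onU k U1 U2 (F : 'rV[R]_n -> R) : Ck_on k U1 F -> Ck_on k U2 F ->
  Ck_on k (U1 `|` U2) F.
Proof.
by move=> [h1 h2] [k1 k2]; split=> [s sk x [Ux|Ux]|s i sk x [Ux|Ux]];
  [exact: h1|exact: k1|exact: h2|exact: k2].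
Qed.

Lemma integral_partial_compact K (F : 'rV[R]_n -> R) i : compact K ->
  Ck_on 1 setT F -> (forall x, ~ K x -> F x = 0) ->
  lam.-integrable setT (EFin \o partial i F) /\
  (\int[lam]_x (partial i F x)%:E = 0)%E.
Proof.
move=> cK cF F0; split.
  apply: (integrable_compact cK) => [x|x nx]; last exact: (partial_off _ cK).
  by have /Ck_on0 := Ck_on_partial i cF; exact.
have [r r0 hr] := compact_norm_bound cK.
apply: (@integral_partial0 _ _ F r) => // x rx; apply: F0 => /hr.
by rewrite ltNge rx.
Qed.

(** Extended by zero, the field is C^1 on the whole space, so its divergence has integral 0 and
    dominates [l] on [U]. *)
Lemma divergence_le0_compact U K (W : 'I_n -> 'rV[R]_n -> R) (l : 'rV[R]_n -> R) :
  open U -> compact K -> K `<=` U -> (forall j, Ck_on 1 U (W j)) ->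
  (forall j x, U x -> ~ K x -> W j x = 0) ->
  lam.-integrable U (EFin \o l) ->
  (forall x, U x -> l x <= \sum_j partial j (W j) x) ->
  (\int[lam]_(x in U) (l x)%:E <= 0)%E.
Proof.
move=> oU cK KU cW W0 il hl.
pose F j x := if x \in U then W j x else 0.
have F0 j x : ~ K x -> F j x = 0.
  by move=> nK; rewrite /F; case: ifPn => // /set_mem Ux; exact: W0.
(* The open sets [U] and the complement of [K] cover the space; [F j] is [W j] on the first and 0 on
   the second. *)
have cF j : Ck_on 1 setT (F j).
  rewrite (_ : setT = U `|` ~` K); last first.
    apply/seteqP; split=> // x _; have [/KU|] := pselect (K x); first by left.
    by right.
  apply: Ck_onU.
    by apply: (Ck_on_eq oU _ (cW j)) => y Uy; rewrite /F mem_set.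
  apply: (Ck_on_eq _ _ (Ck_on_cst 1 (~` K) 0)).
    by apply: closed_openC; exact: compact_closed_rV.
  by move=> y nK; rewrite F0.
have mU : measurable (U : set (borel 'rV[R]_n)) by exact: borel_open.
pose P x := \sum_j partial j (F j) x.
have iP : lam.-integrable setT (EFin \o P).
  rewrite (_ : EFin \o P = fun x => (\sum_j (EFin \o partial j (F j)) x)%E).
    by apply: integrable_sum => // j _; have [] := integral_partial_compact j cK (cF j) (F0 j).
  by apply/funext => x; rewrite /P /= sumEFin.
have P0 : (\int[lam]_x (P x)%:E = 0)%E.
  rewrite (_ : (fun x => (P x)%:E) = fun x => (\sum_j (EFin \o partial j (F j)) x)%E).
    rewrite integral_sum// => [|j].
      by rewrite big1// => j _; have [] := integral_partial_compact j cK (cF j) (F0 j).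
    by have [] := integral_partial_compact j cK (cF j) (F0 j).
  by apply/funext => x; rewrite /P /= sumEFin.
have nP x : ~ U x -> P x = 0.
  move=> nU; rewrite /P big1// => j _; apply: (partial_off _ cK); first exact: F0.
  by move=> /KU.
have PU : (\int[lam]_(x in U) (P x)%:E = 0)%E.
  rewrite -P0 integral_mkcond; apply: eq_integral => x _; rewrite patchE.
  by case: ifPn => // /negP; rewrite inE => /nP ->.
rewrite -PU; apply: le_integral => //.
  exact: (integrableS measurableT mU _ iP).
move=> x Ux; rewrite lee_fin; apply: le_trans (hl x _) _; first by rewrite inE in Ux.
rewrite inE in Ux; rewrite /P le_eqVlt; apply/orP; left; apply/eqP.
apply: eq_bigr => j _; apply: (partial_open _ oU Ux) => y Uy.
by rewrite /F mem_set.
Qed.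

Lemma C1_posq U (F : 'rV[R]_n -> R) : open U -> Ck_on 1 U F ->
  Ck_on 1 U (fun x => posq (F x)).
Proof.
move=> oU cF; apply: (@C1_on_comp1 _ _ posq (fun t => 2 * pos t)) => //.
  by move=> x _; exact: is_derive_posq.
by move=> x _; apply: cvgM; [exact: cvg_cst|exact: pos_continuous].
Qed.

(** Balls being cubes, the product is positive exactly on the open ball of centre [a] and radius
    [r], when [r] is positive. *)
Definition bump (a : 'rV[R]_n) (r : R) (x : 'rV[R]_n) : R :=
  \prod_j posq (1 - (r^-1 * (x 0 j - a 0 j)) ^+ 2).

Lemma C1_bump a r U : open U -> Ck_on 1 U (bump a r).
Proof.
move=> oU; apply: Ck_on_prod => // j _.
apply: (@C1_posq _ (fun x => 1 - (r^-1 * (x 0 j - a 0 j)) ^+ 2)) => //.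
apply: Ck_onB => //; first exact: Ck_on_cst.
have h : Ck_on 1 U (fun x : 'rV[R]_n => r^-1 * (x 0 j - a 0 j)).
  by apply: Ck_onZ => //; apply: Ck_onB => //; [exact: Ck_on_coord|exact: Ck_on_cst].
exact: (Ck_onM oU h h).
Qed.

Lemma bump_ge0 a r x : 0 <= bump a r x.
Proof. by apply: prodr_ge0 => j _; exact: posq_ge0. Qed.

Lemma bump_gt0 a r x : 0 < r -> `|x - a| < r -> 0 < bump a r x.
Proof.
move=> r0 /(rV_norm_ltP _ r0) h; apply: prodr_gt0 => j _.
have := h j; rewrite !mxE => hj.
have k : `|r^-1 * (x 0 j - a 0 j)| < 1.
  by rewrite normrM gtr0_norm ?invr_gt0// ltr_pdivrMl// mulr1.
have : (r^-1 * (x 0 j - a 0 j)) ^+ 2 < 1.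
  by rewrite -real_normK ?num_real// exprn_ilt1.
move: (_ ^+ 2) => b b1; rewrite /posq pos_id ?subr_ge0 ?ltW//.
by rewrite exprn_gt0// subr_gt0.
Qed.

Lemma bump_off a r x : 0 < r -> r <= `|x - a| -> bump a r x = 0.
Proof.
move=> r0 rx; apply/eqP; rewrite prodf_seq_eq0; apply/hasP.
have : ~ (forall j, `|(x - a) 0 j| < r).
  by move=> /(rV_norm_ltP _ r0); rewrite ltNge rx.
move=> /existsNP[j /negP]; rewrite -leNgt !mxE => hj.
exists j; rewrite ?mem_index_enum//=.
have k : 1 <= `|r^-1 * (x 0 j - a 0 j)|.
  by rewrite normrM gtr0_norm ?invr_gt0// ler_pdivlMl// mulr1.
have : 1 <= (r^-1 * (x 0 j - a 0 j)) ^+ 2.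
  by rewrite -real_normK ?num_real// exprn_ege1.
by move: (_ ^+ 2) => b b1; rewrite /posq pos_0 ?subr_le0// expr0n.
Qed.

(** At no more than half the radius every factor is at least (1 - 1/4)^2 = 9/16. *)
Lemma bump_lower r x : 0 < r -> `|x| < r -> (9 / 16) ^+ n <= bump 0 (2 * r) x.
Proof.
move=> r0 /(rV_norm_ltP _ r0) h.
have -> : (9 / 16 : R) ^+ n = \prod_(j < n) (9 / 16) by rewrite prodr_const card_ord.
apply: ler_prod => j _; apply/andP; split; first by lra.
have := h j; rewrite !mxE subr0 => hj.
have k : `|(2 * r)^-1 * x 0 j| <= 1 / 2.
  rewrite normrM gtr0_norm ?invr_gt0 ?mulr_gt0// ler_pdivrMl ?mulr_gt0//.
  by move: hj; move: `|_| => b; lra.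
have : ((2 * r)^-1 * x 0 j) ^+ 2 <= 1 / 4.
  rewrite -real_normK ?num_real//; move: k (normr_ge0 ((2 * r)^-1 * x 0 j)).
  by move: `|_| => b; nra.
have := sqr_ge0 ((2 * r)^-1 * x 0 j).
by move: (_ ^+ 2) => b b0 b1; rewrite /posq pos_id; nra.
Qed.

Lemma exists_cutoff K : compact K -> exists theta : 'rV[R]_n -> R, exists K',
  [/\ Ck_on 1 setT theta, compact K', forall x, ~ K' x -> theta x = 0,
      forall x, 0 <= theta x & forall x, K x -> 1 <= theta x].
Proof.
move=> cK; have [r r0 hr] := compact_norm_bound cK.
exists (fun x => (16 / 9) ^+ n * bump 0 (2 * r) x), [set x | `|x| <= 2 * r].
split.
- by apply: Ck_onZ; [exact: openT|exact: C1_bump openT].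
- exact: compact_sup_ball.
- move=> x /negP; rewrite -ltNge => rx.
  by rewrite bump_off ?mulr0 ?mulr_gt0 ?subr0 ?ltW.
- by move=> x; rewrite mulr_ge0 ?bump_ge0// exprn_ge0//; lra.
- move=> x /hr xr; have := bump_lower r0 xr.
  have p0 : 0 < (16 / 9 : R) ^+ n by rewrite exprn_gt0//; lra.
  rewrite -(ler_pM2l p0) -exprMn.
  by have -> : 16 / 9 * (9 / 16) = 1 :> R; [lra|rewrite expr1n].
Qed.

End EuclideanDivergence.

(** * Divergence inequality near a flat face x_i = 0; the sign [s] tells on which side the domain
    lies *)

Section BoundaryDivergence.
Context {R : realType} {n : nat}.
Local Notation lam := (lebesgue_rV n).
Context (U K : set 'rV[R]_n) (i : 'I_n) (s : R).
Hypotheses (oU : open U) (cK : compact K) (KU : K `<=` U) (s2 : s * s = 1).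
Let Up : set 'rV[R]_n := U `&` [set x | 0 < s * x 0 i].
Context (W : 'I_n -> 'rV[R]_n -> R) (l : 'rV[R]_n -> R) (B : R).
Hypotheses (cW : forall j, Ck_on 1 Up (W j))
  (W0 : forall j x, Up x -> ~ K x -> W j x = 0)
  (ml : measurable_fun (Up : set (borel 'rV[R]_n)) (l : borel 'rV[R]_n -> R))
  (lB : forall x, Up x -> `|l x| <= B)
  (l0 : forall x, Up x -> ~ K x -> l x = 0)
  (hl : forall x, Up x -> l x <= \sum_j partial j (W j) x)
  (Wn : forall x delta, K x -> x 0 i = 0 -> 0 < delta ->
     \forall y \near x, Up y -> - delta <= s * W i y).

(** If this fails, the bad points at distance less than e from the face generate, as e varies, a
    filter on the compact set [K]. A cluster point off the face is impossible since the distances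
    shrink, and on the face it contradicts [Wn]. *)
Lemma uniform_normal_bound delta : 0 < delta -> exists2 e, 0 < e &
  forall y, K y -> Up y -> s * y 0 i < e -> - delta <= s * W i y.
Proof.
move=> d0; apply: contrapT => nE.
pose E e := [set y | [/\ K y, Up y, s * y 0 i < e & s * W i y < - delta]].
have E0 e : 0 < e -> E e !=set0.
  move=> e0; apply: contrapT => h; apply: nE; exists e => // y Ky Uy ye.
  rewrite leNgt; apply/negP => yd; apply: h; by exists y.
have PF : ProperFilter (filter_from [set e : R | 0 < e] E).
  apply: filter_from_proper; last by move=> e /E0.
  apply: filter_from_filter; first by exists 1; rewrite /= ltr01.
  move=> a b a0 b0; exists (Num.min a b); first by rewrite /= lt_min a0.
  by move=> y [y1 y2 + y4]; rewrite lt_min => /andP[ya yb].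
have FK : filter_from [set e : R | 0 < e] E K.
  by exists 1; [rewrite /= ltr01|move=> y []].
have [x [Kx clx]] := cK PF FK.
have cx : {for x, continuous (fun y : 'rV[R]_n => `|y 0 i|)}.
  by apply: (continuous_comp (@coord_continuous _ _ _ 0 i x)); exact: norm_continuous.
have s1 : `|s| = 1.
  have : `|s| ^+ 2 = 1 by rewrite -normrX expr2 s2 normr1.
  have := normr_ge0 s; move: `|s| => t t0 tt; nra.
have [x0|x0] := eqVneq (x 0 i) 0.
  have [y [[Ky Uy _ yd] h]] := clx (E 1) _ (ex_intro2 _ _ 1 ltr01 (fun y Ey => Ey))
    (Wn Kx x0 d0).
  by have := h Uy; rewrite leNgt yd.
have x1 : 0 < `|x 0 i| / 2 by rewrite divr_gt0// normr_gt0.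
have nx : nbhs x [set y | `|x 0 i| / 2 < `|y 0 i|].
  apply: (cx [set t | `|x 0 i| / 2 < t]).
  apply: (open_nbhs_nbhs (conj (@open_gt _ (`|x 0 i| / 2)) _)).
  by rewrite /= ltr_pdivrMr// mulr_natr mulr2n ltrDl normr_gt0.
have FE : filter_from [set e : R | 0 < e] E (E (`|x 0 i| / 2)) by exists (`|x 0 i| / 2).
have [y [[Ky [_ Uy] ye _] h]] := clx _ _ FE nx.
have : `|s * y 0 i| < `|x 0 i| / 2 by rewrite gtr0_norm.
by rewrite normrM s1 mul1r => /(lt_trans h); rewrite ltxx.
Qed.

(* A cutoff of a boundary layer of width e: its gradient is a positive multiple of the inner
   conormal, so it pairs with W up to -delta when s * W i >= - delta near the boundary. *)
Definition layer (e : R) (x : 'rV[R]_n) : R := step (e^-1 * (s * x 0 i)).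

Lemma C1_layer_arg e A : open A -> Ck_on 1 A (fun x => e^-1 * (s * x 0 i)).
Proof. by move=> oA; do 2 apply: Ck_onZ => //; exact: Ck_on_coord. Qed.

Lemma C1_layer e A : open A -> Ck_on 1 A (layer e).
Proof.
move=> oA; apply: (@C1_on_comp1 _ _ step step') => //; first exact: C1_layer_arg.
  by move=> x _; exact: is_derive_step.
by move=> x _; exact: step'_continuous.
Qed.

Lemma partial_layer e j x :
  partial j (layer e) x = step' (e^-1 * (s * x 0 i)) * (e^-1 * (s * (j == i)%:R)).
Proof.
have dc := is_derive_coord x j i.
have d1 : derivable (fun x : 'rV[R]_n => e^-1 * (s * x 0 i)) x (delta_mx 0 j).
  have h := @C1_layer_arg e setT openT.
  by refine (@Ck_on_derivable _ _ 0 setT _ x j h _).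
have [_ E] := is_derive_comp1 d1 (is_derive_step (e^-1 * (s * x 0 i))).
rewrite /partial E; congr (_ * _).
have [dcd dce] := dc.
have E2 : 'D_(delta_mx 0 j) (fun x : 'rV[R]_n => s * x 0 i) x = s * (j == i)%:R.
  by rewrite -dce; exact: (@deriveZ _ _ _ _ s x (delta_mx 0 j) dcd).
rewrite -E2; apply: (@deriveZ _ _ _ (fun x : 'rV[R]_n => s * x 0 i) e^-1 x (delta_mx 0 j)).
exact: (@derivableZ _ _ _ _ s x (delta_mx 0 j) dcd).
Qed.

Lemma layer_bounds e x : 0 <= layer e x <= 1. Proof. exact: step_bounds. Qed.

Lemma open_coord_preimage (V : set R) : open V ->
  open ((fun x : 'rV[R]_n => s * x 0 i) @^-1` V).
Proof.
move=> oV; apply: open_comp => // x _.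
have := @Ck_onZ _ _ 0 setT s _ openT (@Ck_on_coord _ _ 0 setT i).
by move/Ck_on_continuous; exact.
Qed.

Let oUp : open Up.
Proof. exact: openI oU (open_coord_preimage (@open_gt _ 0)). Qed.

Let mUp : measurable (Up : set (borel 'rV[R]_n)).
Proof. exact: borel_open. Qed.

Let mK : measurable (K : set (borel 'rV[R]_n)).
Proof.
rewrite -(setCK K); apply: measurableC; apply: borel_open.
by apply: closed_openC; exact: compact_closed_rV.
Qed.

Let lamK : (lam K < +oo)%E.
Proof.
have [r r0 hr] := compact_norm_bound cK.
apply: le_lt_trans (lebesgue_rV_ball n r).
apply: le_measure; rewrite ?inE//.
by apply: borel_open; exact: ball0_open.
Qed.

Lemma measurable_layer e (A : set 'rV[R]_n) : measurable (A : set (borel 'rV[R]_n)) ->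
  measurable_fun (A : set (borel 'rV[R]_n)) (layer e : borel 'rV[R]_n -> R).
Proof.
move=> mA; apply: (@measurable_funS _ _ (borel 'rV[R]_n) _ setT) => //.
apply: (@continuous_measurableR R 'rV[R]_n setT (layer e)); first exact: openT.
by move=> x _; exact: (Ck_on_continuous (C1_layer e openT) I).
Qed.

Let measurable_layerM e : measurable_fun (Up : set (borel 'rV[R]_n))
  (fun x : borel 'rV[R]_n => layer e x * l x).
Proof. by apply: measurable_funM; [exact: measurable_layer mUp|exact: ml]. Qed.

Lemma integrable_layer e : lam.-integrable Up (fun x => (layer e x * l x)%:E).
Proof.
pose h := (fun x : borel 'rV[R]_n => layer e x * l x) \_ Up.
have ih : lam.-integrable setT (EFin \o h).
  apply: (@integrable_dominated _ (borel 'rV[R]_n) R lam K h `|B|) => //.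
    apply: (measurable_restrictT _ mUp).1; exact: measurable_layerM.
  move=> x; rewrite /h patchE; case: ifPn => [/set_mem Ux|_]; last by rewrite normr0 mulr_ge0.
  have [Kx|nK] := pselect (K x); last by rewrite l0// mulr0 normr0 mulr_ge0.
  rewrite indicE mem_set// mulr1 normrM.
  have := lB Ux; have /andP[a b] := layer_bounds e x; rewrite (ger0_norm a).
  move: (ler_norm B) (normr_ge0 (l x)) a b; move: `|l x| `|B| (layer e x) => p q r.
  by nra.
have := integrableS measurableT mUp (@subsetT _ _) ih.
by apply: eq_integrable => // x xU; rewrite /= /h patchE xU.
Qed.

(** The field [layer e * W] vanishes near the face, so [divergence_le0_compact] applies to it. The
    derivative of the layer has size 1/e but a sign, and its product with [theta] is integrated by
    parts; hence a bound that does not involve [e]. *)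
Lemma layer_estimate theta K' delta e : Ck_on 1 setT theta -> compact K' ->
  (forall x, ~ K' x -> theta x = 0) -> (forall x, 0 <= theta x) ->
  (forall x, K x -> 1 <= theta x) -> 0 < delta -> 0 < e ->
  (forall y, K y -> Up y -> s * y 0 i < 2 * e -> - delta <= s * W i y) ->
  (\int[lam]_(x in Up) (layer e x * l x)%:E <=
   delta%:E * \int[lam]_x (`|partial i theta x|)%:E)%E.
Proof.
move=> ct cK' t0 tp t1 d0 e0 hd.
pose W' j x := if x \in Up then layer e x * W j x else 0.
pose b x := s * partial i (layer e) x * theta x.
pose a := (fun x : borel 'rV[R]_n => layer e x * l x) \_ Up.
have sp x : s * partial i (layer e) x = e^-1 * step' (e^-1 * (s * x 0 i)).
  rewrite partial_layer eqxx mulr1.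
  have -> : forall p q, s * (p * (q * s)) = s * s * (q * p) by move=> p q; ring.
  by rewrite s2 mul1r.
have sp0 x : 0 <= s * partial i (layer e) x.
  by rewrite sp mulr_ge0 ?step'_ge0// invr_ge0 ltW.
have b0 x : 0 <= b x by rewrite mulr_ge0.
have cl : Ck_on 1 setT (layer e) := C1_layer e openT.
have dl j x : derivable (layer e) x (delta_mx 0 j).
  by refine (@Ck_on_derivable _ _ 0 setT _ x j cl _).
have cpl : continuous (partial i (layer e)).
  by move=> x; have /Ck_on0 := Ck_on_partial i cl; exact.
have cth : continuous theta by move=> x; exact: (Ck_on_continuous ct I).
have cb : continuous b.
  have := Ck_onM openT (Ck_onZ s openT (Ck_on_partial i cl)) (Ck_onW (leqnSn 0) ct).
  by move=> /Ck_on0 h x; exact: h.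
have ib : lam.-integrable setT (EFin \o b).
  by apply: (integrable_compact cK' cb) => x /t0; rewrite /b => ->; rewrite mulr0.
have mU : measurable (U : set (borel 'rV[R]_n)) by exact: borel_open.
have ibU : lam.-integrable U (EFin \o b) := integrableS measurableT mU (@subsetT _ _) ib.
have iaT : lam.-integrable setT (EFin \o a).
  have -> : EFin \o a = (fun x => (layer e x * l x)%:E) \_ Up.
    by apply/funext => x; rewrite /a /= !patchE; case: ifP.
  by apply/(integrable_mkcond _ mUp).1; exact: integrable_layer.
have iaU : lam.-integrable U (EFin \o a) := integrableS measurableT mU (@subsetT _ _) iaT.
have idb : lam.-integrable U (fun x => (delta * b x)%:E) := integrableZl mU delta ibU.
(* The layer function vanishes for s x_i < e, so the extension by zero across the face is C^1. *)
have cW' j : Ck_on 1 U (W' j).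
  pose V : set 'rV[R]_n := U `&` [set x | s * x 0 i < e].
  have oV : open V.
    exact: openI oU (open_coord_preimage (@open_lt _ e)).
  apply: (@Ck_on_sub _ _ _ (Up `|` V)).
    move=> x Ux; have [h|h] := ltP 0 (s * x 0 i); first by left.
    by right; split=> //=; exact: le_lt_trans e0.
  apply: Ck_onU.
    apply: (Ck_on_eq oUp _ (Ck_onM oUp (C1_layer e oUp) (cW j))) => y Uy.
    by rewrite /W' mem_set.
  apply: (Ck_on_eq oV _ (Ck_on_cst 1 V 0)) => y [_ /= ye].
  rewrite /W'; case: ifP => // _; rewrite /layer step_lt1 ?mul0r//.
  by rewrite ler_pdivrMl// mulr1 ltW.
have Dle x : U x -> a x - delta * b x <= \sum_j partial j (W' j) x.
  move=> Ux; have [xU|xU] := pselect (Up x); last first.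
    have xs : s * x 0 i <= 0 by rewrite leNgt; apply/negP => h; exact: xU.
    rewrite /a patchE memNset// /b sp step'_lt1; last first.
      by rewrite ler_pdivrMl// (le_trans xs)// mulr1 ltW.
    rewrite mulr0 mul0r mulr0 subr0.
    pose V : set 'rV[R]_n := [set x | s * x 0 i < e].
    have oV : open V.
      exact: open_coord_preimage (@open_lt _ e).
    have Vx : V x by exact: le_lt_trans e0.
    rewrite big1// => j _.
    rewrite (@partial_open _ _ _ (W' j) (fun=> 0) x j oV Vx) ?partialC// => y /= ye.
    rewrite /W'; case: ifP => // _; rewrite /layer step_lt1 ?mul0r//.
    by rewrite ler_pdivrMl// mulr1 ltW.
  have E : \sum_j partial j (W' j) x =
      partial i (layer e) x * W i x + layer e x * \sum_j partial j (W j) x.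
    rewrite mulr_sumr.
    have -> : partial i (layer e) x * W i x = \sum_j partial j (layer e) x * W j x.
      rewrite (bigD1 i)//= big1 ?addr0// => j ji.
      by rewrite partial_layer (negbTE ji) !mulr0 mul0r.
    rewrite -big_split; apply: eq_bigr => j _ /=.
    rewrite (@partial_open _ _ _ (W' j) (fun y => layer e y * W j y) x j oUp xU).
      by rewrite (partialM (dl j x) (Ck_on_derivable (cW j) xU)).
    by move=> y Uy; rewrite /W' mem_set.
  rewrite E /a patchE mem_set//.
  have k1 : layer e x * l x <= layer e x * \sum_j partial j (W j) x.
    by rewrite ler_wpM2l ?hl//; have /andP[] := layer_bounds e x.
  (* Three zones: beyond distance 2e the layer is constant, off [K] the field is zero, and elsewhere
     [hd] applies together with [theta >= 1]. *)
  have k2 : - (delta * b x) <= partial i (layer e) x * W i x.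
    have -> : partial i (layer e) x * W i x =
        (s * partial i (layer e) x) * (s * W i x).
      have -> : forall p q, (s * p) * (s * q) = s * s * (p * q) by move=> p q; ring.
      by rewrite s2 mul1r.
    rewrite /b; have := sp0 x; rewrite sp.
    have [h|h] := leP 2 (e^-1 * (s * x 0 i)).
      by rewrite step'_gt2// !mulr0 !mul0r mulr0 oppr0.
    move: (e^-1 * step' _) => p p0.
    have [Kx|nK] := pselect (K x); last first.
      by rewrite W0// !mulr0 oppr_le0; apply: mulr_ge0; [exact: ltW|exact: mulr_ge0].
    have xe : s * x 0 i < 2 * e by move: h; rewrite ltr_pdivrMl// [e * 2]mulrC.
    have := hd x Kx xU xe; have := t1 x Kx.
    move: (theta x) (s * W i x) => th w h1 h2.
    have : p * (- (delta * th)) <= p * w.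
      by rewrite ler_wpM2l//; nra.
    by apply: le_trans; rewrite le_eqVlt; apply/orP; left; apply/eqP; ring.
  by rewrite addrC; exact: lerD k2 k1.
have := @divergence_le0_compact _ _ U K W' (fun x => a x - delta * b x) oU cK KU cW'.
have h1 j x : U x -> ~ K x -> W' j x = 0.
  by move=> Ux nK; rewrite /W'; case: ifP => // /set_mem xU; rewrite W0// mulr0.
have h2 : lam.-integrable U (EFin \o (fun x => a x - delta * b x)) :=
  integrableB mU iaU idb.
move=> /(_ h1 h2 Dle).
have -> : (\int[lam]_(x in U) (a x - delta * b x)%:E =
   \int[lam]_(x in U) (a x)%:E - \int[lam]_(x in U) (delta * b x)%:E)%E.
  exact: (integralB_EFin mU iaU idb).
have fb : (\int[lam]_(x in U) (delta * b x)%:E)%E \is a fin_num by exact: integrable_fin_num.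
rewrite sube_le0 => h3.
have -> : (\int[lam]_(x in Up) (layer e x * l x)%:E = \int[lam]_(x in U) (a x)%:E)%E.
  rewrite (_ : (fun x => (a x)%:E) = (fun x => (layer e x * l x)%:E) \_ Up).
    by rewrite -integral_mkcondr setIA setIid.
  by apply/funext => x; rewrite /a /= !patchE; case: ifP.
apply: le_trans h3 _.
have -> : (\int[lam]_(x in U) (delta * b x)%:E = delta%:E * \int[lam]_(x in U) (b x)%:E)%E.
  by rewrite -(integralZl mU ibU).
apply: lee_wpmul2l; first by rewrite lee_fin ltW.
apply: (@le_trans _ _ (\int[lam]_x (b x)%:E)%E).
  apply: ge0_subset_integral => //; first by have /integrableP[] := ib.
  by move=> x _; rewrite lee_fin.
(* The integral of [c] is 0, and [b - c] is minus s times the layer times the derivative of [theta],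
   hence at most the absolute value of that derivative. *)
pose c x := s * partial i (fun y => layer e y * theta y) x.
have clt : Ck_on 1 setT (fun y => layer e y * theta y) by exact: Ck_onM openT cl ct.
have lt0 x : ~ K' x -> layer e x * theta x = 0 by move=> /t0 ->; rewrite mulr0.
have [ic c0] := integral_partial_compact i cK' clt lt0.
have cpt : continuous (partial i theta).
  by move=> x; have /Ck_on0 := Ck_on_partial i ct; exact.
have it : lam.-integrable setT (EFin \o (fun x => `|partial i theta x|)).
  apply: (integrable_compact cK') => [x|x nK].
    by apply: continuous_comp; [exact: cpt|exact: norm_continuous].
  by rewrite (partial_off _ cK' t0 nK) normr0.
have icc : lam.-integrable setT (EFin \o c) := integrableZl measurableT s ic.
have C0 : (\int[lam]_x (c x)%:E = 0)%E.
  have -> : (\int[lam]_x (c x)%:E = s%:E *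
     \int[lam]_x (partial i (fun y => layer e y * theta y) x)%:E)%E.
    by rewrite -(integralZl measurableT ic).
  by rewrite c0 mule0.
rewrite -[leRHS]add0e -C0 -(integralD_EFin measurableT icc it).
apply: le_integral => //; first exact: (integrableD measurableT icc it).
move=> x _; rewrite lee_fin /b /c.
have dt : derivable theta x (delta_mx 0 i) by refine (@Ck_on_derivable _ _ 0 setT _ x i ct _).
rewrite (partialM (dl i x) dt).
have /andP[p0 p1] := layer_bounds e x.
have s1 : `|s| = 1.
  have : `|s| ^+ 2 = 1 by rewrite -normrX expr2 s2 normr1.
  have := normr_ge0 s; move: `|s| => t t0' tt; nra.
have : - (s * (layer e x * partial i theta x)) <= `|partial i theta x|.
  apply: le_trans (ler_norm _) _; rewrite normrN normrM s1 mul1r normrM (ger0_norm p0).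
  by rewrite ler_piMl.
rewrite /= mulrDr !mulrA -addrA lerDl -mulrA => h.
by rewrite -lerBlDl sub0r.
Qed.

(** The integral [C] of the derivative of the cutoff is fixed first, then [delta], then the width of
    the layer. As the width tends to 0 the layer functions tend to 1 on [Up], and dominated
    convergence removes them. *)
Theorem boundary_divergence_le0 : (\int[lam]_(x in Up) (l x)%:E <= 0)%E.
Proof.
have [theta [K' [ct cK' t0 tp t1]]] := exists_cutoff cK.
have cpt : continuous (partial i theta).
  by move=> x; have /Ck_on0 := Ck_on_partial i ct; exact.
have it : lam.-integrable setT (EFin \o (fun x => `|partial i theta x|)).
  apply: (integrable_compact cK') => [x|x nK].
    by apply: continuous_comp; [exact: cpt|exact: norm_continuous].
  by rewrite (partial_off _ cK' t0 nK) normr0.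
have [C C0 EC] : exists2 C : R, 0 <= C & (\int[lam]_x (`|partial i theta x|)%:E = C%:E)%E.
  have fC := integrable_fin_num measurableT it.
  exists (fine (\int[lam]_x (`|partial i theta x|)%:E)%E); last by rewrite fineK.
  by rewrite fine_ge0// integral_ge0// => x _; rewrite lee_fin.
pose e k : R := k.+1%:R^-1.
have DC : ((fun k => \int[lam]_(x in Up) (layer (e k) x * l x)%:E) @ \oo -->
    \int[lam]_(x in Up) (l x)%:E)%E.
  have ig : lam.-integrable setT (EFin \o (fun x => `|B| * \1_K x)).
    apply: (@integrable_dominated _ (borel 'rV[R]_n) R lam K _ `|B|) => //.
      by apply: measurable_funM => //; exact: measurable_indic.
    by move=> x; rewrite ger0_norm// mulr_ge0.
  apply: (@dominated_convergence_EFin _ (borel 'rV[R]_n) R lam Up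
    (fun k x => layer (e k) x * l x) l (fun x => `|B| * \1_K x) mUp) => //.
  - move=> x [Ux /= xs].
    apply: cvg_near_cst; exists (Num.truncn (2 / (s * x 0 i))) => // k /= kx.
    rewrite /layer step_gt2 ?mul1r// invrK -ler_pdivrMr//.
    apply: ltW; apply: lt_le_trans (truncnS_gt _) _.
    by rewrite ler_nat ltnS.
  - exact: (integrableS measurableT mUp (@subsetT _ _) ig).
  - move=> k x Ux; have [Kx|nK] := pselect (K x); last by rewrite l0// mulr0 normr0 mulr_ge0.
    rewrite indicE mem_set// mulr1 normrM.
    have := lB Ux; have /andP[a b] := layer_bounds (e k) x; rewrite (ger0_norm a).
    move: (ler_norm B) (normr_ge0 (l x)) a b; move: `|l x| `|B| (layer _ x) => p q r.
    by nra.
apply/lee_addgt0Pr => eps eps0; rewrite add0e.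
pose delta := eps / (C + 1).
have d0 : 0 < delta by rewrite divr_gt0// ltr_wpDl.
have [e1 e10 he1] := uniform_normal_bound d0.
have ev : \forall k \near \oo, (\int[lam]_(x in Up) (layer (e k) x * l x)%:E <= eps%:E)%E.
  exists (Num.truncn (2 / e1)) => // k /= ke.
  have ek : 2 * e k <= e1.
    rewrite /e ler_pdivrMr// mulrC -ler_pdivrMr//.
    apply: ltW; apply: lt_le_trans (truncnS_gt _) _.
    by rewrite ler_nat ltnS.
  have := @layer_estimate theta K' delta (e k) ct cK' t0 tp t1 d0.
  have ekp : 0 < e k by rewrite invr_gt0.
  move=> /(_ ekp (fun y Ky Uy h => he1 y Ky Uy (lt_le_trans h ek))) /le_trans; apply.
  rewrite EC -EFinM lee_fin /delta -mulrA ler_piMr ?ltW//.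
  by rewrite mulrC ltr_pdivrMr ?mul1r ?ltrDl// ltr_wpDl.
rewrite -(cvg_lim _ DC)//; apply: lime_le => //; by apply/cvg_ex; eexists; exact: DC.
Qed.

End BoundaryDivergence.

(** Meant for [K] related to the closure of the domain and [A] the domain itself: a function that is
    only defined inside is bounded once it is bounded near each point, including those of the
    boundary. *)
Lemma compact_local_bound {R : realType} {T : topologicalType} (K A : set T) (h : T -> R) :
  compact K ->
  (forall p, K p -> exists B : R, \forall q \near p, A q -> `|h q| <= B) ->
  exists B : R, forall q, K q -> A q -> `|h q| <= B.
Proof.
move=> /compact_near_coveringP cK hB.
have [|B [_ hq]] := cK R (pinfty_nbhs R) (fun B q => A q -> `|h q| <= B) _.
  move=> p /hB[B HB]; exists ([set q | A q -> `|h q| <= B], [set C | B < C]) => /=.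
    by split => //; exists B; split => //; exact: num_real.
  by move=> [q C] /= [h1 h2] Aq; apply: le_trans (h1 Aq) (ltW h2).
exists (B + 1) => q Kq Aq; apply: (hq (B + 1)) => //.
by rewrite ltrDl.
Qed.

Lemma integrable_bounded_support {R : realType} {n : nat} (A K : set 'rV[R]_n)
    (f : 'rV[R]_n -> R) (B : R) : measurable (A : set (borel 'rV[R]_n)) -> compact K ->
  measurable_fun (A : set (borel 'rV[R]_n)) (f : borel 'rV[R]_n -> R) ->
  (forall x, A x -> `|f x| <= B) -> (forall x, A x -> ~ K x -> f x = 0) ->
  (lebesgue_rV n).-integrable A (EFin \o f).
Proof.
move=> mA cK mf fB f0; have [r r0 hr] := compact_norm_bound cK.
pose A0 : set (borel 'rV[R]_n) := [set x : 'rV[R]_n | `|x| < r].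
have mA0 : measurable A0 by apply: borel_open; exact: ball0_open.
pose h := (f : borel 'rV[R]_n -> R) \_ A.
have ih : (lebesgue_rV n).-integrable setT (EFin \o h).
  apply: (@integrable_dominated _ (borel 'rV[R]_n) R (lebesgue_rV n) A0 h `|B|) => //.
  - exact: lebesgue_rV_ball.
  - exact: (measurable_restrictT _ mA).1.
  move=> x; rewrite /h patchE; case: ifPn => [/set_mem Ax|_]; last by rewrite normr0 mulr_ge0.
  have [Kx|nK] := pselect (K x); last by rewrite f0// normr0 mulr_ge0.
  rewrite indicE mem_set ?mulr1; last exact: hr.
  exact: le_trans (fB x Ax) (ler_norm _).
have := integrableS measurableT mA (@subsetT _ _) ih.
by apply: eq_integrable => // x xA; rewrite /= /h patchE xA.
Qed.

(** * Bump functions on the manifold *)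

Section Bumps.
Context {R : realType} {d : nat} {M : topologicalType}.
Context {S : smooth_structure R d M} (g : riemannian_metric S).
Context (hM : hausdorff_space M).
Implicit Types (c : chart R d M) (A : set M).

Let hc c : atlas S c -> is_chart c := @atlas_chart _ _ _ S c.

Lemma Ck_transition c1 c2 A (F : 'rV[R]_d -> R) : atlas S c1 -> atlas S c2 -> open A ->
  Ck_on 1 (overlap c2 c1 A) F -> Ck_on 1 (overlap c1 c2 A) (F \o transition c1 c2).
Proof.
move=> a1 a2 oA; apply: Ck1_transition.
- exact: (open_overlap a1 a2 oA).
- exact: (open_overlap a2 a1 oA).
- exact: (smooth_transition A a1 a2).
- by move=> x; exact: (overlap_transition a1 a2).
Qed.

Lemma Ck_continuous k A (h : M -> R) p : open A -> Ck S k A h -> A p ->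
  {for p, continuous h}.
Proof.
move=> oA ch Ap; have a := chart_at_atlas S p; have pc := chart_at_dom S p.
have [od oi cK _ _] := hc a.
have h1 : {for p, continuous ((h \o chart_inv (chart_at S p)) \o chart_map (chart_at S p))}.
  apply: continuous_comp; first exact: chart_map_continuous (hc a) pc.
  apply: (Ck_on_continuous (ch _ a)); exact: chart_image_map.
move: h1; rewrite /prop_for /continuous_at /= cK// => h1.
apply: cvg_trans h1; apply: near_eq_cvg.
by apply: filterS (open_nbhs_nbhs (conj od pc)) => q qd /=; rewrite cK.
Qed.

Definition cball (a : 'rV[R]_d) (r : R) : set 'rV[R]_d := [set x | `|x - a| <= r].

Definition oball (a : 'rV[R]_d) (r : R) : set 'rV[R]_d := [set x | `|x - a| < r].

Lemma compact_cball a r : compact (cball a r).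
Proof.
have -> : cball a r = (fun x => x + a) @` [set x : 'rV[R]_d | `|x| <= r].
  apply/seteqP; split=> x /=; last by move=> [y yr <-]; rewrite /cball /= addrK.
  by move=> xr; exists (x - a); rewrite ?subrK.
apply: continuous_compact; last exact: compact_sup_ball.
by apply: continuous_subspaceT => x; exact: continuous_addr.
Qed.

Lemma open_oball a r : open (oball a r).
Proof.
have -> : oball a r = (fun x => x + - a) @^-1` [set x : 'rV[R]_d | `|x| < r] by [].
by apply: open_comp; [move=> x _; exact: continuous_addr|exact: ball0_open].
Qed.

Definition chart_bump c a r (p : M) : R :=
  if p \in chart_dom c then bump a r (chart_map c p) else 0.

Lemma chart_bump_ge0 c a r p : 0 <= chart_bump c a r p.
Proof. by rewrite /chart_bump; case: ifP => // _; exact: bump_ge0. Qed.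

Lemma chart_bump_gt0 c a r p : 0 < r -> chart_dom c p -> oball a r (chart_map c p) ->
  0 < chart_bump c a r p.
Proof. by move=> r0 pc h; rewrite /chart_bump mem_set//; exact: bump_gt0. Qed.

Definition chart_ball c a r : set M := chart_inv c @` cball a r.

Lemma chart_bump_off c a r p : atlas S c -> 0 < r -> ~ chart_ball c a r p ->
  chart_bump c a r p = 0.
Proof.
move=> ac r0 np; rewrite /chart_bump; case: ifP => // /set_mem pc.
apply: bump_off => //; rewrite leNgt; apply/negP => h; apply: np.
by exists (chart_map c p); [exact: ltW|exact: chart_mapK (hc ac) pc].
Qed.

Lemma compact_chart_ball c a r : atlas S c -> cball a r `<=` chart_image c setT ->
  compact (chart_ball c a r).
Proof.
move=> ac sub; apply: continuous_compact; last exact: compact_cball.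
apply: continuous_in_subspaceT => x /set_mem xb.
exact: chart_inv_continuous (hc ac) (sub _ xb).
Qed.

Lemma chart_ball_dom c a r p : atlas S c -> cball a r `<=` chart_image c setT ->
  chart_ball c a r p -> chart_dom c p /\ cball a r (chart_map c p).
Proof.
move=> ac sub [x xb <-]; have [h ->] := chart_image_dom (hc ac) (sub _ xb).
by [].
Qed.

(** The image of the closed ball is compact, hence closed as the space is Hausdorff; off it the bump
    vanishes, so no regularity is lost at the edge of the chart. *)
Lemma C1_chart_bump c a r : atlas S c -> 0 < r -> cball a r `<=` chart_image c setT ->
  Ck S 1 setT (chart_bump c a r).
Proof.
move=> ac r0 sub c' ac'.
have oK : open (~` chart_ball c a r).
  by apply: closed_openC; apply: compact_closed => //; exact: compact_chart_ball.
apply: (@Ck_on_sub _ _ _ (overlap c' c setT `|` chart_image c' (~` chart_ball c a r))).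
  move=> x ix; have [e1 e2] := chart_image_dom (hc ac') ix.
  have [h|h] := pselect (chart_dom c (chart_inv c' x)).
    by left; apply/(overlapP _ _ _ ac').
  right; apply/(chart_imageP _ _ (hc ac')); split=> // k; apply: h.
  by have [] := chart_ball_dom ac sub k.
have o1 := open_overlap ac' ac (@openT M).
have o2 := open_chart_image (hc ac') oK.
apply: Ck_onU.
  apply: (Ck_on_eq o1 _ (Ck_transition ac' ac (@openT M)
    (C1_bump a r (open_overlap ac ac' (@openT M))))) => x.
  by move=> /(overlapP _ _ _ ac')[ix h _]; rewrite /= /chart_bump mem_set.
apply: (Ck_on_eq o2 _ (Ck_on_cst 1 _ 0)) => x /(chart_imageP _ _ (hc ac'))[_ h].
by rewrite /= chart_bump_off.
Qed.

End Bumps.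

Section BoundaryCharts.
Context {R : realType} {d : nat} {M : topologicalType}.
Context {S : smooth_structure R d M}.
Implicit Types (c : chart R d M) (A Omega : set M).
Let hc c : atlas S c -> is_chart c := @atlas_chart _ _ _ S c.

(** Near [p] the domain is exactly one side of the hyperplane x_i = 0, the side being given by [s].
    A slice chart alone does not say this, since the domain could lie on both sides of its
    boundary. *)
Definition boundary_chart Omega c i s p := [/\ atlas S c, chart_dom c p,
  chart_map c p 0 i = 0, s * s = 1 &
  \forall q \near p, chart_dom c q -> (Omega q <-> 0 < s * chart_map c q 0 i)].

Lemma near_chart_inv c p (P : set M) : atlas S c -> chart_dom c p ->
  (\forall q \near p, P q) -> \forall x \near chart_map c p, P (chart_inv c x).
Proof.
move=> a pc; rewrite -{1}(chart_mapK (hc a) pc).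
exact: (chart_inv_continuous (hc a) (chart_image_map pc I)).
Qed.

Lemma near_chart_map c p (P : set 'rV[R]_d) : atlas S c -> chart_dom c p ->
  (\forall x \near chart_map c p, P x) -> \forall q \near p, P (chart_map c q).
Proof. by move=> a pc; exact: (chart_map_continuous (hc a) pc). Qed.

(** The ball of radius [r] supports a function of the partition of unity, and the ball of radius
    [2 * r] is the open set around it in which the Euclidean inequalities are applied. *)
Definition good_ball Omega c a r := [/\ atlas S c, 0 < r,
  oball a (2 * r) `<=` chart_image c setT &
  (oball a (2 * r) `<=` chart_image c Omega) \/
  exists i s, [/\ s * s = 1,
    forall x, oball a (2 * r) x -> (Omega (chart_inv c x) <-> 0 < s * x 0 i) &
    forall x, oball a (2 * r) x -> x 0 i = 0 -> boundary_chart Omega c i s (chart_inv c x)]].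

Lemma nbhs_oball (a : 'rV[R]_d) (A : set 'rV[R]_d) : nbhs a A ->
  exists2 r : R, 0 < r & oball a (2 * r) `<=` A.
Proof.
move=> /nbhs_ballP[r /= r0 h]; exists (r / 2); first exact: divr_gt0.
move=> x; rewrite /oball /= mulrC divfK// => xr; apply: h.
by rewrite mx_norm_ball /ball_ /= distrC.
Qed.

Lemma good_ball_exists Omega p : open Omega ->
  Omega p \/ (exists c i s, boundary_chart Omega c i s p) ->
  exists c r, chart_dom c p /\ good_ball Omega c (chart_map c p) r.
Proof.
move=> oO [Op|[c [i [s [a pc p0 s2 hn]]]]].
  have a := chart_at_atlas S p; have pc := chart_at_dom S p.
  have oi := open_chart_image (hc a) oO.
  have [r r0 hr] := nbhs_oball (open_nbhs_nbhs (conj oi (chart_image_map pc Op))).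
  exists (chart_at S p), r; split=> //; split=> //; last by left.
  by move=> x /hr /(chart_imageP _ _ (hc a))[].
have [od oi _ _ _] := hc a.
move: hn; rewrite /prop_near1 nbhsE => -[V [oV Vp] VO].
have oiV := open_chart_image (hc a) oV.
have [r r0 hr] := nbhs_oball (open_nbhs_nbhs (conj oiV (chart_image_map pc Vp))).
have hr' x : oball (chart_map c p) (2 * r) x -> chart_image c setT x /\ V (chart_inv c x).
  by move=> /hr /(chart_imageP _ _ (hc a)).
exists c, r; split=> //; split=> //; first by move=> x /hr'[].
right; exists i, s; split=> //.
  move=> x /hr'[ix Vx]; have [e1 e2] := chart_image_dom (hc a) ix.
  by have := VO _ Vx e1; rewrite e2.
move=> x /hr'[ix Vx] x0; have [e1 e2] := chart_image_dom (hc a) ix.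
split=> //; first by rewrite e2.
by apply: filterS (open_nbhs_nbhs (conj oV Vx)) => q /VO.
Qed.

End BoundaryCharts.

(** * Divergence inequality on the domain, by a partition of unity *)

Section ManifoldDivergence.
Context {R : realType} {d : nat} {M : ptopologicalType}.
Context {S : smooth_structure R d M} (g : riemannian_metric S).
Context (vol : {measure set (borel M) -> \bar R}) (hvol : is_volume g vol).
Context (hM : hausdorff_space M) (Omega : set M) (oO : open Omega)
  (cO : compact (closure Omega)) (finO : (vol Omega < +oo)%E).
Implicit Types (c : chart R d M) (A : set M).

Let hc c : atlas S c -> is_chart c := @atlas_chart _ _ _ S c.
Let mO : measurable (Omega : set (borel M)) := borel_open oO.

Lemma Ck_measurable k A (h : M -> R) : open A -> Ck S k A h ->
  measurable_fun (A : set (borel M)) (h : borel M -> R).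
Proof.
move=> oA ch; apply: (@continuous_measurableR R M A h oA) => x Ax.
exact: Ck_continuous oA ch Ax.
Qed.

Context (Y : M -> 'rV[R]_d) (L : M -> R) (B : R).
Hypotheses (cY : C1_field Omega (S := S) Y)
  (bY : forall c p, atlas S c -> chart_dom c p -> closure Omega p ->
    exists B', \forall q \near p, Omega q -> forall i, `|vec_in S c q (Y q) 0 i| <= B')
  (sY : forall c i s p delta, boundary_chart (S := S) Omega c i s p -> 0 < delta ->
    \forall q \near p, Omega q -> - delta <= s * vec_in S c q (Y q) 0 i)
  (mL : measurable_fun (Omega : set (borel M)) (L : borel M -> R))
  (LB : forall p, Omega p -> `|L p| <= B)
  (LY : forall p, Omega p -> L p <= div g Y p).

Lemma inner_grad_field c p (h : M -> R) A : atlas S c -> open A -> Ck S 1 A h -> A p ->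
  chart_dom c p -> inner g p (grad g h p) (Y p) =
  \sum_l vec_in S c p (Y p) 0 l * partial l (h \o chart_inv c) (chart_map c p).
Proof. by move=> a oA ch Ap pc; exact: (inner_grad _ _ a oA ch Ap pc). Qed.

Section Piece.
Context (pi : M -> R) (V : set M) (c : chart R d M) (a : 'rV[R]_d) (r : R).
Hypotheses (oV : open V) (OV : closure Omega `<=` V) (cpi : Ck S 1 V pi)
  (pi01 : forall p, Omega p -> 0 <= pi p <= 1) (gb : good_ball (S := S) Omega c a r)
  (pi0 : forall p, Omega p -> ~ chart_ball c a r p -> pi p = 0).

(** A lower bound for the divergence of [pi Y]. In the sum over a partition of unity the gradient
    terms cancel and [L] remains. *)
Definition piece p : R := pi p * L p + inner g p (grad g pi p) (Y p).

Let ac : atlas S c. Proof. by case: gb. Qed.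
Let r0 : 0 < r. Proof. by case: gb. Qed.

Let sub : cball a r `<=` chart_image c setT.
Proof.
case: gb => _ _ h _ x xa; apply: h; apply: le_lt_trans xa _.
by rewrite mulr_natl mulr2n ltrDl.
Qed.

Let OsubV p : Omega p -> V p. Proof. by move=> /subset_closure /OV. Qed.

Lemma piece_off p : Omega p -> ~ chart_ball c a r p -> piece p = 0.
Proof.
move=> Op np; rewrite /piece pi0// mul0r add0r.
have a0 := chart_at_atlas S p; have p0 := chart_at_dom S p.
have oK : open (Omega `&` ~` chart_ball c a r).
  apply: openI => //; apply: closed_openC; apply: compact_closed => //.
  exact: compact_chart_ball ac sub.
rewrite (inner_grad_field a0 oV cpi (OsubV Op) p0) big1// => l _.
rewrite (@partial_open _ _ _ _ (fun=> 0) _ l (open_chart_image (hc a0) oK)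
  (chart_image_map p0 (conj Op np))) ?partialC ?mulr0//.
by move=> y /(chart_imageP _ _ (hc a0))[_ [Oy ny]] /=; exact: pi0.
Qed.

Lemma continuous_inner_grad p : Omega p ->
  {for p, continuous (fun p => inner g p (grad g pi p) (Y p))}.
Proof.
move=> Op; have a0 := chart_at_atlas S p; have p0 := chart_at_dom S p.
set c0 := chart_at S p in a0 p0; have [od _ _ _ _] := hc a0.
pose h q := \sum_l field_in S c0 Y (chart_map c0 q) 0 l *
  partial l (pi \o chart_inv c0) (chart_map c0 q).
have E q : chart_dom c0 q -> Omega q -> h q = inner g q (grad g pi q) (Y q).
  move=> qc Oq; rewrite (inner_grad_field a0 oV cpi (OsubV Oq) qc).
  by apply: eq_bigr => l _; rewrite /field_in (chart_mapK (hc a0) qc).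
have ch : {for p, continuous h}.
  pose H x := \sum_l field_in S c0 Y x 0 l * partial l (pi \o chart_inv c0) x.
  have oi := open_chart_image (hc a0) oO.
  have cH : Ck_on 0 (chart_image c0 Omega) H.
    apply: Ck_on_sum => // l _; apply: Ck_onM => //.
      exact: Ck_onW (leqnSn 0) (cY a0 l).
    apply: Ck_on_sub (Ck_on_partial l (cpi a0)) => x.
    move=> /(chart_imageP _ _ (hc a0))[ix Ox]; apply/(chart_imageP _ _ (hc a0)).
    by split=> //; exact: OsubV.
  have := Ck_on_continuous cH (chart_image_map p0 Op).
  by move=> k; exact: (continuous_comp (chart_map_continuous (hc a0) p0) k).
move: ch; rewrite /prop_for /continuous_at E// => ch.
apply: cvg_trans ch; apply: near_eq_cvg.
apply: filterS (filterI (open_nbhs_nbhs (conj od p0)) (open_nbhs_nbhs (conj oO Op))).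
by move=> q [qc Oq]; exact: E.
Qed.

Lemma measurable_piece : measurable_fun (Omega : set (borel M)) (piece : borel M -> R).
Proof.
apply: measurable_funD.
  apply: measurable_funM => //.
  apply: (@continuous_measurableR R M Omega pi oO) => p Op.
  exact: Ck_continuous oV cpi (OsubV Op).
apply: (@continuous_measurableR R M Omega (fun p => inner g p (grad g pi p) (Y p)) oO).
exact: continuous_inner_grad.
Qed.

Lemma piece_bounded : exists C, forall p, Omega p -> `|piece p| <= C.
Proof.
have [C1 hC1] : exists C, forall q, (chart_ball c a r `&` closure Omega) q -> Omega q ->
    `|inner g q (grad g pi q) (Y q)| <= C.
  apply: compact_local_bound.
    rewrite setIC; apply: compact_closedI => //; apply: compact_closed => //.
    exact: compact_chart_ball ac sub.
  move=> p [pb clp]; have [pc _] := chart_ball_dom ac sub pb.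
  have [od _ _ _ _] := hc ac.
  have [B' hB'] := bY ac pc clp.
  have hl l : \forall q \near p, `|partial l (pi \o chart_inv c) (chart_map c q)| <=
      `|partial l (pi \o chart_inv c) (chart_map c p)| + 1.
    have xi : chart_image c V (chart_map c p) by apply: chart_image_map => //; exact: OV.
    have cl := Ck_on_continuous (Ck_on_partial l (cpi ac)) xi.
    apply: (near_chart_map (P := fun x => `|partial l (pi \o chart_inv c) x| <=
      `|partial l (pi \o chart_inv c) (chart_map c p)| + 1) ac pc).
    have := @cvgr_norm_le _ _ _ _ _ _ _ cl; apply.
    by rewrite ltrDl.
  exists (\sum_(l < d) `|B'| * (`|partial l (pi \o chart_inv c) (chart_map c p)| + 1)).
  have hl' : \forall q \near p, forall l, `|partial l (pi \o chart_inv c) (chart_map c q)| <=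
      `|partial l (pi \o chart_inv c) (chart_map c p)| + 1.
    exact: filter_forall.
  apply: filterS (filterI (filterI hB' hl') (open_nbhs_nbhs (conj od pc))).
  move=> q [[h1 h2] qc] Oq.
  rewrite (inner_grad_field ac oV cpi (OsubV Oq) qc).
  apply: le_trans (ler_norm_sum _ _ _) _; apply: ler_sum => l _.
  rewrite normrM; apply: ler_pM => //; first exact: le_trans (h1 Oq l) (ler_norm _).
exists (`|B| + `|C1|) => p Op; have [pb|np] := pselect (chart_ball c a r p).
  apply: le_trans (ler_normD _ _) _; apply: lerD.
    rewrite normrM; have /andP[h1 h2] := pi01 Op; rewrite (ger0_norm h1).
    have := LB Op; have := ler_norm B; have := normr_ge0 (L p).
    by move: `|L p| `|B| => x y; nra.
  apply: le_trans (hC1 _ _ Op) (ler_norm _); split=> //; exact: subset_closure.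
by rewrite piece_off// normr0 addr_ge0.
Qed.

Lemma integrable_piece : vol.-integrable Omega (EFin \o piece).
Proof.
have [C hC] := piece_bounded.
exact: bounded_integrable mO finO measurable_piece hC.
Qed.

Let P x := pi (chart_inv c x).
Let W j x := P x * (density g c x * field_in S c Y x 0 j).
Let l x := piece (chart_inv c x) * density g c x.
Let K := cball a r.
Let U := oball a (2 * r).
Let Op : set 'rV[R]_d := chart_image c Omega `&` U.

Let OpO x : Op x -> chart_image c Omega x. Proof. by case. Qed.
Let oIm : open (chart_image c Omega). Proof. exact: open_chart_image (hc ac) oO. Qed.
Let oOp : open Op. Proof. by apply: openI => //; exact: open_oball. Qed.
Let Om x : chart_image c Omega x -> Omega (chart_inv c x).
Proof. by move=> /(chart_imageP _ _ (hc ac))[]. Qed.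
Let Im x : chart_image c Omega x -> chart_image c setT x.
Proof. by move=> /(chart_imageP _ _ (hc ac))[]. Qed.

Let KU : K `<=` U.
Proof. by move=> x xa; apply: le_lt_trans xa _; rewrite mulr_natl mulr2n ltrDl. Qed.

Let offK x : chart_image c Omega x -> ~ K x -> ~ chart_ball c a r (chart_inv c x).
Proof.
move=> xO nK /(chart_ball_dom ac sub)[_ h]; apply: nK.
by have [_ E] := chart_image_dom (hc ac) (Im xO); rewrite -E.
Qed.

Let cP : Ck_on 1 Op P.
Proof.
apply: Ck_on_sub (cpi ac) => x /OpO xO; apply/(chart_imageP _ _ (hc ac)).
by split; [exact: Im|exact/OsubV/Om].
Qed.

Let cQ j : Ck_on 1 Op (fun x => density g c x * field_in S c Y x 0 j).
Proof.
apply: (@Ck_on_sub _ _ _ (chart_image c Omega)); first by move=> x /OpO.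
apply: Ck_onM => //; last exact: cY.
exact: (@C1_density _ _ _ _ oIm (@smooth_gram _ _ _ _ g c _ ac)
  (fun x h => @posdef_gram_image _ _ _ _ g c _ x ac h)).
Qed.

Lemma piece_C1 j : Ck_on 1 Op (W j).
Proof. exact: Ck_onM oOp cP (cQ j). Qed.

Lemma piece_W0 j x : Op x -> ~ K x -> W j x = 0.
Proof.
move=> xO nK; rewrite /W /P pi0 ?mul0r//; first exact/Om/OpO.
by apply: offK => //; exact: OpO.
Qed.

Lemma piece_l0 x : chart_image c Omega x -> ~ K x -> l x = 0.
Proof. by move=> xO nK; rewrite /l piece_off ?mul0r//; [exact: Om|exact: offK]. Qed.

(** The density inside [W] turns the Riemannian divergence into the Euclidean one: the sum of the
    partial derivatives is the density times the divergence of [pi Y]. *)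
Lemma piece_le x : Op x -> l x <= \sum_j partial j (W j) x.
Proof.
move=> xO; have xI := OpO xO; have Ox := Om xI.
have [xc E] := chart_image_dom (hc ac) (Im xI).
have -> : \sum_j partial j (W j) x =
    \sum_j partial j P x * (density g c x * field_in S c Y x 0 j) +
    P x * \sum_j partial j (fun y => density g c y * field_in S c Y y 0 j) x.
  rewrite mulr_sumr -big_split; apply: eq_bigr => j _ /=.
  exact: (partialM (Ck_on_derivable cP xO) (Ck_on_derivable (cQ j) xO)).
have dx : 0 < density g c x := density_chart_gt0 g ac (Im xI).
have Ed : \sum_j partial j (fun y => density g c y * field_in S c Y y 0 j) x =
    density g c x * div g Y (chart_inv c x).
  rewrite (div_chart g ac oO cY Ox xc) E.
  by apply: (canRL (mulVKf _)); [exact: lt0r_neq0|].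
have Ei : \sum_j partial j P x * (density g c x * field_in S c Y x 0 j) =
    density g c x * inner g (chart_inv c x) (grad g pi (chart_inv c x)) (Y (chart_inv c x)).
  rewrite (inner_grad_field ac oV cpi (OsubV Ox) xc) E mulr_sumr.
  apply: eq_bigr => j _; rewrite /field_in.
  by rewrite mulrCA; congr (_ * _); rewrite mulrC.
rewrite Ed Ei /l /piece; have := LY Ox; have /andP[p0 _] := pi01 Ox.
move: (inner _ _ _ _) => t; rewrite -/(P x) in p0 *.
move: (div g Y _) (L _) (density g c x) dx (P x) p0 => v w u u0 p p0 wv.
have : p * w <= p * v by rewrite ler_wpM2l.
by nra.
Qed.

Lemma piece_normal i s (x : 'rV[R]_d) (delta : R) : s * s = 1 ->
  (x 0 i = 0 -> boundary_chart (S := S) Omega c i s (chart_inv c x)) ->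
  K x -> x 0 i = 0 -> 0 < delta -> \forall y \near x, Op y -> - delta <= s * W i y.
Proof.
move=> s2 hb Kx x0 d0; have b := hb x0; have ix := sub Kx.
have [xc E] := chart_image_dom (hc ac) ix.
(* Near [x] the factor in front of the normal component of [Y] is at most [D], so [sY] is used with
   [delta / D]. *)
pose D := density g c x + 1.
have D0 : 0 < D by rewrite ltr_wpDl// ltW//; exact: density_chart_gt0.
have h1 := near_chart_inv ac xc (sY b (divr_gt0 d0 D0)); rewrite E in h1.
have h2 : \forall y \near x, `|density g c y| <= D.
  have := @cvgr_norm_le _ _ _ _ _ _ _ (density_continuous (g := g) ac ix); apply.
  by rewrite /D gtr0_norm ?ltrDl//; exact: density_chart_gt0.
apply: filterS (filterI h1 h2) => y [k1 k2] yO; have yI := OpO yO.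
have := k1 (Om yI); have /andP[p0 p1] := pi01 (Om yI).
have dy : 0 < density g c y := density_chart_gt0 g ac (Im yI).
rewrite (gtr0_norm dy) in k2.
rewrite /W /P -/(field_in S c Y y) => k3.
have -> : s * (pi (chart_inv c y) * (density g c y * field_in S c Y y 0 i)) =
   (pi (chart_inv c y) * density g c y) * (s * field_in S c Y y 0 i) by ring.
move: k3; move: (s * field_in S c Y y 0 i) => w.
have q0 : 0 <= pi (chart_inv c y) * density g c y <= D.
  apply/andP; split; first by rewrite mulr_ge0// ltW.
  apply: le_trans k2; rewrite ler_piMl// ltW//.
move: q0; move: (_ * density g c y) => q /andP[q0 qD] k3.
have : q * (- (delta / D)) <= q * w by rewrite ler_wpM2l.
apply: le_trans; rewrite mulrN lerN2.
by rewrite mulrA ler_pdivrMr// mulrC ler_wpM2l// ltW.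
Qed.

Lemma integral_piece_le0 : (\int[vol]_(p in Omega) (piece p)%:E <= 0)%E.
Proof.
have mD : measurable (chart_dom c `&` Omega : set (borel M)).
  by apply: borel_open; apply: openI => //; have [] := hc ac.
have -> : (\int[vol]_(p in Omega) (piece p)%:E =
    \int[vol]_(p in chart_dom c `&` Omega) (piece p)%:E)%E.
  rewrite [RHS]integral_mkcondl [RHS]integral_mkcond [LHS]integral_mkcond.
  apply: eq_integral => p _; rewrite !patchE; case: ifPn => // /set_mem Oq.
  case: ifPn => // /negP nc; rewrite piece_off//.
  by move=> /(chart_ball_dom ac sub)[k _]; apply: nc; rewrite inE.
rewrite (integral_chart hvol ac oO); last first.
  exact: measurable_funS mO (@subIsetr _ _ _) measurable_piece.
have mOp : measurable (Op : set (borel 'rV[R]_d)) by exact: borel_open.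
have -> : (\int[lebesgue_rV d]_(x in chart_image c Omega)
      (piece (chart_inv c x) * density g c x)%:E = \int[lebesgue_rV d]_(x in Op) (l x)%:E)%E.
  rewrite /Op integral_mkcondr; apply: eq_integral => x /set_mem xI.
  rewrite patchE; case: ifPn => // /negP nU; rewrite -/(l x) piece_l0//.
  by move=> /KU h; apply: nU; rewrite inE.
have mi : measurable_fun (Op : set (borel 'rV[R]_d))
    (chart_inv c : borel 'rV[R]_d -> borel M).
  apply: (@continuous_borel 'rV[R]_d M Op (chart_inv c) oOp).
  by move=> x /OpO /Im ix; exact: chart_inv_continuous (hc ac) ix.
have ml : measurable_fun (Op : set (borel 'rV[R]_d)) (l : borel 'rV[R]_d -> R).
  apply: measurable_funM.
    apply: (@measurable_comp _ _ _ _ _ _ (Omega : set (borel M))) mi => //.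
      by move=> _ [x /OpO /Om Ox <-].
    exact: measurable_piece.
  apply: (@continuous_measurableR R 'rV[R]_d Op (density g c) oOp).
  by move=> x /OpO /Im ix; exact: density_continuous.
have [C0 hC0] := piece_bounded.
have [C1 C10 hC1] : exists2 C, 0 <= C & forall x, K x -> `|density g c x| <= C.
  apply: compact_continuous_bound; first exact: compact_cball.
  by move=> x /sub ix; exact: density_continuous.
have lB x : Op x -> `|l x| <= `|C0| * C1.
  move=> xO; have [Kx|nK] := pselect (K x); last first.
    by rewrite piece_l0 ?normr0 ?mulr_ge0//; exact: OpO.
  rewrite normrM ler_pM ?hC1//.
  by apply: le_trans (hC0 _ (Om (OpO xO))) (ler_norm _).
have [_ _ hU [hin|[i [s [s2 hs hb]]]]] := gb.
  have E : Op = U by apply/seteqP; split=> [x []//|x Ux]; split=> //; exact: hin.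
  have H := @divergence_le0_compact _ _ Op K W l oOp (@compact_cball _ _ a r).
  apply: H.
  - by rewrite E; exact: KU.
  - exact: piece_C1.
  - exact: piece_W0.
  - apply: (@integrable_bounded_support _ _ Op K l (`|C0| * C1) mOp _ ml lB).
      exact: compact_cball.
    by move=> x /OpO; exact: piece_l0.
  - exact: piece_le.
have E : Op = U `&` [set x | 0 < s * x 0 i].
  apply/seteqP; split=> x [].
    by move=> xI Ux; split=> //; apply/(hs x Ux); exact: Om.
  move=> Ux sx; split=> //; apply/(chart_imageP _ _ (hc ac)); split; first exact: hU.
  exact/(hs x Ux).
have H := @boundary_divergence_le0 _ _ U K i s (@open_oball _ _ _ _)
   (@compact_cball _ _ a r) KU s2 W l (`|C0| * C1).
rewrite -E in H; apply: H.
- exact: piece_C1.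
- exact: piece_W0.
- exact: ml.
- exact: lB.
- by move=> x /OpO; exact: piece_l0.
- exact: piece_le.
- by move=> x delta Kx; apply: (piece_normal s2 _ Kx); exact: (hb x (KU Kx)).
Qed.

End Piece.

Hypothesis hcov : forall p, closure Omega p ->
  Omega p \/ exists c i s, boundary_chart (S := S) Omega c i s p.

(** [Y] is C^1 inside only and its divergence may be unbounded. Sufficient are a bounded minorant
    [L] of the divergence, local bounds of [Y] up to the boundary and an asymptotic lower bound for
    its inner normal component. *)
Theorem divergence_le0 : (\int[vol]_(p in Omega) (L p)%:E <= 0)%E.
Proof.
have [F hF] : {F : M -> chart R d M * R & forall p, closure Omega p ->
    chart_dom (F p).1 p /\ good_ball (S := S) Omega (F p).1 (chart_map (F p).1 p) (F p).2}.
  apply: (@choice M (chart R d M * R)%type (fun p F => closure Omega p ->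
    chart_dom F.1 p /\ good_ball (S := S) Omega F.1 (chart_map F.1 p) F.2)) => p.
  have [clp|nclp] := pselect (closure Omega p); last by exists (chart_at S p, 0).
  by have [c [r [pc gb]]] := good_ball_exists oO (hcov clp); exists (c, r).
pose phi p := chart_bump (F p).1 (chart_map (F p).1 p) (F p).2.
have gball p : closure Omega p -> cball (chart_map (F p).1 p) (F p).2 `<=` chart_image (F p).1 setT.
  move=> /hF[_ [_ r0 h _]] x xa; apply: h; apply: le_lt_trans xa _.
  by rewrite mulr_natl mulr2n ltrDl.
have cphi p : closure Omega p -> Ck S 1 setT (phi p).
  move=> clp; have [_ [a r0 _ _]] := hF p clp.
  by apply: C1_chart_bump => //; exact: gball.
have phi0 p q : 0 <= phi p q by exact: chart_bump_ge0.
have phip p : closure Omega p -> 0 < phi p p.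
  move=> clp; have [pc [_ r0 _ _]] := hF p clp.
  by apply: chart_bump_gt0 => //; rewrite /oball /= subrr normr0.
have oset (h : M -> R) : Ck S 1 setT h -> open [set q | 0 < h q].
  move=> ch; rewrite (_ : [set q | _] = h @^-1` [set t | 0 < t])//.
  apply: open_comp; last exact: open_gt.
  by move=> q _; exact: (Ck_continuous openT ch I).
have [D DO cov] : finite_subset_cover (closure Omega) (fun p => [set q | 0 < phi p q])
    (closure Omega).
  move: cO; rewrite compact_cover; apply; first by move=> p clp; exact/oset/cphi.
  by move=> p clp; exists p => //; exact: phip.
have DO' p : p \in D -> closure Omega p by move=> /DO; rewrite inE.
pose s := finmap.enum_fset D.
pose psi q := \sum_(p <- s | p \in D) phi p q.
have cpsi : Ck S 1 setT psi.
  move=> c a; have oi := open_chart_image (hc a) (@openT M).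
  have -> : psi \o chart_inv c =
      fun x => \sum_(p <- s | p \in D) (phi p \o chart_inv c) x by [].
  by apply: Ck_on_sum => // p /DO' clp; exact: cphi.
(* An open neighbourhood of the closure on which division by the sum of the bumps is allowed; the
   functions of the partition are C^1 there, hence up to the boundary. *)
pose V := [set q | 0 < psi q].
have oV : open V by exact: oset.
have OV : closure Omega `<=` V.
  move=> q clq; have [p /= pD ppos] := cov q clq.
  rewrite /V /= lt_neqAle sumr_ge0// andbT eq_sym psumr_neq0//.
  by apply/hasP; exists p => //; rewrite pD.
pose pi p q := phi p q / psi q.
have cpi p : closure Omega p -> Ck S 1 V (pi p).
  move=> clp c a; have oi := open_chart_image (hc a) oV.
  have sub : chart_image c V `<=` chart_image c setT by move=> x [q [qc _] <-]; exists q.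
  apply: (@Ck_onM _ _ _ _ (phi p \o chart_inv c) (fun x => (psi (chart_inv c x))^-1)) => //.
    exact: Ck_on_sub sub (cphi p clp c a).
  apply: Ck_onV => //; last exact: Ck_on_sub sub (cpsi c a).
  by move=> x /(chart_imageP _ _ (hc a))[_ Vx]; exact: lt0r_neq0.
have sum1 q : V q -> \sum_(p <- s | p \in D) pi p q = 1.
  by move=> Vq; rewrite -mulr_suml mulfV// lt0r_neq0.
have pi01 p q : p \in D -> Omega q -> 0 <= pi p q <= 1.
  move=> pD Oq; have Vq : V q by exact/OV/subset_closure.
  have h0 : 0 <= pi p q by rewrite divr_ge0// ltW.
  rewrite h0 /= -(sum1 q Vq) (big_rem p)//= pD lerDl sumr_ge0// => p' _.
  by rewrite divr_ge0// ltW.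
have pi0 p q : p \in D -> Omega q ->
    ~ chart_ball (F p).1 (chart_map (F p).1 p) (F p).2 q -> pi p q = 0.
  move=> pD Oq nq; have [_ [a r0 _ _]] := hF p (DO' p pD).
  by rewrite /pi /phi (chart_bump_off a r0 nq) mul0r.
pose f p q := if p \in D then piece (pi p) q else 0.
have fi p : vol.-integrable Omega (EFin \o f p).
  have [pD|nD] := boolP (p \in D); last first.
    rewrite (_ : _ \o _ = cst 0%E); first exact: integrable0.
    by apply/funext => q; rewrite /= /f (negbTE nD).
  rewrite (_ : f p = piece (pi p)); last by apply/funext => q; rewrite /f pD.
  apply: (@integrable_piece (pi p) V _ _ _ oV OV (cpi p (DO' p pD)) _
    (hF p (DO' p pD)).2) => q Oq; [exact: pi01|exact: pi0].
have fle p : (\int[vol]_(q in Omega) (f p q)%:E <= 0)%E.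
  have [pD|nD] := boolP (p \in D); last first.
    by rewrite (@eq_integral _ _ _ _ _ (cst 0%E)) ?integral0// => q _; rewrite /f (negbTE nD).
  rewrite (_ : f p = piece (pi p)); last by apply/funext => q; rewrite /f pD.
  apply: (@integral_piece_le0 (pi p) V _ _ _ oV OV (cpi p (DO' p pD)) _
    (hF p (DO' p pD)).2) => q Oq; [exact: pi01|exact: pi0].
have E q : Omega q -> L q = \sum_(p <- s) f p q.
  move=> Oq; have Vq : V q by exact/OV/subset_closure.
  rewrite -big_mkcond /= big_split /= -mulr_suml sum1// mul1r.
  (* The gradient terms add up to the derivative of the sum of the [pi p], which is constantly 1 on
     [V]. *)
  rewrite [X in _ + X](_ : _ = 0) ?addr0//.
  have a0 := chart_at_atlas S q; have q0 := chart_at_dom S q.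
  transitivity (\sum_(p <- s | p \in D) \sum_l vec_in S (chart_at S q) q (Y q) 0 l *
      partial l (pi p \o chart_inv (chart_at S q)) (chart_map (chart_at S q) q)).
    by apply: eq_bigr => p pD; rewrite (inner_grad_field a0 oV (cpi p (DO' p pD)) Vq q0).
  rewrite exchange_big big1// => l _; rewrite -mulr_sumr.
  have oi := open_chart_image (hc a0) oV.
  have xi := chart_image_map q0 Vq.
  have -> : \sum_(p <- s | p \in D) partial l (pi p \o chart_inv (chart_at S q))
      (chart_map (chart_at S q) q) = 0; last by rewrite mulr0.
  have [<- _] := @partial_sum _ _ _ s (fun p => p \in D)
    (fun p => pi p \o chart_inv (chart_at S q)) _ l
    (fun p pD => Ck_on_derivable (i := l) (cpi p (DO' p pD) _ a0) xi).
  rewrite (@partial_open _ _ _ _ (fun=> 1) _ l oi xi) ?partialC//.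
  by move=> y /(chart_imageP _ _ (hc a0))[_ Vy]; exact: sum1.
have -> : (\int[vol]_(q in Omega) (L q)%:E =
    \int[vol]_(q in Omega) (\sum_(p <- s) (EFin \o f p) q))%E.
  by apply: eq_integral => q /set_mem Oq; rewrite E// sumEFin.
rewrite integral_sum//; apply: sume_le0 => p _; exact: fle.
Qed.

End ManifoldDivergence.

(** * Boundary of the domain *)

Section Tends.
Context {R : realType} {T : topologicalType}.
Implicit Types (A : set T) (x : T) (F G : T -> R).

(** Boundary values are limits from inside: the derivatives of [u] have no meaning at points of the
    boundary themselves. *)
Definition tends A x F (l : R) : Prop := F @ within A (nbhs x) --> l.

Lemma tendsP A x F l : tends A x F l <->
  forall e : R, 0 < e -> \forall y \near x, A y -> `|l - F y| <= e.
Proof.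
split=> [/cvgrPdist_le h e e0|h].
  by have := h e e0; rewrite near_withinE.
by apply/cvgrPdist_le => e e0; rewrite near_withinE; exact: h.
Qed.

Lemma tendsD A x F G a b : tends A x F a -> tends A x G b ->
  tends A x (fun y => F y + G y) (a + b).
Proof. exact: cvgD. Qed.

Lemma tendsM A x F G a b : tends A x F a -> tends A x G b ->
  tends A x (fun y => F y * G y) (a * b).
Proof. exact: cvgM. Qed.

Lemma tends_cst A x (c : R) : tends A x (fun=> c) c.
Proof. exact: cvg_cst. Qed.

Lemma tends_continuous A x F : {for x, continuous F} -> tends A x F (F x).
Proof. exact: cvg_within_filter. Qed.

Lemma tends_eq A x F G l : (forall y, A y -> F y = G y) -> tends A x F l -> tends A x G l.
Proof.
move=> E /tendsP h; apply/tendsP => e e0; apply: filterS (h e e0) => y hy Ay.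
by rewrite -E//; exact: hy.
Qed.

Lemma tends_sum (I : Type) (r : seq I) (P : pred I) A x (F : I -> T -> R) (a : I -> R) :
  (forall i, P i -> tends A x (F i) (a i)) ->
  tends A x (fun y => \sum_(i <- r | P i) F i y) (\sum_(i <- r | P i) a i).
Proof.
move=> h; elim: r => [|i r IH].
  rewrite big_nil; apply: (@tends_eq _ _ (fun=> 0)); last exact: tends_cst.
  by move=> y _; rewrite big_nil.
rewrite big_cons; case: ifPn => Pi; last first.
  by apply: (tends_eq _ IH) => y _; rewrite big_cons (negbTE Pi).
by apply: (tends_eq _ (tendsD (h i Pi) IH)) => y _; rewrite big_cons Pi.
Qed.

Lemma tends_bounded A x F l : tends A x F l ->
  \forall y \near x, A y -> `|F y| <= `|l| + 1.
Proof.
move=> /tendsP /(_ 1 ltr01); apply: filterS => y h Ay.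
have := h Ay; have := ler_normB l (l - F y); rewrite opprB addrC subrK.
by move: `|F y| `|l| `|l - F y| => a b c; lra.
Qed.

Lemma tends_comp {T' : topologicalType} (A : set T) (A' : set T') (t : T -> T') x (H : T' -> R) l :
  {for x, continuous t} -> (\forall y \near x, A y -> A' (t y)) ->
  H @ within A' (nbhs (t x)) --> (l : R) -> tends A x (H \o t) l.
Proof.
move=> ct tA /cvgrPdist_le h; apply/tendsP => e e0.
have := h e e0; rewrite near_withinE => h'.
have := ct _ h'; rewrite /nbhs /= => h''.
by apply: filterS (filterI tA h'') => y /= [k1 k2] Ay; exact: k2 (k1 Ay).
Qed.

Lemma tends_unique A x F a b : ~ (\forall y \near x, ~ A y) -> tends A x F a ->
  tends A x F b -> a = b.
Proof.
move=> nA /tendsP ha /tendsP hb; apply: contrapT => /eqP ab.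
have e0 : 0 < `|a - b| / 4 by rewrite divr_gt0// normr_gt0 subr_eq0.
apply: nA; apply: filterS (filterI (ha _ e0) (hb _ e0)) => y [h1 h2] Ay.
have := h1 Ay; have := h2 Ay.
have : `|a - b| <= `|a - F y| + `|b - F y|.
  by have := ler_normD (a - F y) (F y - b); rewrite addrA subrK [ `|F y - b|]distrC.
move: e0; move: `|a - b| `|a - F y| `|b - F y| => p q r; lra.
Qed.

End Tends.

Section EuclideanBoundary.
Context {R : realType} {n : nat}.
Implicit Types (U V A : set 'rV[R]_n) (x y : 'rV[R]_n).

(** The segment is connected and covered by two disjoint open sets, so it stays in the one where it
    starts. *)
Lemma segment_same_side U V x y : open U -> open V -> (forall z, U z -> ~ V z) ->
  (forall t : R, 0 <= t <= 1 -> U (t *: (y - x) + x) \/ V (t *: (y - x) + x)) ->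
  U x -> U y.
Proof.
move=> oU oV UV cov Ux.
pose f (t : R) := t *: (y - x) + x.
have cf : continuous f.
  by move=> t; apply: cvgD; [apply: cvgZr_tmp; exact: cvg_id|exact: cvg_cst].
have cn : connected `[0, 1 : R] by exact: segment_connected.
have B0 : (`[0, 1] `&` f @^-1` U) 0.
  by split; rewrite /= ?in_itv/= ?lexx ?ler01// /f scale0r add0r.
have E := cn (`[0, 1] `&` f @^-1` U) (ex_intro _ _ B0).
have : (`[0, 1 : R] `&` f @^-1` U) 1; last first.
  by move=> [_]; rewrite /= /f scale1r subrK.
rewrite E.
- by rewrite /= in_itv/= lexx ler01.
- by exists (f @^-1` U) => //; apply: open_comp => // t _; exact: cf.
- exists (~` (f @^-1` V)).
    by apply: open_closedC; apply: open_comp => // t _; exact: cf.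
  apply/seteqP; split=> t [ti h]; split=> //; first exact: UV.
  by case: (cov t _) => //; move: ti; rewrite /= in_itv.
Qed.

Lemma derive_line0 (F : 'rV[R]_n -> R) x v : derivable F x v ->
  (\forall h \near (0 : R), F (h *: v + x) = 0) -> 'D_v F x = 0.
Proof.
move=> dF h0.
have d0 : derivable F ((0 : R) *: v + x) v by rewrite scale0r add0r.
have d1 := is_derive_line d0.
have d2 : is_derive (0 : R) (1 : R) (cst 0 : R -> R) ('D_v F (0 *: v + x)).
  by apply: near_eq_is_derive d1 => //; exact: h0.
have [_ ] := d2; rewrite derive_cst => E.
by rewrite E scale0r add0r.
Qed.

Lemma derive_line_ge0 (F : 'rV[R]_n -> R) x v : derivable F x v -> F x = 0 ->
  (\forall h \near (0 : R)^'+, 0 <= F (h *: v + x)) -> 0 <= 'D_v F x.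
Proof.
move=> dF Fx h0.
have c : (fun h => h^-1 *: (F (h *: v + x) - F x)) @ (0 : R)^'+ --> 'D_v F x.
  exact: (cvg_dnbhs_at_right dF).
rewrite -(cvg_lim _ c)//; apply: limr_ge; first by apply/cvg_ex; eexists; exact: c.
near=> h.
have hp : 0 < h by near: h; exact: nbhs_right_gt.
rewrite Fx subr0; apply: mulr_ge0; first by rewrite invr_ge0 ltW.
by near: h.
Unshelve. all: by end_near.
Qed.

(* Both points [x0 + eta s e_i] and [x0 + t e_l + eta s e_i] approach the face
   [x_i = 0], where F vanishes, so the mean value theorem on the segment joining them
   bounds the limit of the tangential derivative. *)
Lemma tangential_derivative_lim A (F : 'rV[R]_n -> R) (x0 : 'rV[R]_n) i l (s r w : R) :
  s * s = 1 -> 0 < r -> l != i -> x0 0 i = 0 ->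
  (forall y, `|y - x0| < r -> (A y <-> 0 < s * y 0 i)) ->
  (forall y, A y -> derivable F y (delta_mx 0 l)) ->
  tends A x0 (partial l F) w ->
  (forall y, `|y - x0| < r -> y 0 i = 0 -> tends A y F 0) -> w = 0.
Proof.
move=> s2 r0 li x0i hA dF /tendsP hw hF.
apply: contrapT => /eqP w0.
have e0 : 0 < `|w| / 4 by rewrite divr_gt0// normr_gt0.
have /nbhs_ballP[r1 /= r10 hr1] := hw _ e0.
pose t := Num.min r r1 / 4.
have t0 : 0 < t by rewrite divr_gt0// lt_min r0.
have tr : 4 * t <= r by rewrite /t mulrC divfK// ge_min lexx.
have tr1 : 4 * t <= r1 by rewrite /t mulrC divfK// ge_min lexx orbT.
have s1 : `|s| = 1.
  have : `|s| ^+ 2 = 1 by rewrite -normrX expr2 s2 normr1.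
  have := normr_ge0 s; move: `|s| => a a0 aa; nra.
pose y0 := t *: delta_mx 0 l + x0.
have nd j : `|delta_mx 0 j : 'rV[R]_n| <= 1.
  by apply/rV_norm_leP => // k; rewrite !mxE; case: (k == j); rewrite /= ?normr1 ?normr0.
have y0i : y0 0 i = 0.
  by rewrite !mxE eqxx /= eq_sym (negbTE li) mulr0 add0r.
have y0r : `|y0 - x0| < r.
  rewrite addrK normrZ gtr0_norm//.
  apply: le_lt_trans (_ : t * 1 < r); first by rewrite ler_pM2l.
  by rewrite mulr1; lra.
(* Two endpoint values of this size bound the derivative at the intermediate point by |w|/4, while
   continuity keeps that derivative within |w|/4 of [w]; together this contradicts w <> 0. *)
have d0 : 0 < t * (`|w| / 8) by rewrite mulr_gt0// divr_gt0// normr_gt0.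
have x0r : `|x0 - x0| < r by rewrite subrr normr0.
have /tendsP/(_ _ d0)/nbhs_ballP[a1 /= a10 h1] := hF x0 x0r x0i.
have /tendsP/(_ _ d0)/nbhs_ballP[a2 /= a20 h2] := hF y0 y0r y0i.
pose eta := Num.min (Num.min a1 a2) t / 2.
have eta0 : 0 < eta by rewrite divr_gt0// !lt_min a10 a20.
have e2 : 2 * eta <= Num.min (Num.min a1 a2) t by rewrite /eta mulrC divfK.
have ea1 : eta < a1.
  have : Num.min (Num.min a1 a2) t <= a1 by rewrite !ge_min lexx.
  by lra.
have ea2 : eta < a2.
  have : Num.min (Num.min a1 a2) t <= a2 by rewrite !ge_min lexx orbT.
  by lra.
have et : eta < t.
  have : Num.min (Num.min a1 a2) t <= t by rewrite !ge_min lexx orbT.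
  by lra.
pose z := (eta * s) *: delta_mx 0 i : 'rV[R]_n.
have nz : `|z| <= eta.
  rewrite normrZ normrM s1 mulr1 (gtr0_norm eta0).
  by rewrite -[leRHS]mulr1 ler_pM2l.
have Az y : y 0 i = 0 -> `|y - x0| < 2 * t -> A (z + y).
  move=> yi yr; apply/hA.
    rewrite -addrA; apply: le_lt_trans (ler_normD _ _) _.
    by move: nz yr; move: `|z| `|y - x0| => p q; lra.
  rewrite !mxE eqxx eqxx mulr1 yi addr0.
  have -> : s * (eta * s) = eta * (s * s) by ring.
  by rewrite s2 mulr1.
have l1 c : 0 <= c <= t -> `|c *: delta_mx 0 l + x0 - x0| <= t.
  move=> /andP[c0 ct]; rewrite addrK normrZ ger0_norm//.
  by rewrite -[leRHS]mulr1 ler_pM.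
have l2 c : (c *: delta_mx 0 l + x0) 0 i = 0.
  by rewrite !mxE eqxx /= eq_sym (negbTE li) mulr0 add0r.
have Al c : 0 <= c <= t -> A (c *: delta_mx 0 l + (z + x0)).
  move=> ct; rewrite addrCA; apply: Az => //.
  by apply: le_lt_trans (l1 c ct) _; lra.
have [c /[dup] ct /andP[c0 ct'] E] := @line_MVT R _ F (z + x0) (delta_mx 0 l) t (ltW t0)
  (fun c ct => dF _ (Al c ct)).
have b1 : `|F (z + x0)| <= t * (`|w| / 8).
  have := h1 (z + x0); rewrite mx_norm_ball /ball_ /= opprD addrCA subrr addr0 normrN.
  rewrite sub0r normrN; apply; first exact: le_lt_trans nz ea1.
  by have := Al 0; rewrite scale0r add0r; apply; rewrite lexx ltW.
have b2 : `|F (t *: delta_mx 0 l + (z + x0))| <= t * (`|w| / 8).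
  have := h2 (t *: delta_mx 0 l + (z + x0)).
  rewrite mx_norm_ball /ball_ /=.
  have -> : y0 - (t *: delta_mx 0 l + (z + x0)) = - z.
    by rewrite /y0 [X in _ - X]addrCA opprD addrCA subrr addr0.
  rewrite normrN sub0r normrN; apply; first exact: le_lt_trans nz ea2.
  by apply: Al; rewrite lexx ltW.
have b3 : `|w - partial l F (c *: delta_mx 0 l + (z + x0))| <= `|w| / 4.
  apply: hr1; last exact: Al.
  rewrite mx_norm_ball /ball_ /= distrC.
  have -> : c *: delta_mx 0 l + (z + x0) - x0 = z + (c *: delta_mx 0 l + x0 - x0).
    by apply/rowP => j; rewrite !mxE; ring.
  apply: le_lt_trans (ler_normD _ _) _.
  have := l1 c ct; move: nz; move: `|z| `|_ - x0| => p q; lra.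
have b4 : t * `|partial l F (c *: delta_mx 0 l + (z + x0))| <= t * (`|w| / 4).
  rewrite -{1}(gtr0_norm t0) -normrM /partial -E.
  apply: le_trans (ler_normB _ _) _.
  have -> : t * (`|w| / 4) = t * (`|w| / 8) + t * (`|w| / 8) by field.
  exact: lerD.
rewrite ler_pM2l// in b4.
have : 0 < `|w| by rewrite normr_gt0.
have : `|w| <= `|w - partial l F (c *: delta_mx 0 l + (z + x0))| +
   `|partial l F (c *: delta_mx 0 l + (z + x0))|.
  by rewrite -{1}(subrK (partial l F (c *: delta_mx 0 l + (z + x0))) w) ler_normD.
move: b3 b4; move: `|w| `|_ - _| `|partial _ _ _| => p q k; lra.
Qed.

End EuclideanBoundary.

Section BoundaryGeometry.
Context {R : realType} {d : nat} {M : topologicalType}.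
Context {S : smooth_structure R d M} (g : riemannian_metric S).
Context (Omega : set M) (oO : open Omega).
Implicit Types (c : chart R d M) (A : set M).

Let hc c : atlas S c -> is_chart c := @atlas_chart _ _ _ S c.

Lemma boundaryE p : boundary Omega p <-> closure Omega p /\ ~ Omega p.
Proof.
split=> -[h1 h2]; split=> // h; apply: h2; last exact: interior_subset.
exact: (open_nbhs_nbhs (conj oO h)).
Qed.

Lemma closure_cases p : closure Omega p -> Omega p \/ boundary Omega p.
Proof.
by move=> clp; have [Op|nOp] := pselect (Omega p); [left|right; apply/boundaryE].
Qed.

Lemma open_exterior : open (~` closure Omega).
Proof. by apply: closed_openC; exact: closed_closure. Qed.

Lemma near_closureP p : closure Omega p <-> ~ (\forall q \near p, ~ Omega q).
Proof.
split=> [clp h|h V nV].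
  by have [q [Oq nOq]] := clp _ h.
apply: contrapT => nq; apply: h; apply: filterS nV => q Vq Oq.
by apply: nq; exists q.
Qed.

(** A boundary chart at [p] is one at all nearby points of the face. This permits limits at
    neighbouring boundary points, as needed for tangential derivatives. *)
Lemma boundary_chart_near c i s p : boundary_chart (S := S) Omega c i s p ->
  exists2 r : R, 0 < r & forall x, oball (chart_map c p) r x ->
    [/\ chart_image c setT x, Omega (chart_inv c x) <-> 0 < s * x 0 i,
        boundary Omega (chart_inv c x) <-> x 0 i = 0 &
        x 0 i = 0 -> boundary_chart (S := S) Omega c i s (chart_inv c x)].
Proof.
move=> [a pc p0 s2 hn]; have [od oi _ _ _] := hc a.
move: hn; rewrite /prop_near1 nbhsE => -[V [oV Vp] VO].
have oiV := open_chart_image (hc a) oV.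
have /nbhs_ballP[r /= r0 hr] := open_nbhs_nbhs (conj oiV (chart_image_map pc Vp)).
have hr' x : oball (chart_map c p) r x -> chart_image c setT x /\ V (chart_inv c x).
  move=> xr; apply/(chart_imageP _ _ (hc a)); apply: hr.
  by rewrite mx_norm_ball /ball_ /= distrC.
have ns : s != 0 by apply/eqP => s0; move: s2; rewrite s0 mul0r => /esym/eqP; rewrite oner_eq0.
exists r => // x xr; have [ix Vx] := hr' x xr; have [xc E] := chart_image_dom (hc a) ix.
have hO : Omega (chart_inv c x) <-> 0 < s * x 0 i by have := VO _ Vx xc; rewrite E.
have cX : {for x, continuous (fun y : 'rV[R]_d => s * y 0 i)}.
  have := @Ck_onZ _ _ 0 setT s _ openT (@Ck_on_coord _ _ 0 setT i).
  by move/Ck_on_continuous; exact.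
have oB : nbhs x (oball (chart_map c p) r).
  exact: (open_nbhs_nbhs (conj (@open_oball _ _ _ _) xr)).
split=> //.
- split=> [/boundaryE[clx nOx]|x0].
    have sx : s * x 0 i <= 0 by rewrite leNgt; apply/negP => /hO.
    apply: contrapT => /eqP x0.
    have sx' : s * x 0 i < 0 by rewrite lt_neqAle sx mulf_neq0.
    move: clx; rewrite near_closureP; apply.
    have h1 : nbhs x (fun y : 'rV[R]_d => s * y 0 i < 0).
      exact: (cX _ (open_nbhs_nbhs (conj (@open_lt _ 0) sx'))).
    have h2 : nbhs x (fun y : 'rV[R]_d => 0 < s * y 0 i -> False).
      by apply: filterS h1 => y h /(lt_trans h); rewrite ltxx.
    have oVx : nbhs (chart_inv c x) (V `&` chart_dom c).
      exact: (open_nbhs_nbhs (conj (openI oV od) (conj Vx xc))).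
    have h3 : \forall q \near chart_inv c x, 0 < s * chart_map c q 0 i -> False.
      apply: (near_chart_map (P := fun y : 'rV[R]_d => 0 < s * y 0 i -> False) a xc).
      by rewrite E.
    by apply: filterS (filterI oVx h3) => q [[Vq qc] h] Oq; apply/h/(VO q Vq qc).
  apply/boundaryE; split; last by move=> /hO; rewrite x0 mulr0 ltxx.
  apply/near_closureP => h.
  have h1 := near_chart_inv (P := fun q => ~ Omega q) a xc h; rewrite E in h1.
  have /nbhs_ballP[e /= e0 he] : nbhs x (fun y => ~ Omega (chart_inv c y) /\
      oball (chart_map c p) r y) by exact: filterI.
  pose y := (e / 2 * s) *: delta_mx 0 i + x.
  have [] : ~ Omega (chart_inv c y) /\ oball (chart_map c p) r y.
    apply: he; rewrite mx_norm_ball /ball_ /= distrC addrK normrZ.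
    have s1 : `|s| = 1.
      have : `|s| ^+ 2 = 1 by rewrite -normrX expr2 s2 normr1.
      have := normr_ge0 s; move: `|s| => b b0 bb; nra.
    rewrite normrM s1 mulr1 gtr0_norm ?divr_gt0//.
    have nd : `|delta_mx 0 i : 'rV[R]_d| <= 1.
      by apply/rV_norm_leP => // k; rewrite !mxE; case: (k == i); rewrite /= ?normr1 ?normr0.
    apply: le_lt_trans (_ : e / 2 * 1 < e); first by rewrite ler_pM2l ?divr_gt0.
    by rewrite mulr1 ltr_pdivrMr// mulr_natr mulr2n ltrDl.
  move=> nO yr; apply: nO; have [iy Vy] := hr' y yr.
  have [yc Ey] := chart_image_dom (hc a) iy; apply/(VO _ Vy yc); rewrite Ey.
  rewrite !mxE !eqxx mulr1 x0 addr0.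
  have -> : s * (e / 2 * s) = e / 2 * (s * s) by ring.
  by rewrite s2 mulr1 divr_gt0.
- move=> x0; split=> //; first by rewrite E.
  by apply: filterS (open_nbhs_nbhs (conj oV Vx)) => q /VO.
Qed.

(** [tangent_to] quantifies over all slice charts. The transition to another one maps the face into
    its face, so along lines inside the face the relevant coordinate is constantly 0 and its
    derivative vanishes. *)
Lemma tangent_boundary_chart c i s p v : boundary_chart (S := S) Omega c i s p ->
  vec_in S c p v 0 i = 0 -> tangent_to (S := S) (boundary Omega) p v.
Proof.
move=> b vi c' i' [a' sl] pc'; have [a pc p0 s2 _] := b.
have [r r0 hr] := boundary_chart_near b.
have xo := overlap_map pc pc' (I : setT p).
have oo := open_overlap a a' (@openT M).
have st j : Ck_on 1 (overlap c c' setT) (fun y => transition c c' y 0 j).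
  exact: (smooth_transition _ a a').
rewrite (vec_inE v a a' pc pc') mxE big1// => l _.
have [->|li] := eqVneq l i; first by rewrite vi mul0r.
rewrite (jacobian_partial oo xo st) /partial derive_line0 ?mulr0//.
  exact: (Ck_on_derivable (st i') xo).
have ob : nbhs (chart_map c p) (fun y => oball (chart_map c p) r y /\ overlap c c' setT y).
  apply: filterI; last exact: (open_nbhs_nbhs (conj oo xo)).
  apply: (open_nbhs_nbhs (conj (@open_oball _ _ _ _) _)).
  by rewrite /oball /= subrr normr0.
have cl : {for (0 : R), continuous (fun h : R => h *: delta_mx 0 l + chart_map c p)}.
  by apply: cvgD; [apply: cvgZr_tmp; exact: cvg_id|exact: cvg_cst].
have := cl; rewrite /prop_for /continuous_at scale0r add0r => /(_ _ ob) h.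
have {}h : \forall h \near (0 : R), oball (chart_map c p) r (h *: delta_mx 0 l + chart_map c p) /\
  overlap c c' setT (h *: delta_mx 0 l + chart_map c p) by exact: h.
apply: filterS h => h [h1 h2].
have [_ _ [_ hb] _] := hr _ h1.
have /hb bq : (h *: delta_mx 0 l + chart_map c p) 0 i = 0.
  by rewrite !mxE eqxx /= eq_sym (negbTE li) mulr0 add0r.
have [_ d' _] := (overlapP _ _ _ a).1 h2.
by rewrite /transition /=; exact/(sl _ d').
Qed.

Section Normal.
Context (nu : M -> 'rV[R]_d) (hnu : outward_unit_normal g Omega nu).

Lemma boundary_chart_boundary c i s p : boundary_chart (S := S) Omega c i s p ->
  boundary Omega p.
Proof.
move=> b; have [a pc p0 _ _] := b; have [r r0 hr] := boundary_chart_near b.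
have [] := hr (chart_map c p); first by rewrite /oball /= subrr normr0.
by move=> _ _ [_ +] _; rewrite (chart_mapK (hc a) pc); apply.
Qed.

(** Let [e] be the vector whose components in [c] are those of the i-th basis vector. Subtracting
    from [v] its i-th component times [e] leaves a tangent vector, which the normal annihilates. *)
Lemma normal_conormal c i s p : boundary_chart (S := S) Omega c i s p ->
  exists2 lam : R, s * lam < 0 &
    forall v, inner g p (nu p) v = lam * vec_in S c p v 0 i.
Proof.
move=> b; have [a pc p0 s2 _] := b; have bp := boundary_chart_boundary b.
have [n1 ntan nside] := hnu bp.
have [r r0 hr] := boundary_chart_near b.
pose e : 'rV[R]_d := delta_mx 0 i *m jacobian (transition c (chart_at S p)) (chart_map c p).
have Ee : vec_in S c p e = delta_mx 0 i by exact: vec_in_surj.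
pose lam := inner g p (nu p) e.
have H v : inner g p (nu p) v = lam * vec_in S c p v 0 i.
  have t : tangent_to (S := S) (boundary Omega) p (v + (- vec_in S c p v 0 i) *: e).
    apply: (tangent_boundary_chart b).
    by rewrite vec_inD vec_inZ Ee !mxE !eqxx mulr1 subrr.
  have := ntan _ t; rewrite inner_sym innerDl innerZl inner_sym.
  rewrite [inner g p e _]inner_sym -/lam mulNr => /eqP.
  by rewrite subr_eq0 => /eqP ->; rewrite mulrC.
exists lam => //.
set w := vec_in S c p (nu p) 0 i.
have lw : lam * w = 1 by rewrite -H.
have a0 := chart_at_atlas S p; have pc0 := chart_at_dom S p.
set c0 := chart_at S p in a0 pc0 nside *.
have xo := overlap_map pc0 pc (I : setT p).
have oo := open_overlap a0 a (@openT M).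
have st j : Ck_on 1 (overlap c0 c setT) (fun y => transition c0 c y 0 j).
  exact: (smooth_transition _ a0 a).
(* The number - s w is the derivative of s x_i along [- nu p]. It is non-negative because short
   steps in that direction enter the domain; with [lw] the sign of [lam] becomes strict. *)
have sw : s * w <= 0.
  pose F y := s * transition c0 c y 0 i.
  have cF : Ck_on 1 (overlap c0 c setT) F by exact: Ck_onZ.
  have dF : differentiable F (chart_map c0 p) by have [] := @C1_on_diff R d _ F _ oo xo cF.
  have := @derive_line_ge0 R d F (chart_map c0 p) (- nu p) (diff_derivable dF).
  have -> : F (chart_map c0 p) = 0.
    by rewrite /F (transition_map c a0 pc0) p0 mulr0.
  move=> /(_ erefl); have -> : 'D_(- nu p) F (chart_map c0 p) = - (s * w).
    rewrite (C1_on_derive _ oo xo cF) /w /vec_in mxE mulr_sumr -sumrN.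
    apply: eq_bigr => l _; rewrite (jacobian_partial oo xo st) !mxE.
    have [_ E] := @Ck_onS R d 0 (overlap c0 c setT) (fun y => transition c0 c y 0 i).
    have -> : partial l F (chart_map c0 p) =
        s * partial l (fun y => transition c0 c y 0 i) (chart_map c0 p).
      exact: (@deriveZ _ _ _ _ s _ _ (Ck_on_derivable (st i) xo)).
    by ring.
  rewrite oppr_ge0; apply.
  have cl : (fun h : R => h *: (- nu p) + chart_map c0 p) @ (0 : R)^'+ --> chart_map c0 p.
    apply: cvg_at_right_filter.
    have : (fun h : R => h *: (- nu p) + chart_map c0 p) @ (0 : R) -->
        (0 : R) *: (- nu p) + chart_map c0 p.
      by apply: cvgD; [apply: cvgZr_tmp; exact: cvg_id|exact: cvg_cst].
    by rewrite scale0r add0r.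
  have cT : {for chart_map c0 p, continuous (transition c0 c)}.
    apply: differentiable_continuous; apply: (C1_on_diff_map oo xo) => j; exact: st.
  have nb : nbhs (transition c0 c (chart_map c0 p)) (oball (chart_map c p) r).
    rewrite (transition_map c a0 pc0); apply: (open_nbhs_nbhs (conj (@open_oball _ _ _ _) _)).
    by rewrite /oball /= subrr normr0.
  have nI : nbhs (chart_map c0 p) (fun y => oball (chart_map c p) r (transition c0 c y) /\
      overlap c0 c setT y).
    by apply: filterI; [exact: (cT _ nb)|exact: (open_nbhs_nbhs (conj oo xo))].
  have ev := cl _ nI.
  have ev' : \forall h \near (0 : R)^'+, oball (chart_map c p) r
     (transition c0 c (h *: (- nu p) + chart_map c0 p)) /\
     overlap c0 c setT (h *: (- nu p) + chart_map c0 p) by exact: ev.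
  apply: filterS (filterI nside ev') => h [[h1 _] [h2 h3]].
  have [_ hO _ _] := hr _ h2.
  move: h1; rewrite scalerN addrC in h2 h3 hO *; rewrite -(transition_inv a0 a h3) => h1.
  by apply: ltW; rewrite /F; apply/hO.
have : s * w * (s * lam) = 1.
  have -> : s * w * (s * lam) = (s * s) * (lam * w) by ring.
  by rewrite s2 lw mulr1.
by move: sw; move: (s * w) (s * lam) => x y x0 xy; nra.
Qed.

(** In a slice chart each half of a small ball lies entirely in the domain or entirely in its
    exterior. The outward normal shows that both alternatives occur, so one half belongs to each. *)
Lemma boundary_chart_exists p : embedded_hypersurface (S := S) (boundary Omega) ->
  boundary Omega p -> exists c i s, boundary_chart (S := S) Omega c i s p.
Proof.
move=> he bp; have [c [i [[a sl] pc]]] := he p bp.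
have [n1 ntan nside] := hnu bp.
have [od oi _ _ _] := hc a.
have /nbhs_ballP[r /= r0 hr] := open_nbhs_nbhs (conj oi (chart_image_map pc I)).
have hr' x : oball (chart_map c p) r x -> chart_image c setT x.
  by move=> xr; apply: hr; rewrite mx_norm_ball /ball_ /= distrC.
have p0 : chart_map c p 0 i = 0 by apply/(sl p pc).
have o1 := open_chart_image (hc a) oO; have o2 := open_chart_image (hc a) open_exterior.
have dis x : chart_image c Omega x -> ~ chart_image c (~` closure Omega) x.
  move=> /(chart_imageP _ _ (hc a))[_ Ox] /(chart_imageP _ _ (hc a))[_]; apply.
  exact: subset_closure.
have cov x : oball (chart_map c p) r x -> x 0 i != 0 ->
    chart_image c Omega x \/ chart_image c (~` closure Omega) x.
  move=> /hr' ix x0; have [xc E] := chart_image_dom (hc a) ix.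
  have [clx|nclx] := pselect (closure Omega (chart_inv c x)); last first.
    by right; apply/(chart_imageP _ _ (hc a)).
  case: (closure_cases clx) => [Ox|bx]; first by left; apply/(chart_imageP _ _ (hc a)).
  by move/(sl _ xc): bx; rewrite E => x1; rewrite x1 eqxx in x0.
(* A half ball is convex and free of boundary points, so the segment between two of its points
   satisfies the hypotheses of [segment_same_side]. *)
have same (sg : R) x y : oball (chart_map c p) r x -> oball (chart_map c p) r y ->
    0 < sg * x 0 i -> 0 < sg * y 0 i ->
    (chart_image c Omega x -> chart_image c Omega y) /\
    (chart_image c (~` closure Omega) x -> chart_image c (~` closure Omega) y).
  move=> xr yr xs ys.
  have seg (t : R) : 0 <= t <= 1 -> chart_image c Omega (t *: (y - x) + x) \/
      chart_image c (~` closure Omega) (t *: (y - x) + x).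
    move=> /andP[t0 t1]; apply: cov.
      rewrite /oball /=.
      have -> : t *: (y - x) + x - chart_map c p =
         t *: (y - chart_map c p) + (1 - t) *: (x - chart_map c p).
        by apply/rowP => j; rewrite !mxE; ring.
      apply: le_lt_trans (ler_normD _ _) _; rewrite !normrZ ger0_norm// ger0_norm ?subr_ge0//.
      move: xr yr; rewrite /oball /=; move: `|x - _| `|y - _| => b e br er.
      have [->|tn] := eqVneq t 0; first by rewrite mul0r add0r subr0 mul1r.
      have : t * e < t * r by rewrite ltr_pM2l// lt_neqAle eq_sym tn.
      have : (1 - t) * b <= (1 - t) * r by rewrite ler_wpM2l ?subr_ge0// ltW.
      by lra.
    have : 0 < sg * (t *: (y - x) + x) 0 i.
      rewrite !mxE; have [->|tn] := eqVneq t 0; first by rewrite mul0r add0r.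
      have : 0 < t * (sg * y 0 i) by rewrite mulr_gt0// lt_neqAle eq_sym tn.
      have : 0 <= (1 - t) * (sg * x 0 i) by rewrite mulr_ge0 ?subr_ge0// ltW.
      by move: (x 0 i) (y 0 i) => b e; lra.
    by move=> h; apply/eqP => h0; move: h; rewrite h0 mulr0 ltxx.
  split=> [h|h].
    exact: (segment_same_side o1 o2 dis seg h).
  apply: (segment_same_side o2 o1 (fun z h1 h2 => dis z h2 h1) _ h) => t /seg[]; [by right|by left].
have a0 := chart_at_atlas S p; have pc0 := chart_at_dom S p.
set c0 := chart_at S p in a0 pc0 nside.
have xo := overlap_map pc0 pc (I : setT p).
have oo := open_overlap a0 a (@openT M).
have cT : {for chart_map c0 p, continuous (transition c0 c)}.
  by apply: differentiable_continuous; apply: (C1_on_diff_map oo xo) => j;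
    exact: (smooth_transition _ a0 a).
have nb : nbhs (transition c0 c (chart_map c0 p)) (oball (chart_map c p) r).
  rewrite (transition_map c a0 pc0); apply: (open_nbhs_nbhs (conj (@open_oball _ _ _ _) _)).
  by rewrite /oball /= subrr normr0.
have ev (v : 'rV[R]_d) : \forall t \near (0 : R)^'+, oball (chart_map c p) r
     (transition c0 c (chart_map c0 p + t *: v)) /\ overlap c0 c setT (chart_map c0 p + t *: v).
  have cl : (fun h : R => chart_map c0 p + h *: v) @ (0 : R)^'+ --> chart_map c0 p.
    apply: cvg_at_right_filter.
    have : (fun h : R => chart_map c0 p + h *: v) @ (0 : R) --> chart_map c0 p + (0 : R) *: v.
      by apply: cvgD; [exact: cvg_cst|apply: cvgZr_tmp; exact: cvg_id].
    by rewrite scale0r addr0.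
  have nI : nbhs (chart_map c0 p) (fun y => oball (chart_map c p) r (transition c0 c y) /\
      overlap c0 c setT y).
    by apply: filterI; [exact: (cT _ nb)|exact: (open_nbhs_nbhs (conj oo xo))].
  exact: (cl _ nI).
(* Short steps along [- nu p] and [nu p], taken in the chart [chart_at S p] and carried over to [c],
   give one point of the domain and one of the exterior. *)
have [x [y [xr yr xO yE]]] : exists x y, [/\ oball (chart_map c p) r x,
    oball (chart_map c p) r y, chart_image c Omega x & chart_image c (~` closure Omega) y].
  have FF : ProperFilter (0 : R)^'+ by exact: at_right_proper_filter.
  have [t [[h1 h2] [[k1 k2] [k3 k4]]]] :=
    filter_ex (filterI nside (filterI (ev (- nu p)) (ev (nu p)))).
  rewrite scalerN in k1 k2.
  exists (transition c0 c (chart_map c0 p - t *: nu p)),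
    (transition c0 c (chart_map c0 p + t *: nu p)); split=> //.
    apply/(chart_imageP _ _ (hc a)); split; first exact: hr'.
    by rewrite (transition_inv a0 a k2).
  apply/(chart_imageP _ _ (hc a)); split; first exact: hr'.
  by rewrite /= (transition_inv a0 a k4).
have nz z : chart_image c Omega z -> z 0 i != 0.
  move=> /(chart_imageP _ _ (hc a))[iz Oz]; have [zc E] := chart_image_dom (hc a) iz.
  apply/eqP => z0; have : boundary Omega (chart_inv c z) by apply/(sl _ zc); rewrite E.
  by move=> /boundaryE[].
have nz' z : chart_image c (~` closure Omega) z -> z 0 i != 0.
  move=> /(chart_imageP _ _ (hc a))[iz Oz]; have [zc E] := chart_image_dom (hc a) iz.
  apply/eqP => z0; have : boundary Omega (chart_inv c z) by apply/(sl _ zc); rewrite E.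
  by move=> /boundaryE[].
(* The side of the point of the domain; the exterior point must lie on the other side, otherwise
   [same] would put it into the domain. *)
pose s := Num.sg (x 0 i).
have s2 : s * s = 1 by rewrite -expr2 sqr_sg nz.
have sx : 0 < s * x 0 i by rewrite -normrEsg normr_gt0 nz.
have sy : s * y 0 i < 0.
  have : s * y 0 i != 0.
    by rewrite mulf_neq0 ?nz'//; apply/eqP => s0; move: sx; rewrite s0 mul0r ltxx.
  rewrite neq_lt => /orP[//|sy]; exfalso.
  by apply: (dis y) => //; have [h _] := same s x y xr yr sx sy; exact: h.
have main z : oball (chart_map c p) r z -> (chart_image c Omega z <-> 0 < s * z 0 i).
  move=> zr; split=> [zO|sz]; last by have [h _] := same s x z xr zr sx sz; exact: h.
  have : s * z 0 i != 0.
    by rewrite mulf_neq0 ?nz//; apply/eqP => s0; move: sx; rewrite s0 mul0r ltxx.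
  rewrite neq_lt => /orP[sz|//]; exfalso.
  have hy : 0 < - s * y 0 i by rewrite mulNr oppr_gt0.
  have hz : 0 < - s * z 0 i by rewrite mulNr oppr_gt0.
  by apply: (dis z) => //; have [_ h] := same (- s) y z yr zr hy hz; exact: h.
exists c, i, s; split=> //.
have np : \forall q \near p, oball (chart_map c p) r (chart_map c q).
  apply: (near_chart_map (P := oball (chart_map c p) r) a pc).
  apply: (open_nbhs_nbhs (conj (@open_oball _ _ _ _) _)).
  by rewrite /oball /= subrr normr0.
apply: filterS np => q qr qc; rewrite -(main _ qr); split=> [Oq|].
  exact: chart_image_map.
by move=> /(chart_imageP _ _ (hc a))[_]; rewrite (chart_mapK (hc a) qc).
Qed.

End Normal.

End BoundaryGeometry.

Lemma quadratic_substitution {R : comPzRingType} {d : nat} (v : 'I_d -> R) (J : 'M[R]_d)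
    (w : 'rV[R]_d) (C : 'I_d -> 'I_d -> R) :
  (forall i, w 0 i = \sum_b v b * J b i) ->
  \sum_i \sum_j C i j * w 0 i * w 0 j =
  \sum_b \sum_a v b * v a * \sum_i \sum_j J b i * J a j * C i j.
Proof.
move=> hw; transitivity (\sum_i \sum_j \sum_b \sum_a v b * v a * (J b i * J a j * C i j)).
  apply: eq_bigr => i _; apply: eq_bigr => j _; rewrite !hw -mulrA mulr_suml mulr_sumr.
  by apply: eq_bigr => b _; rewrite !mulr_sumr; apply: eq_bigr => a _; ring.
under eq_bigr => i _ do rewrite exchange_big.
rewrite exchange_big; apply: eq_bigr => b _ /=.
under eq_bigr => i _ do rewrite exchange_big.
rewrite exchange_big; apply: eq_bigr => a _ /=; rewrite mulr_sumr.
by apply: eq_bigr => i _; rewrite mulr_sumr.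
Qed.

Lemma exists_row {R : realType} {d : nat} (P : 'I_d -> R -> Prop) :
  (forall k, exists x, P k x) -> exists v : 'rV[R]_d, forall k, P k (v 0 k).
Proof.
move=> /choice[f hf]; exists (\row_k f k) => k.
by rewrite mxE; exact: hf.
Qed.

(** * The second fundamental form in a boundary chart *)

Section SecondForm.
Context {R : realType} {d : nat} {M : topologicalType}.
Context {S : smooth_structure R d M} (g : riemannian_metric S).
Context (Omega : set M) (oO : open Omega).
Implicit Types (c : chart R d M) (A : set M).

Let hc c : atlas S c -> is_chart c := @atlas_chart _ _ _ S c.

Definition const_field c (v : 'rV[R]_d) (q : M) : 'rV[R]_d :=
  v *m jacobian (transition c (chart_at S q)) (chart_map c q).

Lemma vec_in_const_field c v q : atlas S c -> chart_dom c q ->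
  vec_in S c q (const_field c v q) = v.
Proof. exact: vec_in_surj. Qed.

Lemma smooth_const_field c v A : atlas S c -> open A -> A `<=` chart_dom c ->
  smooth_field S A (const_field c v).
Proof.
move=> a oA sA c' a' j k.
have oi := open_chart_image (hc a') oA.
have ox x : chart_image c' A x -> overlap c' c setT x.
  by move=> /(chart_imageP _ _ (hc a'))[ix Ax]; apply/(overlapP _ _ _ a'); split=> //; exact: sA.
have o1 := open_overlap a' a (@openT M); have o2 := open_overlap a a' (@openT M).
have s1 := smooth_transition setT a' a; have s2 := smooth_transition setT a a'.
have t1 x := @overlap_transition _ _ _ S c' c setT x a' a.
have t2 x := @transitionK _ _ _ S c' c setT x a' a.
apply: (@Ck_on_eq _ _ _ _ (fun x => \sum_b v 0 b *
    invmx (jacobian (transition c' c) x) b j)) => //.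
  move=> x xA; have xo := ox x xA.
  have [ix xc _] := (overlapP _ _ _ a').1 xo.
  have [xc' E] := chart_image_dom (hc a') ix.
  rewrite /field_in (vec_inE _ a a' xc xc') vec_in_const_field// mxE.
  by rewrite -(jacobian_invE o1 o2 s1 s2 t1 t2 xo).
apply: Ck_on_sum => // b _; apply: Ck_onZ => //; apply: Ck_on_invmx => //.
  by move=> x /ox xo; exact: (jacobian_unit o1 o2 s1 s2 t1 t2 xo).
move=> i' j'; apply: (Ck_on_sub (fun x (h : chart_image c' A x) => ox x h)).
exact: smooth_map_jacobian.
Qed.

(** [levi_civita] is computed in [chart_at S p], where the field is not constant. The resulting
    second derivatives of the transition map are those in the transformation law [chr_overlap], so
    only the Christoffel symbols of [c] are left. *)
Lemma levi_civita_const_field c v p : atlas S c -> chart_dom c p ->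
  vec_in S c p (levi_civita g p (const_field c v p) (const_field c v)) =
  \row_m \sum_b \sum_a v 0 b * v 0 a * chr (gram g c) m b a (chart_map c p).
Proof.
move=> a pc; have a0 := chart_at_atlas S p; have pc0 := chart_at_dom S p.
have o1 := open_overlap a a0 (@openT M); have o2 := open_overlap a0 a (@openT M).
have s1 := smooth_transition setT a a0; have s2 := smooth_transition setT a0 a.
have t1 x := @overlap_transition _ _ _ S c (chart_at S p) setT x a a0.
have t2 x := @transitionK _ _ _ S c (chart_at S p) setT x a a0.
have xo := overlap_map pc pc0 (I : setT p).
have Tx := transition_map (chart_at S p) a pc.
have st j : Ck_on 1 (overlap c (chart_at S p) setT)
    (fun y => transition c (chart_at S p) y 0 j) by exact: s1.
set J := jacobian (transition c (chart_at S p)) (chart_map c p).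
have [od _ _ _ _] := hc a.
have cX k : Ck_on 1 (overlap (chart_at S p) c setT)
    (fun y => field_in S (chart_at S p) (const_field c v) y 0 k).
  have := smooth_const_field v a od (fun x h => h) a0 k 1.
  apply: Ck_on_sub => x /(overlapP _ _ _ a0)[ix xc _].
  by apply/(chart_imageP _ _ (hc a0)).
set gm := (X in _ = X).
suff -> : levi_civita g p (const_field c v p) (const_field c v) = gm *m J.
  exact: vec_in_surj.
apply/rowP => k; rewrite [LHS]mxE [RHS]mxE.
have E1 : \sum_i const_field c v p 0 i * partial i (fun y =>
      field_in S (chart_at S p) (const_field c v) y 0 k) (chart_map (chart_at S p) p) =
    \sum_b \sum_a' v 0 b * v 0 a' * partial b (partial a'
      (fun y => transition c (chart_at S p) y 0 k)) (chart_map c p).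
  transitivity (\sum_b v 0 b * partial b ((fun y =>
      field_in S (chart_at S p) (const_field c v) y 0 k) \o transition c (chart_at S p))
      (chart_map c p)).
    transitivity (\sum_b \sum_i v 0 b * J b i * partial i (fun y =>
      field_in S (chart_at S p) (const_field c v) y 0 k) (chart_map (chart_at S p) p)).
      rewrite exchange_big; apply: eq_bigr => i _ /=.
      by rewrite -mulr_suml; congr (_ * _); rewrite /const_field mxE.
    apply: eq_bigr => b _.
    have E := partial_transition o1 o2 s1 t1 b xo (cX k).
    apply: etrans (congr1 (fun t => v 0 b * t) (esym E)); rewrite Tx mulr_sumr.
    by apply: eq_bigr => i _; rewrite mulrA.
  apply: eq_bigr => b _.
  have dT a' : derivable (partial a' (fun y => transition c (chart_at S p) y 0 k))
      (chart_map c p) (delta_mx 0 b).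
    have c2 := smooth_transition setT a a0 k 2.
    exact: (Ck_on_derivable (i := b) (Ck_on_partial a' c2) xo).
  have dT' a' : derivable (fun y => v 0 a' *
      partial a' (fun y => transition c (chart_at S p) y 0 k) y) (chart_map c p) (delta_mx 0 b).
    exact: (@derivableZ _ _ _ _ (v 0 a') _ _ (dT a')).
  have -> : partial b ((fun y => field_in S (chart_at S p) (const_field c v) y 0 k) \o
      transition c (chart_at S p)) (chart_map c p) = partial b (fun y => \sum_a' v 0 a' *
      partial a' (fun y => transition c (chart_at S p) y 0 k) y) (chart_map c p).
    apply: (partial_open _ o1 xo) => y yo.
    have [iy _ _] := (overlapP _ _ _ a).1 yo.
    have [yc _] := chart_image_dom (hc a) iy.
    have F := @field_in_transition _ _ _ S _ _ _ (const_field c v) y a a0 yo.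
    rewrite /= -F /field_in (vec_in_const_field v a yc) mxE.
    by apply: eq_bigr => a' _; rewrite (jacobian_partial o1 yo st).
  have [-> _] := @partial_sum _ _ _ (index_enum _) xpredT _ _ b (fun a' _ => dT' a').
  rewrite mulr_sumr; apply: eq_bigr => a' _; rewrite -mulrA; congr (_ * _).
  exact: (@deriveZ _ _ _ _ (v 0 a') _ _ (dT a')).
rewrite E1.
have -> : \sum_j gm 0 j * J j k = \sum_b \sum_a' v 0 b * v 0 a' *
    \sum_m chr (gram g c) m b a' (chart_map c p) * J m k.
  transitivity (\sum_j \sum_b \sum_a' v 0 b * v 0 a' *
      (chr (gram g c) j b a' (chart_map c p) * J j k)).
    apply: eq_bigr => j _; rewrite /gm mxE mulr_suml; apply: eq_bigr => b _.
    by rewrite mulr_suml; apply: eq_bigr => a' _; rewrite mulrA.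
  rewrite exchange_big; apply: eq_bigr => b _; rewrite exchange_big /=.
  by apply: eq_bigr => a' _; rewrite mulr_sumr.
rewrite (@quadratic_substitution _ _ (fun i => v 0 i) J); last by move=> i; rewrite /const_field mxE.
rewrite -big_split; apply: eq_bigr => b _; rewrite -big_split; apply: eq_bigr => a' _ /=.
rewrite -mulrDr; congr (_ * _).
have := @chr_overlap _ _ _ S g c (chart_at S p) setT a a0 (@openT M) _ b a' k xo.
by rewrite Tx => ->.
Qed.

Section SecondFormSign.
Context (nu : M -> 'rV[R]_d) (hnu : outward_unit_normal g Omega nu)
  (hII : second_form_nonneg g Omega nu).

(* The field extending a tangent vector with constant components in c turns II >= 0 into a
   sign of a Christoffel symbol. *)
Lemma second_form_sign c i s p (v : 'rV[R]_d) : boundary_chart (S := S) Omega c i s p -> v 0 i = 0 ->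
  0 <= s * \sum_b \sum_a v 0 b * v 0 a * chr (gram g c) i b a (chart_map c p).
Proof.
move=> b vi; have [a pc p0 s2 _] := b.
have [lam sl H] := normal_conormal oO hnu b.
have [r r0 hr] := boundary_chart_near oO b.
have oV : open (chart_dom c `&` chart_map c @^-1` oball (chart_map c p) r).
  have [od _ _ _ _] := hc a.
  apply: open_preimage_within => //; last exact: open_oball.
  by move=> q; exact: chart_map_continuous (hc a).
have Vp : (chart_dom c `&` chart_map c @^-1` oball (chart_map c p) r) p.
  by split=> //; rewrite /= /oball /= subrr normr0.
have := hII (boundary_chart_boundary oO b) oV Vp
  (smooth_const_field v a oV (@subIsetl _ _ _)).
have tan y : (chart_dom c `&` chart_map c @^-1` oball (chart_map c p) r) y ->
    boundary Omega y -> tangent_to (S := S) (boundary Omega) y (const_field c v y).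
  move=> [yc yr] by_; have [_ _ hb hb'] := hr _ yr.
  rewrite (chart_mapK (hc a) yc) in hb hb'.
  apply: (tangent_boundary_chart oO (hb' (hb.1 by_))).
  by rewrite vec_in_const_field.
move=> /(_ tan); rewrite /second_fundamental_form inner_sym H levi_civita_const_field// mxE.
move: (\sum_b _) => t; move: sl => sl h.
have : (s * lam) * (s * t) <= 0.
  have -> : (s * lam) * (s * t) = (s * s) * (lam * t) by ring.
  by rewrite s2 mul1r; lra.
by move: sl; move: (s * lam) (s * t) => x y; nra.
Qed.

End SecondFormSign.

End SecondForm.

(** * Limits at the boundary of the derivatives of u and of |grad u|^2 *)

Section BoundaryLimits.
Context {R : realType} {d : nat} {M : topologicalType}.
Context {S : smooth_structure R d M} (g : riemannian_metric S).
Context (Omega : set M) (oO : open Omega).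
Context (u : M -> R) (hu3 : Ck S 3 Omega u) (hu2 : Ck_closure S 2 Omega u).
Implicit Types (c : chart R d M) (A : set M).

Let hc c : atlas S c -> is_chart c := @atlas_chart _ _ _ S c.
Let hu2' : Ck S 2 Omega u := CkW hu3.
Let hu1 : Ck S 1 Omega u := CkW hu2'.

Lemma within_nontrivial c p : atlas S c -> chart_dom c p -> closure Omega p ->
  ~ (\forall y \near chart_map c p, ~ chart_image c Omega y).
Proof.
move=> a pc /near_closureP clp h; apply: clp.
have [od _ _ _ _] := hc a.
have := near_chart_map (P := fun y => ~ chart_image c Omega y) a pc h.
move=> h'; apply: filterS (filterI h' (open_nbhs_nbhs (conj od pc))) => q [k qc] Oq.
by apply: k; exact: chart_image_map.
Qed.

Lemma iter_partial_tends c p (s : seq 'I_d) : atlas S c -> chart_dom c p ->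
  closure Omega p -> (size s <= 2)%N ->
  exists l, tends (chart_image c Omega) (chart_map c p) (iter_partial s (u \o chart_inv c)) l.
Proof.
move=> a pc clp hs; have [_ _ h] := hu2; have [H [cH EH]] := h c a s hs.
exists (H (chart_map c p)); apply: (tends_eq EH).
move/subspace_continuousP: cH => /(_ (chart_map c p) (chart_image_map pc clp)) k.
apply: cvg_trans k; apply: cvg_app; apply: within_subset.
by move=> x [q [qc Oq] <-]; exists q => //; split=> //; exact: subset_closure.
Qed.

Lemma gram_inv_continuous c p l k : atlas S c -> chart_dom c p ->
  {for chart_map c p, continuous (fun y => invmx (gram g c y) l k)}.
Proof.
move=> a pc; have oi := open_chart_image (hc a) (@openT M).
have h := @smooth_invmx _ _ _ _ oi (@smooth_gram _ _ _ _ g c _ a)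
  (fun x h => @posdef_gram_image _ _ _ _ g c _ x a h) 0%N l k.
exact: (Ck_on_continuous h (chart_image_map pc I)).
Qed.

Lemma gram_inv_tends c p l k (A : set 'rV[R]_d) : atlas S c -> chart_dom c p ->
  tends A (chart_map c p) (fun y => invmx (gram g c y) l k) (invmx (gram g c (chart_map c p)) l k).
Proof.
move=> a pc; have h := @gram_inv_continuous c p l k a pc.
exact: (@tends_continuous R _ A (chart_map c p) (fun y => invmx (gram g c y) l k) h).
Qed.

Local Notation V c := (local_grad (gram g c) (u \o chart_inv c)).

Lemma grad_tends c p : atlas S c -> chart_dom c p -> closure Omega p ->
  exists v : 'rV[R]_d, forall k,
    tends (chart_image c Omega) (chart_map c p) (fun y => V c y 0 k) (v 0 k).
Proof.
move=> a pc clp.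
pose h l := cid (@iter_partial_tends c p [:: l] a pc clp isT).
apply: (@exists_row R d (fun k t => tends (chart_image c Omega) (chart_map c p)
  (fun y => V c y 0 k) t)) => k; exists (\sum_l projT1 (h l) * invmx (gram g c (chart_map c p)) l k).
have H : tends (chart_image c Omega) (chart_map c p) (fun y =>
    \sum_l partial l (u \o chart_inv c) y * invmx (gram g c y) l k)
    (\sum_l projT1 (h l) * invmx (gram g c (chart_map c p)) l k).
  apply: tends_sum => l _; apply: tendsM; first exact: (projT2 (h l)).
  exact: gram_inv_tends.
exact: (tends_eq (fun y _ => esym (local_gradE _ _ y k)) H).
Qed.

Lemma partial_grad_tends c p m k : atlas S c -> chart_dom c p -> closure Omega p ->
  exists w, tends (chart_image c Omega) (chart_map c p)
    (partial m (fun y => V c y 0 k)) w.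
Proof.
move=> a pc clp; have oi := open_chart_image (hc a) oO.
have oT := open_chart_image (hc a) (@openT M).
pose h l := cid (@iter_partial_tends c p [:: l] a pc clp isT).
pose h2 l := cid (@iter_partial_tends c p [:: m; l] a pc clp isT).
have sub x : chart_image c Omega x -> chart_image c setT x by move=> [q [qc _] <-]; exists q.
have cI l : Ck_on 1 (chart_image c setT) (fun y => invmx (gram g c y) l k).
  exact: (@smooth_invmx _ _ _ _ oT (@smooth_gram _ _ _ _ g c _ a)
    (fun x h => @posdef_gram_image _ _ _ _ g c _ x a h)).
eexists; apply: (@tends_eq _ _ _ _ (fun y => \sum_l
   (partial m (partial l (u \o chart_inv c)) y * invmx (gram g c y) l k +
    partial l (u \o chart_inv c) y * partial m (fun y => invmx (gram g c y) l k) y))).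
  move=> y yA.
  have d1 l : derivable (partial l (u \o chart_inv c)) y (delta_mx 0 m).
    exact: (Ck_on_derivable (i := m) (Ck_on_partial l (hu2' a)) yA).
  have d2 l : derivable (fun y => invmx (gram g c y) l k) y (delta_mx 0 m).
    exact: (Ck_on_derivable (i := m) (cI l) (sub _ yA)).
  have -> : partial m (fun y => V c y 0 k) y = partial m (fun y => \sum_l
      partial l (u \o chart_inv c) y * invmx (gram g c y) l k) y.
    by apply: (partial_open _ oi yA) => z _; rewrite local_gradE.
  have d3 l : derivable (fun y => partial l (u \o chart_inv c) y * invmx (gram g c y) l k) y
      (delta_mx 0 m) by exact: (derivableM (d1 l) (d2 l)).
  have [-> _] := @partial_sum _ _ _ (index_enum _) xpredT _ _ m (fun l _ => d3 l).
  by apply: eq_bigr => l _; rewrite (partialM (d1 l) (d2 l)).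
apply: tends_sum => l _; apply: tendsD; apply: tendsM.
- exact: (projT2 (h2 l)).
- exact: gram_inv_tends.
- exact: (projT2 (h l)).
- apply: tends_continuous.
  exact: (Ck_on_continuous (Ck_on_partial m (cI l)) (chart_image_map pc I)).
Qed.

Lemma chr_continuous c p k i j : atlas S c -> chart_dom c p ->
  {for chart_map c p, continuous (chr (gram g c) k i j)}.
Proof.
move=> a pc; have oi := open_chart_image (hc a) (@openT M).
have h := @smooth_chr _ _ _ _ oi (@smooth_gram _ _ _ _ g c _ a)
  (fun x h => @posdef_gram_image _ _ _ _ g c _ x a h) 0%N k i j.
exact: (Ck_on_continuous h (chart_image_map pc I)).
Qed.

Lemma chr_tends c p k i j (A : set 'rV[R]_d) : atlas S c -> chart_dom c p ->
  tends A (chart_map c p) (chr (gram g c) k i j) (chr (gram g c) k i j (chart_map c p)).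
Proof.
move=> a pc; have h := @chr_continuous c p k i j a pc.
exact: (@tends_continuous R _ A (chart_map c p) (chr (gram g c) k i j) h).
Qed.

Lemma grad_energy_tends c p k v (w : 'I_d -> R) : atlas S c -> chart_dom c p ->
  (forall l, tends (chart_image c Omega) (chart_map c p) (fun y => V c y 0 l) (v l)) ->
  (forall l, tends (chart_image c Omega) (chart_map c p)
     (partial l (fun y => V c y 0 k)) (w l)) ->
  tends (chart_image c Omega) (chart_map c p)
    (fun y => local_grad (gram g c) (energy (gram g c) (u \o chart_inv c)) y 0 k)
    (2 * \sum_l (w l + \sum_m chr (gram g c) k l m (chart_map c p) * v m) * v l).
Proof.
move=> a pc hv hw; have oi := open_chart_image (hc a) oO.
apply: (@tends_eq _ _ _ _ (fun y => 2 * \sum_l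
  covder (gram g c) (u \o chart_inv c) k l y * V c y 0 l)).
  move=> y yA; apply/esym.
  exact: (@grad_energy _ _ _ _ oi (@smooth_gram _ _ _ _ g c _ a)
    (fun x h => @posdef_gram_image _ _ _ _ g c _ x a h) _ (hu3 a) y k yA).
apply: tendsM; first exact: tends_cst.
apply: tends_sum => l _; apply: tendsM; last exact: hv.
apply: tendsD; first exact: hw.
apply: tends_sum => m _; apply: tendsM; last exact: hv.
exact: chr_tends.
Qed.

Section NeumannLimits.
Context (nu : M -> 'rV[R]_d) (hnu : outward_unit_normal g Omega nu)
  (hII : second_form_nonneg g Omega nu)
  (hN : forall p, boundary Omega p -> inner g p (grad_closure g Omega u p) (nu p) = 0).

(** The [lim] in [grad_closure] is meaningful only if a limit exists. Existence comes from the
    regularity of [u] up to the closure, uniqueness from points of the domain accumulating at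
    [p]. *)
Lemma grad_closure_tends p : closure Omega p ->
  forall k, tends (chart_image (chart_at S p) Omega) (chart_map (chart_at S p) p)
    (fun y => V (chart_at S p) y 0 k) (grad_closure g Omega u p 0 k).
Proof.
move=> clp k; have a := chart_at_atlas S p; have pc := chart_at_dom S p.
have nt := within_nontrivial a pc clp.
set c0 := chart_at S p in a pc nt *; set x0 := chart_map c0 p in nt *.
pose L l := lim (partial l (u \o chart_inv c0) @ within (chart_image c0 Omega) (nbhs x0)).
have E : grad_closure g Omega u p 0 k = \sum_l L l * invmx (gram g c0 x0) l k.
  rewrite /grad_closure /sharp mxE; apply: eq_bigr => l _; rewrite mxE.
  exact: (congr1 (fun G => _ * invmx G l k) (esym (gram_chart_at g p))).
have PF : ProperFilter (within (chart_image c0 Omega) (nbhs x0)).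
  split; last exact: within_filter.
  by rewrite /within /= => h; apply: nt; apply: filterS h => y; apply.
have H : tends (chart_image c0 Omega) x0 (fun y =>
    \sum_l partial l (u \o chart_inv c0) y * invmx (gram g c0 y) l k)
    (\sum_l L l * invmx (gram g c0 x0) l k).
  apply: tends_sum => l _; apply: tendsM; last first.
    exact: gram_inv_tends.
  have [x hx] := @iter_partial_tends c0 p [:: l] a pc clp isT.
  have -> : L l = x by apply: cvg_lim => //; exact: hx.
  exact: hx.
rewrite E; exact: (tends_eq (fun y _ => esym (local_gradE _ _ y k)) H).
Qed.

(** By [normal_conormal] the Neumann condition says that the i-th component in [c] of the boundary
    gradient is 0. That gradient is defined in [chart_at S p], so the limit has to be carried over
    to [c]. *)
Lemma normal_component_tends0 c i s p : boundary_chart (S := S) Omega c i s p ->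
  tends (chart_image c Omega) (chart_map c p) (fun y => V c y 0 i) 0.
Proof.
move=> b; have [a pc p0 s2 _] := b; have bp := boundary_chart_boundary oO b.
have clp : closure Omega p by have [] := bp.
have [lam sl H] := normal_conormal oO hnu b.
have a0 := chart_at_atlas S p; have pc0 := chart_at_dom S p.
have lam0 : lam != 0 by apply/eqP => l0; move: sl; rewrite l0 mulr0 ltxx.
have := hN bp; rewrite inner_sym H => /eqP; rewrite mulf_eq0 (negbTE lam0) /= => /eqP <-.
have o1 := open_overlap a a0 oO.
have xo := overlap_map pc pc0 (I : setT p).
have oo := open_overlap a a0 (@openT M).
have o2 := open_overlap a0 a (@openT M).
have s2' := smooth_transition setT a0 a.
have cT : {for chart_map c p, continuous (transition c (chart_at S p))}.
  by apply: differentiable_continuous; apply: (C1_on_diff_map oo xo) => j;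
    exact: (smooth_transition _ a a0).
have Tx := transition_map (chart_at S p) a pc.
pose F (y : 'rV[R]_d) := \sum_k V (chart_at S p) y 0 k * jacobian (transition (chart_at S p) c) y k i.
have tF : tends (chart_image (chart_at S p) Omega) (chart_map (chart_at S p) p) F
    (vec_in S c p (grad_closure g Omega u p) 0 i).
  rewrite /vec_in mxE; apply: tends_sum => k _; apply: tendsM.
    exact: grad_closure_tends.
  apply: tends_continuous.
  have := @smooth_map_jacobian _ _ _ _ 0%N k i o2 s2'.
  by move/Ck_on_continuous; apply; exact: overlap_map.
have E y : chart_image c Omega y /\ overlap c (chart_at S p) setT y ->
    F (transition c (chart_at S p) y) = V c y 0 i.
  move=> [yA yo]; have [iy yc0 _] := (overlapP _ _ _ a).1 yo.
  have [iy' Oy] := (chart_imageP _ _ (hc a)).1 yA.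
  have yo' := overlap_transition a a0 (_ : overlap c (chart_at S p) Omega y).
  have yO : overlap c (chart_at S p) Omega y by apply/(overlapP _ _ _ a).
  have G := @grad_overlap _ _ _ S g (chart_at S p) c Omega a0 a oO u
    (transition c (chart_at S p) y) (overlap_transition a a0 yO).
  have -> : V c y 0 i = V c (transition (chart_at S p) c (transition c (chart_at S p) y)) 0 i.
    by rewrite (transitionK a a0 yO).
  rewrite -G; first by rewrite mxE.
  by apply: Ck_on_sub (hu1 a) => z /overlap_sub.
apply/tendsP => e e0.
have tA : \forall y \near chart_map c p, chart_image c Omega y ->
    chart_image (chart_at S p) Omega (transition c (chart_at S p) y).
  apply: filterS (open_nbhs_nbhs (conj oo xo)) => y yo yA.
  have [iy yc0 _] := (overlapP _ _ _ a).1 yo.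
  have [_ Oy] := (chart_imageP _ _ (hc a)).1 yA.
  by apply: (overlap_sub (overlap_transition a a0 (_ : overlap c (chart_at S p) Omega y)));
    apply/(overlapP _ _ _ a).
rewrite -Tx in tF.
have /tendsP/(_ e e0) h := tends_comp cT tA tF.
apply: filterS (filterI h (open_nbhs_nbhs (conj oo xo))) => y [k yo] yA.
by have := k yA; rewrite /= E.
Qed.

(* On the boundary, the Neumann condition makes the outward normal derivative of
   |grad u|^2 equal to - 2 II(grad u, grad u). *)
Lemma grad_sqr_normal_limit c i s p : boundary_chart (S := S) Omega c i s p ->
  exists2 L, 0 <= s * L & tends (chart_image c Omega) (chart_map c p)
    (fun y => local_grad (gram g c) (energy (gram g c) (u \o chart_inv c)) y 0 i) L.
Proof.
move=> b; have [a pc p0 s2 _] := b; have bp := boundary_chart_boundary oO b.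
have clp : closure Omega p by have [] := bp.
have nt := within_nontrivial a pc clp.
have [v hv] := grad_tends a pc clp.
pose hw l := cid (partial_grad_tends l i a pc clp).
have [r r0 hr] := boundary_chart_near oO b.
have oi := open_chart_image (hc a) oO.
have v0 : v 0 i = 0 by exact: (tends_unique nt (hv i) (normal_component_tends0 b)).
have w0 l : l != i -> projT1 (hw l) = 0.
  move=> li; apply: (tangential_derivative_lim s2 r0 li p0 _ _ (projT2 (hw l))).
  - move=> y yr; have [iy hO _ _] := hr y yr.
    rewrite -hO; split=> [/(chart_imageP _ _ (hc a))[]//|Oy].
    exact/(chart_imageP _ _ (hc a)).
  - move=> y yA.
    have cV := @Ck_on_local_grad _ _ _ _ oi (@smooth_gram _ _ _ _ g c _ a)
      (fun x h => @posdef_gram_image _ _ _ _ g c _ x a h) _ 1 i (hu2' a).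
    exact: (Ck_on_derivable (i := l) cV yA).
  - move=> y yr y0; have [iy _ _ hb] := hr y yr.
    have := normal_component_tends0 (hb y0).
    by have [_ ->] := chart_image_dom (hc a) iy.
have := grad_energy_tends a pc hv (fun l => projT2 (hw l)).
set L := 2 * _ => hL; exists L => //.
(* Only Christoffel terms survive: for [l = i] the factor [v 0 i] is 0, and for other [l] the
   tangential derivative of the i-th component vanishes. *)
have -> : L = 2 * \sum_b \sum_a' v 0 b * v 0 a' * chr (gram g c) i b a' (chart_map c p).
  rewrite /L; congr (_ * _); apply: eq_bigr => l _.
  have -> : (projT1 (hw l) + \sum_m chr (gram g c) i l m (chart_map c p) * v 0 m) * v 0 l =
      (\sum_m chr (gram g c) i l m (chart_map c p) * v 0 m) * v 0 l.
    by have [->|li] := eqVneq l i; [rewrite v0 !mulr0|rewrite w0// add0r].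
  rewrite mulr_suml; apply: eq_bigr => m _; ring.
by rewrite mulrCA mulr_ge0//; exact: (second_form_sign oO hnu hII b v0).
Qed.

End NeumannLimits.

End BoundaryLimits.

(** * Integrated Bernstein inequality *)

Lemma quad_sum {R : realType} {d : nat} (v w : 'rV[R]_d) (G : 'M[R]_d) :
  (v *m G *m w^T) 0 0 = \sum_j (\sum_i v 0 i * G i j) * w 0 j.
Proof. by rewrite mxE; apply: eq_bigr => j _; rewrite !mxE. Qed.

(** * Product and chain rules for fields, and bounds from boundary limits *)

Section FieldCalculus.
Context {R : realType} {d : nat} {M : ptopologicalType}.
Context {S : smooth_structure R d M} (g : riemannian_metric S).
Implicit Types (c : chart R d M) (A : set M) (X Y : M -> 'rV[R]_d).

Let hc c : atlas S c -> is_chart c := @atlas_chart _ _ _ S c.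

Lemma field_in_scale c (a : M -> R) X x i :
  field_in S c (fun q => a q *: X q) x 0 i = a (chart_inv c x) * field_in S c X x 0 i.
Proof. by rewrite /field_in vec_inZ [LHS]mxE. Qed.

Lemma field_inD c X Y x i :
  field_in S c (fun q => X q + Y q) x 0 i = field_in S c X x 0 i + field_in S c Y x 0 i.
Proof. by rewrite /field_in vec_inD [LHS]mxE. Qed.

Lemma C1_field_scale A (a : M -> R) X : open A -> Ck S 1 A a -> C1_field (S := S) A X ->
  C1_field (S := S) A (fun p => a p *: X p).
Proof.
move=> oA ca cX c ac i; have oi := open_chart_image (hc ac) oA.
apply: (@Ck_on_eq _ _ _ _ (fun x => (a \o chart_inv c) x * field_in S c X x 0 i)) => //.
  by move=> x _; rewrite field_in_scale.
by apply: Ck_onM => //; [exact: ca|exact: cX].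
Qed.

Lemma C1_fieldD A X Y : open A -> C1_field (S := S) A X -> C1_field (S := S) A Y ->
  C1_field (S := S) A (fun p => X p + Y p).
Proof.
move=> oA cX cY c ac i; have oi := open_chart_image (hc ac) oA.
apply: (@Ck_on_eq _ _ _ _ (fun x => field_in S c X x 0 i + field_in S c Y x 0 i)) => //.
  by move=> x _; rewrite field_inD.
by apply: Ck_onD => //; [exact: cX|exact: cY].
Qed.

Lemma Ck_M k A (a b : M -> R) : open A -> Ck S k A a -> Ck S k A b ->
  Ck S k A (fun p => a p * b p).
Proof.
move=> oA ca cb c ac.
exact: (Ck_onM (open_chart_image (hc ac) oA) (ca c ac) (cb c ac)).
Qed.

Lemma Ck_cst k A (a : R) : Ck S k A (fun=> a).
Proof. by move=> c ac; exact: Ck_on_cst. Qed.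

Lemma Ck_inner A X Y : open A -> C1_field (S := S) A X -> C1_field (S := S) A Y ->
  Ck S 1 A (fun p => inner g p (X p) (Y p)).
Proof.
move=> oA cX cY c ac; have oi := open_chart_image (hc ac) oA.
apply: (@Ck_on_eq _ _ _ _ (fun x => \sum_j (\sum_i field_in S c X x 0 i * gram g c x i j) *
  field_in S c Y x 0 j)) => //.
  move=> x /(chart_imageP _ _ (hc ac))[ix Ax].
  have [xc E] := chart_image_dom (hc ac) ix.
  by rewrite /= (inner_chart g _ _ ac xc) E /quad quad_sum.
apply: Ck_on_sum => // j _; apply: Ck_onM => //; last exact: cY.
apply: Ck_on_sum => // i _; apply: Ck_onM => //; first exact: cX.
exact: smooth_gram.
Qed.

Lemma div_scale A (a : M -> R) X p : open A -> Ck S 1 A a -> C1_field (S := S) A X -> A p ->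
  div g (fun p => a p *: X p) p = a p * div g X p + inner g p (grad g a p) (X p).
Proof.
move=> oA ca cX Ap; have a0 := chart_at_atlas S p; have p0 := chart_at_dom S p.
have oi := open_chart_image (hc a0) oA; have xA := chart_image_map p0 Ap.
have cQ j : Ck_on 1 (chart_image (chart_at S p) A)
    (fun x => density g (chart_at S p) x * field_in S (chart_at S p) X x 0 j).
  apply: Ck_onM => //; last exact: cX.
  exact: (@C1_density _ _ _ _ oi (@smooth_gram _ _ _ _ g _ _ a0)
    (fun x h => @posdef_gram_image _ _ _ _ g _ _ x a0 h)).
rewrite (inner_grad g _ a0 oA ca Ap p0) /div.
set c := chart_at S p in a0 p0 oi xA cQ *; set x := chart_map c p in xA *.
have -> : \sum_i partial i (fun y => density g c y *
      field_in S c (fun q => a q *: X q) y 0 i) x =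
    \sum_i (partial i (a \o chart_inv c) x * (density g c x * field_in S c X x 0 i) +
      (a \o chart_inv c) x * partial i (fun y => density g c y * field_in S c X y 0 i) x).
  apply: eq_bigr => i _.
  apply: etrans (partialM (Ck_on_derivable (ca c a0) xA) (Ck_on_derivable (cQ i) xA)).
  apply: (partial_open _ oi xA) => y _.
  by rewrite field_in_scale mulrCA.
have dx : density g c x != 0.
  by apply: lt0r_neq0; exact: (density_chart_gt0 g a0 (chart_image_map p0 I)).
rewrite big_split /= mulrDr addrC -!mulr_sumr; congr (_ + _).
  by rewrite mulrCA /x /= (chart_mapK (hc a0) p0).
rewrite mulr_sumr; apply: eq_bigr => i _.
rewrite /field_in /x (chart_mapK (hc a0) p0) -/x.
by rewrite [partial i _ _ * _]mulrC -!mulrA mulKf// mulrC.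
Qed.

Lemma divD A X Y p : open A -> C1_field (S := S) A X -> C1_field (S := S) A Y -> A p ->
  div g (fun p => X p + Y p) p = div g X p + div g Y p.
Proof.
move=> oA cX cY Ap; have a0 := chart_at_atlas S p; have p0 := chart_at_dom S p.
have oi := open_chart_image (hc a0) oA; have xA := chart_image_map p0 Ap.
have cQ Z j : C1_field (S := S) A Z -> Ck_on 1 (chart_image (chart_at S p) A)
    (fun x => density g (chart_at S p) x * field_in S (chart_at S p) Z x 0 j).
  move=> cZ; apply: Ck_onM => //; last exact: cZ.
  exact: (@C1_density _ _ _ _ oi (@smooth_gram _ _ _ _ g _ _ a0)
    (fun x h => @posdef_gram_image _ _ _ _ g _ _ x a0 h)).
rewrite /div -mulrDr -big_split; congr (_ * _); apply: eq_bigr => i _ /=.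
apply: etrans (partialD (Ck_on_derivable (cQ X i cX) xA) (Ck_on_derivable (cQ Y i cY) xA)).
apply: (partial_open _ oi xA) => y _.
by rewrite field_inD mulrDr.
Qed.

Section Composition.
Context (F F' : R -> R) (dF : forall t, is_derive t (1 : R) F (F' t)) (cF' : continuous F').

Lemma Ck_comp A (h : M -> R) : open A -> Ck S 1 A h -> Ck S 1 A (F \o h).
Proof.
move=> oA ch c ac; have oi := open_chart_image (hc ac) oA.
exact: (@C1_on_comp1 _ _ F F' _ _ oi (ch c ac) (fun x _ => dF _) (fun x _ => @cF' _)).
Qed.

Lemma grad_comp A (h : M -> R) p : Ck S 1 A h -> A p ->
  grad g (F \o h) p = F' (h p) *: grad g h p.
Proof.
move=> ch Ap; have a0 := chart_at_atlas S p; have p0 := chart_at_dom S p.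
rewrite /grad /sharp scalemxAl; congr (_ *m _); apply/rowP => i; rewrite !mxE.
have [_ E] := is_derive_comp1 (Ck_on_derivable (i := i) (ch _ a0) (chart_image_map p0 Ap))
  (dF _).
by apply: etrans E _; rewrite /= (chart_mapK (hc a0) p0).
Qed.

End Composition.

Lemma gradZ A (h : M -> R) (b : R) p : Ck S 1 A h -> A p ->
  grad g (fun q => b * h q) p = b *: grad g h p.
Proof.
move=> ch Ap; have a0 := chart_at_atlas S p; have p0 := chart_at_dom S p.
rewrite /grad /sharp scalemxAl; congr (_ *m _); apply/rowP => i; rewrite !mxE.
exact: (@deriveZ _ _ _ _ b _ _ (Ck_on_derivable (i := i) (ch _ a0) (chart_image_map p0 Ap))).
Qed.

Lemma innerDr p v w1 w2 : inner g p v (w1 + w2) = inner g p v w1 + inner g p v w2.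
Proof. by rewrite inner_sym innerDl ![inner g p _ v]inner_sym. Qed.

Lemma innerZr p a v w : inner g p v (a *: w) = a * inner g p v w.
Proof. by rewrite inner_sym innerZl inner_sym. Qed.

Lemma has_trace_bound Omega X Y : compact (closure Omega) ->
  (forall c p, atlas S c -> chart_dom c p -> closure Omega p -> exists v : 'rV[R]_d, forall k,
    tends (chart_image c Omega) (chart_map c p) (fun y => field_in S c X y 0 k) (v 0 k)) ->
  (forall c p, atlas S c -> chart_dom c p -> closure Omega p -> exists v : 'rV[R]_d, forall k,
    tends (chart_image c Omega) (chart_map c p) (fun y => field_in S c Y y 0 k) (v 0 k)) ->
  exists B, forall q, Omega q -> `|inner g q (X q) (Y q)| <= B.
Proof.
move=> cO tX tY.
have [B hB] : exists B, forall q, closure Omega q -> Omega q ->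
    `|inner g q (X q) (Y q)| <= B; last by exists B => q Oq; apply: hB => //; exact: subset_closure.
apply: compact_local_bound => // p clp.
have a0 := chart_at_atlas S p; have p0 := chart_at_dom S p.
set c := chart_at S p in a0 p0.
have [v hv] := tX c p a0 p0 clp; have [w hw] := tY c p a0 p0 clp.
have oi := open_chart_image (hc a0) (@openT M).
have H : tends (chart_image c Omega) (chart_map c p) (fun x => \sum_j
    (\sum_i field_in S c X x 0 i * gram g c x i j) * field_in S c Y x 0 j)
    (\sum_j (\sum_i v 0 i * gram g c (chart_map c p) i j) * w 0 j).
  apply: tends_sum => j _; apply: tendsM; last exact: hw.
  apply: tends_sum => i _; apply: tendsM; first exact: hv.
  have cg := @smooth_gram _ _ _ _ g c setT a0 i j 0%N.
  have cg' : {for chart_map c p, continuous (fun x => gram g c x i j)}.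
    exact: (Ck_on_continuous cg (chart_image_map p0 I)).
  exact: (@tends_continuous R _ _ (chart_map c p) (fun x => gram g c x i j) cg').
have := tends_bounded H; set B := `|_| + 1 => hb; exists B.
have [od _ _ _ _] := hc a0.
have hb' := near_chart_map (P := fun y => chart_image c Omega y -> `|\sum_j
    (\sum_i field_in S c X y 0 i * gram g c y i j) * field_in S c Y y 0 j| <= B) a0 p0 hb.
apply: filterS (filterI hb' (open_nbhs_nbhs (conj od p0))) => q [k qc] Oq.
have := k (chart_image_map qc Oq); apply: le_trans; rewrite le_eqVlt; apply/orP; left; apply/eqP.
by rewrite (inner_chart g _ _ a0 qc) /quad quad_sum /field_in (chart_mapK (hc a0) qc).
Qed.

End FieldCalculus.

(** Here p1 and p2 are the products of grad u with the gradients of its Laplacian and of f, p3 the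
    Ricci term, p4 the product of grad z and grad u, p5 the Laplacian of z, p6 that of u, p7 = z, p8
    = f and p9 = z^(gamma/2-1). The first two enter through their sum only, so both gradients are
    eliminated. *)
Lemma bernstein_algebra {R : realType} (D kappa p1 p2 p3 p4 p5 p6 p7 p8 p9 : R) :
  2 * (p6 ^+ 2 / D + p1 + p3) <= p5 -> - kappa * p7 <= p3 ->
  p1 + p2 = 2^-1 * p9 * p4 ->
  2 * p6 ^+ 2 / D + p9 * p4 - 2 * kappa * p7 + 2 * p8 * p6 <=
  p5 + (2 * p8 * p6 + 2 * p2).
Proof.
have -> : 2 * p6 ^+ 2 / D = 2 * (p6 ^+ 2 / D) by rewrite mulrA.
move: (p6 ^+ 2 / D) => p10 h1 h2 h3.
have -> : p9 * p4 = 2 * (p1 + p2) by rewrite h3; field.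
by lra.
Qed.

Lemma near_continuous {T U : topologicalType} (h1 h2 : T -> U) p :
  (\forall q \near p, h1 q = h2 q) -> {for p, continuous h1} -> {for p, continuous h2}.
Proof.
move=> E ch; rewrite /prop_for /continuous_at -(nbhs_singleton E).
exact: cvg_trans (near_eq_cvg E) ch.
Qed.

Section FieldRegularity.
Context {R : realType} {d : nat} {M : ptopologicalType}.
Context {S : smooth_structure R d M} (g : riemannian_metric S).
Let hc c : atlas S c -> is_chart c := @atlas_chart _ _ _ S c.

Lemma tnormZ p (a : R) v : tnorm g p (a *: v) = `|a| * tnorm g p v.
Proof. by rewrite /tnorm innerZl innerZr mulrA sqrtrM ?sqr_ge0// -expr2 sqrtr_sqr. Qed.

Lemma Ck_div X : smooth_field S setT X -> Ck S 1 setT (div g X).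
Proof.
move=> sX c a; have oi := open_chart_image (hc a) (@openT M).
have cX : C1_field (S := S) setT X by move=> c' a' i; exact: sX.
have sG := @smooth_gram _ _ _ _ g c setT a.
have pG x (h : chart_image c setT x) := @posdef_gram_image _ _ _ _ g c setT x a h.
apply: (@Ck_on_eq _ _ _ _ (fun x => \sum_i partial i (fun y => field_in S c X y 0 i) x +
    \sum_i (\sum_k chr (gram g c) k k i x) * field_in S c X x 0 i)) => //.
  move=> x xA /=; have [pc Ex] := chart_image_dom (hc a) xA.
  rewrite (div_chart g a openT cX I pc) Ex (local_divE oi sG pG)// => i.
  exact: (Ck_on_derivable (i := i) (cX c a i) xA).
apply: Ck_onD => //; apply: Ck_on_sum => // i _.
  by apply: Ck_on_partial; exact: sX.
apply: Ck_onM => //; last exact: cX.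
by apply: Ck_on_sum => // k _; exact: (smooth_chr oi sG pG).
Qed.

End FieldRegularity.

Section BernsteinInequality.
Context {R : realType} {d : nat} {M : ptopologicalType}.
Context {S : smooth_structure R d M} (g : riemannian_metric S).
Context (vol : {measure set (borel M) -> \bar R}) (hvol : is_volume g vol).
Context (hM : hausdorff_space M) (Omega : set M) (nu : M -> 'rV[R]_d)
  (hO : class_Oplus g Omega nu) (finO : (vol Omega < +oo)%E).
Context (gamma kappa : R) (hgamma : 1 < gamma) (hkappa : 0 < kappa) (f u : M -> R).
Hypotheses (hric : forall (x : M) (xi : 'rV[R]_d), Omega x ->
     - kappa * tnorm g x xi ^+ 2 <= ricci g x xi xi)
  (hf1 : Ck S 1 Omega f) (hf0 : {within closure Omega, continuous f})
  (hu3 : Ck S 3 Omega u) (hu2 : Ck_closure S 2 Omega u)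
  (hsol : neumann_solution g Omega nu gamma f u).

Let hc c : atlas S c -> is_chart c := @atlas_chart _ _ _ S c.

Lemma Oplus_open : open Omega.
Proof. by case: hO => -[[]]. Qed.

Lemma Oplus_compact : compact (closure Omega).
Proof. by case: hO => -[]. Qed.

Let oO := Oplus_open.
Let cO := Oplus_compact.
Let hnu : outward_unit_normal g Omega nu. Proof. by case: hO. Qed.
Let hII : second_form_nonneg g Omega nu. Proof. by case: hO. Qed.
Let hN : forall p, boundary Omega p -> inner g p (grad_closure g Omega u p) (nu p) = 0.
Proof. by case: hsol. Qed.

Let gamma_gt0 : 0 < gamma := lt_trans ltr01 hgamma.
Let hu2' : Ck S 2 Omega u := CkW hu3.
Let hu1 : Ck S 1 Omega u := CkW hu2'.

Local Notation z := (grad_sqr g u).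
Local Notation w := (laplacian g u).

Lemma Oplus_cover p : closure Omega p ->
  Omega p \/ exists c i s, boundary_chart (S := S) Omega c i s p.
Proof.
move=> clp; case: (closure_cases oO clp) => [Op|bp]; first by left.
right; apply: (boundary_chart_exists oO hnu) => //.
by case: hO => -[].
Qed.

Lemma tnorm_sqr p v : tnorm g p v ^+ 2 = inner g p v v.
Proof. by rewrite /tnorm sqr_sqrtr// inner_ge0. Qed.

Lemma z_ge0 p : 0 <= z p. Proof. exact: inner_ge0. Qed.

Let hz2 : Ck S 2 Omega z := C2_grad_sqr g oO hu3.
Let hz1 : Ck S 1 Omega z := CkW hz2.

Lemma grad_u_trace c p : atlas S c -> chart_dom c p -> closure Omega p ->
  exists v : 'rV[R]_d, forall k, tends (chart_image c Omega) (chart_map c p)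
    (fun y => field_in S c (grad g u) y 0 k) (v 0 k).
Proof.
move=> a pc clp; have [v hv] := grad_tends g hu2 a pc clp.
exists v => k; apply: (tends_eq _ (hv k)) => y yA.
by rewrite (field_in_grad g a oO hu1 yA).
Qed.

Lemma grad_z_chart c y : atlas S c -> chart_image c Omega y ->
  field_in S c (grad g z) y =
  local_grad (gram g c) (energy (gram g c) (u \o chart_inv c)) y.
Proof.
move=> a yA; rewrite (field_in_grad g a oO hz1 yA) /local_grad.
apply: (congr1 (fun v : 'rV[R]_d => v *m _)); apply/rowP => i; rewrite [LHS]mxE [RHS]mxE.
apply: (partial_open _ (open_chart_image (hc a) oO) yA) => y' yA'.
exact: (grad_sqr_chart g a oO hu1 yA').
Qed.

Lemma grad_z_trace c p : atlas S c -> chart_dom c p -> closure Omega p ->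
  exists v : 'rV[R]_d, forall k, tends (chart_image c Omega) (chart_map c p)
    (fun y => field_in S c (grad g z) y 0 k) (v 0 k).
Proof.
move=> a pc clp; have [v hv] := grad_tends g hu2 a pc clp.
apply: (@exists_row R d (fun k t => tends (chart_image c Omega) (chart_map c p)
  (fun y => field_in S c (grad g z) y 0 k) t)) => k.
pose hw l := cid (partial_grad_tends g oO hu3 hu2 l k a pc clp).
have H := grad_energy_tends oO hu3 a pc hv (fun l => projT2 (hw l)).
eexists; apply: (tends_eq _ H) => y yA.
by rewrite (grad_z_chart a yA).
Qed.

Lemma z_bounded : exists B : R, forall q, Omega q -> `|z q| <= B.
Proof. exact: (has_trace_bound g cO grad_u_trace grad_u_trace). Qed.

Lemma f_bounded : exists B : R, forall q, Omega q -> `|f q| <= B.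
Proof.
have [B hB] : exists B : R, forall q, closure Omega q -> Omega q ->
    `|f q| <= B; last by exists B => q Oq; apply: hB => //; exact: subset_closure.
apply: compact_local_bound => // p clp.
move/subspace_continuousP: hf0 => /(_ p clp) h.
have := tends_bounded h => h'; exists (`|f p| + 1).
by apply: filterS h' => q k Oq; apply: k; exact: subset_closure.
Qed.

Lemma pde p : Omega p -> w p = gamma^-1 * z p `^ (gamma / 2) - f p.
Proof.
move=> Op; have [h _] := hsol; have := h p Op.
rewrite /tnorm -powR12_sqrt ?inner_ge0// -powRrM mulrC.
rewrite (mulrC 2^-1) -/(grad_sqr g u p) => <-; ring.
Qed.

Lemma w_bounded : exists B : R, forall q, Omega q -> `|w q| <= B.
Proof.
have [Z hZ] := z_bounded; have [B hB] := f_bounded.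
exists (gamma^-1 * `|Z| `^ (gamma / 2) + B) => q Oq; rewrite pde//.
apply: le_trans (ler_normB _ _) _; apply: lerD; last exact: hB.
have g0 := gamma_gt0.
have gi : 0 <= gamma^-1 by rewrite invr_ge0 ltW.
rewrite normrM (ger0_norm gi); apply: ler_wpM2l => //.
have h2 : 0 <= gamma / 2 by rewrite divr_ge0// ltW.
rewrite ger0_norm ?powR_ge0// ge0_ler_powR ?nnegrE ?z_ge0//.
by have := hZ q Oq; rewrite ger0_norm ?z_ge0// => /le_trans; apply; exact: ler_norm.
Qed.

Section TestFunction.
Context (F F' : R -> R) (k : R) (k0 : 0 < k).
Hypotheses (dF : forall t, is_derive t (1 : R) F (F' t)) (cF' : continuous F')
  (F0 : forall t, 0 <= F t) (Fk : forall t, t <= k -> F t = 0)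
  (F'k : forall t, t <= k -> F' t = 0).

Lemma F_continuous : continuous F.
Proof. by move=> t; apply: differentiable_continuous; apply/derivable1_diffP; have [] := dF t. Qed.

Lemma comp_bounded (H : R -> R) : continuous H -> exists B : R, forall q, Omega q -> `|H (z q)| <= B.
Proof.
move=> cH; have [Z hZ] := z_bounded.
have [||c _ hB] := @EVT_max R (fun t => `|H t|) (- `|Z|) `|Z|.
- by rewrite lerNl (le_trans _ (normr_ge0 Z))// oppr_le0.
- apply: continuous_subspaceT => t; apply: continuous_comp; first exact: cH.
  exact: norm_continuous.
exists `|H c| => q Oq; apply: hB; rewrite in_itv /= -ler_norml.
exact: le_trans (hZ q Oq) (ler_norm _).
Qed.

Let Y p := F (z p) *: (grad g z p + (2 * f p) *: grad g u p).

Let c2f : Ck S 1 Omega (fun p => 2 * f p).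
Proof. exact: (Ck_M oO (@Ck_cst _ _ _ _ _ _ _) hf1). Qed.

Let cgu : C1_field (S := S) Omega (grad g u) := C1_field_grad g oO hu2'.
Let cgz : C1_field (S := S) Omega (grad g z) := C1_field_grad g oO hz2.
Let cFz : Ck S 1 Omega (F \o z) := Ck_comp dF cF' oO hz1.

Let cX : C1_field (S := S) Omega (fun p => grad g z p + (2 * f p) *: grad g u p).
Proof. exact: (C1_fieldD oO cgz (C1_field_scale oO c2f cgu)). Qed.

Let cY : C1_field (S := S) Omega Y.
Proof. exact: (C1_field_scale oO cFz cX). Qed.

(** A minorant of the divergence of [Y] without third derivatives of [u] or derivatives of [f],
    hence bounded. The power of z may be singular at 0, but it is multiplied by [F], which vanishes
    below [k]. *)
Definition bernstein_density p : R :=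
  F (z p) * (2 * w p ^+ 2 / d%:R + z p `^ (gamma / 2 - 1) * inner g p (grad g z p) (grad g u p)
     - 2 * kappa * z p + 2 * f p * w p) +
  F' (z p) * (inner g p (grad g z p) (grad g z p) +
     2 * f p * inner g p (grad g z p) (grad g u p)).

Lemma bernstein_density_le p : Omega p -> bernstein_density p <= div g Y p.
Proof.
move=> Op; rewrite /Y (div_scale g oO cFz cX Op).
rewrite (grad_comp g dF hz1 Op) innerZl innerDr innerZr.
rewrite /bernstein_density lerD2r.
have [zk|zk] := leP (z p) k; first by rewrite [F (z p)]/= Fk//= ?mul0r /= Fk// mul0r.
rewrite /= ler_wpM2l//.
rewrite (divD g oO cgz (C1_field_scale oO c2f cgu) Op).
rewrite (div_scale g oO c2f cgu Op) (gradZ g _ hf1 Op) innerZl.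
have z0 : 0 < z p by exact: lt_trans zk.
have B := bochner_manifold g oO hu3 Op.
have ric := hric (grad g u p) Op; rewrite tnorm_sqr -/(grad_sqr g u p) in ric.
(* The derivative of the equation along grad u: the Laplacian of u plus f equals z^(gamma/2)/gamma,
   whose gradient is z^(gamma/2-1) grad z / 2. The level keeps z positive here, so the power is
   differentiable. *)
have E : inner g p (grad g w p) (grad g u p) + inner g p (grad g f p) (grad g u p) =
    2^-1 * z p `^ (gamma / 2 - 1) * inner g p (grad g z p) (grad g u p).
  have a := chart_at_atlas S p; have pc := chart_at_dom S p.
  have oi := open_chart_image (hc a) oO; have xA := chart_image_map pc Op.
  have cw := C1_manifold_laplacian g oO hu3.
  rewrite (inner_grad g _ a oO cw Op pc) (inner_grad g _ a oO hf1 Op pc).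
  rewrite (inner_grad g _ a oO hz1 Op pc) -big_split mulr_sumr.
  apply: eq_bigr => l _ /=; rewrite -mulrDr mulrCA; congr (_ * _).
  set c := chart_at S p in a pc oi xA *; set x := chart_map c p in xA *.
  have dz : derivable (z \o chart_inv c) x (delta_mx 0 l) := Ck_on_derivable (hz1 a) xA.
  have -> : partial l (w \o chart_inv c) x + partial l (f \o chart_inv c) x =
      partial l (fun y => gamma^-1 * z (chart_inv c y) `^ (gamma / 2)) x.
    rewrite -(partialD (Ck_on_derivable (cw c a) xA) (Ck_on_derivable (hf1 a) xA)).
    apply: (partial_open _ oi xA) => y /(chart_imageP _ _ (hc a))[_ Oy] /=.
    by rewrite pde// subrK.
  have Ez : (z \o chart_inv c) x = z p by rewrite /= /x (chart_mapK (hc a) pc).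
  have dP : is_derive (z p) (1 : R) (fun t => gamma^-1 * t `^ (gamma / 2))
      (gamma^-1 * (gamma / 2 * z p `^ (gamma / 2 - 1))).
    have zi : z p \in `]0, +oo[%R by rewrite in_itv /= z0.
    have d1 : derivable (fun t : R => t `^ (gamma / 2)) (z p) 1 by exact: derivable_powR.
    split; first exact: (@derivableZ _ _ _ _ gamma^-1 _ _ d1).
    apply: etrans (@deriveZ _ _ _ _ gamma^-1 _ _ d1) _; congr (_ * _).
    by rewrite -derive1E powR_derive1.
  rewrite -Ez in dP; have [_ E] := is_derive_comp1 dz dP.
  apply: etrans E _; rewrite Ez; have g0 : gamma != 0 := lt0r_neq0 gamma_gt0.
  by rewrite /partial; field.
rewrite -/(laplacian g z p) -/(laplacian g u p).
exact: bernstein_algebra B ric E.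
Qed.

Let gb (X X' : M -> 'rV[R]_d) : C1_field (S := S) Omega X -> C1_field (S := S) Omega X' ->
  measurable_fun (Omega : set (borel M)) ((fun p => inner g p (X p) (X' p)) : borel M -> R).
Proof. by move=> cX1 cX2; apply: (Ck_measurable oO); exact: Ck_inner. Qed.

Lemma measurable_z : measurable_fun (Omega : set (borel M)) (z : borel M -> R).
Proof. exact: (Ck_measurable oO hz1). Qed.

Lemma measurable_f : measurable_fun (Omega : set (borel M)) (f : borel M -> R).
Proof. exact: (Ck_measurable oO hf1). Qed.

Lemma measurable_w : measurable_fun (Omega : set (borel M)) (w : borel M -> R).
Proof. exact: (Ck_measurable oO (C1_manifold_laplacian g oO hu3)). Qed.

Lemma measurable_compz (H : R -> R) : measurable_fun setT H ->
  measurable_fun (Omega : set (borel M)) ((fun p => H (z p)) : borel M -> R).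
Proof. by move=> mH; exact: (measurableT_comp mH measurable_z). Qed.

Lemma continuous_measurable1 (H : R -> R) : continuous H -> measurable_fun setT H.
Proof. by move=> cH; exact: continuous_measurable_fun. Qed.

Lemma measurable_density :
  measurable_fun (Omega : set (borel M)) (bernstein_density : borel M -> R).
Proof.
have mF := measurable_compz (continuous_measurable1 F_continuous).
have mF' := measurable_compz (continuous_measurable1 cF').
have mzu := gb cgz cgu; have mzz := gb cgz cgz.
have mw := measurable_w; have mf := measurable_f; have mz := measurable_z.
have mp := measurable_compz (@measurable_powR R (gamma / 2 - 1)).
have mc (r : R) : measurable_fun (Omega : set (borel M)) (cst r : borel M -> R).
  exact: measurable_cst.
have m2f := measurable_funM (mc 2) mf.
apply: measurable_funD; apply: measurable_funM => //.
  apply: measurable_funD; last exact: (measurable_funM m2f mw).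
  apply: measurable_funB; last exact: (measurable_funM (mc (2 * kappa)) mz).
  apply: measurable_funD; last exact: (measurable_funM mp mzu).
  apply: measurable_funM; last exact: (mc _).
  apply: measurable_funM; first exact: (mc _).
  exact: (measurable_funX 2 mw).
exact: (measurable_funD mzz (measurable_funM m2f mzu)).
Qed.

Lemma density_bounded : exists B : R, forall p, Omega p -> `|bernstein_density p| <= B.
Proof.
have [Z hZ] := z_bounded; have [W hW] := w_bounded; have [Ff hF] := f_bounded.
have [Bu hBu] := has_trace_bound g cO grad_z_trace grad_u_trace.
have [Bz hBz] := has_trace_bound g cO grad_z_trace grad_z_trace.
have [BF hBF] := comp_bounded F_continuous.
have [BF' hBF'] := comp_bounded cF'.
(* The exponent may be negative, so the power is bounded only on an interval starting at the level
   [k > 0]. *)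
have [||c _ hP] := @EVT_max R (fun t => t `^ (gamma / 2 - 1)) k (k + `|Z|).
- by rewrite lerDl.
- apply: continuous_in_subspaceT => t; rewrite inE /= in_itv /= => /andP[kt _].
  apply: differentiable_continuous; apply/derivable1_diffP; apply: derivable_powR.
  by rewrite in_itv /= andbT (lt_le_trans k0 kt).
pose P := c `^ (gamma / 2 - 1).
exists (`|BF| * (2 * `|W| ^+ 2 / d%:R + P * `|Bu| + 2 * kappa * `|Z| + 2 * `|Ff| * `|W|) +
  `|BF'| * (`|Bz| + 2 * `|Ff| * `|Bu|)) => p Op.
have le_abs (x y : R) : x <= y -> x <= `|y| by move=> /le_trans; apply; exact: ler_norm.
have [zk|zk] := leP (z p) k.
  rewrite /bernstein_density Fk// F'k// !mul0r addr0 normr0.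
  by rewrite !(addr_ge0, mulr_ge0, divr_ge0)// ?powR_ge0// ltW.
apply: le_trans (ler_normD _ _) _; apply: lerD; rewrite normrM; apply: ler_pM => //.
- exact/le_abs/hBF.
- apply: le_trans (ler_normD _ _) _; apply: lerD; last first.
    rewrite normrM (normrM 2) ger0_norm//; apply: ler_pM; rewrite ?mulr_ge0//.
      by apply: ler_wpM2l => //; exact/le_abs/hF.
    exact/le_abs/hW.
  apply: le_trans (ler_normB _ _) _; apply: lerD; last first.
    have k2 : 0 <= 2 * kappa by rewrite mulr_ge0// ltW.
    rewrite normrM (ger0_norm k2); apply: ler_wpM2l => //.
    exact/le_abs/hZ.
  apply: le_trans (ler_normD _ _) _; apply: lerD.
    rewrite ger0_norm; last by rewrite divr_ge0// mulr_ge0// sqr_ge0.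
    apply: ler_wpM2r; rewrite ?invr_ge0//; apply: ler_wpM2l => //.
    rewrite -[w p ^+ 2]real_normK ?num_real// lerXn2r ?nnegrE//; exact/le_abs/hW.
  rewrite normrM ler_pM//; last exact/le_abs/hBu.
  rewrite ger0_norm ?powR_ge0//; apply: hP; rewrite in_itv /= ltW//=.
  apply: ler_wpDl; first exact: ltW.
  by apply: le_abs; apply: le_trans (ler_norm _) (hZ p Op).
- exact/le_abs/hBF'.
- apply: le_trans (ler_normD _ _) _; apply: lerD; first exact/le_abs/hBz.
  rewrite normrM (normrM 2) ger0_norm//; apply: ler_pM; rewrite ?mulr_ge0//.
    by apply: ler_wpM2l => //; exact/le_abs/hF.
  exact/le_abs/hBu.
Qed.

Theorem bernstein_integral_le0 : (\int[vol]_(p in Omega) (bernstein_density p)%:E <= 0)%E.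
Proof.
have [B hB] := density_bounded.
have [Ff hF] := f_bounded; have [BF hBF] := comp_bounded F_continuous.
have vY c q i : vec_in S c q (Y q) 0 i = F (z q) * (vec_in S c q (grad g z q) 0 i +
    2 * f q * vec_in S c q (grad g u q) 0 i).
  by rewrite /Y vec_inZ vec_inD vec_inZ [LHS]mxE; congr (_ * _); rewrite [LHS]mxE;
    congr (_ + _); rewrite [LHS]mxE.
apply: (@divergence_le0 _ _ _ _ g vol hvol hM Omega oO cO finO Y bernstein_density B cY).
- move=> c p a pc clp.
  have [v hv] := grad_z_trace a pc clp; have [v' hv'] := grad_u_trace a pc clp.
  exists (`|BF| * \sum_j ((`|v 0 j| + 1) + 2 * `|Ff| * (`|v' 0 j| + 1))).
  have [od _ _ _ _] := hc a.
  have hz' : \forall y \near chart_map c p, forall j, chart_image c Omega y ->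
      `|field_in S c (grad g z) y 0 j| <= `|v 0 j| + 1.
    have hj j := tends_bounded (hv j).
    exact: (@filter_forall _ _ _ _ (nbhs_filter (chart_map c p)) hj).
  have hu' : \forall y \near chart_map c p, forall j, chart_image c Omega y ->
      `|field_in S c (grad g u) y 0 j| <= `|v' 0 j| + 1.
    have hj j := tends_bounded (hv' j).
    exact: (@filter_forall _ _ _ _ (nbhs_filter (chart_map c p)) hj).
  have h1 := near_chart_map a pc hz'; have h2 := near_chart_map a pc hu'.
  have h3 := open_nbhs_nbhs (conj od pc).
  apply: filterS3 h1 h2 h3 => q k1 k2 qc Oq i.
  have := k1 i (chart_image_map qc Oq); have := k2 i (chart_image_map qc Oq).
  rewrite /field_in (chart_mapK (hc a) qc) => e1 e2.
  rewrite vY normrM; apply: ler_pM => //; first exact: le_trans (hBF q Oq) (ler_norm _).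
  rewrite (bigD1 i)//=; apply: ler_wpDr.
    by apply: sumr_ge0 => j _; rewrite !(addr_ge0, mulr_ge0).
  apply: le_trans (ler_normD _ _) _; apply: lerD => //.
  rewrite !normrM ger0_norm// !ler_pM ?mulr_ge0//.
  exact: le_trans (hF q Oq) (ler_norm _).
- move=> c i s p delta b d0; have [a pc p0 s2 _] := b.
  have [L sL hL] := grad_sqr_normal_limit oO hu3 hu2 hnu hII hN b.
  have hV := normal_component_tends0 oO hu3 hu2 hnu hN b.
  (* The normal component of [Y] is F(z) (x + 2 f y), where s x tends to a non-negative number and y
     to 0. With errors at most [e] in both limits and the bounds of F(z) and f, the loss is at most
     [delta]; the added constants keep the denominator positive. *)
  pose e := delta / ((`|BF| + 1) * (2 * `|Ff| + 2)).
  have BF0 : 0 < `|BF| + 1 by rewrite ltr_wpDl.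
  have Ff0 : 0 < 2 * `|Ff| + 2 by rewrite ltr_wpDl// mulr_ge0.
  have e0 : 0 < e by rewrite divr_gt0// mulr_gt0.
  have s1 : `|s| = 1.
    have : `|s| ^+ 2 = 1 by rewrite -normrX expr2 s2 normr1.
    have := normr_ge0 s; move: `|s| => t t0 tt; nra.
  have h1 := near_chart_map a pc ((tendsP _ _ _ _).1 hL e e0).
  have h2 := near_chart_map a pc ((tendsP _ _ _ _).1 hV e e0).
  have [od _ _ _ _] := hc a.
  have h3 := open_nbhs_nbhs (conj od pc).
  apply: filterS3 h1 h2 h3 => q k1 k2 qc Oq.
  have qA := chart_image_map qc Oq.
  have := k1 qA; have := k2 qA.
  have -> : local_grad (gram g c) (energy (gram g c) (u \o chart_inv c)) (chart_map c q) =
      vec_in S c q (grad g z q).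
    by rewrite -(grad_z_chart a qA) /field_in (chart_mapK (hc a) qc).
  have -> : local_grad (gram g c) (u \o chart_inv c) (chart_map c q) =
      vec_in S c q (grad g u q) by rewrite (grad_chart g a oO hu1 Oq qc).
  rewrite vY; move: (vec_in S c q (grad g z q) 0 i) (vec_in S c q (grad g u q) 0 i) => x y.
  rewrite sub0r normrN => hy hx.
  have hF0 := F0 (z q); have := le_trans (ler_norm _) (hBF q Oq).
  move/le_trans => /(_ _ (ler_norm BF)) => hFB.
  have fb : `|f q| <= `|Ff| := le_trans (hF q Oq) (ler_norm _).
  have k3 : - (e * (2 * `|Ff| + 2)) <= s * (x + 2 * f q * y).
    have j1 : - e <= s * x.
      have : `|s * (L - x)| <= e by rewrite normrM s1 mul1r.
      by rewrite ler_norml => /andP[]; rewrite mulrBr; move: sL; move: (s * L) (s * x) => l m; lra.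
    have j2 : - (2 * `|Ff| * e) <= s * (2 * f q * y).
      rewrite lerNl; apply: le_trans (ler_norm _) _; rewrite normrN !normrM s1 mul1r ger0_norm//.
      by rewrite !ler_pM ?mulr_ge0.
    rewrite (mulrDr s); apply: le_trans (lerD j1 j2); rewrite -subr_ge0.
    suff -> : - e + - (2 * `|Ff| * e) - - (e * (2 * `|Ff| + 2)) = e by exact: ltW.
    by move: (`|Ff|) (e) => l m; ring.
  have -> : s * (F (z q) * (x + 2 * f q * y)) = F (z q) * (s * (x + 2 * f q * y)) by ring.
  have j3 : F (z q) * (- (e * (2 * `|Ff| + 2))) <= F (z q) * (s * (x + 2 * f q * y)).
    by rewrite ler_wpM2l.
  apply: le_trans j3; rewrite mulrN lerN2.
  have -> : delta = (`|BF| + 1) * (e * (2 * `|Ff| + 2)).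
    rewrite /e; field.
    by rewrite !lt0r_neq0.
  apply: ler_wpM2r; first by apply: mulr_ge0; exact: ltW.
  by apply: le_trans hFB _; rewrite lerDl.
- exact: measurable_density.
- exact: hB.
- exact: bernstein_density_le.
- exact: Oplus_cover.
Qed.

End TestFunction.

(** * Functions of z as Sobolev functions *)

Section SobolevTest.
Context (F F' : R -> R).
Hypotheses (dF : forall t, is_derive t (1 : R) F (F' t)) (cF' : continuous F').

Let cFz : Ck S 1 Omega (F \o z) := Ck_comp dF cF' oO hz1.
Let cF : continuous F := F_continuous dF.

Section TestField.
Context (X : M -> 'rV[R]_d) (sX : smooth_field S setT X) (K : set M) (cK : compact K)
  (KO : K `<=` Omega) (X0 : forall p, ~ K p -> X p = 0).

Let cXT : C1_field (S := S) setT X.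
Proof. by move=> c a i; exact: sX. Qed.

Let cX : C1_field (S := S) Omega X.
Proof. move=> c a i; apply: (@Ck_on_sub _ _ _ (chart_image c setT) _ _ _ (cXT a i)).
by apply: image_subset; exact: setIS. Qed.

Lemma test_field_trace c p : atlas S c -> chart_dom c p -> closure Omega p ->
  exists v : 'rV[R]_d, forall k, tends (chart_image c Omega) (chart_map c p)
    (fun y => field_in S c X y 0 k) (v 0 k).
Proof.
move=> a pc _; exists (field_in S c X (chart_map c p)) => k.
apply: (@tends_continuous R _ _ (chart_map c p) (fun y => field_in S c X y 0 k)).
exact: (Ck_on_continuous (cXT a k) (chart_image_map pc I)).
Qed.

Lemma div_test_bounded : exists B : R, forall q, Omega q -> `|div g X q| <= B.
Proof.
have [B hB] : exists B : R, forall q, closure Omega q -> Omega q ->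
    `|div g X q| <= B; last by exists B => q Oq; apply: hB => //; exact: subset_closure.
apply: compact_local_bound => // p _; exists (`|div g X p| + 1).
have cd : {for p, continuous (div g X)} := Ck_continuous openT (Ck_div g sX) I.
have := @cvgr_norm_le _ _ _ _ _ _ _ cd (`|div g X p| + 1).
rewrite ltrDl ltr01 => /(_ _ isT); apply: filterS => q h _; exact: h.
Qed.

(** The divergence of F(z) X. Since [X] has compact support in the domain, no boundary condition is
    needed for its integral. *)
Definition green_density p : R :=
  F (z p) * div g X p + F' (z p) * inner g p (grad g z p) (X p).

Lemma measurable_green1 : measurable_fun (Omega : set (borel M))
  ((fun p => F (z p) * div g X p) : borel M -> R).
Proof.
have md : measurable_fun (Omega : set (borel M)) (div g X : borel M -> R).
  apply: (@measurable_funS _ _ (borel M) _ setT) => //.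
  exact: (Ck_measurable openT (Ck_div g sX)).
exact: (measurable_funM (measurable_compz (continuous_measurable1 cF)) md).
Qed.

Lemma measurable_green2 : measurable_fun (Omega : set (borel M))
  ((fun p => F' (z p) * inner g p (grad g z p) (X p)) : borel M -> R).
Proof.
have mi := Ck_measurable oO (Ck_inner g oO (C1_field_grad g oO hz2) cX).
exact: (measurable_funM (measurable_compz (continuous_measurable1 cF')) mi).
Qed.

Lemma green_bounded : exists B : R, forall p, Omega p ->
  `|F (z p) * div g X p| <= B /\ `|F' (z p) * inner g p (grad g z p) (X p)| <= B.
Proof.
have [B1 h1] := comp_bounded cF; have [B2 h2] := comp_bounded cF'.
have [B3 h3] := div_test_bounded.
have [B4 h4] := has_trace_bound g cO grad_z_trace test_field_trace.
exists (`|B1| * `|B3| + `|B2| * `|B4|) => p Op; split.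
  rewrite normrM ler_wpDr ?mulr_ge0//; apply: ler_pM => //.
    exact: le_trans (h1 p Op) (ler_norm _).
  exact: le_trans (h3 p Op) (ler_norm _).
rewrite normrM ler_wpDl ?mulr_ge0//; apply: ler_pM => //.
  exact: le_trans (h2 p Op) (ler_norm _).
exact: le_trans (h4 p Op) (ler_norm _).
Qed.

Lemma green_integral_le0 : (\int[vol]_(p in Omega) (green_density p)%:E <= 0)%E.
Proof.
have [B hB] := green_bounded.
pose Y p := F (z p) *: X p.
have cY : C1_field (S := S) Omega Y := C1_field_scale oO cFz cX.
have [BF hBF] := comp_bounded cF.
apply: (@divergence_le0 _ _ _ _ g vol hvol hM Omega oO cO finO Y green_density (B + B) cY).
- move=> c p a pc clp; have [v hv] := test_field_trace a pc clp.
  exists (`|BF| * \sum_j (`|v 0 j| + 1)).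
  have [od _ _ _ _] := hc a.
  have hv' : \forall y \near chart_map c p, forall j, chart_image c Omega y ->
      `|field_in S c X y 0 j| <= `|v 0 j| + 1.
    have hj j := tends_bounded (hv j).
    exact: (@filter_forall _ _ _ _ (nbhs_filter (chart_map c p)) hj).
  have h1 := near_chart_map a pc hv'; have h2 := open_nbhs_nbhs (conj od pc).
  apply: filterS2 h1 h2 => q k qc Oq i.
  have := k i (chart_image_map qc Oq).
  rewrite /field_in (chart_mapK (hc a) qc) /Y vec_inZ => e1.
  rewrite [X in `|X|]mxE normrM; apply: ler_pM => //; first exact: le_trans (hBF q Oq) (ler_norm _).
  rewrite (bigD1 i)//=; apply: ler_wpDr => //.
  by apply: sumr_ge0 => j _; rewrite addr_ge0.
- move=> c i s p delta b d0.
  have /(boundaryE oO)[_ nOp] := boundary_chart_boundary oO b.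
  have oK : open (~` K) by apply: closed_openC; exact: compact_closed.
  have nK : nbhs p (~` K) by apply: open_nbhs_nbhs; split => // Kp; exact/nOp/KO.
  apply: filterS nK => q nKq _.
  by rewrite /Y (X0 nKq) scaler0 /vec_in mul0mx [X in s * X]mxE mulr0 oppr_le0 ltW.
- exact: (measurable_funD measurable_green1 measurable_green2).
- move=> p Op; have [h1 h2] := hB p Op.
  exact: le_trans (ler_normD _ _) (lerD h1 h2).
- move=> p Op; rewrite /Y (div_scale g oO cFz cX Op) (grad_comp g dF hz1 Op) innerZl.
  exact: lexx.
- exact: Oplus_cover.
Qed.

End TestField.
End SobolevTest.

Lemma bounded_Lp_norm (h : M -> R) (r B : R) : 0 < r ->
  measurable_fun (Omega : set (borel M)) (h : borel M -> R) ->
  (forall p, Omega p -> `|h p| <= B) -> (Lp_norm vol Omega r h < +oo)%E.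
Proof.
move=> r0 mh hB; rewrite /Lp_norm.
have mp : measurable_fun (Omega : set (borel M)) ((fun p => `|h p| `^ r) : borel M -> R).
  apply: (measurableT_comp (@measurable_powR R r)); exact: measurableT_comp mh.
have hi : vol.-integrable Omega (EFin \o (fun p => `|h p| `^ r)).
  apply: (bounded_integrable (B := `|B| `^ r) (borel_open oO) finO mp) => p Op.
  rewrite ger0_norm ?powR_ge0// ge0_ler_powR ?nnegrE//; first exact: ltW.
  exact: le_trans (hB p Op) (ler_norm _).
have := integrable_fin_num (borel_open oO) hi; rewrite /comp.
by move=> /fineK <-; rewrite poweR_EFin ltry.
Qed.

Section SobolevTestFunction.
Context (F F' : R -> R).
Hypotheses (dF : forall t, is_derive t (1 : R) F (F' t)) (cF' : continuous F').

(** The divergence theorem at hand is an inequality; used for [F] and for [- F] it gives the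
    equality that defines the weak gradient. *)
Lemma sobolev_test : sobolev12 g vol Omega (fun p => F (z p)) (fun p => F' (z p) *: grad g z p).
Proof.
have cF : continuous F := F_continuous dF.
have [B1 h1] := comp_bounded cF; have [B2 h2] := comp_bounded cF'.
have [Bz hBz] := has_trace_bound g cO grad_z_trace grad_z_trace.
have mF := measurable_compz (continuous_measurable1 cF).
have mF' := measurable_compz (continuous_measurable1 cF').
have mzz : measurable_fun (Omega : set (borel M))
    ((fun p => inner g p (grad g z p) (grad g z p)) : borel M -> R).
  by apply: (Ck_measurable oO); apply: (Ck_inner g oO); exact: (C1_field_grad g oO hz2).
split; [split=> //| | |].
- move=> c a i; have [od _ _ _ _] := hc a.
  have oOc : open (Omega `&` chart_dom c) by exact: openI.
  have -> : (fun p => vec_in S c p (F' (z p) *: grad g z p) 0 i) =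
      (fun p => F' (z p) * vec_in S c p (grad g z p) 0 i).
    by apply/funext => p; rewrite vec_inZ mxE.
  apply: measurable_funM.
    by apply: measurable_funS mF'; [exact: borel_open|exact: subIsetl].
  apply: (@continuous_measurableR R M _ (fun p => vec_in S c p (grad g z p) 0 i) oOc).
  move=> p [Op pc].
  have cg := C1_field_grad g oO hz2 a i.
  have h := Ck_on_continuous cg (chart_image_map pc Op).
  have hcm := chart_map_continuous (hc a) pc.
  have hh : {for p, continuous ((fun x => field_in S c (grad g z) x 0 i) \o chart_map c)}.
    exact: continuous_comp hcm h.
  have E : \forall q \near p, ((fun x => field_in S c (grad g z) x 0 i) \o chart_map c) q =
      vec_in S c q (grad g z q) 0 i.
    apply: filterS (open_nbhs_nbhs (conj od pc)) => q qc.
    by rewrite /= /field_in (chart_mapK (hc a) qc).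
  exact: near_continuous E hh.
- exact: (bounded_Lp_norm _ mF h1).
- apply: (@bounded_Lp_norm _ _ (`|B2| * Num.sqrt `|Bz|)) => //.
    have -> : (fun p => tnorm g p (F' (z p) *: grad g z p)) =
        (fun p => `|F' (z p)| * Num.sqrt (inner g p (grad g z p) (grad g z p))).
      by apply/funext => p; rewrite tnormZ.
    apply: measurable_funM; first exact: measurableT_comp mF'.
    exact: (measurableT_comp (continuous_measurable_fun (@sqrt_continuous R)) mzz).
  move=> p Op; rewrite ger0_norm ?sqrtr_ge0// tnormZ; apply: ler_pM => //.
  - exact: sqrtr_ge0.
  - exact: le_trans (h2 p Op) (ler_norm _).
  apply: ler_wsqrtr.
  by apply: le_trans (ler_norm _) _; apply: le_trans (hBz p Op) (ler_norm _).
- move=> X [sX [K cK [KO X0]]].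
  have le1 := green_integral_le0 dF cF' sX cK KO X0.
  have dF2 t : is_derive t (1 : R) (fun t => - F t) (- F' t) by exact: is_deriveN.
  have cF2 : continuous (fun t => - F' t) by move=> t; apply: continuousN; exact: cF'.
  have le2 := green_integral_le0 dF2 cF2 sX cK KO X0.
  have [B hB] := green_bounded dF cF' sX.
  have i1 := bounded_integrable (borel_open oO) finO (measurable_green1 dF sX) (fun p Op => (hB p Op).1).
  have i2 := bounded_integrable (borel_open oO) finO (measurable_green2 cF' sX) (fun p Op => (hB p Op).2).
  have E : (fun p => (inner g p (F' (z p) *: grad g z p) (X p))%:E) =
      (EFin \o (fun p => F' (z p) * inner g p (grad g z p) (X p))).
    by apply/funext => p; rewrite innerZl.
  rewrite E; move: le1 le2; rewrite /green_density.
  have -> : (fun p => (F (z p) * div g X p + F' (z p) * inner g p (grad g z p) (X p))%:E) =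
    ((EFin \o (fun p => F (z p) * div g X p)%R) \+
     (EFin \o (fun p => F' (z p) * inner g p (grad g z p) (X p))%R))%E by [].
  have -> : (fun p => (- F (z p) * div g X p + - F' (z p) * inner g p (grad g z p) (X p))%:E) =
    (fun p => - ((EFin \o (fun p => F (z p) * div g X p)%R) p +
     (EFin \o (fun p => F' (z p) * inner g p (grad g z p) (X p))%R) p))%E.
    by apply/funext => p /=; rewrite !mulNr -opprD.
  have mO := borel_open oO.
  rewrite integralN; last exact: (integrable_add_def mO (integrableD mO i1 i2)).
  rewrite integralD//; try exact: borel_open.
  have := integrable_fin_num (borel_open oO) i1; have := integrable_fin_num (borel_open oO) i2.
  rewrite /comp; move: (integral _ _ _) (integral _ _ _) => [a| |] [b| |]//= _ _.
  rewrite -EFinD !lee_fin oppr_le0 => l1 l2; apply/(congr1 EFin)/eqP.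
  by rewrite eq_le -subr_le0 opprK l1 -subr_ge0 opprK l2.
Qed.

End SobolevTestFunction.

End BernsteinInequality.

(** * Pointwise estimates *)

Lemma powR_continuous {R : realType} (e t : R) : 0 < t -> {for t, continuous (fun s : R => s `^ e)}.
Proof.
move=> t0; apply: differentiable_continuous; apply/derivable1_diffP.
by have [] := is_derive1_powR e t0.
Qed.

Lemma pos_powR_continuous {R : realType} (e : R) : 0 < e -> continuous (fun t : R => pos t `^ e).
Proof.
move=> e0 t; have [t0|t0|->] := ltgtP t 0.
- have E : \forall s \near t, 0 = pos s `^ e.
    near=> s; rewrite pos_0 ?powR0 ?gt_eqF// ltW//; near: s; exact: lt_nbhsl.
  exact: near_continuous E (@cst_continuous _ _ _ _).
- have E : \forall s \near t, s `^ e = pos s `^ e.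
    near=> s; rewrite pos_id// ltW//; near: s; exact: lt_nbhsr.
  apply: (near_continuous E); exact: powR_continuous.
apply/(@cvgrPdist_le _ R^o) => eps eps0; rewrite pos_0// powR0 ?gt_eqF//.
have h : 0 < eps `^ e^-1 by rewrite powR_gt0.
near=> s; rewrite sub0r normrN ger0_norm ?powR_ge0//.
have -> : eps = (eps `^ e^-1) `^ e by rewrite -powRrM mulVf ?gt_eqF// powRr1// ltW.
apply: ge0_ler_powR; rewrite ?nnegrE ?pos_ge0 ?powR_ge0//; first exact: ltW.
have [s0|s0] := leP s 0; first by rewrite pos_0// powR_ge0.
rewrite pos_id ?ltW//; near: s; exact: lt_nbhsl.
Unshelve. all: by end_near. Qed.

Lemma is_derive_pos_powR {R : realType} (a t : R) : 1 < a ->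
  is_derive t (1 : R) (fun t => pos t `^ a) (a * pos t `^ (a - 1)).
Proof.
move=> a1; have a0 : 0 < a by exact: lt_trans a1.
have a10 : 0 < a - 1 by rewrite subr_gt0.
have [t0|t0|->] := ltgtP t 0.
- rewrite pos_0 ?(ltW t0)// powR0 ?gt_eqF// mulr0.
  apply: (near_eq_is_derive (f := fun=> 0)).
  near=> s; rewrite pos_0 ?powR0 ?gt_eqF// ltW//; near: s; exact: lt_nbhsl.
- rewrite pos_id ?(ltW t0)//.
  apply: (near_eq_is_derive (f := fun s => s `^ a)); last exact: is_derive1_powR.
  near=> s; rewrite pos_id// ltW//; near: s; exact: lt_nbhsr.
rewrite pos_0// powR0 ?gt_eqF// mulr0.
have c : (fun h : R => pos `|h| `^ (a - 1)) @ (0 : R)^' --> (0 : R).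
  have := @pos_powR_continuous R _ a10 0; rewrite /continuous_at pos_0// powR0 ?gt_eqF// => c.
  apply: (cvg_comp (fun h : R => `|h|) (fun h => pos h `^ (a - 1)) _ c).
  have := @norm_continuous _ R (0 : R); rewrite /continuous_at normr0 => c'.
  exact: cvg_within_filter c'.
have D : (fun h : R => h^-1 *: ((fun t => pos t `^ a) (h *: 1 + 0) - pos 0 `^ a)) @ (0 : R)^' --> (0 : R).
  apply/cvgr0Pnorm_le => eps eps0; move/cvgr0Pnorm_le : c => /(_ eps eps0); apply: filterS => h.
  apply: le_trans; rewrite addr0 [h *: 1]mulr1 (pos_0 (lexx 0)) powR0 ?gt_eqF// subr0 normrZ normfV.
  have [h0|h0] := leP h 0; first by rewrite pos_0// powR0 ?gt_eqF// normr0 mulr0.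
  rewrite (gtr0_norm h0) (pos_id (ltW h0)) !ger0_norm ?powR_ge0//.
  by rewrite -(mulr_powRB1 (ltW h0) a0) mulKf ?gt_eqF.
split; first by apply/cvg_ex; exists 0.
exact/cvg_lim.
Unshelve. all: by end_near. Qed.

Section TruncatedPower.
Context {R : realType}.
Implicit Types k a b t : R.

(* For t < 0 the library has t `^ b = 1; the first factor vanishes there. *)
Definition trunc_pow k a b t : R := pos (t - k) `^ a * t `^ b.
Definition trunc_pow' k a b t : R := a * trunc_pow k (a - 1) b t + b * trunc_pow k a (b - 1) t.

Lemma trunc_pow_ge0 k a b t : 0 <= trunc_pow k a b t.
Proof. by rewrite mulr_ge0 ?powR_ge0. Qed.

Lemma trunc_pow0 k a b t : 0 < a -> t <= k -> trunc_pow k a b t = 0.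
Proof.
by move=> a0 tk; rewrite /trunc_pow pos_0 ?subr_le0// powR0 ?mul0r// gt_eqF.
Qed.

Lemma trunc_pow'0 k a b t : 1 < a -> t <= k -> trunc_pow' k a b t = 0.
Proof.
move=> a1 tk; rewrite /trunc_pow' !trunc_pow0 ?mulr0 ?addr0// ?subr_gt0//.
exact: lt_trans a1.
Qed.

Lemma trunc_pow_gt k a b t : k < t -> trunc_pow k a b t = (t - k) `^ a * t `^ b.
Proof. by move=> kt; rewrite /trunc_pow pos_id// subr_ge0 ltW. Qed.

Lemma near_trunc_pow0 k a b t : 0 < k -> 0 < a -> t <= 0 ->
  \forall s \near t, 0 = trunc_pow k a b s.
Proof.
move=> k0 a0 t0; have tk : t < k by exact: le_lt_trans k0.
near=> s; rewrite trunc_pow0// ltW//; near: s; exact: lt_nbhsl.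
Unshelve. all: by end_near. Qed.

Lemma trunc_pow_continuous k a b : 0 < k -> 0 < a -> continuous (trunc_pow k a b).
Proof.
move=> k0 a0 t; have [t0|t0] := leP t 0.
  exact: near_continuous (near_trunc_pow0 b k0 a0 t0) (@cst_continuous _ _ _ _).
have c1 : {for t, continuous (fun s : R => s - k)}.
  by apply: continuousB; [exact: cvg_id|exact: cst_continuous].
have c2 : {for t, continuous (fun s : R => pos (s - k) `^ a)}.
  have c3 := @pos_powR_continuous R a a0 (t - k).
  exact: (continuous_comp c1 c3).
exact: (continuousM c2 (powR_continuous t0)).
Qed.

Lemma is_derive_trunc_pow k a b t : 0 < k -> 1 < a ->
  is_derive t (1 : R) (trunc_pow k a b) (trunc_pow' k a b t).
Proof.
move=> k0 a1; have a0 : 0 < a by exact: lt_trans a1.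
have [t0|t0] := leP t 0.
  rewrite trunc_pow'0// ?(le_trans t0 (ltW k0))//.
  exact: (near_eq_is_derive (near_trunc_pow0 b k0 a0 t0)).
have d1 := is_derive_pos_powR (t - k) a1.
have d0 : is_derive t (1 : R) (fun s : R => s - k) 1.
  by have := @is_deriveB _ _ _ id (cst k) t 1 1 0 _ _; rewrite subr0; apply.
have d2 : is_derive t (1 : R) (fun s : R => pos (s - k) `^ a) (a * pos (t - k) `^ (a - 1)).
  by have := @is_derive1_comp _ (fun t => pos t `^ a) (fun s => s - k) t _ _ d1 d0; rewrite mulr1.
have d3 := is_derive1_powR b t0.
have d4 : is_derive t (1 : R) (trunc_pow k a b) _ := is_deriveM d2 d3.
apply: (is_derive_eq d4); rewrite /trunc_pow' /trunc_pow /GRing.scale /=; ring.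
Qed.

Lemma trunc_pow'_continuous k a b : 0 < k -> 1 < a -> continuous (trunc_pow' k a b).
Proof.
move=> k0 a1 t; have a0 : 0 < a by exact: lt_trans a1.
have a10 : 0 < a - 1 by rewrite subr_gt0.
have c1 := @trunc_pow_continuous k (a - 1) b k0 a10 t.
have c2 := @trunc_pow_continuous k a (b - 1) k0 a0 t.
have cc c : {for t, continuous (cst c : R -> R)} by exact: cst_continuous.
exact: (continuousD (continuousM (cc a) c1) (continuousM (cc b) c2)).
Qed.

End TruncatedPower.

Section PointwiseEstimates.
Context {R : realType}.
Implicit Types x y z p r : R.

(** The arithmetic-geometric inequality in the form in which a cross term [x] is absorbed by two
    good terms. *)
Lemma sqr_le_opp x p r : 0 <= p -> 0 <= r -> x ^+ 2 <= 4 * p * r -> - (p + r) <= x.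
Proof.
move=> p0 r0 h; rewrite lerNl; apply: le_trans (ler_norm _) _; rewrite normrN.
rewrite -(@ler_pXn2r _ 2) ?nnegrE ?addr_ge0// real_normK ?num_real//.
apply: le_trans h _; rewrite -subr_ge0.
have -> : (p + r) ^+ 2 - 4 * p * r = (p - r) ^+ 2 by ring.
exact: sqr_ge0.
Qed.

(** To be read with y = z - k, G = |grad z|^2, H = <grad z, grad u>, U = z^(gamma-1), V =
    z^(gamma/2-1), W = z^(gamma/2), S = y^(a-1) z^(b+1) and w the Laplacian of u. The cross terms F
    V H and 2 f F' H each use up a quarter of F' G, which leaves one half. *)
Lemma bernstein_lower (n gamma kappa m Mx F F' y z f G H U V W S w : R) :
  1 <= n -> 0 < gamma -> 0 < m -> 0 <= F -> 0 <= F' -> 0 <= y -> 0 <= z -> 0 <= G ->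
  m * F <= F' * y -> z * F' <= Mx * S -> F <= S -> H ^+ 2 <= G * z ->
  V ^+ 2 * z = U -> 0 <= U ->
  w = gamma^-1 * W - f ->
  2^-1 * (F' * G) + (2 * n * gamma ^+ 2)^-1 * (F * W ^+ 2)
    - (n + 1 + 4 * Mx) * (f ^+ 2 * S) - m^-1 * (F * y * U) - 2 * kappa * (F * z) <=
  F * (2 * w ^+ 2 / n + V * H - 2 * kappa * z + 2 * f * w) + F' * (G + 2 * f * H).
Proof.
move=> n1 g0 m0 F0 F'0 y0 z0 G0 h1 h2 h3 h4 h5 U0 hw.
have n0 : 0 < n by exact: lt_le_trans n1.
have FG : 0 <= F' * G by rewrite mulr_ge0.
have k1 : - (4^-1 * (F' * G) + m^-1 * (F * y * U)) <= F * (V * H).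
  apply: sqr_le_opp; rewrite ?mulr_ge0 ?invr_ge0// ?(ltW m0)//.
  have -> : (F * (V * H)) ^+ 2 = F ^+ 2 * V ^+ 2 * H ^+ 2 by ring.
  apply: (@le_trans _ _ (F ^+ 2 * V ^+ 2 * (G * z))).
    by apply: ler_wpM2l => //; rewrite mulr_ge0 ?sqr_ge0.
  have -> : F ^+ 2 * V ^+ 2 * (G * z) = (m^-1 * F * G * U) * (m * F).
    by rewrite -h5; field; rewrite gt_eqF.
  have -> : 4 * (4^-1 * (F' * G)) * (m^-1 * (F * y * U)) = (m^-1 * F * G * U) * (F' * y).
    by field; rewrite gt_eqF.
  by apply: ler_wpM2l => //; rewrite !mulr_ge0 ?invr_ge0// ltW.
have k2 : - (4^-1 * (F' * G) + 4 * (f ^+ 2 * (z * F'))) <= F' * (2 * f * H).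
  apply: sqr_le_opp; first by rewrite mulr_ge0.
    exact: (mulr_ge0 (ler0n _ 4) (mulr_ge0 (sqr_ge0 f) (mulr_ge0 z0 F'0))).
  have -> : (F' * (2 * f * H)) ^+ 2 = (4 * F' ^+ 2 * f ^+ 2) * H ^+ 2 by ring.
  have -> : 4 * (4^-1 * (F' * G)) * (4 * (f ^+ 2 * (z * F'))) =
      (4 * F' ^+ 2 * f ^+ 2) * (G * z) by field.
  apply: ler_wpM2l => //.
  exact: (mulr_ge0 (mulr_ge0 (ler0n _ 4) (sqr_ge0 F')) (sqr_ge0 f)).
have k3 : 4 * (f ^+ 2 * (z * F')) <= 4 * Mx * (f ^+ 2 * S).
  have -> : 4 * Mx * (f ^+ 2 * S) = 4 * (f ^+ 2 * (Mx * S)) by ring.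
  by rewrite ler_wpM2l// ler_wpM2l ?sqr_ge0.
(* Since W = gamma (w + f), the difference of the two sides is an explicit sum of squares, with
   non-negative coefficients because n >= 1. *)
have k4 : (2 * n * gamma ^+ 2)^-1 * W ^+ 2 - (n + 1) * f ^+ 2 <= 2 * w ^+ 2 / n + 2 * f * w.
  have -> : W = gamma * (w + f) by rewrite hw subrK mulrA divff ?mul1r// gt_eqF.
  rewrite -subr_ge0.
  have -> : 2 * w ^+ 2 / n + 2 * f * w - ((2 * n * gamma ^+ 2)^-1 * (gamma * (w + f)) ^+ 2
      - (n + 1) * f ^+ 2) =
      n^-1 * ((w + n * f) ^+ 2 + 2^-1 * (w - f) ^+ 2 + (n - 1) * f ^+ 2).
    by field; rewrite !gt_eqF.
  have n10 : 0 <= n - 1 by rewrite subr_ge0.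
  rewrite mulr_ge0 ?invr_ge0 ?(ltW n0)//; apply: addr_ge0; last exact: mulr_ge0 n10 (sqr_ge0 f).
  apply: addr_ge0; first exact: sqr_ge0.
  by apply: mulr_ge0 (sqr_ge0 _); rewrite invr_ge0.
have k5 : (n + 1) * (F * f ^+ 2) <= (n + 1) * (f ^+ 2 * S).
  rewrite ler_wpM2l ?addr_ge0 ?(ltW n0)// mulrC; apply: ler_wpM2l => //; exact: sqr_ge0.
have k6 : F * ((2 * n * gamma ^+ 2)^-1 * W ^+ 2 - (n + 1) * f ^+ 2) <=
   F * (2 * w ^+ 2 / n + 2 * f * w) by exact: ler_wpM2l.
move: k1 k2 k3 k5 k6 {k4}.
move: (2 * w ^+ 2 / n) (2 * f * w) ((2 * n * gamma ^+ 2)^-1) => q1 q2 q3.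
have -> : F * (q3 * W ^+ 2 - (n + 1) * f ^+ 2) = q3 * (F * W ^+ 2) - (n + 1) * (F * f ^+ 2).
  by ring.
have -> : F * (q1 + V * H - 2 * kappa * z + q2) =
    F * (q1 + q2) + F * (V * H) - 2 * kappa * (F * z) by ring.
rewrite (mulrDr F') (mulrDl (n + 1)).
move: (F' * G) (m^-1 * (F * y * U)) (F * (V * H)) (f ^+ 2 * (z * F')) (F' * (2 * f * H))
  (4 * Mx * (f ^+ 2 * S)) ((n + 1) * (F * f ^+ 2)) ((n + 1) * (f ^+ 2 * S))
  (q3 * (F * W ^+ 2)) (F * (q1 + q2)) (2 * kappa * (F * z)) => x1 x2 x3 x4 x5 x6 x7 x8 x9 x10 x11.
by lra.
Qed.

End PointwiseEstimates.

(** A form of Young's inequality with simple constants: if x <= eps s the first term suffices,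
    otherwise s < x / eps and the second one does. *)
Lemma young_split {R : realType} (x s eps r : R) : 0 <= x -> 0 <= s -> 0 < eps -> 0 <= r ->
  x * s `^ r <= eps * s `^ (r + 1) + eps `^ (- r) * x `^ (r + 1).
Proof.
move=> x0 s0 e0 r0; have r1 : 0 < r + 1 by rewrite ltr_wpDl.
have pe t : 0 <= t -> t `^ (r + 1) = t * t `^ r.
  by move=> t0; have := mulr_powRB1 t0 r1; rewrite addrK.
rewrite !pe//; have [xs|xs] := leP x (eps * s).
  rewrite ler_wpDr ?mulr_ge0 ?powR_ge0// mulrA.
  by apply: ler_wpM2r => //; exact: powR_ge0.
apply: ler_wpDl; first by rewrite !mulr_ge0 ?powR_ge0// ltW.
rewrite mulrCA; apply: ler_wpM2l => //.
have -> : eps `^ (- r) = eps^-1 `^ r.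
  by rewrite -(powR_inv1 (ltW e0)) -powRrM mulN1r.
rewrite -powRM ?invr_ge0// ?(ltW e0)//; apply: ge0_ler_powR; rewrite ?nnegrE ?mulr_ge0 ?invr_ge0 ?(ltW e0)//.
by rewrite mulrC ler_pdivlMr// mulrC ltW.
Qed.

Section Exponents.
Context {R : realType} (q gamma : R).
(* The exponents for which y^a z^b z^gamma = (y z^(gamma-1))^(q/2) and
   y^(a-1) z^(b+1) = (y z^(gamma-1))^(q/2-1). *)
Definition exp_a : R := q / 2.
Definition exp_b : R := gamma * (q - 2) / 2 - q / 2.
Definition exp_min : R := Num.min exp_a (exp_a + exp_b).
Definition exp_max : R := Num.max exp_a (exp_a + exp_b).
Local Notation a := exp_a.
Local Notation b := exp_b.
Local Notation m := exp_min.
Local Notation Mx := exp_max.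
Hypotheses (q2 : 2 < q) (gamma1 : 1 < gamma).

Lemma exp_a_gt1 : 1 < a.
Proof. by rewrite /a ltr_pdivlMr// mul1r. Qed.

Lemma exp_ab_gt0 : 0 < a + b.
Proof.
rewrite /a /b addrC subrK divr_gt0// mulr_gt0 ?subr_gt0//.
exact: lt_trans gamma1.
Qed.

Lemma exp_min_gt0 : 0 < m.
Proof. by rewrite lt_min exp_ab_gt0 (lt_trans ltr01 exp_a_gt1). Qed.

Lemma exp_max_gt1 : 1 < Mx.
Proof. by rewrite lt_max exp_a_gt1. Qed.

Section Point.
Context (y z : R) (y0 : 0 < y) (yz : y <= z).
Let z0 : 0 < z := lt_le_trans y0 yz.
Let zn : z != 0. Proof. by rewrite gt_eqF. Qed.
Let yn : y != 0. Proof. by rewrite gt_eqF. Qed.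

Lemma powR_addn0 (t r s : R) : t != 0 -> t `^ (r + s) = t `^ r * t `^ s.
Proof. by move=> tn; rewrite powRD// tn implybT. Qed.

Lemma exp_main : y `^ a * z `^ b * (z `^ (gamma / 2)) ^+ 2 = y `^ a * z `^ ((gamma - 1) * a).
Proof.
rewrite -powR_mulrn ?powR_ge0// -powRrM -mulrA -powR_addn0//.
by congr (_ * _ `^ _); rewrite /a /b; field.
Qed.

Lemma exp_f : y `^ (a - 1) * z `^ (b + 1) = (y * z `^ (gamma - 1)) `^ (a - 1).
Proof.
rewrite powRM ?(ltW y0) ?powR_ge0// -powRrM.
by congr (_ * _ `^ _); rewrite /a /b; field.
Qed.

Lemma exp_s : y `^ a * z `^ ((gamma - 1) * a) = (y * z `^ (gamma - 1)) `^ (a - 1 + 1).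
Proof. by rewrite powRM ?(ltW y0) ?powR_ge0// -powRrM subrK. Qed.

Lemma exp_z : y `^ a * z `^ b * z = y `^ a * z `^ ((gamma - 1) * a) * z `^ (1 - gamma).
Proof.
rewrite -!mulrA -powR_addn0// -{2}(powRr1 (ltW z0)) -powR_addn0//.
by congr (_ * _ `^ _); rewrite /a /b; field.
Qed.

(** By [exp_deriv] the derivative of y^a z^b is y^(a-1) z^(b-1) (a z + b y). The exponent b may have
    either sign; since 0 < y <= z, the linear factor lies between the multiples of z by a and by a +
    b, hence the minimum and the maximum. *)
Lemma lin_lower : m * z <= a * z + b * y.
Proof.
have [b0|b0] := leP 0 b.
  apply: (@le_trans _ _ (a * z)); first by rewrite ler_wpM2r ?(ltW z0)// ge_min lexx.
  by rewrite lerDl mulr_ge0// ltW.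
apply: (@le_trans _ _ ((a + b) * z)); first by rewrite ler_wpM2r ?(ltW z0)// ge_min lexx orbT.
by rewrite (mulrDl a b z) lerD2l ler_wnM2l// ltW.
Qed.

Lemma lin_upper : a * z + b * y <= Mx * z.
Proof.
have [b0|b0] := leP 0 b.
  apply: (@le_trans _ _ ((a + b) * z)); last first.
    by rewrite ler_wpM2r ?(ltW z0)// le_max lexx orbT.
  by rewrite (mulrDl a b z) lerD2l ler_wpM2l.
apply: (@le_trans _ _ (a * z)); last by rewrite ler_wpM2r ?(ltW z0)// le_max lexx.
by rewrite gerDl mulr_le0_ge0 ?(ltW y0)// ltW.
Qed.

Lemma exp_deriv c d : c * (y `^ (c - 1) * z `^ d) + d * (y `^ c * z `^ (d - 1)) =
  y `^ (c - 1) * z `^ (d - 1) * (c * z + d * y).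
Proof.
have -> : z `^ d = z `^ (d - 1) * z.
  by rewrite -{3}(powRr1 (ltW z0)) -powR_addn0// subrK.
have -> : y `^ c = y `^ (c - 1) * y.
  by rewrite -{3}(powRr1 (ltW y0)) -powR_addn0// subrK.
ring.
Qed.

Local Notation F := (y `^ a * z `^ b).
Local Notation F' := (a * (y `^ (a - 1) * z `^ b) + b * (y `^ a * z `^ (b - 1))).

Lemma exp_deriv_lower : m * (y `^ (a - 1) * z `^ b) <= F'.
Proof.
rewrite exp_deriv; have -> : z `^ b = z `^ (b - 1) * z.
  by rewrite -{3}(powRr1 (ltW z0)) -powR_addn0// subrK.
rewrite mulrCA -mulrA; apply: ler_wpM2l; first exact: powR_ge0.
by rewrite mulrCA; apply: ler_wpM2l; [exact: powR_ge0|exact: lin_lower].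
Qed.

Lemma exp_deriv_ge0 : 0 <= F'.
Proof.
by apply: le_trans exp_deriv_lower; rewrite !mulr_ge0 ?powR_ge0// ltW// exp_min_gt0.
Qed.

Lemma exp_F_le : m * F <= F' * y.
Proof.
have := exp_deriv_lower; rewrite -(ler_pM2r y0); apply: le_trans.
have -> : y `^ a = y `^ (a - 1) * y by rewrite -{3}(powRr1 (ltW y0)) -powR_addn0// subrK.
by rewrite le_eqVlt; apply/orP; left; apply/eqP; ring.
Qed.

Lemma exp_zF' : z * F' <= Mx * (y `^ (a - 1) * z `^ (b + 1)).
Proof.
rewrite exp_deriv.
have -> : z `^ (b + 1) = z * (z `^ (b - 1) * z).
  have -> : b + 1 = b - 1 + 1 + 1 by ring.
  by rewrite !(powR_addn0 _ _ zn) powRr1 ?(ltW z0)//; ring.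
have h : y `^ (a - 1) * z `^ (b - 1) * (a * z + b * y) <=
    y `^ (a - 1) * z `^ (b - 1) * (Mx * z).
  by apply: ler_wpM2l; [rewrite mulr_ge0 ?powR_ge0|exact: lin_upper].
have := h; rewrite -(ler_pM2l z0) => /le_trans; apply.
by rewrite le_eqVlt; apply/orP; left; apply/eqP; ring.
Qed.

Lemma exp_F_S : F <= y `^ (a - 1) * z `^ (b + 1).
Proof.
have -> : y `^ a = y `^ (a - 1) * y by rewrite -{3}(powRr1 (ltW y0)) -powR_addn0// subrK.
rewrite (powR_addn0 b 1 zn) powRr1 ?(ltW z0)//; rewrite -mulrA; apply: ler_wpM2l; first exact: powR_ge0.
by rewrite mulrC; apply: ler_wpM2l => //; exact: powR_ge0.
Qed.

(** For psi = y^((a+1)/2) z^(b/2), whose square is F y, the square of the derivative is controlled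
    by F'. Thus the good term F' |grad z|^2 bounds the gradient that enters the Sobolev
    inequality. *)
Lemma exp_psi_deriv :
  ((a + 1) / 2 * (y `^ ((a + 1) / 2 - 1) * z `^ (b / 2)) +
   b / 2 * (y `^ ((a + 1) / 2) * z `^ (b / 2 - 1))) ^+ 2 <=
  (Mx + 1) ^+ 2 / (4 * m) * F'.
Proof.
rewrite exp_deriv; set L := _ * z + _ * y.
have L0 : 0 <= L.
  have -> : L = 2^-1 * (a * z + b * y + z) by rewrite /L; field.
  rewrite mulr_ge0 ?invr_ge0// addr_ge0 ?(ltW z0)//; apply: le_trans lin_lower.
  by rewrite mulr_ge0// ltW// exp_min_gt0.
have L1 : L <= (Mx + 1) / 2 * z.
  have -> : L = 2^-1 * (a * z + b * y + z) by rewrite /L; field.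
  have -> : (Mx + 1) / 2 * z = 2^-1 * (Mx * z + z) by field.
  by rewrite ler_wpM2l ?invr_ge0// lerD2r lin_upper.
apply: (@le_trans _ _ ((Mx + 1) ^+ 2 / (4 * m) * (m * (y `^ (a - 1) * z `^ b)))).
  rewrite exprMn.
  have -> : (y `^ ((a + 1) / 2 - 1) * z `^ (b / 2 - 1)) ^+ 2 = y `^ (a - 1) * z `^ (b - 2).
    rewrite exprMn -!powR_mulrn ?powR_ge0// -!powRrM; by congr (_ `^ _ * _ `^ _); field.
  apply: (@le_trans _ _ (y `^ (a - 1) * z `^ (b - 2) * ((Mx + 1) / 2 * z) ^+ 2)).
    apply: ler_wpM2l; first by rewrite mulr_ge0 ?powR_ge0.
    by rewrite lerXn2r ?nnegrE// (le_trans L0).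
  have -> : z `^ b = z `^ (b - 2) * z ^+ 2.
    by rewrite -[z ^+ 2]powR_mulrn ?(ltW z0)// -powR_addn0// subrK.
  rewrite le_eqVlt; apply/orP; left; apply/eqP; field.
  by rewrite gt_eqF// exp_min_gt0.
apply: ler_wpM2l; last exact: exp_deriv_lower.
by rewrite divr_ge0 ?sqr_ge0// mulr_ge0// ltW// exp_min_gt0.
Qed.

End Point.
End Exponents.

(** * Energy estimate and descent on the levels *)

Lemma powR_le_neg {R : realType} (x y r : R) : 0 < x -> x <= y -> 0 <= r ->
  y `^ (- r) <= x `^ (- r).
Proof.
move=> x0 xy r0; have y0 : 0 < y := lt_le_trans x0 xy.
by rewrite !powRN lef_pV2 ?posrE ?powR_gt0// ge0_ler_powR// nnegrE ltW.
Qed.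

(** * Constants, and pointwise inequalities for the truncated powers *)

Section Constants.
Context {R : realType} (n gamma kappa sigma q K : R).
Hypotheses (n3 : 3 <= n) (gamma1 : 1 < gamma) (kappa0 : 0 < kappa) (sigma0 : 0 < sigma)
  (q2 : 2 < q) (K0 : 0 < K).

Local Notation a := (exp_a q).
Local Notation b := (exp_b q gamma).
Local Notation m := (exp_min q gamma).
Local Notation Mx := (exp_max q gamma).

(** The coefficient of the main good term in [bernstein_lower]. [c_f] and [c_s] are the prices of
    [young_split] when the terms with f^2 and with y z^(gamma-1) may each use up a quarter of it;
    [c_psi] is the constant of [exp_psi_deriv]. *)
Definition c_main : R := (2 * n * gamma ^+ 2)^-1.
Definition c_f : R := (n + 1 + 4 * Mx) * (c_main / (4 * (n + 1 + 4 * Mx))) `^ (- (a - 1)).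
Definition c_s : R := m^-1 * (m * (c_main / 4)) `^ (- (gamma - 1)).
Definition c_psi : R := (Mx + 1) ^+ 2 / (4 * m).
(* c_lam and c_small are such that, when the integral of (z - k)_+^((gamma-1) n/2) is at most
   c_small, the Sobolev inequality bounds c_s times the integral of psi^2 y^(gamma-1) by half
   of the good terms, leaving c_energy as a bound for the integral of (y z^(gamma-1))^(q/2). *)
Definition c_lam : R :=
  Num.min 4^-1 (c_main / 8) / (2 * (c_s * (2 * sigma ^+ 2) * Num.max c_psi 1)).
Definition c_small : R := c_lam `^ (n / 2).
Definition c_energy : R := 4 / c_main * (c_f * K `^ q).

Let g0 : 0 < gamma := lt_trans ltr01 gamma1.
Let n0 : 0 < n. Proof. by apply: lt_le_trans n3. Qed.
Let m0 : 0 < m := exp_min_gt0 q2 gamma1.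
Let Mx1 : 1 < Mx := exp_max_gt1 gamma q2.
Let a1 : 1 < a := exp_a_gt1 q2.
Let a0 : 0 < a := lt_trans ltr01 a1.

Lemma c_main_gt0 : 0 < c_main.
Proof. by rewrite invr_gt0 !mulr_gt0. Qed.

Let A0 : 0 < n + 1 + 4 * Mx.
Proof. by rewrite !addr_gt0// mulr_gt0// (lt_trans ltr01). Qed.

Lemma c_f_gt0 : 0 < c_f.
Proof. by rewrite mulr_gt0// powR_gt0// divr_gt0 ?mulr_gt0// c_main_gt0. Qed.

Lemma c_s_gt0 : 0 < c_s.
Proof. by rewrite mulr_gt0 ?invr_gt0// powR_gt0// mulr_gt0// divr_gt0// c_main_gt0. Qed.

Lemma c_psi_gt0 : 0 < c_psi.
Proof.
rewrite divr_gt0//; last exact: mulr_gt0.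
by rewrite exprn_gt0// addr_gt0// (lt_trans ltr01).
Qed.

Lemma c_lam_gt0 : 0 < c_lam.
Proof.
rewrite divr_gt0//; first by rewrite lt_min invr_gt0 ltr0n divr_gt0// c_main_gt0.
apply: mulr_gt0 => //; apply: mulr_gt0; last by rewrite lt_max c_psi_gt0.
by apply: mulr_gt0; [exact: c_s_gt0|rewrite mulr_gt0// exprn_gt0].
Qed.

(** Of the main term, one quarter absorbs f, one quarter the term with y z^(gamma-1), and one eighth
    the curvature, whose F z is at most k^(1-gamma) times the main term; 3/8 are left. *)
Lemma density_lower (k z f G H w : R) : 1 <= k -> 2 * kappa * k `^ (- (gamma - 1)) <= c_main / 8 ->
  0 <= z -> 0 <= G -> H ^+ 2 <= G * z -> w = gamma^-1 * z `^ (gamma / 2) - f ->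
  2^-1 * (trunc_pow' k a b z * G) + 3 / 8 * c_main * trunc_pow k a ((gamma - 1) * a) z
    - c_f * `|f| `^ q - c_s * trunc_pow k (a + gamma) b z <=
  trunc_pow k a b z * (2 * w ^+ 2 / n + z `^ (gamma / 2 - 1) * H - 2 * kappa * z + 2 * f * w) +
  trunc_pow' k a b z * (G + 2 * f * H).
Proof.
move=> k1 hk z0 G0 hH hw; have k0 : 0 < k by exact: lt_le_trans k1.
have [zk|kz] := leP z k.
  rewrite !trunc_pow'0// !trunc_pow0 ?addr_gt0// !mul0r !mulr0 !addr0 subr0 sub0r oppr_le0.
  by rewrite mulr_ge0 ?powR_ge0// ltW// c_f_gt0.
have zp : 0 < z by exact: lt_trans kz.
have zn : z != 0 by rewrite gt_eqF.
have yp : 0 < z - k by rewrite subr_gt0.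
have yz : z - k <= z by rewrite gerBl ltW.
rewrite /trunc_pow' !trunc_pow_gt//; set y := z - k in yp yz *.
have yn : y != 0 by rewrite gt_eqF.
set F' := a * (y `^ (a - 1) * z `^ b) + b * (y `^ a * z `^ (b - 1)); set F := y `^ a * z `^ b.
have B := @bernstein_lower R n gamma kappa m Mx F F' y z f G H (z `^ (gamma - 1))
  (z `^ (gamma / 2 - 1)) (z `^ (gamma / 2)) (y `^ (a - 1) * z `^ (b + 1)) w.
have n1 : 1 <= n by apply: le_trans n3; rewrite ler1n.
have F0 : 0 <= F by rewrite mulr_ge0 ?powR_ge0.
have EU : (z `^ (gamma / 2 - 1)) ^+ 2 * z = z `^ (gamma - 1).
  rewrite -powR_mulrn ?powR_ge0// -powRrM -{2}(powRr1 z0) -powR_addn0//.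
  by congr (_ `^ _); field.
apply: le_trans (B n1 g0 m0 F0 (exp_deriv_ge0 q2 gamma1 yp yz) (ltW yp) z0 G0
  (exp_F_le q gamma yp yz) (exp_zF' q gamma yp yz) (exp_F_S q gamma yp yz) hH EU
  (powR_ge0 _ _) hw).
rewrite exp_main// exp_f// -/(c_main); set SA := y `^ a * z `^ ((gamma - 1) * a).
have SA0 : 0 <= SA by rewrite mulr_ge0 ?powR_ge0.
set s := y * z `^ (gamma - 1).
have s0 : 0 <= s by rewrite mulr_ge0 ?powR_ge0// ltW.
have e10 : 0 < c_main / (4 * (n + 1 + 4 * Mx)) by rewrite divr_gt0 ?mulr_gt0// c_main_gt0.
have e20 : 0 < m * (c_main / 4) by rewrite mulr_gt0// divr_gt0// c_main_gt0.
have k2 : (n + 1 + 4 * Mx) * (f ^+ 2 * s `^ (a - 1)) <= c_main / 4 * SA + c_f * `|f| `^ q.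
  have a10 : 0 <= a - 1 by rewrite subr_ge0 ltW.
  have Y := young_split (sqr_ge0 f) s0 e10 a10; rewrite -exp_s// in Y.
  have Ef : (f ^+ 2) `^ (a - 1 + 1) = `|f| `^ q.
    rewrite subrK -(real_normK (num_real f)) -powR_mulrn// -powRrM; congr (_ `^ _).
    by rewrite /exp_a; field.
  rewrite Ef -/SA in Y; have := ler_wpM2l (ltW A0) Y; move=> /le_trans; apply.
  rewrite le_eqVlt; apply/orP; left; apply/eqP; rewrite /c_f.
  move: (_ `^ (- (a - 1))) (`|f| `^ q) (SA) (A0) => t1 t2 t3.
  by move: (n + 1 + 4 * Mx) => t4 t40; field; rewrite gt_eqF.
have k3 : m^-1 * (F * y * z `^ (gamma - 1)) <= c_main / 4 * SA + c_s * (y `^ (a + gamma) * z `^ b).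
  have g10 : 0 <= gamma - 1 by rewrite subr_ge0 ltW.
  have Y := young_split (ltW yp) z0 e20 g10; rewrite subrK in Y.
  have mF0 : 0 <= m^-1 * F by rewrite mulr_ge0// invr_ge0 ltW.
  have -> : m^-1 * (F * y * z `^ (gamma - 1)) = m^-1 * F * (y * z `^ (gamma - 1)) by rewrite !mulrA.
  apply: le_trans (ler_wpM2l mF0 Y) _.
  have E1 : F * z `^ gamma = SA.
    by rewrite /F /SA -mulrA -powR_addn0//; congr (_ * _ `^ _); rewrite /exp_a /exp_b; field.
  have E2 : F * y `^ gamma = y `^ (a + gamma) * z `^ b.
    by rewrite /F powR_addn0// mulrAC.
  rewrite -E1 -E2 le_eqVlt; apply/orP; left; apply/eqP; rewrite /c_s.
  by move: (_ `^ (- _)) (F) => t1 t2; field; rewrite gt_eqF.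
have k4 : 2 * kappa * (F * z) <= c_main / 8 * SA.
  rewrite /F exp_z// -/SA mulrA mulrAC.
  apply: ler_wpM2r => //; apply: le_trans hk; apply: ler_wpM2l; first by rewrite mulr_ge0// ltW.
  rewrite -(opprB gamma 1); apply: powR_le_neg => //; first exact: ltW.
  by rewrite subr_ge0 ltW.
move: k2 k3 k4; move: (_ * (f ^+ 2 * _)) (m^-1 * _) (2 * kappa * (F * z)) (c_f * _) (c_s * _)
  (2^-1 * (F' * G)) => x1 x2 x3 x4 x5 x6.
have -> : 3 / 8 * c_main * SA = c_main * SA - c_main / 4 * SA - c_main / 4 * SA - c_main / 8 * SA.
  by field.
move: (c_main / 4 * SA) (c_main / 8 * SA) (c_main * SA) => x7 x8 x9; lra.
Qed.

(* Replaces Hoelder's inequality with exponents n/(n-2) and n/2: integrating with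
   Q^(n/(n-2)) at least the integral of |psi|^(2n/(n-2)) gives the product bound. *)
Lemma sobolev_young (k z Q lam : R) : 0 < k -> 0 < Q -> 0 < lam ->
  trunc_pow k (a + gamma) b z <=
  Q * (lam * Q `^ (- (n / (n - 2))) * `|trunc_pow k ((a + 1) / 2) (b / 2) z| `^ (2 * n / (n - 2)) +
       lam `^ (- ((n - 2) / 2)) * trunc_pow k ((gamma - 1) * n / 2) 0 z).
Proof.
move=> k0 Q0 lam0; have [zk|kz] := leP z k.
  rewrite (trunc_pow0 _ _ zk) ?addr_gt0//.
  rewrite mulr_ge0 ?(ltW Q0)// addr_ge0 ?mulr_ge0 ?powR_ge0 ?trunc_pow_ge0// ?(ltW lam0)//.
have zp : 0 < z by exact: lt_trans kz.
have n20 : 0 < n - 2 by rewrite subr_gt0 (lt_le_trans _ n3)// ltr_nat.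
have nn : n - 2 != 0 by rewrite gt_eqF.
rewrite !trunc_pow_gt// powRr0 mulr1.
have yp : 0 < z - k by rewrite subr_gt0.
move: (z - k) yp => y yp; have yn : y != 0 by rewrite gt_eqF.
set psi := y `^ ((a + 1) / 2) * z `^ (b / 2).
have psi0 : 0 < psi by rewrite mulr_gt0 ?powR_gt0.
have E : y `^ (a + gamma) * z `^ b = psi ^+ 2 * y `^ (gamma - 1).
  have -> : psi ^+ 2 = y `^ (a + 1) * z `^ b.
    rewrite exprMn -!powR_mulrn ?powR_ge0// -!powRrM.
    by congr (_ `^ _ * _ `^ _); field.
  rewrite mulrAC -powR_addn0//; congr (_ `^ _ * _); ring.
have r0 : 0 <= (n - 2) / 2 by rewrite divr_ge0// ltW.
have u0 : 0 <= psi ^+ 2 / Q by rewrite divr_ge0 ?sqr_ge0// ltW.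
have s0 : 0 <= (psi ^+ 2 / Q) `^ (2 / (n - 2)) by exact: powR_ge0.
have v0 : 0 <= y `^ (gamma - 1) by exact: powR_ge0.
(* With r = (n-2)/2 the conjugate exponents are n/2 and n/(n-2); the second factor is chosen so that
   its power [r] equals psi^2 / Q. *)
have := young_split v0 s0 lam0 r0; rewrite -!powRrM.
have -> : 2 / (n - 2) * ((n - 2) / 2) = 1 by field.
have -> : 2 / (n - 2) * ((n - 2) / 2 + 1) = n / (n - 2) by field.
have -> : (gamma - 1) * ((n - 2) / 2 + 1) = (gamma - 1) * n / 2 by field.
rewrite (powRr1 u0) powRM ?sqr_ge0// ?invr_ge0 ?(ltW Q0)//.
have -> : (Q^-1) `^ (n / (n - 2)) = Q `^ (- (n / (n - 2))).
  by rewrite -(powR_inv1 (ltW Q0)) -powRrM mulN1r.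
have -> : (psi ^+ 2) `^ (n / (n - 2)) = `|psi| `^ (2 * n / (n - 2)).
  by rewrite (gtr0_norm psi0) -powR_mulrn ?(ltW psi0)// -powRrM mulrA.
rewrite E -(ler_pM2l Q0) => h; apply: (le_trans _ (le_trans h _)).
  by rewrite le_eqVlt; apply/orP; left; apply/eqP; field; rewrite gt_eqF.
rewrite le_eqVlt; apply/orP; left; apply/eqP; congr (_ * (_ + _)); ring.
Qed.

(** The square is F y <= F z, and F z is z^(1-gamma) times the right side; above a level at least 1
    that factor is at most 1. *)
Lemma psi_sqr_le (k z : R) : 1 <= k ->
  trunc_pow k ((a + 1) / 2) (b / 2) z ^+ 2 <= trunc_pow k a ((gamma - 1) * a) z.
Proof.
move=> k1; have k0 : 0 < k by exact: lt_le_trans k1.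
have a12 : 0 < (a + 1) / 2 by rewrite divr_gt0// addr_gt0.
have [zk|kz] := leP z k; first by rewrite !trunc_pow0// expr0n.
have zp : 0 < z by exact: lt_trans kz.
have yp : 0 < z - k by rewrite subr_gt0.
have yz : z - k <= z by rewrite gerBl ltW.
rewrite !trunc_pow_gt//; move: (z - k) yp yz => y yp yz.
have yn : y != 0 by rewrite gt_eqF.
have -> : (y `^ ((a + 1) / 2) * z `^ (b / 2)) ^+ 2 = y `^ a * z `^ b * y.
  have -> : y `^ a * z `^ b * y = y `^ (a + 1) * z `^ b.
    by rewrite (powR_addn0 a 1 yn) (powRr1 (ltW yp)); ring.
  rewrite exprMn -!powR_mulrn ?powR_ge0// -!powRrM.
  by congr (_ `^ _ * _ `^ _); field.
apply: (@le_trans _ _ (y `^ a * z `^ b * z)).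
  by apply: ler_wpM2l => //; rewrite mulr_ge0 ?powR_ge0.
rewrite exp_z//; apply: ler_piMr; first by rewrite mulr_ge0 ?powR_ge0.
have -> : (1 : R) = 1 `^ (- (gamma - 1)) by rewrite powR1.
rewrite powR1 -(opprB gamma 1); apply: le_trans (powR_le_neg (y := z) ltr01 _ _) _.
- exact: le_trans k1 (ltW kz).
- by rewrite subr_ge0 ltW.
- by rewrite powR1.
Qed.

Lemma psi_deriv_le (k z : R) : 0 < k ->
  trunc_pow' k ((a + 1) / 2) (b / 2) z ^+ 2 <= c_psi * trunc_pow' k a b z.
Proof.
move=> k0; have a12 : 1 < (a + 1) / 2 by rewrite ltr_pdivlMr// mul1r (_ : 2 = 1 + 1) ?ltrD2r// -natrD.
have [zk|kz] := leP z k; first by rewrite !trunc_pow'0// expr0n mulr0.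
have zp : 0 < z by exact: lt_trans kz.
have yp : 0 < z - k by rewrite subr_gt0.
have yz : z - k <= z by rewrite gerBl ltW.
rewrite /trunc_pow' !trunc_pow_gt//; exact: exp_psi_deriv.
Qed.

Lemma trunc_pow'_ge0 (k z : R) : 0 < k -> 0 <= trunc_pow' k a b z.
Proof.
move=> k0; have [zk|kz] := leP z k; first by rewrite trunc_pow'0.
have zp : 0 < z by exact: lt_trans kz.
have yp : 0 < z - k by rewrite subr_gt0.
have yz : z - k <= z by rewrite gerBl ltW.
rewrite /trunc_pow' !trunc_pow_gt//; exact: exp_deriv_ge0.
Qed.

(* c_level is so large that, above it, a level integral at most c_small is at most c_next;
   the loss 2^e_small in the step from k + delta down to k is then compensated. *)
Definition e_small : R := (gamma - 1) * n / 2.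
Definition e_gap : R := gamma * q / 2 - e_small.
Definition c_next : R := c_small / (2 * 2 `^ e_small).
Definition c_cut : R := (c_next / (2 * c_energy)) `^ (- e_gap^-1).
Definition c_level : R :=
  Num.max 1 (Num.max ((c_main / (16 * kappa)) `^ (- (gamma - 1)^-1))
    ((c_next / (2 * (c_cut `^ e_small * K))) `^ (- (2^-1)^-1))).
Definition c_gradient (rho : R) : R :=
  2 `^ (gamma * q / 2) * (c_energy + c_level `^ (gamma * q / 2) * rho).

Hypothesis hq : n * ((gamma - 1) / gamma) < q.

Lemma e_small_gt0 : 0 < e_small.
Proof. by rewrite divr_gt0// mulr_gt0// subr_gt0. Qed.

(** This is exactly the condition q > n (gamma-1)/gamma: the energy controls a higher power than the
    one that has to be small. *)
Lemma e_gap_gt0 : 0 < e_gap.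
Proof.
rewrite subr_gt0 /e_small ltr_pM2r ?invr_gt0// mulrC [ltRHS]mulrC -ltr_pdivrMr//.
by rewrite -mulrA.
Qed.

Lemma c_small_gt0 : 0 < c_small.
Proof. by rewrite powR_gt0// c_lam_gt0. Qed.

Lemma c_next_gt0 : 0 < c_next.
Proof. by rewrite divr_gt0 ?c_small_gt0// mulr_gt0// powR_gt0. Qed.

Lemma c_energy_gt0 : 0 < c_energy.
Proof. by apply: mulr_gt0; [rewrite divr_gt0// c_main_gt0|rewrite mulr_gt0 ?powR_gt0// c_f_gt0]. Qed.

Lemma c_cut_gt0 : 0 < c_cut.
Proof. by rewrite powR_gt0// divr_gt0 ?c_next_gt0// mulr_gt0// c_energy_gt0. Qed.

Lemma powR_neg_root (x r k : R) : 0 < x -> 0 < r -> x `^ (- r^-1) <= k -> k `^ (- r) <= x.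
Proof.
move=> x0 r0 h; apply: le_trans (powR_le_neg (powR_gt0 _ x0) h (ltW r0)) _.
by rewrite -powRrM mulrNN mulVf ?gt_eqF// powRr1// ltW.
Qed.

Lemma c_level_ge k : c_level <= k -> [/\ 1 <= k, 2 * kappa * k `^ (- (gamma - 1)) <= c_main / 8 &
  c_cut `^ e_small * k `^ (- 2^-1) * K <= c_next / 2].
Proof.
rewrite !ge_max => /and3P[k1 k2 k3]; split=> //.
  have g10 : 0 < gamma - 1 by rewrite subr_gt0.
  have x0 : 0 < c_main / (16 * kappa) by rewrite divr_gt0 ?c_main_gt0// mulr_gt0.
  have h := powR_neg_root x0 g10 k2.
  apply: le_trans (ler_wpM2l _ h) _; first by rewrite mulr_ge0// ltW.
  by rewrite le_eqVlt; apply/orP; left; apply/eqP; field; rewrite gt_eqF.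
have c0 : 0 < c_cut `^ e_small * K by rewrite mulr_gt0// powR_gt0// c_cut_gt0.
have x0 : 0 < c_next / (2 * (c_cut `^ e_small * K)) by rewrite divr_gt0 ?c_next_gt0// mulr_gt0.
have i0 : 0 < (2^-1 : R) by rewrite invr_gt0.
have h := powR_neg_root x0 i0 k3; rewrite mulrAC.
apply: le_trans (ler_wpM2l (ltW c0) h) _.
move: c0; move: (_ * K) (c_next) => t1 t2 c0.
by rewrite le_eqVlt; apply/orP; left; apply/eqP; field; rewrite gt_eqF.
Qed.

Lemma trunc_main_ge (k t : R) : 0 < k -> k < t ->
  (t - k) `^ (gamma * q / 2) <= trunc_pow k a ((gamma - 1) * a) t.
Proof.
move=> k0 kt; rewrite trunc_pow_gt//.
have yp : 0 < t - k by rewrite subr_gt0.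
have yz : t - k <= t by rewrite gerBl ltW.
have yn : t - k != 0 by rewrite gt_eqF.
have -> : gamma * q / 2 = a + (gamma - 1) * a by rewrite /exp_a; field.
rewrite powR_addn0//; apply: ler_wpM2l; first exact: powR_ge0.
by apply: ge0_ler_powR; rewrite ?nnegrE ?(ltW yp) ?(ltW (lt_trans k0 kt))// mulr_ge0 ?(ltW a0)// subr_ge0 ltW.
Qed.

(** Split at t - k = [c_cut]. Above, the surplus [e_gap] of the exponent gains a negative power of
    [c_cut]; below, the power is at most a constant on the set t > k, which (t/k)^(1/2) dominates as
    in Chebyshev's inequality. *)
Lemma trunc_small_le (k t : R) : 0 < k -> 0 <= t ->
  trunc_pow k e_small 0 t <= c_cut `^ (- e_gap) * trunc_pow k a ((gamma - 1) * a) t +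
    c_cut `^ e_small * k `^ (- 2^-1) * t `^ 2^-1.
Proof.
move=> k0 t0; have es := e_small_gt0; have L0 := c_cut_gt0.
have [tk|kt] := leP t k.
  by rewrite (trunc_pow0 _ es tk) addr_ge0 ?mulr_ge0 ?powR_ge0.
have yp : 0 < t - k by rewrite subr_gt0.
have yn : t - k != 0 by rewrite gt_eqF.
rewrite (trunc_pow_gt _ _ kt) powRr0 mulr1.
have [yL|yL] := leP c_cut (t - k).
  apply: ler_wpDr; first by rewrite !mulr_ge0 ?powR_ge0.
  apply: le_trans (ler_wpM2l (powR_ge0 _ _) (trunc_main_ge k0 kt)).
  have -> : e_small = - e_gap + gamma * q / 2 by rewrite /e_gap; ring.
  rewrite powR_addn0//; apply: ler_wpM2r; first exact: powR_ge0.
  exact: powR_le_neg L0 yL (ltW e_gap_gt0).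
apply: ler_wpDl; first by rewrite mulr_ge0 ?powR_ge0// trunc_pow_ge0.
rewrite -mulrA; apply: (@le_trans _ _ (c_cut `^ e_small)).
  by apply: ge0_ler_powR; rewrite ?nnegrE ?(ltW es) ?(ltW yp) ?(ltW L0)// ltW.
apply: ler_peMr; first exact: powR_ge0.
have e1 : k `^ (- 2^-1) * k `^ 2^-1 = 1 by rewrite powRN mulVf// gt_eqF// powR_gt0.
rewrite -[leLHS]e1; apply: ler_wpM2l; first exact: powR_ge0.
by apply: ge0_ler_powR; rewrite ?nnegrE ?invr_ge0 ?(ltW k0)// ltW.
Qed.

(** The positive part of t - k is at most the one at level k + delta plus delta, hence at most twice
    the larger of the two. *)
Lemma trunc_small_step (k delta t : R) : 0 < k -> 0 < delta ->
  trunc_pow k e_small 0 t <= 2 `^ e_small * (trunc_pow (k + delta) e_small 0 t + delta `^ e_small).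
Proof.
move=> k0 d0; have es := e_small_gt0.
rewrite /trunc_pow powRr0 !mulr1 mulrDr -!powRM ?pos_ge0 ?(ltW d0)//.
have h : pos (t - k) <= pos (t - (k + delta)) + delta.
  rewrite /pos; have [] := leP (t - k) 0; have [] := leP (t - (k + delta)) 0; lra.
have [hd|hd] := leP (pos (t - (k + delta))) delta.
  apply: ler_wpDl; first exact: powR_ge0.
  apply: ge0_ler_powR; rewrite ?nnegrE ?pos_ge0 ?(ltW es)//; first by rewrite mulr_ge0// ltW.
  by apply: le_trans h _; rewrite mulr_natl mulr2n lerD2r.
apply: ler_wpDr; first exact: powR_ge0.
apply: ge0_ler_powR; rewrite ?nnegrE ?pos_ge0 ?(ltW es)//; first by rewrite mulr_ge0// pos_ge0.
by apply: le_trans h _; rewrite mulr_natl mulr2n lerD2l ltW.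
Qed.

Lemma full_le (k t : R) : 0 < k -> 0 <= t ->
  t `^ (gamma * q / 2) <=
  2 `^ (gamma * q / 2) * (trunc_pow k a ((gamma - 1) * a) t + k `^ (gamma * q / 2)).
Proof.
move=> k0 t0; have gq : 0 <= gamma * q / 2.
  by rewrite divr_ge0// mulr_ge0 ?(ltW g0)// (le_trans _ (ltW q2)).
have [tk|kt] := leP t (2 * k).
  rewrite mulrDr -powRM ?(ltW k0)//; apply: ler_wpDl.
    by rewrite mulr_ge0 ?powR_ge0// trunc_pow_ge0.
  by apply: ge0_ler_powR; rewrite ?nnegrE// mulr_ge0// ltW.
have kt' : k < t by apply: le_lt_trans kt; rewrite ler_peMl ?(ltW k0)// ler1n.
have yp : 0 < t - k by rewrite subr_gt0.
rewrite mulrDr; apply: ler_wpDr; first by rewrite mulr_ge0 ?powR_ge0.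
apply: le_trans (ler_wpM2l (powR_ge0 _ _) (trunc_main_ge k0 kt')).
rewrite -powRM ?(ltW yp)//.
apply: ge0_ler_powR; rewrite ?nnegrE//; first by rewrite mulr_ge0// ltW.
by move: kt; lra.
Qed.

(** * Energy estimate and descent for an abstract positive linear functional *)

Section Functional.
Context (X : Type) (D : set X) (bm : (X -> R) -> Prop) (I : (X -> R) -> R).
Hypotheses (bmZ : forall c h, bm h -> bm (fun x => c * h x))
  (bmD : forall h1 h2, bm h1 -> bm h2 -> bm (fun x => h1 x + h2 x))
  (IZ : forall c h, bm h -> I (fun x => c * h x) = c * I h)
  (ID : forall h1 h2, bm h1 -> bm h2 -> I (fun x => h1 x + h2 x) = I h1 + I h2)
  (Ile : forall h1 h2, bm h1 -> bm h2 -> (forall x, D x -> h1 x <= h2 x) -> I h1 <= I h2).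
Context (z f G H w : X -> R).
Hypotheses (z0 : forall x, 0 <= z x) (G0 : forall x, D x -> 0 <= G x)
  (hH : forall x, D x -> H x ^+ 2 <= G x * z x)
  (hw : forall x, D x -> w x = gamma^-1 * z x `^ (gamma / 2) - f x)
  (bmz : forall h : R -> R, continuous h -> bm (fun x => h (z x)))
  (bmG : forall h : R -> R, continuous h -> bm (fun x => h (z x) * G x))
  (bmf : bm (fun x => `|f x| `^ q)) (hIf : I (fun x => `|f x| `^ q) <= K `^ q).

(** In the application z = |grad u|^2, G = |grad z|^2, H = <grad z, grad u>, w is the Laplacian of u
    and [I] the integral over the domain. The hypotheses [hB] and [hS] below are then the integrated
    Bernstein inequality and the Sobolev inequality for functions of z. *)
Definition density (F F' : R -> R) x : R :=
  F (z x) * (2 * w x ^+ 2 / n + z x `^ (gamma / 2 - 1) * H x - 2 * kappa * z x + 2 * f x * w x) +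
  F' (z x) * (G x + 2 * f x * H x).

Hypotheses
  (hB : forall k (F F' : R -> R), 0 < k -> (forall t, is_derive t (1 : R) F (F' t)) ->
    continuous F' -> (forall t, 0 <= F t) -> (forall t, t <= k -> F t = 0) ->
    (forall t, t <= k -> F' t = 0) -> bm (density F F') /\ I (density F F') <= 0)
  (hS : forall F F' : R -> R, (forall t, is_derive t (1 : R) F (F' t)) -> continuous F' ->
    I (fun x => `|F (z x)| `^ (2 * n / (n - 2))) <=
    (2 * sigma ^+ 2 * (I (fun x => F' (z x) ^+ 2 * G x) + I (fun x => F (z x) ^+ 2))) `^ (n / (n - 2))).

Lemma bm_trunc k c d : 0 < k -> 0 < c -> bm (fun x => trunc_pow k c d (z x)).
Proof. by move=> k0 c0; apply: bmz; exact: trunc_pow_continuous. Qed.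

Lemma continuous_sqr (h : R -> R) : continuous h -> continuous (fun t => h t ^+ 2).
Proof. by move=> ch t; apply: (continuousM (ch t) (ch t)). Qed.

Lemma I_ge0 h : bm h -> (forall x, D x -> 0 <= h x) -> 0 <= I h.
Proof.
move=> bh h0; have := Ile (bmZ 0 bh) bh; rewrite IZ// mul0r; apply=> x Dx.
by rewrite mul0r h0.
Qed.

Lemma energy_bound k : 1 <= k -> 2 * kappa * k `^ (- (gamma - 1)) <= c_main / 8 ->
  I (fun x => trunc_pow k ((gamma - 1) * n / 2) 0 (z x)) <= c_small ->
  I (fun x => trunc_pow k a ((gamma - 1) * a) (z x)) <= c_energy.
Proof.
move=> k1 hk hS0; have k0 : 0 < k by exact: lt_le_trans k1.
set P := I _.
(* Strict positivity of [P] makes the quantity [Q] below positive, and [Q] is divided by. *)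
have [P0|P0] := leP P 0.
  apply: le_trans P0 _; rewrite mulr_ge0 ?divr_ge0 ?(ltW c_main_gt0)//.
  by rewrite mulr_ge0 ?powR_ge0// ltW// c_f_gt0.
have a12 : 1 < (a + 1) / 2 by rewrite ltr_pdivlMr// mul1r (_ : 2 = 1 + 1) ?ltrD2r// -natrD.
have a120 : 0 < (a + 1) / 2 := lt_trans ltr01 a12.
have e0 : 0 < (gamma - 1) * n / 2 by rewrite divr_gt0// mulr_gt0// subr_gt0.
have cF' := @trunc_pow'_continuous R k a b k0 a1.
have dF t := @is_derive_trunc_pow R k a b t k0 a1.
have cp' := @trunc_pow'_continuous R k _ (b / 2) k0 a12.
have dp t := @is_derive_trunc_pow R k _ (b / 2) t k0 a12.
have cp := @trunc_pow_continuous R k _ (b / 2) k0 a120.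
have [bd Id] := hB k0 dF cF' (trunc_pow_ge0 k a b) (fun t => @trunc_pow0 R k a b t a0)
  (fun t => @trunc_pow'0 R k a b t a1).
have bE := bmG cF'.
have bP := @bm_trunc k a ((gamma - 1) * a) k0 a0.
have bJ := @bm_trunc k (a + gamma) b k0 (addr_gt0 a0 g0).
have bS := @bm_trunc k _ 0 k0 e0.
pose E1 := I (fun x => trunc_pow' k a b (z x) * G x).
pose J := I (fun x => trunc_pow k (a + gamma) b (z x)).
have h1 : 2^-1 * E1 + 3 / 8 * c_main * P - c_f * K `^ q - c_s * J <= 0.
  apply: le_trans Id.
  have b1 := bmZ 2^-1 bE; have b2 := bmZ (3 / 8 * c_main) bP.
  have b3 := bmZ (- c_f) bmf; have b4 := bmZ (- c_s) bJ.
  have h : I (fun x => 2^-1 * (trunc_pow' k a b (z x) * G x) +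
        3 / 8 * c_main * trunc_pow k a ((gamma - 1) * a) (z x) + - c_f * `|f x| `^ q +
        - c_s * trunc_pow k (a + gamma) b (z x)) <=
      I (density (trunc_pow k a b) (trunc_pow' k a b)).
    apply: Ile bd _; first exact: (bmD (bmD (bmD b1 b2) b3) b4).
    move=> x Dx; rewrite !mulNr.
    exact: (density_lower k1 hk (z0 x) (G0 Dx) (hH Dx) (hw Dx)).
  apply: le_trans h; rewrite (ID (bmD (bmD b1 b2) b3) b4) (ID (bmD b1 b2) b3) (ID b1 b2).
  rewrite !IZ// !mulNr lerD2r lerD2l lerN2; apply: ler_wpM2l => //; exact/ltW/c_f_gt0.
have h2 : I (fun x => trunc_pow' k ((a + 1) / 2) (b / 2) (z x) ^+ 2 * G x) <= c_psi * E1.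
  rewrite -IZ//; apply: Ile; [exact: (bmG (continuous_sqr cp'))|exact: bmZ|].
  by move=> x Dx; rewrite mulrA ler_wpM2r ?G0// psi_deriv_le.
have h3 : I (fun x => trunc_pow k ((a + 1) / 2) (b / 2) (z x) ^+ 2) <= P.
  apply: Ile => //; first exact: (bmz (continuous_sqr cp)).
  by move=> x Dx; exact: psi_sqr_le.
have E10 : 0 <= E1.
  by apply: I_ge0 bE _ => x Dx; rewrite mulr_ge0 ?G0// trunc_pow'_ge0.
pose Q := 2 * sigma ^+ 2 * (c_psi * E1 + P).
have s2 : 0 < 2 * sigma ^+ 2 by rewrite mulr_gt0// exprn_gt0.
have Q0 : 0 < Q by rewrite mulr_gt0// ltr_wpDl// mulr_ge0// ltW// c_psi_gt0.
have n20 : 0 < n - 2 by rewrite subr_gt0 (lt_le_trans _ n3)// ltr_nat.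
have nn0 : 0 < n / (n - 2) by rewrite divr_gt0.
have bpsi : bm (fun x => `|trunc_pow k ((a + 1) / 2) (b / 2) (z x)| `^ (2 * n / (n - 2))).
  apply: (bmz (h := fun t => `|trunc_pow k ((a + 1) / 2) (b / 2) t| `^ (2 * n / (n - 2)))).
  have -> : (fun t => `|trunc_pow k ((a + 1) / 2) (b / 2) t| `^ (2 * n / (n - 2))) =
      (fun t => pos (trunc_pow k ((a + 1) / 2) (b / 2) t) `^ (2 * n / (n - 2))).
    by apply/funext => t; rewrite pos_id ?ger0_norm// trunc_pow_ge0.
  have p0 : 0 < 2 * n / (n - 2) by rewrite divr_gt0// mulr_gt0.
  by move=> t; exact: (continuous_comp (cp t) (@pos_powR_continuous R _ p0 _)).
have h4 : I (fun x => `|trunc_pow k ((a + 1) / 2) (b / 2) (z x)| `^ (2 * n / (n - 2))) <=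
    Q `^ (n / (n - 2)).
  apply: le_trans (hS dp cp') _; apply: ge0_ler_powR; rewrite ?nnegrE ?(ltW nn0) ?(ltW Q0)//.
    apply: mulr_ge0; first exact: ltW.
    apply: addr_ge0; apply: I_ge0.
    - exact: (bmG (continuous_sqr cp')).
    - by move=> x Dx; rewrite mulr_ge0 ?sqr_ge0 ?G0.
    - exact: (bmz (continuous_sqr cp)).
    - by move=> x _; exact: sqr_ge0.
  by rewrite ler_wpM2l ?(ltW s2)// lerD.
(* Both terms of [sobolev_young] contribute [c_lam]: the first by the Sobolev bound [h4], the second
   because [c_small] is c_lam^(n/2). *)
have h5 : J <= Q * (2 * c_lam).
  have lam0 := c_lam_gt0.
  have := Ile bJ (bmZ Q (bmD (bmZ (c_lam * Q `^ (- (n / (n - 2)))) bpsi)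
    (bmZ (c_lam `^ (- ((n - 2) / 2))) bS))).
  rewrite IZ; last by apply: bmD; apply: bmZ.
  rewrite ID ?IZ; try exact: bmZ; try by [].
  move=> h; apply: le_trans (h _) _; first by move=> x Dx; exact: sobolev_young.
  apply: ler_wpM2l; first exact: ltW.
  have -> : 2 * c_lam = c_lam + c_lam by ring.
  apply: lerD.
    rewrite -mulrA ler_piMr ?(ltW lam0)//.
    rewrite powRN mulrC ler_pdivrMr ?powR_gt0// mul1r; exact: h4.
  apply: (@le_trans _ _ (c_lam `^ (- ((n - 2) / 2)) * c_small)).
    by apply: ler_wpM2l => //; exact: powR_ge0.
  rewrite /c_small -powR_addn0 ?gt_eqF// -[leRHS](powRr1 (ltW lam0)).
  by rewrite le_eqVlt; apply/orP; left; apply/eqP; congr (_ `^ _); field.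
(* The definition of [c_lam] is solved for this: c_s Q 2 c_lam equals mu/mx times c_psi E1 + P, and
   that sum is at most mx (E1 + P). *)
have h6 : c_s * J <= 4^-1 * E1 + c_main / 8 * P.
  apply: le_trans (ler_wpM2l (ltW c_s_gt0) h5) _.
  set mx := Num.max c_psi 1; set mu := Num.min 4^-1 (c_main / 8).
  have mx0 : 0 < mx by rewrite lt_max ltr01 orbT.
  have k3 : c_psi * E1 + P <= mx * (E1 + P).
    rewrite mulrDr; apply: lerD; first by rewrite ler_wpM2r// le_max lexx.
    by rewrite ler_peMl ?(ltW P0)// le_max lexx orbT.
  have -> : c_s * (Q * (2 * c_lam)) = mu / mx * (c_psi * E1 + P).
    rewrite /Q /c_lam -/mx -/mu; have := c_s_gt0.
    move: (c_s) (c_psi * E1 + P) (mu) => t1 t2 t3 t10.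
    by field; rewrite !gt_eqF.
  have mu0 : 0 < mu by rewrite lt_min invr_gt0 ltr0n divr_gt0// c_main_gt0.
  apply: le_trans (ler_wpM2l _ k3) _; first by rewrite divr_ge0// ltW.
  rewrite mulrA divfK ?gt_eqF// mulrDr; apply: lerD; rewrite ler_wpM2r// ?(ltW P0)//.
    by rewrite ge_min lexx.
  by rewrite ge_min lexx orbT.
(* Of [P] there remain 3/8 - 1/8 = 1/4 of [c_main], which explains the factor 4 / c_main in
   [c_energy]. *)
rewrite /c_energy mulrAC ler_pdivlMr ?c_main_gt0//.
move: h1 h6; lra.
Qed.

Context (rho Z : R).
Hypotheses (rho0 : 0 < rho) (I1 : I (fun=> 1) <= rho) (zB : forall x, D x -> z x <= Z)
  (hIz : I (fun x => z x `^ 2^-1) <= K).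

Let bm1 : bm (fun=> 1). Proof. by apply: (bmz (h := fun=> 1)) => t; exact: cst_continuous. Qed.

Let S k := I (fun x => trunc_pow k e_small 0 (z x)).

(** Each of the two terms of [trunc_small_le] contributes at most c_next / 2: the energy term by the
    choice of [c_cut], the L^1 term by that of [c_level]. *)
Lemma small_improve k : c_level <= k -> bm (fun x => z x `^ 2^-1) -> S k <= c_small -> S k <= c_next.
Proof.
move=> kl bz hS0; have [k1 hk hk2] := c_level_ge kl; have k0 : 0 < k by exact: lt_le_trans k1.
have hP := energy_bound k1 hk hS0.
have bP := @bm_trunc k a ((gamma - 1) * a) k0 a0.
have bS := @bm_trunc k e_small 0 k0 e_small_gt0.
have := Ile bS (bmD (bmZ (c_cut `^ (- e_gap)) bP) (bmZ (c_cut `^ e_small * k `^ (- 2^-1)) bz)).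
rewrite ID ?IZ//; try exact: bmZ.
move=> h; apply: le_trans (h _) _; first by move=> x Dx; exact: trunc_small_le (z0 x).
have -> : c_next = c_next / 2 + c_next / 2 by field.
apply: lerD; last first.
  by apply: le_trans hk2; apply: ler_wpM2l => //; rewrite mulr_ge0 ?powR_ge0.
apply: (@le_trans _ _ (c_cut `^ (- e_gap) * c_energy)); first by rewrite ler_wpM2l ?powR_ge0.
rewrite /c_cut -powRrM mulrNN mulVf ?gt_eqF ?e_gap_gt0// powRr1.
  have := c_energy_gt0; move: (c_next) (c_energy) => t1 t2 t20.
  by rewrite le_eqVlt; apply/orP; left; apply/eqP; field; rewrite gt_eqF.
by rewrite divr_ge0 ?(ltW c_next_gt0)// mulr_ge0// ltW// c_energy_gt0.
Qed.

(** Induction on the number [i] of steps that separate the level from the bound [Z] of z, where the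
    integral vanishes. One step down may lose smallness by a fixed factor only, and [small_improve]
    has gained that factor beforehand. *)
Lemma small_everywhere k : c_level <= k -> bm (fun x => z x `^ 2^-1) -> S k <= c_small.
Proof.
move=> kl bz; have es := e_small_gt0.
(* Chosen so that 2^e_small (c_next + delta^e_small rho) is exactly [c_small], both summands giving
   one half. It does not depend on [Z]. *)
pose delta := (c_small / (2 * 2 `^ e_small * rho)) `^ e_small^-1.
have p2 : 0 < 2 `^ e_small :> R by rewrite powR_gt0.
have x0 : 0 < c_small / (2 * 2 `^ e_small * rho).
  by rewrite divr_gt0 ?c_small_gt0// !mulr_gt0.
have d0 : 0 < delta by rewrite powR_gt0.
have Ed : delta `^ e_small = c_small / (2 * 2 `^ e_small * rho).
  by rewrite -powRrM mulVf ?gt_eqF// powRr1// ltW.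
have main (i : nat) : forall k, c_level <= k -> Z <= k + i%:R * delta -> S k <= c_small.
  elim: i => [|i IH] {}k {}kl hZ; have [k1 _ _] := c_level_ge kl;
    have k0 : 0 < k by [exact: lt_le_trans k1 | exact: lt_le_trans k1].
    rewrite mul0r addr0 in hZ; apply: le_trans (ltW c_small_gt0).
    have bS := @bm_trunc k e_small 0 k0 es.
    have := Ile bS (bmZ 0 bS); rewrite IZ// mul0r; apply=> x Dx.
    by rewrite mul0r trunc_pow0// (le_trans (zB Dx)).
  have kl' : c_level <= k + delta by rewrite ler_wpDr// ltW.
  have kd0 : 0 < k + delta by rewrite addr_gt0.
  have hS1 := small_improve kl' bz (IH (k + delta) kl' _).
  have {}hS1 : S (k + delta) <= c_next.
    by apply: hS1; apply: le_trans hZ _; rewrite -natr1 mulrDl mul1r addrA addrAC.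
  have bS := @bm_trunc k e_small 0 k0 es; have bS' := @bm_trunc (k + delta) e_small 0 kd0 es.
  have := Ile bS (bmZ (2 `^ e_small) (bmD bS' (bmZ (delta `^ e_small) bm1))).
  rewrite IZ; last exact: bmD (bmZ _ _).
  rewrite ID ?IZ//; last exact: bmZ.
  move=> h; apply: le_trans (h _) _.
    by move=> x Dx; rewrite mulr1; exact: trunc_small_step.
  apply: (@le_trans _ _ (2 `^ e_small * (c_next + delta `^ e_small * rho))).
    by rewrite ler_wpM2l ?powR_ge0// lerD// ler_wpM2l ?powR_ge0.
  rewrite Ed /c_next; move: p2; move: (2 `^ e_small) (c_small) => t1 t2 t10.
  by rewrite le_eqVlt; apply/orP; left; apply/eqP; field; rewrite !gt_eqF.
have [i hi] : exists i : nat, (Z - k) / delta <= i%:R.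
  by exists (Num.truncn ((Z - k) / delta)).+1; apply/ltW/truncnS_gt.
apply: (main i) => //; rewrite -lerBlDl.
by move: hi; rewrite ler_pdivrMr.
Qed.

Lemma gradient_bound : I (fun x => z x `^ (gamma * q / 2)) <= c_gradient rho.
Proof.
have bz e : 0 < e -> bm (fun x => z x `^ e).
  move=> e0; have -> : (fun x => z x `^ e) = (fun x => pos (z x) `^ e).
    by apply/funext => x; rewrite pos_id.
  exact: (bmz (pos_powR_continuous e0)).
have b2 : bm (fun x => z x `^ 2^-1) by apply: bz; rewrite invr_gt0.
have gq : 0 < gamma * q / 2 by rewrite divr_gt0// mulr_gt0// (lt_trans _ q2).
have [k1 hk _] := c_level_ge (lexx _); have k0 : 0 < c_level by exact: lt_le_trans k1.
have hP := energy_bound k1 hk (small_everywhere (lexx _) b2).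
have bP := @bm_trunc c_level a ((gamma - 1) * a) k0 a0.
have := Ile (bz _ gq) (bmZ (2 `^ (gamma * q / 2)) (bmD bP (bmZ (c_level `^ (gamma * q / 2)) bm1))).
rewrite IZ; last exact: bmD (bmZ _ _).
rewrite ID ?IZ//; last exact: bmZ.
move=> h; apply: le_trans (h _) _; first by move=> x Dx; rewrite mulr1; exact: full_le (z0 x).
by rewrite /c_gradient ler_wpM2l ?powR_ge0// lerD// ler_wpM2l ?powR_ge0.
Qed.

End Functional.

End Constants.

(** * Proof of the theorem *)

Lemma powR_add_le {R : realType} (x y r : R) : 0 <= x -> 0 <= y -> 0 <= r ->
  (x + y) `^ r <= 2 `^ r * (x `^ r + y `^ r).
Proof.
move=> x0 y0 r0; rewrite mulrDr -!powRM//.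
have [xy|xy] := leP x y.
  apply: ler_wpDl; first exact: powR_ge0.
  apply: ge0_ler_powR; rewrite ?nnegrE ?addr_ge0 ?mulr_ge0//.
  by rewrite mulr_natl mulr2n lerD2r.
apply: ler_wpDr; first exact: powR_ge0.
apply: ge0_ler_powR; rewrite ?nnegrE ?addr_ge0 ?mulr_ge0//.
by rewrite mulr_natl mulr2n lerD2l ltW.
Qed.

Section BoundedMeasurable.
Context {R : realType} (disp : measure_display) (T : measurableType disp)
  (mu : {measure set T -> \bar R}) (D : set T) (mD : measurable D) (finD : (mu D < +oo)%E).
Implicit Types h : T -> R.

Definition bounded_measurable h : Prop :=
  measurable_fun D h /\ exists B : R, forall x, D x -> `|h x| <= B.

(** The integral as a real number, not divided by the measure of [D]. On bounded measurable
    functions [fine] loses nothing, and this is the functional to which the descent is applied. *)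
Definition mean h : R := fine (\int[mu]_(x in D) (h x)%:E).

Lemma bounded_measurable_integrable h : bounded_measurable h ->
  mu.-integrable D (EFin \o h).
Proof.
by move=> [mh [B hB]]; exact: bounded_integrable mD finD mh hB.
Qed.

Lemma meanE h : bounded_measurable h -> (\int[mu]_(x in D) (h x)%:E)%E = (mean h)%:E.
Proof.
move=> bh; rewrite /mean fineK//.
exact: (integrable_fin_num mD (bounded_measurable_integrable bh)).
Qed.

Lemma bounded_measurableZ c h : bounded_measurable h -> bounded_measurable (fun x => c * h x).
Proof.
move=> [mh [B hB]]; split; first by apply: measurable_funM => //; exact: measurable_cst.
by exists (`|c| * B) => x Dx; rewrite normrM ler_wpM2l// hB.
Qed.

Lemma bounded_measurableD h1 h2 : bounded_measurable h1 -> bounded_measurable h2 ->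
  bounded_measurable (fun x => h1 x + h2 x).
Proof.
move=> [m1 [B1 b1]] [m2 [B2 b2]]; split; first exact: measurable_funD.
exists (B1 + B2) => x Dx; apply: le_trans (ler_normD _ _) _.
by apply: lerD; [exact: b1|exact: b2].
Qed.

Lemma bounded_measurableM h1 h2 : bounded_measurable h1 -> bounded_measurable h2 ->
  bounded_measurable (fun x => h1 x * h2 x).
Proof.
move=> [m1 [B1 b1]] [m2 [B2 b2]]; split; first exact: measurable_funM.
by exists (B1 * B2) => x Dx; rewrite normrM ler_pM ?b1 ?b2.
Qed.

Lemma bounded_measurable_powR r h : 0 < r -> bounded_measurable h ->
  bounded_measurable (fun x => `|h x| `^ r).
Proof.
move=> r0 [mh [B hB]]; split.
  by apply: (measurableT_comp (@measurable_powR R r)); exact: measurableT_comp mh.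
exists (`|B| `^ r) => x Dx; rewrite ger0_norm ?powR_ge0//.
apply: ge0_ler_powR; rewrite ?nnegrE//; first exact: ltW.
exact: le_trans (hB x Dx) (ler_norm _).
Qed.

Lemma meanZ c h : bounded_measurable h -> mean (fun x => c * h x) = c * mean h.
Proof.
move=> bh; apply/EFin_inj; rewrite -meanE; last exact: bounded_measurableZ.
rewrite EFinM -meanE//.
exact: (integralZl mD (bounded_measurable_integrable bh)).
Qed.

Lemma meanD h1 h2 : bounded_measurable h1 -> bounded_measurable h2 ->
  mean (fun x => h1 x + h2 x) = mean h1 + mean h2.
Proof.
move=> b1 b2; apply/EFin_inj; rewrite -meanE; last exact: bounded_measurableD.
rewrite EFinD -!meanE//.
exact: (integralD mD (bounded_measurable_integrable b1) (bounded_measurable_integrable b2)).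
Qed.

Lemma mean_le h1 h2 : bounded_measurable h1 -> bounded_measurable h2 ->
  (forall x, D x -> h1 x <= h2 x) -> mean h1 <= mean h2.
Proof.
move=> b1 b2 h; rewrite -lee_fin -!meanE//.
apply: (le_integral mD (bounded_measurable_integrable b1) (bounded_measurable_integrable b2)) => x xD.
by rewrite lee_fin h// -in_setE.
Qed.

Lemma mean_eq h1 h2 : (forall x, D x -> h1 x = h2 x) -> mean h1 = mean h2.
Proof.
by move=> h; congr fine; apply: eq_integral => x; rewrite inE => Dx; rewrite h.
Qed.

Lemma mean1 rho : (mu D <= rho%:E)%E -> mean (fun=> 1) <= rho.
Proof.
move=> h; rewrite -lee_fin -meanE ?integral_cst ?mul1e//.
by split; [exact: measurable_cst|exists 1 => x _; rewrite normr1].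
Qed.

Lemma mean_ge0 h : (forall x, D x -> 0 <= h x) -> 0 <= mean h.
Proof. by move=> h0; apply: fine_ge0; apply: integral_ge0 => x Dx; rewrite lee_fin h0. Qed.

End BoundedMeasurable.

Section Assembly.
Context {R : realType} {d : nat} {M : ptopologicalType}.
Context {S : smooth_structure R d M} (g : riemannian_metric S).
Context (vol : {measure set (borel M) -> \bar R}) (hvol : is_volume g vol).
Context (hM : hausdorff_space M) (Omega : set M) (nu : M -> 'rV[R]_d)
  (hO : class_Oplus g Omega nu) (rho : R) (hrho : 0 < rho) (finO : (vol Omega <= rho%:E)%E).
Context (gamma kappa sigma q K : R) (hd : (3 <= d)%N) (hgamma : 1 < gamma) (hkappa : 0 < kappa)
  (hsigma : 0 < sigma) (hK : 0 < K) (hq2 : 2 < q) (hqd : d%:R * ((gamma - 1) / gamma) < q)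
  (f u : M -> R).
Hypotheses (hric : forall (x : M) (xi : 'rV[R]_d), Omega x ->
     - kappa * tnorm g x xi ^+ 2 <= ricci g x xi xi)
  (hsob : exists2 Cs : R, sobolev_constant g vol Omega Cs & Cs <= sigma)
  (hf1 : Ck S 1 Omega f) (hf0 : {within closure Omega, continuous f})
  (hu3 : Ck S 3 Omega u) (hu2 : Ck_closure S 2 Omega u)
  (hsol : neumann_solution g Omega nu gamma f u)
  (hfu : (Lp_norm vol Omega q f + Lp_norm_field g vol Omega 1 (grad g u) <= K%:E)%E).

Let oO : open Omega := Oplus_open hO.
Let mO : measurable (Omega : set (borel M)) := borel_open oO.
Let finO' : (vol Omega < +oo)%E. Proof. exact: le_lt_trans finO (ltry _). Qed.
Local Notation z := (grad_sqr g u).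
Local Notation w := (laplacian g u).
Local Notation bm := (@bounded_measurable R _ (borel M) Omega).
Local Notation I := (@mean R _ (borel M) vol Omega).
Local Notation G := (fun p => inner g p (grad g z p) (grad g z p)).

Lemma Lp_normE (h : M -> R) r : 0 < r -> bm h ->
  Lp_norm vol Omega r h = (I (fun p => `|h p| `^ r) `^ r^-1)%:E.
Proof.
move=> r0 bh; rewrite /Lp_norm.
by rewrite (meanE mO finO' (bounded_measurable_powR r0 bh)) poweR_EFin.
Qed.

Lemma bm_comp (h : R -> R) : continuous h -> bm (fun p => h (z p)).
Proof.
move=> ch; split; last exact: (comp_bounded hO hu3 hu2 ch).
exact: (measurable_compz hO hu3 (continuous_measurable_fun ch)).
Qed.

Lemma bm_f : bm f.
Proof. by split; [exact: (measurable_f hO hf1)|exact: (f_bounded hO hf0)]. Qed.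

Lemma bm_G : bm G.
Proof.
split; last exact: (has_trace_bound g (Oplus_compact hO) (grad_z_trace hO hu3 hu2) (grad_z_trace hO hu3 hu2)).
have hz2 := C2_grad_sqr g oO hu3; have cgz := C1_field_grad g oO hz2.
by apply: (Ck_measurable oO); exact: (Ck_inner g oO cgz cgz).
Qed.

Lemma tnormE p v : tnorm g p v = inner g p v v `^ 2^-1.
Proof. by rewrite /tnorm powR12_sqrt// inner_ge0. Qed.

Lemma bm_tnorm : bm (fun p => tnorm g p (grad g u p)).
Proof.
have -> : (fun p => tnorm g p (grad g u p)) = (fun p => Num.sqrt (z p)) by [].
exact: bm_comp (@sqrt_continuous R).
Qed.

Lemma f_Lq : I (fun p => `|f p| `^ q) <= K `^ q.
Proof.
have q0 : 0 < q by exact: lt_trans hq2.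
have h : (Lp_norm vol Omega q f <= K%:E)%E.
  by apply: le_trans hfu; rewrite leeDl// poweR_ge0.
move: h; rewrite (Lp_normE q0 bm_f) lee_fin => h.
have I0 : 0 <= I (fun p => `|f p| `^ q) by apply: mean_ge0 => p _; exact: powR_ge0.
have -> : I (fun p => `|f p| `^ q) = (I (fun p => `|f p| `^ q) `^ q^-1) `^ q.
  by rewrite -powRrM mulVf ?gt_eqF// powRr1.
by apply: ge0_ler_powR; rewrite ?nnegrE ?powR_ge0// ltW.
Qed.

Lemma grad_L1 : I (fun p => z p `^ 2^-1) <= K.
Proof.
have h : (Lp_norm_field g vol Omega 1 (grad g u) <= K%:E)%E.
  by apply: le_trans hfu; rewrite leeDr// poweR_ge0.
move: h; rewrite /Lp_norm_field (Lp_normE ltr01 bm_tnorm) lee_fin invr1 powRr1.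
  apply: le_trans; rewrite le_eqVlt; apply/orP; left; apply/eqP; apply: mean_eq => p _.
  by rewrite powRr1// ger0_norm tnormE ?powR_ge0.
by apply: mean_ge0 => p _; exact: powR_ge0.
Qed.

(** The Sobolev inequality raised to the power 2d/(d-2). The square of the sum of the two norms is
    at most twice the sum of their squares, hence the factor 2 sigma^2. *)
Lemma sobolev_mean (F F' : R -> R) : (forall t, is_derive t (1 : R) F (F' t)) -> continuous F' ->
  I (fun p => `|F (z p)| `^ (2 * d%:R / (d%:R - 2))) <=
  (2 * sigma ^+ 2 * (I (fun p => F' (z p) ^+ 2 * G p) + I (fun p => F (z p) ^+ 2)))
    `^ (d%:R / (d%:R - 2)).
Proof.
move=> dF cF'; have [Cs [Cs0 hCs] Csig] := hsob.
have n20 : 0 < d%:R - 2 :> R by rewrite subr_gt0 ltr_nat.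
have n0 : 0 < d%:R :> R by rewrite ltr0n (leq_trans _ hd).
have p0 : 0 < 2 * d%:R / (d%:R - 2) :> R by rewrite divr_gt0// mulr_gt0.
have cF : continuous F := F_continuous dF.
have bF := bm_comp cF; have bF' := bm_comp cF'.
have bW : bm (fun p => tnorm g p (F' (z p) *: grad g z p)).
  have -> : (fun p => tnorm g p (F' (z p) *: grad g z p)) =
      (fun p => `|F' (z p)| * `|G p| `^ 2^-1).
    by apply/funext => p; rewrite tnormZ tnormE (ger0_norm (inner_ge0 _ _ _)).
  have b1 : bm (fun p => `|F' (z p)|).
    by apply: (bm_comp (h := fun t => `|F' t|)) => t; apply: continuous_comp (cF' t) _; exact: norm_continuous.
  apply: bounded_measurableM b1 _.
  by apply: bounded_measurable_powR bm_G; rewrite invr_gt0.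
have := hCs _ _ (sobolev_test hvol hM hO finO' hu3 hu2 dF cF').
rewrite (Lp_normE p0 bF) (Lp_normE (ltr0n _ 2) bF) /Lp_norm_field (Lp_normE (ltr0n _ 2) bW).
rewrite -EFinD -EFinM lee_fin.
have -> : I (fun p => `|tnorm g p (F' (z p) *: grad g z p)| `^ 2) = I (fun p => F' (z p) ^+ 2 * G p).
  apply: mean_eq => p _; rewrite powR_mulrn// real_normK ?num_real// tnorm_sqr.
  by rewrite innerZl innerZr mulrA.
have -> : I (fun p => `|F (z p)| `^ 2) = I (fun p => F (z p) ^+ 2).
  by apply: mean_eq => p _; rewrite powR_mulrn// real_normK ?num_real.
have A0 : 0 <= I (fun p => `|F (z p)| `^ (2 * d%:R / (d%:R - 2))).
  by apply: mean_ge0 => p _; exact: powR_ge0.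
have B0 : 0 <= I (fun p => F' (z p) ^+ 2 * G p).
  by apply: mean_ge0 => p _; rewrite mulr_ge0 ?sqr_ge0 ?inner_ge0.
have C0 : 0 <= I (fun p => F (z p) ^+ 2) by apply: mean_ge0 => p _; exact: sqr_ge0.
move: A0 B0 C0; move: (I _) (I _) (I _) => C B A A0 B0 C0 h.
have -> : A = (A `^ (2 * d%:R / (d%:R - 2))^-1) `^ (2 * d%:R / (d%:R - 2)).
  by rewrite -powRrM mulVf ?gt_eqF// powRr1.
have E2 : 2 * d%:R / (d%:R - 2) = 2 * (d%:R / (d%:R - 2)) :> R by rewrite mulrA.
rewrite [X in _ `^ X <= _]E2 powRrM; apply: ge0_ler_powR; rewrite ?nnegrE ?powR_ge0//.
- by rewrite divr_ge0// ltW.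
- by rewrite mulr_ge0 ?addr_ge0// mulr_ge0// sqr_ge0.
rewrite powR_mulrn ?powR_ge0//.
apply: (@le_trans _ _ ((sigma * (B `^ 2^-1 + C `^ 2^-1)) ^+ 2)).
  rewrite lerXn2r ?nnegrE ?powR_ge0 ?mulr_ge0 ?addr_ge0 ?powR_ge0 ?(ltW hsigma)//.
  by apply: le_trans h _; apply: ler_wpM2r => //; rewrite addr_ge0 ?powR_ge0.
rewrite !powR12_sqrt// exprMn.
have -> : 2 * sigma ^+ 2 * (B + C) = sigma ^+ 2 * (2 * (B + C)) by ring.
apply: ler_wpM2l; first exact: sqr_ge0.
have := sqr_ge0 (Num.sqrt B - Num.sqrt C); rewrite sqrrB sqrrD !sqr_sqrtr//.
by move: (Num.sqrt B * Num.sqrt C) => t; rewrite mulrDr !mulr_natl; lra.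
Qed.

Lemma grad_power_bound :
  I (fun p => z p `^ (gamma * q / 2)) <= c_gradient d%:R gamma kappa sigma q K rho.
Proof.
have n3 : (3 : R) <= d%:R by rewrite ler_nat.
have [Z hZ] := z_bounded hO hu3 hu2.
apply: (@gradient_bound R d%:R gamma kappa sigma q K n3 hgamma hkappa hsigma hq2 hK hqd
  (borel M) Omega bm I (@bounded_measurableZ _ _ _ _) (@bounded_measurableD _ _ _ _)
  (meanZ mO finO') (meanD mO finO') (mean_le mO finO') z f G
  (fun p => inner g p (grad g z p) (grad g u p)) w _ _ _ _ bm_comp _ _ f_Lq _
  sobolev_mean rho Z hrho (mean1 mO finO' finO) _ grad_L1).
- exact: z_ge0.
- by move=> p _; exact: inner_ge0.
- by move=> p _; exact: inner_CS.
- by move=> p Op; exact: (pde hsol Op).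
- by move=> h ch; exact: bounded_measurableM (bm_comp ch) bm_G.
- by apply: bounded_measurable_powR bm_f; exact: lt_trans hq2.
- move=> k F F' k0 dF cF' F0 Fk F'k.
  have bd : bm (bernstein_density g gamma kappa f u F F').
    split; first exact: (measurable_density hO gamma kappa hf1 hu3 dF cF').
    exact: (density_bounded hO hgamma hkappa hf0 hu3 hu2 hsol k0 dF cF' Fk F'k).
  split; first exact: bd.
  rewrite -lee_fin -(meanE mO finO' bd).
  exact: (bernstein_integral_le0 hvol hM hO finO' hgamma hkappa hric hf1 hf0 hu3 hu2 hsol
    k0 dF cF' F0 Fk F'k).
- by move=> p Op; exact: le_trans (ler_norm _) (hZ p Op).
Qed.

(** By the equation and gamma > 1 the Laplacian is at most z^(gamma/2) + |f| in absolute value,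
    which gives the first summand; the second bounds the power of the gradient, and the last one
    makes the constant positive. *)
Definition c_final : R :=
  (2 `^ q * (c_gradient d%:R gamma kappa sigma q K rho + K `^ q)) `^ q^-1 +
  c_gradient d%:R gamma kappa sigma q K rho `^ q^-1 + 1.

Lemma final_bound : (Lp_norm vol Omega q w +
  Lp_norm vol Omega q (fun x => (tnorm g x (grad g u x) `^ gamma)%R) <= c_final%:E)%E.
Proof.
have q0 : 0 < q by exact: lt_trans hq2.
have g0 : 0 < gamma by exact: lt_trans hgamma.
have bw : bm w by split; [exact: (measurable_w hO hu3)|exact: (w_bounded hO hgamma hf0 hu3 hu2 hsol)].
have bt : bm (fun p => tnorm g p (grad g u p) `^ gamma).
  have := bounded_measurable_powR g0 bm_tnorm; congr (bm _); apply/funext => p.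
  by rewrite ger0_norm// tnormE powR_ge0.
have gq : 0 < gamma * q / 2 by rewrite divr_gt0// mulr_gt0.
have bz : bm (fun p => z p `^ (gamma * q / 2)).
  have := bm_comp (pos_powR_continuous gq); congr (bm _); apply/funext => p.
  by rewrite pos_id// z_ge0.
have C0 : 0 <= c_gradient d%:R gamma kappa sigma q K rho.
  by apply: le_trans grad_power_bound; apply: mean_ge0 => p _; exact: powR_ge0.
rewrite (Lp_normE q0 bw) (Lp_normE q0 bt) -EFinD lee_fin /c_final.
apply: ler_wpDr => //; apply: lerD; apply: ge0_ler_powR; rewrite ?nnegrE ?invr_ge0 ?(ltW q0)//.
- by apply: mean_ge0 => p _; exact: powR_ge0.
- by rewrite mulr_ge0 ?powR_ge0// addr_ge0 ?powR_ge0.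
- have bf := bounded_measurable_powR q0 bm_f.
  apply: (@le_trans _ _ (2 `^ q * (I (fun p => z p `^ (gamma * q / 2)) + I (fun p => `|f p| `^ q)))); last first.
    by rewrite ler_wpM2l ?powR_ge0// lerD ?f_Lq// grad_power_bound.
  rewrite -(meanD mO finO' bz bf) -(meanZ mO finO'); last exact: bounded_measurableD.
  apply: (mean_le mO finO').
  + exact: bounded_measurable_powR.
  + by apply: bounded_measurableZ; exact: bounded_measurableD.
  move=> p Op; rewrite (pde hsol Op).
  have gi : gamma^-1 <= 1 by rewrite invf_le1// ltW.
  have -> : gamma * q / 2 = gamma / 2 * q by rewrite mulrAC.
  rewrite [z p `^ (_ * q)]powRrM.
  have A := powR_add_le (powR_ge0 (z p) (gamma / 2)) (normr_ge0 (f p)) (ltW q0).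
  apply: le_trans A.
  apply: ge0_ler_powR; rewrite ?nnegrE ?addr_ge0 ?powR_ge0 ?(ltW q0)//.
  apply: le_trans (ler_normB _ _) _; rewrite lerD2r ger0_norm ?mulr_ge0 ?powR_ge0 ?invr_ge0 ?(ltW g0)//.
  by apply: ler_piMl => //; exact: powR_ge0.
- by apply: mean_ge0 => p _; exact: powR_ge0.
- apply: le_trans grad_power_bound; rewrite le_eqVlt; apply/orP; left; apply/eqP.
  apply: mean_eq => p _; rewrite ger0_norm ?powR_ge0// tnormE -!powRrM.
  by congr (_ `^ _); field.
Qed.

End Assembly.

Theorem theorem3p2 (R : realType) (d : nat) (gamma kappa rho sigma q K : R)
    (hd : (3 <= d)%N) (hgamma : 1 < gamma) (hkappa : 0 < kappa)
    (hrho : 0 < rho) (hsigma : 0 < sigma) (hK : 0 < K)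
    (hq : Num.max (d%:R * ((gamma - 1) / gamma)) 2 < q) :
  exists C : R, 0 < C /\
    forall (M : ptopologicalType) (S : smooth_structure R d M)
      (g : riemannian_metric S) (vol : {measure set (borel M) -> \bar R})
      (Omega : set M) (nu : M -> 'rV[R]_d) (f u : M -> R),
      hausdorff_space M -> @second_countable M -> connected [set: M] ->
      orientable S ->
      is_volume g vol ->
      class_Oplus g Omega nu ->
      (vol Omega <= rho%:E)%E ->
      (forall (x : M) (xi : 'rV[R]_d), Omega x ->
         - kappa * tnorm g x xi ^+ 2 <= ricci g x xi xi) ->
      (exists2 Cs : R, sobolev_constant g vol Omega Cs & Cs <= sigma) ->
      Ck S 1 Omega f -> {within closure Omega, continuous f} ->
      Ck S 3 Omega u -> Ck_closure S 2 Omega u ->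
      neumann_solution g Omega nu gamma f u ->
      (Lp_norm vol Omega q f +
       Lp_norm_field g vol Omega 1 (grad g u) <= K%:E)%E ->
      (Lp_norm vol Omega q (laplacian g u) +
       Lp_norm vol Omega q (fun x => (tnorm g x (grad g u x) `^ gamma)%R)
       <= C%:E)%E.
Proof.
move: (hq); rewrite gt_max => /andP[hqd hq2].
exists (@c_final R d rho gamma kappa sigma q K).
split; first by rewrite /c_final ltr_wpDl// addr_ge0 ?powR_ge0.
move=> M S g vol Omega nu f u hM _ _ _ hvol hO finO hric hsob hf1 hf0 hu3 hu2 hsol hfu.
exact: (final_bound hvol hM hO hrho finO hd hgamma hkappa hsigma hK hq2 hqd hric hsob
  hf1 hf0 hu3 hu2 hsol hfu).
Qed.
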